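(* Let $0<T<\infty$ and let $u$ and $U=(U_1,U_2)$ be weak solutions on $(0,T)\times\mathbb{R}^2$ to the two-dimensional anisotropic incompressible Navier--Stokes equations $\partial_t u+\operatorname{div}(u\otimes u)+\nabla p=\partial_{x_1}^2u$, $\operatorname{div}u=0$ (in the sense defined in the context), identified with their representatives in $C([0,T];L^2(\mathbb{R}^2))$. Assume that $\partial_{x_2}U_1\in L^2(0,T;L^2(\mathbb{R}^2))$. If $u(0)=U(0)$ in $L^2(\mathbb{R}^2)$, then $u(t)=U(t)$ in $L^2(\mathbb{R}^2)$ for every $t\in(0,T]$.
   Context: Definition (weak solution). A vector field $u=(u_1,u_2):(0,T)\times\mathbb{R}^2\to\mathbb{R}^2$ is called a weak solution if: (i) $u\in L^\infty(0,T;L^2(\mathbb{R}^2))$ and the weak derivative $\partial_{x_1}u\in L^2(0,T;L^2(\mathbb{R}^2))$; (ii) $u$ is weakly divergence-free, i.e. $\int_{\mathbb{R}^2}u\cdot\nabla\psi\,dx=0$ for all $\psi\in C_c^\infty(\mathbb{R}^2)$ and almost every $t\in(0,T)$; (iii) for every divergence-free vector field $\phi\in C_c^\infty((0,T)\times\mathbb{R}^2)$ (with values in $\mathbb{R}^2$), $$\int_0^T\int_{\mathbb{R}^2}\partial_t\phi\cdot u+\nabla\phi:(u\otimes u)-\partial_{x_1}\phi\cdot\partial_{x_1}u\,dx\,dt=0,$$ where $\nabla\phi:(u\otimes u)=\sum_{i,j=1}^2\partial_{x_j}\phi_i\,u_iu_j$. Every weak solution has a unique representative in $C([0,T];L^2(\mathbb{R}^2))$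 (a function on $[0,T]$ with values in $L^2(\mathbb{R}^2)$ agreeing with it for almost every $t$); pointwise values such as $u(0)$, $U(0)$, $u(t)$, $U(t)$ refer to these representatives. *)

(* Defs.v *)
From HB Require Import structures.
From mathcomp Require Import all_boot all_order all_algebra.
From mathcomp Require Import all_classical all_reals all_analysis ess_sup_inf.

Set Implicit Arguments.
Unset Strict Implicit.
Unset Printing Implicit Defensive.

Import Order.TTheory GRing.Theory Num.Theory.
Import numFieldNormedType.Exports.

Local Open Scope classical_set_scope.
Local Open Scope ring_scope.

Definition leb2 (R : realType) :
    {measure set (measurableTypeR R * measurableTypeR R) -> \bar R} :=
  (@lebesgue_measure R \x @lebesgue_measure R)%E.

Arguments leb2 {R}.

(* The two components of a time-dependent vector field on the plane; u_1 and
   u_2 are [u 0] and [u 1]. *)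
Definition vector_field (R : realType) := 'I_2 -> R -> R * R -> R.

Section test_functions.
Context {R : realType}.

(* [foldr] ranges over all iterated directional derivatives. *)
Definition smooth {V : normedModType R} (f : V -> R) : Prop :=
  forall s : seq V,
    let g := foldr (fun (v : V) (h : V -> R) => 'D_v h) f s in
    continuous g /\ (forall x v, derivable g x v).

(* C_c^oo(Omega), its elements being extended by 0 outside Omega. *)
Definition test_function {V : normedModType R} (Omega : set V) (f : V -> R) :
    Prop :=
  [/\ smooth f, compact (closure [set x | f x != 0])
    & closure [set x | f x != 0] `<=` Omega].

Definition basis_vector (i : 'I_2) : R * R := if i == 0 then (1, 0) else (0, 1).

Definition time_direction : R * (R * R) := (1, 0).

Definition space_direction (i : 'I_2) : R * (R * R) := (0, basis_vector i).

Definition slab (T : R) : set (R * (R * R)) := `]0, T[ `*` setT.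

Definition dt (phi : R * (R * R) -> R) (t : R) (x : R * R) : R :=
  'D_time_direction phi (t, x).

Definition dx (i : 'I_2) (phi : R * (R * R) -> R) (t : R) (x : R * R) : R :=
  'D_(space_direction i) phi (t, x).

End test_functions.

Section weak_solutions.
Context {R : realType}.
Implicit Types (T : R) (f g : R -> R * R -> R) (u v : vector_field R).

(* Elements of the Bochner spaces L^p(0,T;L^2(R^2)) are represented by jointly
   measurable functions of (t, x). *)
Definition slab_measurable T f : Prop :=
  measurable_fun (slab T) (fun z : R * (R * R) => f z.1 z.2).

Definition Linfty_L2 T f : Prop :=
  slab_measurable T f /\
  (ess_sup lebesgue_measure
     ((fun t : R => 'N[leb2]_2%:E[EFin \o f t]) \_ `]0%R, T[) < +oo)%E.

Definition L2_L2 T f : Prop :=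
  slab_measurable T f /\
  (\int[lebesgue_measure]_(t in `]0%R, T[) 'N[leb2]_2%:E[EFin \o f t] ^+ 2
     < +oo)%E.

Definition C_L2 T f : Prop :=
  (forall t : R, t \in `[0, T] -> f t \in Lfun leb2 2%:E) /\
  (forall t0 : R, t0 \in `[0, T] ->
    'N[leb2]_2%:E[EFin \o (f t \- f t0)%R]%E
      @[t --> within `[0, T] (nbhs t0)] --> 0%E).

(* g = partial_{x_i} f in the sense of distributions on (0,T) x R^2. *)
Definition weak_dx T (i : 'I_2) f g : Prop :=
  forall phi, test_function (slab T) phi ->
    (\int[lebesgue_measure]_(t in `]0%R, T[)
       \int[leb2]_x (f t x * dx i phi t x)%:E =
     - \int[lebesgue_measure]_(t in `]0%R, T[)
         \int[leb2]_x (g t x * phi (t, x))%:E)%E.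

Definition weakly_divergence_free T u : Prop :=
  forall psi : R * R -> R, test_function setT psi ->
    {ae lebesgue_measure, forall t : R, t \in `]0%R, T[ ->
      (\int[leb2]_x (\sum_(i < 2) u i t x * 'D_(basis_vector i) psi x)%:E
        = 0)%E}.

Definition weak_solution T u : Prop :=
  (forall i, Linfty_L2 T (u i)) /\
  (exists d1u : vector_field R,
    [/\ forall i, L2_L2 T (d1u i) /\ weak_dx T 0 (u i) (d1u i),
        weakly_divergence_free T u
      & forall phi : 'I_2 -> R * (R * R) -> R,
          (forall i, test_function (slab T) (phi i)) ->
          (forall t x, \sum_(i < 2) dx i (phi i) t x = 0) ->
          (\int[lebesgue_measure]_(t in `]0%R, T[) \int[leb2]_x
             (\sum_(i < 2) dt (phi i) t x * u i t x
              + \sum_(i < 2) \sum_(j < 2)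
                  dx j (phi i) t x * (u i t x * u j t x)
              - \sum_(i < 2) dx 0 (phi i) t x * d1u i t x)%:E = 0)%E]).

Definition L2_eq u v (t : R) : Prop :=
  forall i, u i t = v i t %[ae leb2].

Definition continuous_representative T u v : Prop :=
  (forall i, C_L2 T (v i)) /\
  {ae lebesgue_measure, forall t : R, t \in `]0%R, T[ -> L2_eq u v t}.

End weak_solutions.

(* Main.v *)
Require Import Defs.
From HB Require Import structures.
From mathcomp Require Import all_boot all_order all_algebra.
From mathcomp Require Import all_classical all_reals all_analysis ess_sup_inf.
From mathcomp Require Import measurable_realfun ring lra.

(* The difference w = u - U is estimated by the energy method.  The anisotropic bound
   |f g|^2 <= 4 |f| |d_1 f| |g| |d_2 g| in L2 controls the trilinear terms: the vertical derivatives of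
   w_2 and U_2 are minus horizontal ones, and that of U_1 is square integrable by assumption, so
   that no other vertical derivative is needed.  As w is not regular enough to be a test function, the
   equation is tested with mollifiers, made divergence free by the Leray projection; subtracting a
   mollifier at a large scale gives them mean zero, so that the gradient of their inverse Laplacian
   has compact support.  The commutator of the mollification with the transport by u is a sum of
   products of L2 functions and tends to zero in L1 only; hence the energy is replaced by a
   truncation beta_e(w) of w^2 / 2 with bounded derivative.  The price is that the pressure does not
   cancel: there remains the integral of the pressure, which the anisotropic bound puts in L2, against
   (1 - beta_e''(w_i)) d_1 w_1, which tends to zero with e.  Gronwall's lemma concludes. *)

Set Implicit Arguments.
Unset Strict Implicit.
Unset Printing Implicit Defensive.

Import Order.TTheory GRing.Theory Num.Theory.
Import numFieldNormedType.Exports.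

Local Open Scope classical_set_scope.
Local Open Scope ring_scope.

(** * Integrals of real functions *)

(** The square of the first component of [u] is out of reach of the anisotropic bound, since no
    vertical derivative of that component is known. It enters the pressure only through the second
    horizontal derivative of an inverse Laplacian, which is square integrable all the same: its
    vertical derivative is a transform of the horizontal derivative of the square ([KK_sq]).

    The commutator estimate costs the factor 1 + 1/e, so the mollification is removed before e tends
    to zero. The pressure defect is cut at a level m of the squared derivative, with m tending to
    infinity and e m to zero; the parameter of Young's inequality on the pressure is sent to zero
    last.

    Weak derivatives are tested with a sequence of mollifiers and, by continuity, at rational points
    only, so that all properties of a slice in time hold outside a single null set. Riesz transforms
    are bounded by integrating by parts against truncated gradient kernels. Components are indexed
    by 0 and 1 in the code. *)

Lemma ordinal2 (i : 'I_2) : i = 0 \/ i = 1.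
Proof. by move: i => [[|[|//]] hi]; [left|right]; exact/val_inj. Qed.

HB.lock Definition Int d (T : measurableType d) (R : realType)
  (mu : {measure set T -> \bar R}) (f : T -> R) : R := Rintegral mu setT f.

Section integrals.
Context d (T : measurableType d) (R : realType) (mu : {measure set T -> \bar R}).

Lemma ae_imp (P Q : T -> Prop) : (forall x, P x -> Q x) ->
  {ae mu, forall x, P x} -> {ae mu, forall x, Q x}.
Proof. by move=> PQ; apply: (@filterS _ _ (ae_filter_ringOfSetsType mu)). Qed.

Implicit Types f g h : T -> R.

Definition L1 f := mu.-integrable setT (EFin \o f).
Notation Int := (Int mu).

Lemma IntDef f : Int f = Rintegral mu setT f.
Proof. by rewrite Int.unlock. Qed.
Definition L2 f := measurable_fun setT f /\ L1 (fun x => f x ^+ 2).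
Definition N2 f : R := Num.sqrt (Int (fun x => f x ^+ 2)).

Lemma L1_meas f : L1 f -> measurable_fun setT f.
Proof. by move=> /integrableP[/measurable_EFinP]. Qed.

Lemma L2_meas f : L2 f -> measurable_fun setT f.
Proof. by case. Qed.

Lemma L1_le f g : measurable_fun setT f -> L1 g -> (forall x, `|f x| <= g x) -> L1 f.
Proof.
move=> mf Lg fg; apply: (le_integrable measurableT) Lg; first exact/measurable_EFinP.
by move=> x _ /=; rewrite lee_fin (le_trans (fg x))// ler_norm.
Qed.

Lemma L1D f g : L1 f -> L1 g -> L1 (fun x => f x + g x).
Proof. by move=> Lf Lg; have := integrableD measurableT Lf Lg. Qed.

Lemma L1Z a f : L1 f -> L1 (fun x => a * f x).
Proof. by move=> Lf; have := integrableZl measurableT a Lf. Qed.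

Lemma L1Zr a f : L1 f -> L1 (fun x => f x * a).
Proof. by move=> Lf; under eq_fun do rewrite mulrC; exact: L1Z. Qed.

Lemma L1N f : L1 f -> L1 (fun x => - f x).
Proof. by move=> Lf; under eq_fun do rewrite -mulN1r; exact: L1Z. Qed.

Lemma L1B f g : L1 f -> L1 g -> L1 (fun x => f x - g x).
Proof. by move=> Lf /L1N; exact: L1D. Qed.

Lemma L1_0 : L1 (fun=> 0).
Proof. exact: integrable0. Qed.

Lemma L1_abs f : L1 f -> L1 (fun x => `|f x|).
Proof. by move=> Lf; have := integrable_abse Lf. Qed.

Lemma L1_sum (I : Type) (s : seq I) (F : I -> T -> R) :
  (forall i, L1 (F i)) -> L1 (fun x => \sum_(i <- s) F i x).
Proof.
move=> LF; elim: s => [|i s ih].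
  by under eq_fun do rewrite big_nil; exact: L1_0.
by under eq_fun do rewrite big_cons; exact: L1D.
Qed.

Lemma IntE f : L1 f -> (Int f)%:E = (\int[mu]_x (f x)%:E)%E.
Proof. by move=> Lf; rewrite !IntDef /Rintegral fineK//; exact: integrable_fin_num. Qed.

Lemma eq_Int f g : f =1 g -> Int f = Int g.
Proof. by move=> /funext ->. Qed.

Lemma IntD f g : L1 f -> L1 g -> Int (fun x => f x + g x) = Int f + Int g.
Proof. by move=> Lf Lg; rewrite !IntDef RintegralD. Qed.

Lemma IntB f g : L1 f -> L1 g -> Int (fun x => f x - g x) = Int f - Int g.
Proof. by move=> Lf Lg; rewrite !IntDef RintegralB. Qed.

Lemma IntZ a f : L1 f -> Int (fun x => a * f x) = a * Int f.
Proof. by move=> Lf; rewrite !IntDef RintegralZl. Qed.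

Lemma IntZr a f : L1 f -> Int (fun x => f x * a) = Int f * a.
Proof. by move=> Lf; rewrite !IntDef RintegralZr. Qed.

Lemma IntN f : L1 f -> Int (fun x => - f x) = - Int f.
Proof.
by move=> Lf; rewrite -mulN1r -IntZ//; apply: eq_Int => x; rewrite mulN1r.
Qed.

Lemma Int0 : Int (fun=> 0) = 0.
Proof. by rewrite !IntDef /Rintegral integral0. Qed.

Lemma Int_sum (I : Type) (s : seq I) (F : I -> T -> R) :
  (forall i, L1 (F i)) ->
  Int (fun x => \sum_(i <- s) F i x) = \sum_(i <- s) Int (F i).
Proof.
move=> LF; elim: s => [|i s ih].
  by rewrite big_nil -[RHS]Int0; apply: eq_Int => x; rewrite big_nil.
rewrite big_cons -ih -IntD//; last exact: L1_sum.
by apply: eq_Int => x; rewrite big_cons.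
Qed.

Lemma Int_ge0 f : (forall x, 0 <= f x) -> 0 <= Int f.
Proof. by move=> f0; rewrite IntDef; apply: Rintegral_ge0 => x _. Qed.

Lemma le_Int f g : L1 f -> L1 g -> (forall x, f x <= g x) -> Int f <= Int g.
Proof. by move=> Lf Lg fg; rewrite !IntDef; apply: le_Rintegral => // x _. Qed.

Lemma le_Int0 f g : measurable_fun setT f -> L1 g -> (forall x, 0 <= f x <= g x) ->
  Int f <= Int g.
Proof.
move=> mf Lg fg; apply: le_Int => // [|x]; last by case/andP: (fg x).
by apply: (L1_le mf Lg) => x; case/andP: (fg x) => ? ?; rewrite ger0_norm.
Qed.

Lemma abs_Int f : L1 f -> `|Int f| <= Int (fun x => `|f x|).
Proof. by move=> Lf; rewrite !IntDef; exact: le_normr_Rintegral. Qed.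

Lemma abs_Int_le f g : L1 f -> L1 g -> (forall x, `|f x| <= g x) -> `|Int f| <= Int g.
Proof.
by move=> Lf Lg fg; apply: (le_trans (abs_Int Lf)); apply: le_Int => //; exact: L1_abs.
Qed.

Lemma ae_eq_Int f g : measurable_fun setT f -> measurable_fun setT g ->
  (f = g %[ae mu]) -> Int f = Int g.
Proof.
move=> mf mg fg; rewrite !IntDef /Rintegral; congr fine.
apply: ae_eq_integral => //; try exact/measurable_EFinP.
by apply: ae_imp fg => x fg _; rewrite /= fg.
Qed.

Lemma ae_eq_L1 f g : measurable_fun setT g -> (f = g %[ae mu]) -> L1 f -> L1 g.
Proof.
move=> mg fg Lf.
have Lf' := Lf; move: Lf' => /integrableP[mf fo].
apply/integrableP; split; first exact/measurable_EFinP.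
rewrite (_ : (\int[mu]_x _ = \int[mu]_x `|(EFin \o f) x|)%E)//.
apply: ae_eq_integral => //.
- by apply: measurableT_comp => //; exact/measurable_EFinP.
- by apply: measurableT_comp.
- by apply: ae_imp fg => x fg _; rewrite /= fg.
Qed.

Lemma L1_0le f : measurable_fun setT f -> (forall x, 0 <= f x) ->
  (\int[mu]_x (f x)%:E < +oo)%E -> L1 f.
Proof.
move=> mf f0 fo; apply/integrableP; split; first exact/measurable_EFinP.
by under eq_integral => x _ do rewrite /= ger0_norm//.
Qed.

Lemma Int_eq0_ae f : L1 f -> (forall x, 0 <= f x) -> Int f = 0 -> f = (fun=> 0) %[ae mu].
Proof.
move=> Lf f0 If.
have : (\int[mu]_x `|(EFin \o f) x| = 0)%E.
  transitivity ((Int f)%:E); last by rewrite If.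
  by rewrite IntE//; apply: eq_integral => x _; rewrite /= ger0_norm.
have mf : measurable_fun setT (EFin \o f) by exact/measurable_EFinP/L1_meas.
move/(ae_eq_integral_abs mu measurableT mf); rewrite /ae_eq.
by apply: ae_imp => x /(_ I) /= [].
Qed.

Lemma Int_dct (f_ : nat -> T -> R) f g :
  (forall n, measurable_fun setT (f_ n)) ->
  (forall x, f_ ^~ x @ \oo --> f x) -> L1 g ->
  (forall n x, `|f_ n x| <= g x) ->
  L1 f /\ (fun n => Int (f_ n)) @ \oo --> Int f.
Proof.
move=> mf_ cvf Lg fg.
have mf : measurable_fun setT f.
  by apply: (measurable_fun_cvg (fun n => mf_ n)) => x _; exact: cvf.
have [] := @dominated_convergence _ _ _ mu _ measurableT
    (fun n => EFin \o f_ n) (EFin \o f) (EFin \o g).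
- by move=> n; exact/measurable_EFinP.
- exact/measurable_EFinP.
- by apply: aeW => x _ /=; apply: cvg_EFin; [exact: nearW|exact: cvf].
- exact: Lg.
- by apply: aeW => x n _ /=; rewrite lee_fin.
move=> Lf _ h; split => //.
rewrite IntDef; under eq_fun do rewrite IntDef; apply: fine_cvg.
by rewrite -IntDef IntE.
Qed.

Lemma cvg0_le (u v : nat -> R) : (forall n, 0 <= u n <= v n) ->
  v @ \oo --> (0 : R) -> u @ \oo --> (0 : R).
Proof.
move=> uv v0; apply: (@squeeze_cvgr _ _ _ _ (cst 0) v) => //; last exact: cvg_cst.
by apply: nearW.
Qed.

Lemma L2M f g : L2 f -> L2 g -> L1 (fun x => f x * g x).
Proof.
move=> [mf Lf] [mg Lg]; apply: (@L1_le _ (fun x => f x ^+ 2 + g x ^+ 2)).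
- exact: measurable_funM.
- exact: L1D.
- move=> x; rewrite normrM.
  have := sqr_ge0 (`|f x| - `|g x|); rewrite -(real_normK (num_real (f x))).
  rewrite -(real_normK (num_real (g x))).
  have := normr_ge0 (f x); have := normr_ge0 (g x).
  by nra.
Qed.

Lemma L2_0 : L2 (fun=> 0).
Proof. by split => //; under eq_fun do rewrite expr0n; exact: L1_0. Qed.

Lemma L2_le f g : measurable_fun setT f -> L2 g -> (forall x, `|f x| <= `|g x|) -> L2 f.
Proof.
move=> mf [mg Lg] fg; split => //; apply: (@L1_le _ (fun x => g x ^+ 2)) => //.
  exact: measurable_funX.
by move=> x; rewrite normrX -(real_normK (num_real (g x))) lerXn2r ?nnegrE.
Qed.

Lemma L2Z a f : L2 f -> L2 (fun x => a * f x).
Proof.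
move=> [mf Lf]; split; first exact: measurable_funM.
by under eq_fun do rewrite exprMn; exact: L1Z.
Qed.

Lemma L2N f : L2 f -> L2 (fun x => - f x).
Proof. by move=> Lf; under eq_fun do rewrite -mulN1r; exact: L2Z. Qed.

Lemma L2D f g : L2 f -> L2 g -> L2 (fun x => f x + g x).
Proof.
move=> Lf Lg; have [mf Lf2] := Lf; have [mg Lg2] := Lg.
split; first exact: measurable_funD.
under eq_fun do rewrite sqrrD.
by apply: L1D => //; apply: L1D => //; under eq_fun do rewrite -mulr_natl;
  apply: L1Z; exact: L2M.
Qed.

Lemma L2B f g : L2 f -> L2 g -> L2 (fun x => f x - g x).
Proof. by move=> Lf /L2N; exact: L2D. Qed.

Lemma L2_abs f : L2 f -> L2 (fun x => `|f x|).
Proof.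
by move=> Lf; apply: (L2_le _ Lf) => [|x];
  [apply: measurableT_comp => //; exact: L2_meas|rewrite normr_id].
Qed.

Lemma L2_bd f g C : measurable_fun setT f -> (forall x, `|f x| <= C) -> L2 g ->
  L2 (fun x => f x * g x).
Proof.
move=> mf fC Lg; apply: (@L2_le _ (fun x => C * g x)).
- by apply: measurable_funM => //; exact: L2_meas.
- exact: L2Z.
- move=> x; rewrite !normrM ler_wpM2r// (le_trans (fC x))//; exact: ler_norm.
Qed.

Lemma L1_bd f g C : measurable_fun setT f -> (forall x, `|f x| <= C) -> L1 g ->
  L1 (fun x => f x * g x).
Proof.
move=> mf fC Lg; apply: (@L1_le _ (fun x => C * `|g x|)).
- by apply: measurable_funM => //; exact: L1_meas.
- exact/L1Z/L1_abs.
- by move=> x; rewrite normrM ler_wpM2r.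
Qed.

Lemma L2_of_bdL1 f C : (forall x, `|f x| <= C) -> L1 f -> L2 f.
Proof.
move=> fC Lf; split; first exact: L1_meas.
by under eq_fun do rewrite expr2; apply: (L1_bd _ fC) => //; exact: L1_meas.
Qed.

Lemma N2_ge0 f : 0 <= N2 f.
Proof. exact: sqrtr_ge0. Qed.

Lemma N2sq f : N2 f ^+ 2 = Int (fun x => f x ^+ 2).
Proof. by rewrite sqr_sqrtr//; apply: Int_ge0 => x; exact: sqr_ge0. Qed.

(** Young's inequality with weights b / (2 a) and a / (2 b), where a and b are positive upper bounds
    of the two norms. Working with bounds instead of the norms avoids a separate case for vanishing
    norms. *)
Lemma CS f g : L2 f -> L2 g -> Int (fun x => `|f x * g x|) <= N2 f * N2 g.
Proof.
move=> Lf Lg; have Lfg := L1_abs (L2M Lf Lg).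
have key (a b : R) : 0 < a -> 0 < b -> N2 f <= a -> N2 g <= b ->
    Int (fun x => `|f x * g x|) <= a * b.
  move=> a0 b0 fa gb.
  have : Int (fun x => `|f x * g x|) <=
      Int (fun x => (b / (2 * a)) * f x ^+ 2 + (a / (2 * b)) * g x ^+ 2).
    apply: le_Int => //.
      by apply: L1D; apply: L1Z; [case: Lf|case: Lg].
    move=> x; rewrite normrM -(real_normK (num_real (f x))).
    rewrite -(real_normK (num_real (g x))).
    set p := `|f x|; set q := `|g x|.
    have := sqr_ge0 (b * p - a * q) => h.
    rewrite -subr_ge0 (_ : _ - _ = (b * p - a * q) ^+ 2 / (2 * a * b)).
      by rewrite divr_ge0// mulr_ge0 ?mulr_ge0 ?ltW.
    by field; rewrite !gt_eqF.
  rewrite IntD; [|by apply: L1Z; case: Lf|by apply: L1Z; case: Lg].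
  rewrite !IntZ; [|by case: Lg|by case: Lf].
  rewrite -!N2sq => /le_trans; apply.
  have fa2 : N2 f ^+ 2 <= a ^+ 2 by rewrite lerXn2r ?nnegrE ?N2_ge0// ltW.
  have gb2 : N2 g ^+ 2 <= b ^+ 2 by rewrite lerXn2r ?nnegrE ?N2_ge0// ltW.
  apply: (@le_trans _ _ (b / (2 * a) * a ^+ 2 + a / (2 * b) * b ^+ 2)).
    by apply: lerD; rewrite ler_wpM2l// divr_ge0 ?mulr_ge0 ?ltW.
  by rewrite le_eqVlt; apply/orP; left; apply/eqP; field; rewrite !gt_eqF.
apply/ler_addgt0Pr => e e0.
pose D := 1 + N2 f + N2 g.
have D0 : 0 < D by rewrite /D; have := N2_ge0 f; have := N2_ge0 g; lra.
(* As t is at most 1, raising both norms by t raises their product by at most t * D. *)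
pose t := Num.min 1 (e / D).
have t0 : 0 < t by rewrite lt_min ltr01 divr_gt0.
have t1 : t <= 1 by rewrite ge_min lexx.
have tD : t * D <= e.
  by rewrite -ler_pdivlMr// ge_min lexx orbT.
have fN := N2_ge0 f; have gN := N2_ge0 g.
apply: (le_trans (key (N2 f + t) (N2 g + t) _ _ _ _)); try lra.
have : t * t <= t * 1 by rewrite ler_pM2l.
move: tD; rewrite /D; nra.
Qed.

Lemma CSr f g : L2 f -> L2 g -> `|Int (fun x => f x * g x)| <= N2 f * N2 g.
Proof.
by move=> Lf Lg; apply: le_trans (CS Lf Lg); apply: abs_Int; exact: L2M.
Qed.

Lemma N2Z a f : L2 f -> N2 (fun x => a * f x) = `|a| * N2 f.
Proof.
move=> [_ Lf]; rewrite /N2 -sqrtr_sqr -sqrtrM ?sqr_ge0// -IntZ//.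
by congr Num.sqrt; apply: eq_Int => x; rewrite exprMn.
Qed.

Lemma N2N f : N2 (fun x => - f x) = N2 f.
Proof. by congr Num.sqrt; apply: eq_Int => x; rewrite sqrrN. Qed.

Lemma N2_absE f : N2 (fun x => `|f x|) = N2 f.
Proof. by congr Num.sqrt; apply: eq_Int => x; rewrite real_normK ?num_real. Qed.

Lemma N2_0 : N2 (fun=> 0) = 0.
Proof. by rewrite /N2 (@eq_Int _ (fun=> 0)) ?Int0 ?sqrtr0// => x; rewrite expr0n. Qed.

Lemma N2D f g : L2 f -> L2 g -> N2 (fun x => f x + g x) <= N2 f + N2 g.
Proof.
move=> Lf Lg; rewrite -(@ler_pXn2r _ 2)// ?nnegrE ?addr_ge0 ?N2_ge0//.
have -> : N2 (fun x => f x + g x) ^+ 2 =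
    N2 f ^+ 2 + 2 * Int (fun x => f x * g x) + N2 g ^+ 2.
  have := L2M Lf Lg; have [_ ?] := Lf; have [_ ?] := Lg => ?.
  rewrite !N2sq -IntZ// -!IntD//.
  - by apply: eq_Int => x; rewrite sqrrD mulr_natl.
  - by apply: L1D => //; exact: L1Z.
  - exact: L1Z.
have := CSr Lf Lg => /ler_normlW h.
by rewrite sqrrD; rewrite -mulr_natl; lra.
Qed.

Lemma N2B f g : L2 f -> L2 g -> N2 (fun x => f x - g x) <= N2 f + N2 g.
Proof. by move=> Lf Lg; rewrite -(N2N g); apply: N2D => //; exact: L2N. Qed.

Lemma N2_le f g : measurable_fun setT f -> L2 g -> (forall x, `|f x| <= `|g x|) ->
  N2 f <= N2 g.
Proof.
move=> mf Lg fg; rewrite ler_wsqrtr//; have [mg Lg2] := Lg.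
apply: le_Int0 => // [|x]; first exact: measurable_funX.
rewrite sqr_ge0/= -(real_normK (num_real (f x))) -(real_normK (num_real (g x))).
by rewrite lerXn2r ?nnegrE.
Qed.

Lemma N2_bd f g C : measurable_fun setT f -> (forall x, `|f x| <= C) -> L2 g ->
  N2 (fun x => f x * g x) <= C * N2 g.
Proof.
move=> mf fC Lg.
have C0 : 0 <= C := le_trans (normr_ge0 _) (fC point).
rewrite -[X in X * _](ger0_norm C0) -N2Z//; apply: N2_le.
- by apply: measurable_funM => //; exact: L2_meas.
- exact: L2Z.
- by move=> x; rewrite !normrM ler_wpM2r// (ger0_norm C0).
Qed.

Lemma N2_tri f g : L2 f -> L2 g -> `|N2 f - N2 g| <= N2 (fun x => f x - g x).
Proof.
move=> Lf Lg; have LB := L2B Lf Lg.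
have h1 : N2 f <= N2 (fun x => f x - g x) + N2 g.
  by rewrite -(_ : N2 (fun x => (f x - g x) + g x) = N2 f) ?N2D//;
    congr N2; apply/funext => x; rewrite subrK.
have h2 : N2 g <= N2 f + N2 (fun x => f x - g x).
  rewrite -{1}(_ : N2 (fun x => f x - (f x - g x)) = N2 g) ?N2B//;
    by congr N2; apply/funext => x; rewrite subKr.
by rewrite ler_norml; apply/andP; split; lra.
Qed.

Lemma ae_eq_N2 f g : measurable_fun setT f -> measurable_fun setT g ->
  (f = g %[ae mu]) -> N2 f = N2 g.
Proof.
move=> mf mg fg; congr Num.sqrt; apply: ae_eq_Int; try exact: measurable_funX.
by apply: ae_imp fg => x fg /fg ->.
Qed.

Lemma N2_eq0_ae f : L2 f -> N2 f = 0 -> f = (fun=> 0) %[ae mu].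
Proof.
move=> [mf Lf] f0; have : Int (fun x => f x ^+ 2) = 0 by rewrite -N2sq f0 expr0n.
move=> /(Int_eq0_ae Lf (fun x => sqr_ge0 (f x))); apply: ae_imp => x h /h/= /eqP.
by rewrite sqrf_eq0 => /eqP.
Qed.

(* Lower semicontinuity of the L2 norm under L1 convergence, tested against the
   truncations of the limit. *)
Lemma L2_lsc (f_ : nat -> T -> R) f C : (forall n, L2 (f_ n)) ->
  (forall n, N2 (f_ n) <= C) -> L1 f -> (forall n, L1 (f_ n)) ->
  (fun n => Int (fun x => `|f_ n x - f x|)) @ \oo --> (0 : R) ->
  L2 f /\ N2 f <= C.
Proof.
move=> Lf_ fC Lf Lf1 cvf; have mf := L1_meas Lf.
have C0 : 0 <= C := le_trans (N2_ge0 _) (fC 0%N).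
pose tr (M : nat) x := if `|f x| <= M%:R then f x else 0.
have mtr M : measurable_fun setT (tr M).
  apply: measurable_fun_ifT => //.
  by apply: measurable_fun_ler => //; exact: measurableT_comp.
have trM M x : `|tr M x| <= M%:R by rewrite /tr; case: ifP => // _; rewrite normr0.
have trf M x : `|tr M x| <= `|f x| by rewrite /tr; case: ifP => // _; rewrite normr0.
have trE M x : tr M x * f x = tr M x ^+ 2.
  by rewrite /tr; case: ifP => _; rewrite ?mul0r ?expr0n ?expr2.
have Ltr M : L2 (tr M).
  apply: (L2_of_bdL1 (trM M)); apply: (L1_le (mtr M) (L1_abs Lf)); exact: trf.
have trC M : Int (fun x => tr M x ^+ 2) <= C ^+ 2.
  have h : N2 (tr M) ^+ 2 <= C * N2 (tr M).
    apply/ler_addgt0Pr => e e0.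
    have M0 : 0 <= M%:R :> R by [].
    have /cvgrPdist_lt /(_ (e / (M%:R + 1))) : (fun n => Int (fun x => `|f_ n x - f x|)) @ \oo --> (0 : R) by [].
    rewrite divr_gt0// ?ltr_wpDl// => /(_ isT) [N _ /(_ N (leqnn _))] /=.
    rewrite sub0r normrN => /ltW he.
    have LB : L1 (fun x => f_ N x - f x) by exact: L1B.
    rewrite N2sq (_ : Int _ = Int (fun x => tr M x * f_ N x) - Int (fun x => tr M x * (f_ N x - f x))); last first.
      rewrite -IntB.
      - by apply: eq_Int => x; rewrite -trE; ring.
      - exact: L2M.
      - exact: L1_bd (mtr M) (trM M) LB.
    have h1 := ler_normlW (CSr (Ltr M) (Lf_ N)).
    have h2 : `|Int (fun x => tr M x * (f_ N x - f x))| <= M%:R * Int (fun x => `|f_ N x - f x|).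
      rewrite -IntZ; last exact: L1_abs.
      apply: abs_Int_le.
      - exact: L1_bd (mtr M) (trM M) LB.
      - exact/L1Z/L1_abs.
      - by move=> x; rewrite normrM ler_wpM2r.
    have h3 : N2 (tr M) * N2 (f_ N) <= C * N2 (tr M).
      by rewrite mulrC ler_wpM2r ?N2_ge0.
    have h4 : M%:R * Int (fun x => `|f_ N x - f x|) <= e.
      apply: (@le_trans _ _ (M%:R * (e / (M%:R + 1)))).
        by rewrite ler_wpM2l// (le_trans _ he)// ler_norm.
      by rewrite mulrCA ger_pMr// ler_pdivrMr ?mul1r ?lerDl// ltr_wpDl.
    by move: h2; rewrite ler_norml => /andP[h2 _]; lra.
  rewrite -N2sq lerXn2r ?nnegrE ?N2_ge0//.
  have [->//|n0] := eqVneq (N2 (tr M)) 0.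
  move: h; rewrite expr2 ler_pM2r// lt_neqAle eq_sym n0; exact: N2_ge0.
have lim : (\int[mu]_x (f x ^+ 2)%:E <= (C ^+ 2)%:E)%E.
  have := @cvg_monotone_convergence _ _ _ mu setT measurableT
     (fun M x => (tr M x ^+ 2)%:E).
  move=> /(_ _ _ _)/cvg_lim; rewrite (_ : (fun x => lim _) = (fun x => (f x ^+ 2)%:E)); last first.
    apply/funext => x; apply/cvg_lim => //; apply: cvg_EFin; first exact: nearW.
    apply: cvg_near_cst.
    exists (Num.truncn `|f x|).+1 => // M /= hM.
    rewrite /tr ifT//; apply: (le_trans (ltW (truncnS_gt _))).
    by rewrite ler_nat.
  move=> <- //.
  - apply: lime_le.
      apply: ereal_nondecreasing_is_cvgn => a b ab.
      apply: ge0_le_integral => //.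
      + by move=> x _; rewrite lee_fin sqr_ge0.
      + by apply/measurable_EFinP; exact: measurable_funX.
      + by apply/measurable_EFinP; exact: measurable_funX.
      + move=> x _; rewrite lee_fin /tr.
        case: ifP => h; last by rewrite expr0n; exact: sqr_ge0.
        by rewrite ifT// (le_trans h)// ler_nat.
    by apply: nearW => M; rewrite -IntE ?lee_fin//; case: (Ltr M).
  - by move=> n; apply/measurable_EFinP; exact: measurable_funX.
  - by move=> n x _; rewrite lee_fin sqr_ge0.
  - move=> x _ a b ab; rewrite lee_fin /tr.
    case: ifP => h; last by rewrite expr0n; exact: sqr_ge0.
    by rewrite ifT// (le_trans h)// ler_nat.
have Lf2 : L2 f.
  split => //; apply: L1_0le; [exact: measurable_funX|by move=> x; exact: sqr_ge0|].
  by rewrite (le_lt_trans lim)// ltry.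
split=> //; rewrite -(@ler_pXn2r _ 2)// ?nnegrE ?N2_ge0// N2sq -lee_fin IntE//.
by case: Lf2.
Qed.

End integrals.

(** * Product measures *)

Notation PL R := (measurableTypeR R * measurableTypeR R)%type.

Section measurability.
Context {R : realType}.

Lemma mcomp d1 d2 d3 (T1 : measurableType d1) (T2 : measurableType d2)
  (T3 : measurableType d3) (f : T2 -> T3) (g : T1 -> T2) :
  measurable_fun setT f -> measurable_fun setT g ->
  measurable_fun setT (fun x => f (g x)).
Proof. by move=> mf mg; exact: measurableT_comp mf mg. Qed.

Lemma mcomp2 d1 d2 d3 d4 (T1 : measurableType d1) (T2 : measurableType d2)
  (T3 : measurableType d3) (T4 : measurableType d4) (f : T2 -> T3 -> T4)
  (a : T1 -> T2) (b : T1 -> T3) :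
  measurable_fun setT (fun z : T2 * T3 => f z.1 z.2) ->
  measurable_fun setT a -> measurable_fun setT b ->
  measurable_fun setT (fun x => f (a x) (b x)).
Proof.
move=> mf ma mb.
exact: (mcomp (f := fun z : T2 * T3 => f z.1 z.2) mf (measurable_fun_pair ma mb)).
Qed.

Lemma mslice d1 d2 d3 (T1 : measurableType d1) (T2 : measurableType d2)
  (T3 : measurableType d3) (f : T1 -> T2 -> T3) x :
  measurable_fun setT (fun z : T1 * T2 => f z.1 z.2) -> measurable_fun setT (f x).
Proof. by move=> mf; apply: (mcomp2 mf). Qed.

Context d (T : measurableType d).

Lemma m2pair (f g : T -> measurableTypeR R) : measurable_fun setT f -> measurable_fun setT g ->
  measurable_fun setT (fun x => (f x, g x)).
Proof. exact: measurable_fun_pair. Qed.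

Lemma m2fst (f : T -> PL R) : measurable_fun setT f ->
  measurable_fun setT (fun x => (f x).1).
Proof. exact: mcomp measurable_fst. Qed.

Lemma m2snd (f : T -> PL R) : measurable_fun setT f ->
  measurable_fun setT (fun x => (f x).2).
Proof. exact: mcomp measurable_snd. Qed.

Lemma m2D (f g : T -> PL R) : measurable_fun setT f -> measurable_fun setT g ->
  measurable_fun setT (fun x => f x + g x).
Proof.
move=> mf mg; apply: m2pair; apply: measurable_funD;
  by [exact: m2fst|exact: m2snd].
Qed.

Lemma m2B (f g : T -> PL R) : measurable_fun setT f -> measurable_fun setT g ->
  measurable_fun setT (fun x => f x - g x).
Proof.
move=> mf mg; apply: m2pair; apply: measurable_funB;
  by [exact: m2fst|exact: m2snd].
Qed.

Lemma mabs (f : T -> R) : measurable_fun setT f ->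
  measurable_fun setT (fun x => `|f x|).
Proof. by move=> mf; exact: measurableT_comp. Qed.

End measurability.

Section fubini.
Context d1 d2 (T1 : measurableType d1) (T2 : measurableType d2) (R : realType).
Context (m1 : {sigma_finite_measure set T1 -> \bar R}).
Context (m2 : {sigma_finite_measure set T2 -> \bar R}).
Implicit Type F : T1 -> T2 -> R.

(** An integrable extended function is finite almost everywhere; this carries Fubini's theorem from
    the extended reals to real valued inner integrals. *)
Lemma L1_fine d (T : measurableType d) (mu : {measure set T -> \bar R})
    (g : T -> \bar R) : mu.-integrable setT g ->
  L1 mu (fun x => fine (g x)) /\ (Int mu (fun x => fine (g x)))%:E = (\int[mu]_x g x)%E.
Proof.
move=> ig; have mg := measurable_int _ ig.
have fg : {ae mu, forall x, setT x -> (EFin \o (fun x => fine (g x))) x = g x}.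
  have := integrable_ae measurableT ig.
  by apply: ae_imp => x h /h/= fx; rewrite fineK.
have mfg : measurable_fun setT (EFin \o (fun x => fine (g x))).
  by apply/measurable_EFinP; exact: measurableT_comp.
have Lg : L1 mu (fun x => fine (g x)).
  move: ig => /integrableP[_ ig]; apply/integrableP; split => //.
  rewrite (_ : (\int[mu]_x _ = \int[mu]_x `|g x|)%E)//.
  apply: ae_eq_integral => //; try exact: measurableT_comp.
  by apply: ae_imp fg => x h /h /= <-.
by split => //; rewrite IntE//; exact: ae_eq_integral.
Qed.

Lemma meas_int F : measurable_fun setT (fun p => F p.1 p.2) ->
  measurable_fun setT (fun x => \int[m2]_y (F x y)%:E)%E.
Proof.
move=> mF; under eq_fun do rewrite integralE.
apply: emeasurable_funB.
- under eq_fun do under eq_integral do rewrite (funepos_comp (EFin \o (fun p => F p.1 p.2)) (pair _)).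
  apply: (measurable_fun_fubini_tonelli_F (fun p => ((EFin \o (fun p => F p.1 p.2))^\+)%E p)) => //.
  exact/measurable_funepos/measurable_EFinP.
- under eq_fun do under eq_integral do rewrite (funeneg_comp (EFin \o (fun p => F p.1 p.2)) (pair _)).
  apply: (measurable_fun_fubini_tonelli_F (fun p => ((EFin \o (fun p => F p.1 p.2))^\-)%E p)) => //.
  exact/measurable_funeneg/measurable_EFinP.
Qed.

Lemma meas_Int F : measurable_fun setT (fun p => F p.1 p.2) ->
  measurable_fun setT (fun x => Int m2 (F x)).
Proof.
by move=> /meas_int mF; under eq_fun do rewrite IntDef; apply: (mcomp (f := fine)) => //; exact: fine_measurable.
Qed.

Lemma prodL1 F : measurable_fun setT (fun p => F p.1 p.2) ->
  (forall x, L1 m2 (F x)) -> L1 m1 (fun x => Int m2 (fun y => `|F x y|)) ->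
  L1 (m1 \x m2)%E (fun p => F p.1 p.2).
Proof.
move=> mF LF LI; apply/integrable12ltyP; first exact/measurable_EFinP.
under eq_integral => x _ do rewrite /= -(IntE (L1_abs (LF x))).
by rewrite -(IntE LI) ltry.
Qed.

Lemma prodL1r F : measurable_fun setT (fun p => F p.1 p.2) ->
  (forall y, L1 m1 (F^~ y)) -> L1 m2 (fun y => Int m1 (fun x => `|F x y|)) ->
  L1 (m1 \x m2)%E (fun p => F p.1 p.2).
Proof.
move=> mF LF LI; apply/integrable21ltyP; first exact/measurable_EFinP.
under eq_integral => x _ do rewrite /= -(IntE (L1_abs (LF x))).
by rewrite -(IntE LI) ltry.
Qed.

Section integrable.
Variable F : T1 -> T2 -> R.
Hypothesis LF : L1 (m1 \x m2)%E (fun p => F p.1 p.2).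

Lemma fub_meas : measurable_fun setT (fun p => F p.1 p.2).
Proof. exact: L1_meas LF. Qed.

Lemma fub12 : L1 m1 (fun x => Int m2 (F x)) /\
  Int m1 (fun x => Int m2 (F x)) = Int (m1 \x m2)%E (fun p => F p.1 p.2).
Proof.
have /L1_fine[L e] := integrable_fubini_F LF.
have E : (fun x => Int m2 (F x)) = (fun x => fine (fubini_F m2 (EFin \o (fun p => F p.1 p.2)) x)).
  by apply/funext => x; rewrite IntDef.
rewrite E; split => //.
by apply: EFin_inj; rewrite [LHS]e IntE// integral12_prod_meas1.
Qed.

Lemma fub21 : L1 m2 (fun y => Int m1 (F^~ y)) /\
  Int m2 (fun y => Int m1 (F^~ y)) = Int (m1 \x m2)%E (fun p => F p.1 p.2).
Proof.
have iG : m2.-integrable setT (fubini_G m1 (EFin \o (fun p => F p.1 p.2))).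
  apply/integrableP; split; first exact: measurable_fubini_G LF.
  have := (integrable21ltyP m1 m2 (measurable_int _ LF)).1 LF; apply: le_lt_trans.
  apply: ge0_le_integral => //.
  - by apply: measurableT_comp => //; exact: measurable_fubini_G LF.
  - apply: (measurable_fun_fubini_tonelli_G (fun p => `|(EFin \o (fun p => F p.1 p.2)) p|%E)) => //.
    by apply: measurableT_comp => //; exact: measurable_int LF.
  - move=> y _; rewrite /fubini_G; apply: le_abse_integral => //.
    apply/measurable_EFinP.
    exact: (measurable_fun_pair1 (f := fun p => F p.1 p.2) y fub_meas).
have /L1_fine[L e] := iG.
have E : (fun y => Int m1 (F^~ y)) = (fun y => fine (fubini_G m1 (EFin \o (fun p => F p.1 p.2)) y)).
  by apply/funext => y; rewrite IntDef.
rewrite E; split => //.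
by apply: EFin_inj; rewrite [LHS]e IntE// integral21_prod_meas1.
Qed.

Lemma fubE : Int m1 (fun x => Int m2 (F x)) = Int m2 (fun y => Int m1 (F^~ y)).
Proof. by rewrite fub12.2 fub21.2. Qed.

End integrable.

(** Norm bounds for superpositions of translates are reduced to this form: only the integrals over
    the first variable have to be bounded, and integrability of the outer integral comes with the
    estimate. *)
Lemma tonelli_le F (g : T2 -> R) :
  measurable_fun setT (fun p => F p.1 p.2) -> (forall x y, 0 <= F x y) ->
  (forall y, L1 m1 (F^~ y)) -> L1 m2 g -> (forall y, Int m1 (F^~ y) <= g y) ->
  L1 m1 (fun x => Int m2 (F x)) /\ Int m1 (fun x => Int m2 (F x)) <= Int m2 g.
Proof.
move=> mF F0 LF Lg Fg.
have mI : measurable_fun setT (fun y => Int m1 (F^~ y)).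
  under eq_fun do rewrite IntDef.
  apply: (mcomp (f := fine)); first exact: fine_measurable.
  apply: (measurable_fun_fubini_tonelli_G (fun p => (EFin \o (fun p => F p.1 p.2)) p)) => //.
    exact/measurable_EFinP.
  by move=> x; rewrite /= lee_fin.
have LI : L1 m2 (fun y => Int m1 (fun x => `|F x y|)).
  under eq_fun do under eq_Int do rewrite ger0_norm//.
  apply: (L1_le mI Lg) => y; rewrite ger0_norm//; exact: Int_ge0.
have LP := prodL1r mF LF LI.
split; first exact: (fub12 LP).1.
rewrite (fubE LP); apply: le_Int => //; exact: (fub21 LP).1.
Qed.

End fubini.

Definition lam (R : realType) :
    {sigma_finite_measure set (measurableTypeR R) -> \bar R} :=
  @lebesgue_measure R.
Arguments lam {R}.

(** The product measure gets a name so that it can carry a sigma-finite structure: in correlations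
    the plane is itself a factor of a product, and Fubini's theorem asks for sigma-finiteness of
    both factors. *)
Definition lam2_fun (R : realType) : set (PL R) -> \bar R :=
  (@lam R \x @lam R)%E.

HB.instance Definition _ (R : realType) := Measure.on (@lam2_fun R).

Lemma lam2_sigma_finite (R : realType) : sigma_finite setT (@lam2_fun R).
Proof.
have /sigma_finiteP[F [TF ndF Foo]] := sigma_finiteT (@lam R).
exists (fun n => F n `*` F n).
  apply/seteqP; split=> [[x y] _|//].
  have [n _ Fx] : (\bigcup_n F n) x by rewrite -TF.
  have [k _ Fy] : (\bigcup_n F n) y by rewrite -TF.
  exists (maxn n k) => //; split.
  - by move: x Fx; exact/subsetPset/ndF/leq_maxl.
  - by move: y Fy; exact/subsetPset/ndF/leq_maxr.
move=> k; have [mF Fk] := Foo k; split; first exact: measurableX.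
by rewrite /lam2_fun product_measure1E// lte_mul_pinfty// ge0_fin_numE.
Qed.

HB.instance Definition _ (R : realType) :=
  Measure_isSigmaFinite.Build _ _ _ (@lam2_fun R) (@lam2_sigma_finite R).

Definition lam2 (R : realType) : {sigma_finite_measure set (PL R) -> \bar R} :=
  @lam2_fun R.
Arguments lam2 {R}.

(** * Translation invariance of the integral *)

Section translation.
Context {R : realType}.
Local Open Scope ereal_scope.

(** Lebesgue measure is determined by its values on half-open intervals, and a translation does not
    change their lengths. *)
Lemma lebesgue_shift (a : R) (A : set (measurableTypeR R)) : measurable A ->
  pushforward lam (fun x => x + a : measurableTypeR R)%R A = lam A.
Proof.
move=> mA.
apply/esym/lebesgue_measure_unique => //; first exact: measurable_funD.
move=> ? _ [[b c] _ <-] /=; rewrite /pushforward /=.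
rewrite (_ : (fun x => x + a)%R @^-1` `]b, c] = `](b - a)%R, (c - a)%R]%classic).
  rewrite /lam/= !lebesgue_measure_itv/= !lte_fin ltrD2r.
  by case: ifPn => // _; rewrite -!EFinB; congr EFin; ring.
by apply/seteqP; split => x /=; rewrite !in_itv/= ltrBlDr lerBrDr.
Qed.

Lemma int_shift1 (a : R) (f : measurableTypeR R -> \bar R) : measurable_fun setT f ->
  (forall x, 0 <= f x) -> \int[lam]_x f (x + a)%R = \int[lam]_x f x.
Proof.
move=> mf f0.
have mshift : measurable_fun setT (fun x : measurableTypeR R => x + a : measurableTypeR R)%R by exact: measurable_funD.
transitivity (\int[pushforward lam (fun x : measurableTypeR R => x + a : measurableTypeR R)%R]_x f x).
  by rewrite (ge0_integral_pushforward mshift)//.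
by apply: eq_measure_integral => A mA _; exact: lebesgue_shift.
Qed.

Lemma int_lam2E (f : PL R -> \bar R) : \int[lam2]_x f x = \int[lam \x lam]_x f x.
Proof. by []. Qed.

Lemma int_shift (z : R * R) (f : PL R -> \bar R) : measurable_fun setT f ->
  (forall x, 0 <= f x) -> \int[lam2]_x f (x + z)%R = \int[lam2]_x f x.
Proof.
move=> mf f0; rewrite !int_lam2E.
have mz : measurable_fun setT (fun x : PL R => x + z)%R by exact: m2D.
rewrite fubini_tonelli1//; last exact: (mcomp mf mz).
rewrite fubini_tonelli1// /fubini_F.
rewrite -[RHS](int_shift1 z.1); first last.
- by move=> x; exact: integral_ge0.
- exact: (measurable_fun_fubini_tonelli_F f).
apply: eq_integral => x _; rewrite -[RHS](int_shift1 z.2)//.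
exact: measurable_fun_pair2.
Qed.

Lemma int_shiftr (z : R * R) (f : PL R -> R) : measurable_fun setT f ->
  \int[lam2]_x (f (x + z)%R)%:E = \int[lam2]_x (f x)%:E.
Proof.
move=> mf; rewrite integralE [RHS]integralE; congr (_ - _).
- have h := int_shift z (f := (EFin \o f)^\+) (measurable_funepos _) (funepos_ge0 _).
  rewrite -h; last exact/measurable_EFinP.
  by apply: eq_integral => x _; rewrite !funeposE.
- have h := int_shift z (f := (EFin \o f)^\-) (measurable_funeneg _) (funeneg_ge0 _).
  rewrite -h; last exact/measurable_EFinP.
  by apply: eq_integral => x _; rewrite !funenegE.
Qed.

Local Open Scope ring_scope.

Lemma Int_shift (z : R * R) (f : PL R -> R) : measurable_fun setT f ->
  Int lam2 (fun x => f (x + z)) = Int lam2 f.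
Proof. by move=> mf; rewrite !IntDef /Rintegral int_shiftr. Qed.

Lemma meas_shift (z : R * R) (f : PL R -> R) : measurable_fun setT f ->
  measurable_fun setT (fun x : PL R => f (x + z)).
Proof. by move=> mf; apply: (mcomp mf); exact: m2D. Qed.

Lemma L1_shift (z : R * R) (f : PL R -> R) : L1 lam2 f ->
  L1 lam2 (fun x => f (x + z)).
Proof.
move=> Lf; have mf := L1_meas Lf.
move/integrableP : Lf => [_ fo]; apply/integrableP; split.
  by apply/measurable_EFinP; exact: meas_shift.
have := int_shiftr z (mabs mf) => /= ->; exact: fo.
Qed.

Lemma L2_shift (z : R * R) (f : PL R -> R) : L2 lam2 f ->
  L2 lam2 (fun x => f (x + z)).
Proof.
by move=> [mf Lf]; split; [exact: meas_shift|exact: (L1_shift z Lf)].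
Qed.

Lemma N2_shift (z : R * R) (f : PL R -> R) : measurable_fun setT f ->
  N2 lam2 (fun x => f (x + z)) = N2 lam2 f.
Proof.
move=> mf; congr Num.sqrt; apply: (Int_shift z (f := fun x => f x ^+ 2)).
exact: measurable_funX.
Qed.

End translation.

(** * Continuity of translations in L2 *)

Lemma Int_dct_ae d (T : measurableType d) (R : realType) (mu : {measure set T -> \bar R})
  (f_ : nat -> T -> R) (f g : T -> R) :
  (forall n, measurable_fun setT (f_ n)) -> measurable_fun setT f -> L1 mu g ->
  {ae mu, forall x, f_ ^~ x @ \oo --> f x /\ forall n, `|f_ n x| <= g x} ->
  (fun n => Int mu (f_ n)) @ \oo --> Int mu f.
Proof.
move=> mf_ mf Lg H.
have [] := @dominated_convergence _ _ _ mu _ measurableT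
    (fun n => EFin \o f_ n) (EFin \o f) (EFin \o g).
- by move=> n; exact/measurable_EFinP.
- exact/measurable_EFinP.
- by apply: ae_imp H => x [cx _] _ /=; apply: cvg_EFin; first exact: nearW.
- exact: Lg.
- by apply: ae_imp H => x [_ bx] n _ /=; rewrite lee_fin.
move=> Lf _ h; rewrite IntDef; under eq_fun do rewrite IntDef; apply: fine_cvg.
by rewrite -IntDef IntE.
Qed.

Section translation_line.
Context {R : realType}.
Notation RM := (measurableTypeR R).
Implicit Types f g : RM -> R.

Lemma meas_shift1 (a : R) f : measurable_fun setT f ->
  measurable_fun setT (fun x : RM => f (x + a)).
Proof. by move=> mf; apply: (mcomp mf); exact: measurable_funD. Qed.

Lemma Int_shift1 (a : R) f : measurable_fun setT f -> (forall x, 0 <= f x) ->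
  Int lam (fun x => f (x + a)) = Int lam f.
Proof.
move=> mf f0; rewrite !IntDef /Rintegral (int_shift1 a (f := EFin \o f))//.
exact/measurable_EFinP.
Qed.

Lemma L1_shift1 (a : R) f : L1 lam f -> L1 lam (fun x => f (x + a)).
Proof.
move=> Lf; have mf := L1_meas Lf.
move/integrableP : Lf => [_ fo]; apply/integrableP; split.
  by apply/measurable_EFinP; exact: meas_shift1.
have := int_shift1 a (f := EFin \o (fun x => `|f x|)) _ _ => /= ->; first exact: fo.
- by apply/measurable_EFinP; exact: mabs.
- by move=> x; rewrite lee_fin.
Qed.

Lemma L2_shift1 (a : R) f : L2 lam f -> L2 lam (fun x => f (x + a)).
Proof. by move=> [mf Lf]; split; [exact: meas_shift1|exact: (L1_shift1 a Lf)]. Qed.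

Lemma in_segment (a : R) (x : RM) :
  (x \in (`[- a, a]%classic : set RM)) = (`|x| <= a).
Proof. by apply/idP/idP; rewrite inE/= in_itv/= -ler_norml. Qed.

Definition box1 (a : R) (x : RM) : R := if `|x| <= a then 1 else 0.

Lemma meas_box1 a : measurable_fun setT (box1 a).
Proof.
by apply: measurable_fun_ifT => //; apply: measurable_fun_ler => //; exact: mabs.
Qed.

Lemma L1_box1 a : L1 lam (box1 a).
Proof.
apply: L1_0le; [exact: meas_box1|by move=> x; rewrite /box1; case: ifP|].
rewrite (_ : (\int[lam]_x _ = \int[lam]_x (\1_(`[-a, a]%classic : set RM) x)%:E)%E); last first.
  apply: eq_integral => x _; rewrite indicE /box1 in_segment.
  by case: ifP.
rewrite integral_indic// setIT /lam /= lebesgue_measure_itv/=.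
by case: ifPn => // _; rewrite -EFinB ltry.
Qed.

(** Dominated convergence: the cut-off to |x| <= a and the bound |h n| <= 1 keep all arguments in
    the compact interval of radius a + 1, where [g] is bounded. *)
Lemma continuous_shift_L1 (a : R) g (h : nat -> R) : continuous (g : R -> R) ->
  h @ \oo --> (0 : R) -> (forall n, `|h n| <= 1) ->
  (fun n => Int lam (fun x => box1 a x * `|g (x + h n) - g x|)) @ \oo --> (0 : R).
Proof.
move=> cg h0 h1.
have mg : measurable_fun setT g by exact: continuous_measurable_fun.
have [C hC] : exists C : R, forall x : R, `|x| <= a + 1 -> `|g x| <= C.
  have : compact ((g : R -> R) @` `[-(a + 1), a + 1]%classic).
    apply: continuous_compact; last exact: segment_compact.
    exact: continuous_subspaceT.
  move=> /compact_bounded [M [_ hM]]; exists (M + 1) => x xa.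
  by apply: hM; [rewrite ltrDl|exists x => //=; rewrite in_itv/= -ler_norml].
have := @Int_dct _ _ _ lam (fun n x => box1 a x * `|g (x + h n) - g x|) (fun=> 0)
   (fun x => box1 a x * (C + C)).
rewrite Int0; case => //.
- move=> n; apply: measurable_funM; first exact: meas_box1.
  by apply/mabs/measurable_funB => //; exact: meas_shift1.
- move=> x; rewrite -[X in _ --> X](mulr0 (box1 a x)).
  apply: cvgMr; rewrite -(normr0 R) -[X in `|X|](subrr (g x)).
  apply: cvg_norm; apply: cvgB; last exact: cvg_cst.
  have xh : (fun n => x + h n) @ \oo --> (x : R).
    by rewrite -[X in _ --> X]addr0; apply: cvgD => //; exact: cvg_cst.
  exact: (cvg_comp _ _ xh (cg x)).
- by apply: L1Zr; exact: L1_box1.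
- move=> n x; rewrite /box1; case: ifP => hx; last by rewrite !mul0r normr0.
  rewrite !mul1r normr_id (le_trans (ler_normB _ _))// lerD//.
    by rewrite hC// (le_trans (ler_normD _ _))// lerD.
  by rewrite hC// (le_trans hx)// lerDl.
Qed.

(** Approximation of [f] in L1 by a continuous function on a larger interval; translating the
    approximation error does not change its integral. *)
Lemma bounded_shift_L1 f (M : R) (h : nat -> R) : measurable_fun setT f ->
  (forall x, `|f x| <= M) -> (forall x, M < `|x| -> f x = 0) ->
  h @ \oo --> (0 : R) -> (forall n, `|h n| <= 1) ->
  (fun n => Int lam (fun x => `|f (x + h n) - f x|)) @ \oo --> (0 : R).
Proof.
move=> mf fM f0 h0 h1.
(* Two units of margin: for |x| <= M + 1 both x and x + h n lie in [E], and for larger |x| both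
   values of [f] vanish. *)
pose E : set RM := `[- (M + 2), M + 2]%classic.
have mE : measurable E by exact: measurable_itv.
have Lcut (g : RM -> R) : measurable_fun setT g -> lam.-integrable E (EFin \o g) ->
    L1 lam (fun x => box1 (M + 2) x * g x).
  move=> mg /(integrable_mkcond _ mE) ig.
  rewrite /L1 (_ : _ \o _ = (EFin \o g) \_ E)//.
  apply/funext => x /=; rewrite patchE /box1 in_segment.
  by case: ifP; rewrite ?mul1r ?mul0r.
have Lf : L1 lam f.
  apply: (@L1_le _ _ _ _ _ (fun x => box1 M x * M)) => //.
    by apply: L1Zr; exact: L1_box1.
  move=> x; rewrite /box1; case: (leP `|x| M) => hx; first by rewrite mul1r.
  by rewrite f0// mul0r normr0.
have iE : lam.-integrable E (EFin \o f).
  by apply: integrableS Lf => //; exact: measurable_itv.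
have [||g_ [cg ig cvg]] := @approximation_continuous_integrable R E f _ _ iE.
- exact: measurable_itv.
- have hE := @lebesgue_measure_itv R `[- (M + 2), M + 2]%R.
  apply: (@eq_ind_r _ _ (fun y => y < +oo)%E _ _ hE).
  by rewrite /=; case: ifPn => // _; rewrite -EFinB ltry.
apply/cvgrPdist_lt => e e0.
have e40 : 0 < e / 4 by rewrite divr_gt0.
have [N hN] : exists N, Int lam (fun x => box1 (M + 2) x * `|f x - g_ N x|) < e / 4.
  have /fine_cvgP[_ /cvgrPdist_lt /(_ _ e40)[N _ /(_ N (leqnn _))]] := cvg.
  rewrite /= sub0r normrN => hN; exists N.
  apply: le_lt_trans hN; rewrite (le_trans _ (ler_norm _))//.
  rewrite le_eqVlt; apply/orP; left; apply/eqP; rewrite !IntDef /Rintegral; congr fine.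
  rewrite [RHS]integral_mkcond; apply: eq_integral => x _.
  rewrite patchE /box1 in_segment.
  by case: ifP; rewrite ?mul1r ?mul0r.
pose g : RM -> R := g_ N.
have {}hN : Int lam (fun x => box1 (M + 2) x * `|f x - g x|) < e / 4 := hN.
have mg : measurable_fun (setT : set RM) g by apply: continuous_measurable_fun; exact: cg.
pose a x := box1 (M + 2) x * `|f x - g x|.
have La : L1 lam a.
  apply: Lcut; first by apply/mabs; exact: measurable_funB.
  have := integrable_abse (integrableB mE iE (ig N)).
  exact: eq_integrable.
have ma := L1_meas La.
have a0 x : 0 <= a x by rewrite /a /box1; case: ifP; rewrite ?mul1r ?mul0r.
have key n x : `|f (x + h n) - f x| <=
    a (x + h n) + box1 (M + 1) x * `|g (x + h n) - g x| + a x.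
  have [hx|hx] := leP `|x| (M + 1).
    have hx2 : `|x + h n| <= M + 2.
      by rewrite (le_trans (ler_normD _ _))//; have := h1 n; lra.
    rewrite /a /box1 hx hx2 ifT ?mul1r; last by lra.
    rewrite (_ : f (x + h n) - f x =
      (f (x + h n) - g (x + h n)) + (g (x + h n) - g x) - (f x - g x)); last by ring.
    by rewrite (le_trans (ler_normB _ _))// lerD2r ler_normD.
  have hx2 : M < `|x + h n|.
    have := ler_normB (x + h n) (h n); rewrite addrK.
    by have := h1 n; lra.
  rewrite (f0 _ hx2) f0 ?subrr ?normr0; last by lra.
  by rewrite !addr_ge0// /box1; case: ifP; rewrite ?mul1r ?mul0r.
have cvgg := continuous_shift_L1 (M + 1) (cg N) h0 h1.
have /cvgrPdist_lt /(_ _ e40) := cvgg; apply: filterS => n.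
rewrite /= !sub0r !normrN => hn.
have Lg : L1 lam (fun x => box1 (M + 1) x * `|g (x + h n) - g x|).
  apply: (@L1_le _ _ _ _ _ (fun x : RM => a (x + h n) + `|f (x + h n) - f x| + a x)).
  - apply: measurable_funM; first exact: meas_box1.
    by apply/mabs/measurable_funB => //; exact: meas_shift1.
  - apply: L1D => //; apply: L1D; first exact: L1_shift1.
    by apply: L1_abs; apply: L1B => //; exact: L1_shift1.
  - move=> x; rewrite /box1; case: ifPn => hx; last first.
      by rewrite mul0r normr0 !addr_ge0.
    have hx2 : `|x + h n| <= M + 2.
      by rewrite (le_trans (ler_normD _ _))//; have := h1 n; lra.
    rewrite mul1r normr_id /a /box1 hx2 ifT ?mul1r; last by lra.
    rewrite (_ : g (x + h n) - g x =
      - (f (x + h n) - g (x + h n)) + (f (x + h n) - f x) + (f x - g x)); last by ring.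
    rewrite (le_trans (ler_normD _ _))// lerD2r (le_trans (ler_normD _ _))//.
    by rewrite normrN.
rewrite ger0_norm; last exact: Int_ge0.
apply: (@le_lt_trans _ _ (Int lam a + Int lam (fun x => box1 (M + 1) x * `|g (x + h n) - g x|) + Int lam a)).
  rewrite -{1}(Int_shift1 (h n) ma a0) -IntD ?L1_shift1//.
  rewrite -IntD//; last by apply: L1D => //; exact: L1_shift1.
  apply: le_Int; last exact: key.
  - by apply: L1_abs; apply: L1B => //; exact: L1_shift1.
  - by apply: L1D => //; apply: L1D => //; exact: L1_shift1.
move: hn; rewrite ger0_norm; last first.
  by apply: Int_ge0 => x; rewrite /box1; case: ifP; rewrite ?mul1r ?mul0r.
by move: hN; rewrite -/(a _) -[Int lam (fun x => box1 (M+2) _ * _)]/(Int lam a); lra.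
Qed.

(** Cutting [f] off where its value or its argument is large leaves a function bounded by B and of
    bounded support. The square of its increment is at most 2 B times the modulus of the increment,
    so the L1 statement suffices. *)
Lemma continuous_shift_L2_line f (h : nat -> R) : L2 lam f ->
  h @ \oo --> (0 : R) -> (forall n, `|h n| <= 1) ->
  (fun n => Int lam (fun x => (f (x + h n) - f x) ^+ 2)) @ \oo --> (0 : R).
Proof.
move=> Lf h0 h1; have [mf Lf2] := Lf.
pose c (M : nat) (x : RM) : R := if (`|f x| <= M%:R) && (`|x| <= M%:R) then f x else 0.
have mc M : measurable_fun setT (c M).
  apply: measurable_fun_ifT => //; apply: measurable_and;
    by apply: measurable_fun_ler => //; exact: mabs.
have cf M x : `|c M x| <= `|f x| by rewrite /c; case: ifP => //; rewrite normr0.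
have cM M x : `|c M x| <= M%:R by rewrite /c; case: ifP => [/andP[]//|]; rewrite normr0.
have Lc M : L2 lam (c M) by exact: (L2_le (mc M) Lf).
have cvc : (fun M => Int lam (fun x => (f x - c M x) ^+ 2)) @ \oo --> (0 : R).
  have := @Int_dct _ _ _ lam (fun M x => (f x - c M x) ^+ 2) (fun=> 0) (fun x => f x ^+ 2).
  rewrite Int0; case => //.
  - by move=> M; apply: measurable_funX; exact: measurable_funB.
  - move=> x; apply: cvg_near_cst.
    exists (Num.truncn (Num.max `|f x| `|x|)).+1 => // M /= hM.
    rewrite /c ifT ?subrr ?expr0n//.
    have : Num.max `|f x| `|x| <= M%:R.
      by rewrite (le_trans (ltW (truncnS_gt _)))// ler_nat.
    by rewrite ge_max.
  - move=> M x; rewrite ger0_norm ?sqr_ge0// /c.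
    by case: ifP => _; rewrite ?subr0// subrr expr0n sqr_ge0.
apply/cvgrPdist_lt => e e0.
have e0' : 0 < e / 16 by rewrite divr_gt0.
have /cvgrPdist_lt /(_ _ e0')[M _ /(_ M (leqnn _))] := cvc.
rewrite /= sub0r normrN ger0_norm => [hM|]; last by apply: Int_ge0 => x; exact: sqr_ge0.
pose B : R := M%:R.
have B0 : 0 <= B by rewrite /B.
have cv1 : (fun n => Int lam (fun x => `|c M (x + h n) - c M x|)) @ \oo --> (0 : R).
  apply: (@bounded_shift_L1 _ B) => // x xB.
  by rewrite /c [X in _ && X]leNgt xB andbF.
have e1 : 0 < e / (16 * (B + 1)) by rewrite divr_gt0 ?mulr_gt0 ?ltr_wpDl.
have /cvgrPdist_lt /(_ _ e1) := cv1; apply: filterS => n.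
rewrite /= !sub0r !normrN ger0_norm; last by apply: Int_ge0.
move=> hn; rewrite ger0_norm; last by apply: Int_ge0 => x; exact: sqr_ge0.
pose r x := f x - c M x.
have Lr : L2 lam r by exact: L2B.
have Lcc : L1 lam (fun x => `|c M (x + h n) - c M x|).
  apply: L1_abs; apply: L1B; [apply: L1_shift1|];
  (apply: (@L1_le _ _ _ _ _ (fun x => box1 B x * B)) => //;
  [by apply: L1Zr; exact: L1_box1|move=> x; rewrite /box1; case: ifPn => hx; rewrite ?mul1r// /c [X in _ && X](negbTE hx) andbF mul0r normr0//]).
have key x : (f (x + h n) - f x) ^+ 2 <=
   4 * r (x + h n) ^+ 2 + 4 * r x ^+ 2 + (4 * B) * `|c M (x + h n) - c M x|.
  set p := r (x + h n); set q := r x; set d := c M (x + h n) - c M x.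
  have -> : f (x + h n) - f x = p - q + d by rewrite /p /q /d /r; ring.
  have hd : `|d| <= 2 * B.
    rewrite (le_trans (ler_normB _ _))//.
    by have := cM M (x + h n); have := cM M x; rewrite -/B; lra.
  have hd2 : d ^+ 2 <= 2 * B * `|d|.
    by rewrite -(real_normK (num_real d)) expr2 ler_wpM2r.
  have := sqr_ge0 (p + q); have := sqr_ge0 (p - q - d).
  nra.
apply: (@le_lt_trans _ _ (4 * Int lam (fun x => r x ^+ 2) + 4 * Int lam (fun x => r x ^+ 2)
   + (4 * B) * Int lam (fun x => `|c M (x + h n) - c M x|))).
  have [mr Lr2] := Lr.
  rewrite -{1}(Int_shift1 (h n) (f := fun x => r x ^+ 2)); last 2 first.
  - exact: measurable_funX.
  - by move=> x; exact: sqr_ge0.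
  have Lr2s := L1_shift1 (h n) Lr2.
  rewrite -!IntZ// -IntD; [|exact: L1Z|exact: L1Z].
  rewrite -IntD; [|by apply: L1D; exact: L1Z|exact: L1Z].
  apply: le_Int => //.
  - by have [_] := L2B (L2_shift1 (h n) Lf) Lf.
  - by apply: L1D; [apply: L1D|]; exact: L1Z.
have : (4 * B) * Int lam (fun x => `|c M (x + h n) - c M x|) <= e / 4.
  apply: (@le_trans _ _ (4 * B * (e / (16 * (B + 1))))).
    by rewrite ler_wpM2l ?mulr_ge0// ltW.
  rewrite (_ : 4 * B * _ = (B / (B + 1)) * (e / 4)); last by field; rewrite gt_eqF// ltr_wpDl.
  rewrite ger_pMl ?divr_gt0// ler_pdivrMr ?ltr_wpDl// mul1r lerDl//.
by move: hM; rewrite /r; lra.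
Qed.

End translation_line.

Section translation_plane.
Context {R : realType}.
Notation RM := (measurableTypeR R).
Implicit Type f : PL R -> R.

Lemma paddE (x z : PL R) : x + z = (x.1 + z.1, x.2 + z.2).
Proof. by []. Qed.

Lemma psubE (x z : PL R) : x - z = (x.1 - z.1, x.2 - z.2).
Proof. by []. Qed.

Lemma Int2_12 (g : PL R -> R) : L1 lam2 g ->
  L1 lam (fun a => Int lam (fun b => g (a, b))) /\
  Int lam (fun a => Int lam (fun b => g (a, b))) = Int lam2 g.
Proof.
have gE : (fun p : PL R => g (p.1, p.2)) = g by apply/funext => -[].
move=> Lg; have Lg' : L1 (lam \x lam)%E (fun p : PL R => g (p.1, p.2)) by rewrite gE.
have [? e] := fub12 (F := fun a b => g (a, b)) Lg'; split => //.
by rewrite [LHS]e gE.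
Qed.

Lemma Int2_21 (g : PL R -> R) : L1 lam2 g ->
  L1 lam (fun b => Int lam (fun a => g (a, b))) /\
  Int lam (fun b => Int lam (fun a => g (a, b))) = Int lam2 g.
Proof.
have gE : (fun p : PL R => g (p.1, p.2)) = g by apply/funext => -[].
move=> Lg; have Lg' : L1 (lam \x lam)%E (fun p : PL R => g (p.1, p.2)) by rewrite gE.
have [? e] := fub21 (F := fun a b => g (a, b)) Lg'; split => //.
by rewrite [LHS]e gE.
Qed.

Lemma L1_swap (g : PL R -> R) : L1 lam2 g -> L1 lam2 (fun p => g (p.2, p.1)).
Proof.
move=> Lg; have mg := L1_meas Lg.
have mgs : measurable_fun setT (fun p : PL R => g (p.2, p.1)).
  by apply: (mcomp mg); apply: m2pair; [exact: measurable_snd|exact: measurable_fst].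
have mg1 := mabs mg; have mgs1 := mabs mgs.
move: Lg => /integrableP[_ fo]; apply/integrableP; split; first exact/measurable_EFinP.
rewrite -[X in (X < _)%E]/(\int[lam \x lam]_p (`|g (p.2, p.1)|)%:E)%E.
rewrite fubini_tonelli1//; last exact/measurable_EFinP.
move: fo; rewrite -[X in (X < _)%E]/(\int[lam \x lam]_p (`|g p|)%:E)%E.
by rewrite fubini_tonelli2//; exact/measurable_EFinP.
Qed.

(** By Fubini's theorem almost every section is square integrable, so that the one-dimensional
    result applies to it; four times its squared norm dominates the increments uniformly in [n]. *)
Lemma shift_cont_sections (F : RM -> RM -> R) (h : nat -> R) :
  measurable_fun setT (fun p : PL R => F p.1 p.2) ->
  L1 (lam \x lam)%E (fun p : PL R => F p.1 p.2 ^+ 2) ->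
  h @ \oo --> (0 : R) -> (forall n, `|h n| <= 1) ->
  (fun n => Int lam (fun y => Int lam (fun s => (F (s + h n) y - F s y) ^+ 2)))
    @ \oo --> (0 : R).
Proof.
move=> mF LF h0 h1.
have mFs a : measurable_fun setT (fun p : PL R => F (p.1 + a) p.2).
  by apply: (mcomp2 mF) => //; apply: measurable_funD.
have mS y : measurable_fun setT (F^~ y) by apply: (mcomp2 mF).
have [Lg _] := fub21 (F := fun a b => F a b ^+ 2) LF.
rewrite -[X in _ --> X](Int0 lam).
apply: (@Int_dct_ae _ _ _ lam _ (fun=> 0) (fun y => 4 * Int lam (fun s => F s y ^+ 2))).
- move=> n; apply: (meas_Int lam (F := fun y s => (F (s + h n) y - F s y) ^+ 2)).
  apply: measurable_funX; apply: measurable_funB.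
    by apply: (mcomp2 mF) => //; exact: measurable_funD.
  exact: (mcomp2 mF).
- exact: measurable_cst.
- exact: L1Z.
- have := ae_integrable2 (m1 := lam) (m2 := lam) LF; apply: ae_imp => y Ly.
  have L2y : L2 lam (F^~ y) by split.
  split; first exact: continuous_shift_L2_line L2y h0 h1.
  move=> n; rewrite ger0_norm; last by apply: Int_ge0 => x; exact: sqr_ge0.
  have := Int_shift1 (h n) (f := fun s => F s y ^+ 2) (measurable_funX _ (mS y)) (fun s => sqr_ge0 _).
  move=> e; rewrite (_ : 4 * _ = 2 * Int lam (fun s => F s y ^+ 2) + 2 * Int lam (fun s => F s y ^+ 2)); last by ring.
  rewrite -{1}e.
  have Lys := L1_shift1 (h n) Ly.
  rewrite -!IntZ// -IntD; [|exact: L1Z|exact: L1Z].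
  apply: le_Int.
  + by have [_] := L2B (L2_shift1 (h n) L2y) L2y.
  + by apply: L1D; exact: L1Z.
  + move=> x; set p := F _ y; set q := F _ y.
    by have := sqr_ge0 (p + q); nra.
Qed.

Lemma L2_dtr f z : L2 lam2 f -> L2 lam2 (fun x => f (x + z) - f x).
Proof. by move=> Lf; apply: L2B => //; exact: L2_shift. Qed.

(** The L2 modulus of continuity of [f] under translation by [z]. It is subadditive in [z], which
    allows the axes to be treated one at a time. *)
Definition dtr f (z : PL R) : R := N2 lam2 (fun x => f (x + z) - f x).

Lemma dtr_ge0 f z : 0 <= dtr f z.
Proof. exact: N2_ge0. Qed.

Lemma dtr_le f z : L2 lam2 f -> dtr f z <= 2 * N2 lam2 f.
Proof.
move=> Lf; have mf := L2_meas Lf; rewrite /dtr (le_trans (N2B _ Lf)) ?N2_shift//; last by rewrite mulrDl mul1r.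
exact: L2_shift.
Qed.

Lemma dtrD f z w : L2 lam2 f -> dtr f (z + w) <= dtr f z + dtr f w.
Proof.
move=> Lf; have mf := L2_meas Lf.
have ms := meas_shift z mf.
have e : N2 lam2 (fun x => f (x + w + z) - f (x + w)) = dtr f z.
  apply: (N2_shift w (f := fun x => f (x + z) - f x)); exact: measurable_funB.
rewrite -e; have L1 := L2_shift w (L2_dtr z Lf); have L2' := L2_dtr w Lf.
apply: le_trans (N2D L1 L2').
rewrite le_eqVlt; apply/orP; left; apply/eqP; congr N2; apply/funext => x.
by rewrite (addrC z) addrA addrA subrK.
Qed.

(** The Boolean selects the axis. The argument is by contradiction along a sequence of shifts, since
    dominated convergence is sequential. *)
Lemma dtr_axis f (i : bool) : L2 lam2 f -> forall e, 0 < e -> exists2 d, 0 < d &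
  forall h : R, `|h| < d -> dtr f (if i then (0, h) else (h, 0)) < e.
Proof.
move=> Lf e e0; apply: contrapT => H.
have {}H (n : nat) : exists h : R, `|h| < n.+1%:R^-1 /\
    e <= dtr f (if i then (0, h) else (h, 0)).
  apply: contrapT => Hn; apply: H; exists n.+1%:R^-1; first by rewrite invr_gt0.
  move=> h hn; rewrite ltNge; apply/negP => eh.
  by apply: Hn; exists h.
have {H}[h H] := choice H.
have h0 : h @ \oo --> (0 : R).
  apply/cvgrPdist_lt => r r0; near=> n; rewrite sub0r normrN.
  have [hn _] := H n; apply: (lt_trans hn).
  by near: n; exact: near_infty_natSinv_lt (PosNum r0).
have h1 n : `|h n| <= 1.
  have [/ltW hn _] := H n; rewrite (le_trans hn)// invf_le1//.
  by rewrite ler1n.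
have mf := L2_meas Lf; have [_ Lf2] := Lf.
pose z n : PL R := if i then (0, h n) else (h n, 0).
have LD n := (L2_dtr (z n) Lf).2.
have {}H n : e <= dtr f (z n) by have [] := H n.
have : (fun n => dtr f (z n) ^+ 2) @ \oo --> (0 : R).
  pose F (s y : RM) := if i then f (y, s) else f (s, y).
  have -> : (fun n => dtr f (z n) ^+ 2) =
      (fun n => Int lam (fun y => Int lam (fun s => (F (s + h n) y - F s y) ^+ 2))).
    apply/funext => n; rewrite /dtr N2sq /F /z; case: i @z LD {H F} => z LD.
    - rewrite -(Int2_12 (LD n)).2; apply: eq_Int => y; apply: eq_Int => s.
      by rewrite paddE /z /= addr0.
    - rewrite -(Int2_21 (LD n)).2; apply: eq_Int => y; apply: eq_Int => s.
      by rewrite paddE /z /= addr0.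
  apply: shift_cont_sections => //.
  - rewrite /F; case: (i) => //; apply: (mcomp mf); apply: m2pair => //;
    by [exact: measurable_snd|exact: measurable_fst].
  - rewrite /F; case: (i); first exact: (L1_swap Lf2).
    rewrite (_ : (fun p => _) = (fun p => f p ^+ 2))//.
    by apply/funext => -[].
move/cvgrPdist_lt => /(_ (e ^+ 2)); rewrite exprn_gt0// => /(_ isT)[N _ /(_ N (leqnn _))].
rewrite /= sub0r normrN ger0_norm ?sqr_ge0// ltr_pXn2r ?nnegrE ?dtr_ge0 ?(ltW e0)//.
by rewrite ltNge H.
Unshelve. all: end_near. Qed.

Lemma dtr_small f : L2 lam2 f -> forall e, 0 < e -> exists2 d, 0 < d &
  forall z : PL R, `|z.1| < d -> `|z.2| < d -> dtr f z < e.
Proof.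
move=> Lf e e0; have e20 : 0 < e / 2 by rewrite divr_gt0.
have [d d0 hd] := dtr_axis false Lf e20.
have [d' d'0 hd'] := dtr_axis true Lf e20.
exists (Num.min d d'); first by rewrite lt_min d0.
move=> [z1 z2] /=; rewrite !lt_min => /andP[h1 _] /andP[_ h2].
have -> : (z1, z2) = (z1, 0) + (0, z2) :> R * R.
  by rewrite paddE /= addr0 add0r.
have := dtrD (z1, 0) (0, z2) Lf; have := hd _ h1; have := hd' _ h2 => /=; lra.
Qed.

End translation_plane.

(** * Calculus along the coordinate lines *)

Section line_calculus.
Context {R : realType}.
Notation RM := (measurableTypeR R).

Notation e_ i := (basis_vector i : R * R).

(* Continuous differentiability along the lines parallel to the i-th axis. *)
Definition C1 (i : 'I_2) (F F' : PL R -> R) : Prop := forall x : PL R,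
  (forall s : R, is_derive s 1 (fun s : R => F (x + s *: e_ i)) (F' (x + s *: e_ i))) /\
  continuous (fun s : R => F' (x + s *: e_ i)).

Lemma is_derive_cont (H H' : R -> R) : (forall s : R, is_derive s 1 H (H' s)) ->
  continuous H.
Proof.
move=> dH s; apply: differentiable_continuous; apply/derivable1_diffP.
by have [] := dH s.
Qed.

Definition seg (l : R) (s : RM) : R := if 0 <= s <= l then 1 else 0.

Lemma meas_seg l : measurable_fun setT (seg l).
Proof.
by apply: measurable_fun_ifT => //; apply: measurable_and; apply: measurable_fun_ler.
Qed.

Lemma L1_seg l : L1 lam (seg l).
Proof.
apply: (L1_le (meas_seg l) (L1_box1 l)) => x; rewrite /seg /box1.
case: ifPn => [/andP[x0 x1]|_]; last by rewrite normr0; case: ifP.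
by rewrite normr1 ger0_norm// x1.
Qed.

Lemma seg_ge0 l x : 0 <= seg l x.
Proof. by rewrite /seg; case: ifP. Qed.

Lemma in_seg l (x : RM) : (x \in (`[0, l]%classic : set RM)) = (0 <= x <= l).
Proof. by apply/idP/idP; rewrite inE/= in_itv/=. Qed.

Lemma Int_seg l : 0 < l -> Int lam (seg l) = l.
Proof.
move=> l0.
rewrite !IntDef /Rintegral (_ : (\int[lam]_x _)%E = (\int[lam]_x (\1_(`[0, l]%classic : set RM) x)%:E)%E); last first.
  by apply: eq_integral => x _; rewrite indicE /seg in_seg; case: ifP.
rewrite integral_indic// setIT /lam /= lebesgue_measure_itv/= lte_fin l0.
by rewrite -EFinB subr0.
Qed.

(** Regularity is asked beyond -1 only, to match the antiderivatives of [antiderivative_gt], which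
    are integrals starting at -1. *)
Lemma FTC_seg_gt l (G g : R -> R) : 0 < l -> (forall s : R, -1 < s -> is_derive s 1 G (g s)) ->
  (forall s : R, -1 < s -> {for s, continuous g}) -> Int lam (fun s => seg l s * g s) = G l - G 0.
Proof.
move=> l0 dG cg.
have cG (s : R) : -1 < s -> {for s, continuous G}.
  move=> s1; apply: differentiable_continuous; apply/derivable1_diffP.
  by have [] := dG s s1.
have h : (\int[lebesgue_measure]_(x in `[0%R, l]) (g x)%:E = (G l)%:E - (G 0)%:E)%E.
  apply: continuous_FTC2 => //.
  - apply: continuous_in_subspaceT => x; rewrite inE/= in_itv/= => /andP[x0 _].
    by apply: cg; exact: lt_le_trans x0.
  - split => //.
    + by move=> x; rewrite in_itv/= => /andP[x0 _]; have [] := dG x (lt_trans (ltrN10 R) x0).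
    + by apply: cvg_at_right_filter; apply: cG.
    + by apply: cvg_at_left_filter; apply: cG; exact: lt_trans l0.
  - move=> x; rewrite in_itv/= => /andP[x0 _]; rewrite derive1E.
    by have [_] := dG x (lt_trans (ltrN10 R) x0).
rewrite !IntDef /Rintegral (_ : (\int[lam]_x _)%E =
    (\int[lebesgue_measure]_(x in `[0%R, l]) (g x)%:E)%E); first by rewrite h.
rewrite [RHS]integral_mkcond; apply: eq_integral => x _.
by rewrite patchE in_seg /seg; case: ifP; rewrite ?mul1r ?mul0r.
Qed.

Lemma FTC_seg l (G g : R -> R) : 0 < l -> (forall s : R, is_derive s 1 G (g s)) ->
  continuous g -> Int lam (fun s => seg l s * g s) = G l - G 0.
Proof. by move=> l0 dG cg; apply: FTC_seg_gt => // s _; exact: cg. Qed.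

Lemma C1_line i F F' : C1 i F F' -> forall x : PL R,
  F (x + e_ i) - F x = Int lam (fun s => seg 1 s * F' (x + s *: e_ i)).
Proof.
move=> CF x; have [dF cF] := CF x.
by rewrite (FTC_seg ltr01 dF cF) scale1r scale0r addr0.
Qed.

Lemma meas_line d (T : measurableType d) i (f : T -> PL R) (s : T -> RM) :
  measurable_fun setT f -> measurable_fun setT s ->
  measurable_fun setT (fun p => f p + s p *: e_ i : PL R).
Proof.
move=> mf ms; apply: m2pair; apply: measurable_funD.
- exact: m2fst.
- exact: (measurable_funM (f := s) (g := fun=> (e_ i).1)).
- exact: m2snd.
- exact: (measurable_funM (f := s) (g := fun=> (e_ i).2)).
Qed.

(** [F] and its unit translate have the same integral, while their difference is the average of [F']
    over unit segments, whose integral is that of [F']. *)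
Lemma Int_C1 i F F' : C1 i F F' -> L1 lam2 F -> L1 lam2 F' -> Int lam2 F' = 0.
Proof.
move=> CF LF LF'; have mF := L1_meas LF; have mF' := L1_meas LF'.
have LFs := L1_shift (e_ i) LF.
have : Int lam2 (fun x : PL R => F (x + e_ i) - F x) = 0.
  by rewrite IntB// Int_shift// subrr.
rewrite (@eq_Int _ _ _ _ _ _ (C1_line CF)).
have LP : L1 (lam2 \x lam)%E (fun p : PL R * RM => seg 1 p.2 * F' (p.1 + p.2 *: e_ i)).
  apply: (prodL1r (F := fun (x : PL R) (s : RM) => seg 1 s * F' (x + s *: e_ i))).
  - apply: measurable_funM; first exact: (mcomp (meas_seg 1) measurable_snd).
    apply: (mcomp mF'); apply: meas_line; [exact: measurable_fst|exact: measurable_snd].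
  - by move=> s; apply: L1Z; exact: (L1_shift (s *: e_ i) LF').
  - apply: (@L1_le _ _ _ _ _ (fun s => seg 1 s * Int lam2 (fun x => `|F' x|))).
    + apply: (meas_Int lam2 (F := fun (s : RM) (x : PL R) => `|seg 1 s * F' (x + s *: e_ i)|)).
      apply: mabs; apply: measurable_funM; first exact: (mcomp (meas_seg 1) measurable_fst).
      apply: (mcomp mF'); apply: meas_line; [exact: measurable_snd|exact: measurable_fst].
    + by apply: L1Zr; exact: (L1_seg 1).
    + move=> s; rewrite ger0_norm; last exact: Int_ge0.
      rewrite -[X in _ <= _ * X](Int_shift (s *: e_ i)); last exact: mabs.
      rewrite -IntZ; last by apply: L1_abs; exact: (L1_shift (s *: e_ i) LF').
      rewrite le_eqVlt; apply/orP; left; apply/eqP; apply: eq_Int => x.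
      by rewrite normrM /seg; case: ifP; rewrite ?normr1 ?normr0.
rewrite (fubE (F := fun (x : PL R) (s : RM) => seg 1 s * F' (x + s *: e_ i)) LP).
rewrite (@eq_Int _ _ _ _ _ (fun s => seg 1 s * Int lam2 F')); last first.
  move=> s; rewrite IntZ; last exact: (L1_shift (s *: e_ i) LF').
  by rewrite Int_shift.
by rewrite IntZr ?(Int_seg ltr01) ?mul1r//; exact: (L1_seg 1).
Qed.

Lemma C1M i F F' G G' : C1 i F F' -> C1 i G G' ->
  C1 i (fun x => F x * G x) (fun x => F' x * G x + F x * G' x).
Proof.
move=> CF CG x; have [dF cF] := CF x; have [dG cG] := CG x.
split.
  move=> s; have h := is_deriveM (dF s) (dG s); refine (is_derive_eq h _).
  by rewrite /GRing.scale/= addrC [X in X + _]mulrC.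
move=> s; apply: cvgD; apply: cvgM; by [exact: cF|exact: cG|exact: (is_derive_cont dF)|exact: (is_derive_cont dG)].
Qed.

Lemma C1D i F F' G G' : C1 i F F' -> C1 i G G' ->
  C1 i (fun x => F x + G x) (fun x => F' x + G' x).
Proof.
move=> CF CG x; have [dF cF] := CF x; have [dG cG] := CG x; split.
  by move=> s; exact: (is_deriveD (dF s) (dG s)).
by move=> s; apply: cvgD; [exact: cF|exact: cG].
Qed.

Lemma C1_comp i (b b' : R -> R) F F' : (forall s : R, is_derive s 1 b (b' s)) ->
  continuous b' -> C1 i F F' ->
  C1 i (fun x => b (F x)) (fun x => b' (F x) * F' x).
Proof.
move=> db cb CF x; have [dF cF] := CF x.
split.
  move=> s; have dbs := db (F (x + s *: e_ i)).
  exact: (is_derive1_comp dbs (dF s)).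
move=> s; apply: cvgM; last exact: cF.
by apply: (cvg_comp _ _ (is_derive_cont dF (x := s))); exact: cb.
Qed.

(* The boundary terms vanish by integrability. *)
Lemma IBP i F F' G G' : C1 i F F' -> C1 i G G' ->
  L1 lam2 (fun x => F x * G x) -> L1 lam2 (fun x => F' x * G x) ->
  L1 lam2 (fun x => F x * G' x) ->
  Int lam2 (fun x => F x * G' x) = - Int lam2 (fun x => F' x * G x).
Proof.
move=> CF CG L L' L''.
have := Int_C1 (C1M CF CG) L (L1D L' L''); rewrite IntD// => h.
by apply/eqP; rewrite -addr_eq0 addrC h.
Qed.

End line_calculus.

(** * Correlations with kernels *)

(* The correlation of a kernel with a function; the kernel sits at the point
   of evaluation, so that no reflection of the measure is needed. *)
HB.lock Definition cv (R : realType) (K f : PL R -> R) (x : PL R) : R :=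
  Int lam2 (fun y => K (y - x) * f y).

Section correlation.
Context {R : realType}.
Notation RM := (measurableTypeR R).
Notation e_ i := (basis_vector i : R * R).
Implicit Types (K f g : PL R -> R) (i : 'I_2).

Definition box (a : R) (x : PL R) : R := box1 a x.1 * box1 a x.2.

Lemma meas_box a : measurable_fun setT (box a).
Proof.
by apply: measurable_funM; apply: (mcomp (meas_box1 a));
  [exact: measurable_fst|exact: measurable_snd].
Qed.

Lemma boxE a x : box a x = if (`|x.1| <= a) && (`|x.2| <= a) then 1 else 0.
Proof. by rewrite /box /box1; case: ifP; case: ifP; rewrite ?mulr0 ?mul0r ?mulr1. Qed.

Lemma box_ge0 a x : 0 <= box a x.
Proof. by rewrite boxE; case: ifP. Qed.

Lemma box_le1 a x : `|box a x| <= 1.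
Proof. by rewrite boxE; case: ifP; rewrite ?normr1 ?normr0. Qed.

Lemma Int_box1 (a : R) : 0 <= a -> Int lam (box1 a) = 2 * a.
Proof.
move=> a0; rewrite !IntDef /Rintegral (_ : (\int[lam]_x _)%E = (\int[lam]_x (\1_(`[-a, a]%classic : set RM) x)%:E)%E); last first.
  by apply: eq_integral => x _; rewrite indicE /box1 in_segment; case: ifP.
rewrite integral_indic// setIT /lam /= lebesgue_measure_itv/= lte_fin.
case: ifPn => [_|]; first by rewrite -EFinB/=; ring.
rewrite -leNgt => h; have -> : a = 0 by lra.
by rewrite mulr0.
Qed.

Lemma L1_box a : L1 lam2 (box a).
Proof.
apply: (prodL1 (F := fun x y => box1 a x * box1 a y) (m1 := lam) (m2 := lam)).
- exact: meas_box.
- by move=> x; apply: L1Z; exact: L1_box1.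
- rewrite (_ : (fun x => _) = (fun x => `|box1 a x| * Int lam (fun y => `|box1 a y|))).
    by apply: L1Zr; apply: L1_abs; exact: L1_box1.
  apply/funext => x; rewrite -IntZ; last by apply: L1_abs; exact: L1_box1.
  by apply: eq_Int => y; rewrite normrM.
Qed.

Lemma Int_box a : 0 <= a -> Int lam2 (box a) = 4 * a ^+ 2.
Proof.
move=> a0; have [_ <-] := Int2_12 (L1_box a).
rewrite (@eq_Int _ _ _ _ _ (fun x => box1 a x * (2 * a))); last first.
  by move=> x; rewrite /box/= IntZ ?Int_box1//; exact: L1_box1.
by rewrite IntZr ?Int_box1//; [ring|exact: L1_box1].
Qed.

Definition ker K : Prop := measurable_fun setT K /\
  exists A C : R, forall x, `|K x| <= C * box A x.

Lemma ker_bd K : ker K -> exists A C : R, [/\ 0 <= A, 0 <= C,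
  (forall x, `|K x| <= C), (forall x, K x != 0 -> `|x.1| <= A /\ `|x.2| <= A) &
  (forall x, `|K x| <= C * box A x)].
Proof.
move=> [mK [A [C KC]]].
have h x : `|K x| <= `|C| * box `|A| x.
  apply: (le_trans (KC x)); rewrite !boxE; case: ifPn => [/andP[h1 h2]|_].
    by rewrite (le_trans h1 (ler_norm A)) (le_trans h2 (ler_norm A)) /= !mulr1 ler_norm.
  by rewrite mulr0; case: ifP; rewrite ?mulr1 ?mulr0.
exists `|A|, `|C|; split => //.
- move=> x; apply: (le_trans (h x)); rewrite boxE; case: ifP => _; rewrite ?mulr1 ?mulr0//.
- move=> x K0; have := h x; rewrite boxE; case: ifP => [/andP[]//|_].
  by rewrite mulr0 normr_le0 (negbTE K0).
Qed.

Lemma ker_L1 K : ker K -> L1 lam2 K.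
Proof.
move=> kK; have [mK _] := kK; have [A [C [_ _ _ _ h]]] := ker_bd kK.
by apply: (L1_le mK _ h); apply: L1Z; exact: L1_box.
Qed.

Lemma ker_L2 K : ker K -> L2 lam2 K.
Proof.
move=> kK; have [A [C [_ _ h _ _]]] := ker_bd kK.
exact: (L2_of_bdL1 h (ker_L1 kK)).
Qed.

Lemma kerZ a K : ker K -> ker (fun x => a * K x).
Proof.
move=> [mK [A [C h]]]; split; first exact: measurable_funM.
by exists A, (`|a| * C) => x; rewrite normrM -mulrA ler_wpM2l.
Qed.

Lemma ker_abs K : ker K -> ker (fun x => `|K x|).
Proof.
by move=> [mK [A [C h]]]; split; [exact: mabs|exists A, C => x; rewrite normr_id].
Qed.

Definition Lloc f := measurable_fun setT f /\ forall a, L1 lam2 (fun x => box a x * f x).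

Lemma L1_Lloc f : L1 lam2 f -> Lloc f.
Proof.
move=> Lf; split; first exact: L1_meas Lf.
by move=> a; exact: (L1_bd (meas_box a) (box_le1 a) Lf).
Qed.

Lemma L2_Lloc f : L2 lam2 f -> Lloc f.
Proof.
move=> Lf; split; first exact: L2_meas Lf.
move=> a; apply: L2M => //; exact: L2_of_bdL1 (box_le1 a) (L1_box a).
Qed.

Lemma cvE K f x : cv K f x = Int lam2 (fun y => K (y - x) * f y).
Proof. by rewrite cv.unlock. Qed.

Lemma meas_ker_sub K (x : PL R) : measurable_fun setT K ->
  measurable_fun setT (fun y : PL R => K (y - x)).
Proof. by move=> mK; apply: (mcomp mK); exact: m2B. Qed.

Lemma box_shift (A B : R) (x y : PL R) : `|x.1| <= B -> `|x.2| <= B ->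
  `|(y - x).1| <= A -> `|(y - x).2| <= A -> box (A + B) y = 1.
Proof.
move=> h1 h2 h3 h4; rewrite boxE.
have g (a b : R) : `|b| <= B -> `|a - b| <= A -> `|a| <= A + B.
  by move=> hb hab; rewrite -(subrK b a) (le_trans (ler_normD _ _))// lerD.
by rewrite (g _ _ h1 h3) (g _ _ h2 h4).
Qed.

Lemma cv_L1 K f x : ker K -> Lloc f -> L1 lam2 (fun y => K (y - x) * f y).
Proof.
move=> kK [mf Lf]; have [mK _] := kK; have [A [C [A0 C0 hC hA _]]] := ker_bd kK.
pose B := Num.max `|x.1| `|x.2|.
apply: (@L1_le _ _ _ _ _ (fun y => C * `|box (A + B) y * f y|)).
- by apply: measurable_funM => //; exact: meas_ker_sub.
- exact/L1Z/L1_abs.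
- move=> y; have [->|K0] := eqVneq (K (y - x)) 0; first by rewrite mul0r normr0 mulr_ge0.
  have [h3 h4] := hA _ K0.
  rewrite (box_shift (A := A) (B := B) (x := x)) ?le_max ?lexx ?orbT//.
  by rewrite mul1r normrM ler_wpM2r.
Qed.

Lemma meas_cv K f : measurable_fun setT K -> measurable_fun setT f ->
  measurable_fun setT (cv K f).
Proof.
move=> mK mf; have -> : cv K f = fun x => Int lam2 (fun y => K (y - x) * f y) by apply/funext => x; rewrite cvE.
  apply: (meas_Int lam2 (F := fun x y : PL R => K (y - x) * f y)).
apply: measurable_funM.
  by apply: (mcomp mK); apply: m2B; [exact: measurable_snd|exact: measurable_fst].
exact: (mcomp mf measurable_snd).
Qed.

Lemma cv_shiftE K f x : measurable_fun setT K -> measurable_fun setT f ->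
  cv K f x = Int lam2 (fun z => K z * f (x + z)).
Proof.
move=> mK mf;rewrite !cvE -(Int_shift x (f := fun y => K (y - x) * f y)).
  by apply: eq_Int => z; rewrite addrK addrC.
by apply: measurable_funM => //; exact: meas_ker_sub.
Qed.

Lemma cvD K f g : ker K -> Lloc f -> Lloc g ->
  cv K (fun x => f x + g x) = (fun x => cv K f x + cv K g x).
Proof.
move=> kK Lf Lg; apply/funext => x;rewrite !cvE -IntD; try exact: cv_L1.
by apply: eq_Int => y; rewrite mulrDr.
Qed.

Lemma cvZ K f a : ker K -> Lloc f -> cv K (fun x => a * f x) = (fun x => a * cv K f x).
Proof.
move=> kK Lf; apply/funext => x;rewrite !cvE -IntZ; last exact: cv_L1.
by apply: eq_Int => y; rewrite mulrCA.
Qed.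

Lemma cvN K f : ker K -> Lloc f -> cv K (fun x => - f x) = (fun x => - cv K f x).
Proof.
move=> kK Lf; rewrite (_ : (fun x => - f x) = (fun x => -1 * f x)); last first.
  by apply/funext => x; rewrite mulN1r.
by rewrite cvZ//; apply/funext => x; rewrite mulN1r.
Qed.

Lemma LlocN f : Lloc f -> Lloc (fun x => - f x).
Proof.
move=> [mf Lf]; split; first exact: measurableT_comp.
by move=> a; under eq_fun do rewrite mulrN; exact: L1N.
Qed.

Lemma cvB K f g : ker K -> Lloc f -> Lloc g ->
  cv K (fun x => f x - g x) = (fun x => cv K f x - cv K g x).
Proof.
by move=> kK Lf Lg; rewrite (cvD kK Lf (LlocN Lg)) (cvN kK Lg).
Qed.

Lemma cvDl K K' f : ker K -> ker K' -> Lloc f ->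
  cv (fun x => K x + K' x) f = (fun x => cv K f x + cv K' f x).
Proof.
move=> kK kK' Lf; apply/funext => x;rewrite !cvE -IntD; try exact: cv_L1.
by apply: eq_Int => y; rewrite mulrDl.
Qed.

Lemma cvZl K f a : ker K -> Lloc f -> cv (fun x => a * K x) f = (fun x => a * cv K f x).
Proof.
move=> kK Lf; apply/funext => x;rewrite !cvE -IntZ; last exact: cv_L1.
by apply: eq_Int => y; rewrite mulrA.
Qed.

(** Differentiation under the integral sign; the minus sign comes from the kernel being placed at
    [y - x]. One integrable majorant serves all points of the line within parameter distance 1, as
    the supports of the translated kernels lie in a common square. *)
Lemma C1_cv i K K' f : ker K -> ker K' -> C1 i K K' -> Lloc f ->
  C1 i (cv K f) (fun x => - cv K' f x).
Proof.
move=> kK kK' CK Lf; have [mf Lfa] := Lf; have [mK _] := kK; have [mK' _] := kK'.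
have [A [C [A0 C0 hC hA _]]] := ker_bd kK'.
have subE (x y : PL R) (s : R) : y - (x + s *: e_ i) = (y - x) + (- s) *: e_ i.
  by rewrite opprD addrA scaleNr.
have dK (x y : PL R) (s : R) : is_derive s 1 (fun s : R => K (y - (x + s *: e_ i)))
    (- K' (y - (x + s *: e_ i))).
  have [dk _] := CK (y - x).
  have h1 : is_derive s 1 (fun s : R => - s) (-1) := is_deriveN (is_derive_id s 1).
  have h := is_derive1_comp (dk (- s)) h1.
  rewrite (_ : (fun s : R => K _) = (fun s : R => K (y - x + s *: e_ i)) \o -%R); last first.
    by apply/funext => t /=; rewrite subE.
  have -> : - K' (y - (x + s *: e_ i)) = K' (y - x + - s *: e_ i) * -1.
    by rewrite mulrN1 subE.
  exact: h.
have cK (x y : PL R) : continuous (fun s : R => K' (y - (x + s *: e_ i))).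
  have [_ ck] := CK (y - x) => s.
  rewrite (_ : (fun s : R => K' _) = (fun s : R => K' (y - x + s *: e_ i)) \o -%R); last first.
    by apply/funext => t /=; rewrite subE.
  by apply: continuous_comp; [exact: opp_continuous|exact: ck].
have dom (x : PL R) (s0 : R) : exists G : PL R -> R, [/\ L1 lam2 G, (forall y, 0 <= G y) &
    forall s y, `]s0 - 1, s0 + 1[%classic s -> `|K' (y - (x + s *: e_ i)) * f y| <= G y].
  pose B := Num.max `|x.1| `|x.2| + (`|s0| + 1).
  exists (fun y => C * `|box (A + B) y * f y|); split.
  - exact/L1Z/L1_abs.
  - by move=> y; rewrite mulr_ge0.
  - move=> s y; rewrite /= in_itv/= => /andP[hs1 hs2].
    have hs : `|s| <= `|s0| + 1.
      rewrite -(subrK s0 s) addrC (le_trans (ler_normD _ _))// lerD2l ler_norml.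
      by apply/andP; split; lra.
    have [->|K0] := eqVneq (K' (y - (x + s *: e_ i))) 0.
      by rewrite mul0r normr0 mulr_ge0.
    have [h3 h4] := hA _ K0.
    have be j : `|s * (if j then (e_ i).1 else (e_ i).2)| <= `|s0| + 1.
      rewrite normrM (le_trans _ hs)// ler_piMr//.
      by rewrite /basis_vector; case: (i == 0); case: j; rewrite /= ?normr1 ?normr0 ?lexx ?ler01.
    rewrite (box_shift (A := A) (B := B) (x := x + s *: e_ i))//.
    + by rewrite mul1r normrM ler_wpM2r.
    + apply: (le_trans (ler_normD _ _)); apply: lerD; first by rewrite le_max lexx.
      exact: (be true).
    + apply: (le_trans (ler_normD _ _)); apply: lerD; first by rewrite le_max lexx orbT.
      exact: (be false).
move=> x; split => s0.
- have [G [LG G0 hG]] := dom x s0.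
  have s0I : `]s0 - 1, s0 + 1[%classic s0 by rewrite /= in_itv/=; apply/andP; split; lra.
  have LI s : L1 lam2 (fun y => K (y - (x + s *: e_ i)) * f y) by exact: cv_L1.
  pose H (s : R) (y : PL R) : R := K (y - (x + s *: e_ i)) * f y.
  have der (s : R) (y : PL R) : is_derive s 1 (H ^~ y) (- K' (y - (x + s *: e_ i)) * f y).
    have h := is_deriveM (dK x y s) (is_derive_cst (f y) s 1); refine (is_derive_eq h _).
    by rewrite scaler0 add0r /GRing.scale/= mulrC.
  have dE (s : R) (y : PL R) : partial1of2 H s y = - K' (y - (x + s *: e_ i)) * f y.
    by rewrite partial1of2E; have [_] := der s y.
  have GB (s : R) (y : PL R) : `]s0 - 1, s0 + 1[%classic s -> [set: PL R] y ->
     `|partial1of2 H s y| <= G y.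
    by move=> hs _; rewrite dE mulNr normrN; exact: hG.
  have derv (s : R) (y : PL R) : `]s0 - 1, s0 + 1[%classic s -> [set: PL R] y ->
      derivable (H ^~ y) s 1.
    by move=> _ _; have [] := der s y.
  have h1 := @derivable_under_integral _ _ _ lam2 H _ measurableT s0 _ _ s0I (fun s _ => LI s) derv G G0 LG GB.
  have h2 := @differentiation_under_integral _ _ _ lam2 H _ measurableT s0 _ _ s0I (fun s _ => LI s) derv G G0 LG GB.
  have EH : (fun s : R => cv K f (x + s *: e_ i)) = (fun s : R => Rintegral lam2 setT (H s)).
    by apply/funext => s; rewrite cvE IntDef.
  rewrite EH; split; first exact: h1.
  rewrite -derive1E [LHS]h2 !cvE -IntN; last exact: cv_L1.
  by rewrite IntDef; apply: eq_Rintegral => y _; rewrite dE mulNr.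
- have [G [LG G0 hG]] := dom x s0.
  have s0I : s0 \in `]s0 - 1, s0 + 1[%classic by rewrite inE /= in_itv/=; apply/andP; split; lra.
  have h := @continuity_under_integral _ _ _ lam2 (fun s y => K' (y - (x + s *: e_ i)) * f y) setT
    measurableT (s0 - 1) (s0 + 1) (fun s _ => cv_L1 _ kK' Lf) _ G LG _ _ s0I.
  under eq_fun do rewrite cvE IntDef.
  apply: cvgN; apply: h.
  + apply: aeW => y _ s _; apply: cvgM; last exact: cvg_cst.
    exact: cK.
  + by move=> s hs; apply: aeW => y _; exact: hG.
Qed.

End correlation.

(** * Smooth functions *)

Section smooth_line.
Context {R : realType}.
Implicit Types g h : R -> R.

(** A greatest fixed point: smoothness is proved by exhibiting a class [P] of functions stable under
    differentiation, and no iterated derivative has to be computed. *)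
Definition smooth1 h : Prop := exists P : (R -> R) -> Prop,
  P h /\ forall g, P g -> exists2 g', P g' & forall x : R, is_derive x 1 g (g' x).

Lemma smooth1_derive h : smooth1 h ->
  exists2 h', smooth1 h' & forall x : R, is_derive x 1 h (h' x).
Proof.
move=> [P [Ph HP]]; have [h' Ph' dh] := HP _ Ph.
by exists h' => //; exists P.
Qed.

Lemma smooth1_continuous h : smooth1 h -> continuous h.
Proof. by move=> /smooth1_derive[h' _ dh]; exact: is_derive_cont dh. Qed.

(** The classical flat functions x^-n exp(-1/x). All powers are considered together because
    differentiation of one produces the next two, so that their span is stable. *)
Definition flat (n : nat) (x : R) : R := if 0 < x then x ^- n * expR (- x^-1) else 0.

(** The exponential series gives y^(n+1) <= (n+1)! exp y for y = 1/x. The remaining factor x yields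
    continuity at the origin. *)
Lemma flat_bound n (x : R) : 0 < x -> flat n x <= (n.+1)`!%:R * x.
Proof.
move=> x0; rewrite /flat x0 expRN.
have y0 : 0 <= x^-1 by rewrite invr_ge0 ltW.
have := expR_ge1Dxn n y0; set E := expR _; set F := (n.+1)`!%:R : R => h.
have F0 : 0 < F by rewrite ltr0n fact_gt0.
have E0 : 0 < E := expR_gt0 _.
rewrite ler_pdivrMr//.
have : x^-1 ^+ n.+1 <= F * E.
  rewrite mulrC -ler_pdivrMr//; apply: le_trans h.
  by rewrite lerDr.
rewrite exprVn => h2; have := ler_wpM2r (ltW x0) h2.
by rewrite exprSr invfM divfK ?gt_eqF// mulrAC.
Qed.

Lemma flat_ge0 n x : 0 <= flat n x.
Proof.
rewrite /flat; case: ifP => // x0.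
by rewrite mulr_ge0 ?expR_ge0// invr_ge0 exprn_ge0// ltW.
Qed.

Lemma flat_le0 n x : x <= 0 -> flat n x = 0.
Proof. by rewrite /flat leNgt => /negbTE ->. Qed.

Lemma flat_derive n (x : R) :
  is_derive x 1 (flat n) (flat n.+2 x - n%:R * flat n.+1 x).
Proof.
have [x0|x0|->] := ltgtP x 0.
- rewrite !flat_le0 ?ltW// mulr0 subr0.
  apply: (@near_eq_is_derive _ _ _ (fun _ : R => 0 : R) (flat n) x 1 0).
  near=> y; rewrite flat_le0// ltW//; near: y; exact: (lt_nbhsl x0).
- have dV : is_derive x 1 (fun x : R => x^-1) (- x ^- 2 *: 1).
    by apply: is_deriveV; rewrite gt_eqF.
  have dE : is_derive x 1 (fun x : R => expR (- x^-1)) (expR (- x^-1) * (- (- x ^- 2 *: 1))).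
    exact: (is_derive1_comp (is_derive_expR _) (is_deriveN dV)).
  have dX : is_derive x 1 (fun x : R => x^-1 ^+ n) (n%:R * x^-1 ^+ n.-1 *: (- x ^- 2 *: 1)).
    have := is_deriveX n dV; case: n => [|n].
      rewrite mul0r scale0r => _.
      by rewrite (_ : (fun x : R => _) = cst 1); [exact: is_derive_cst|apply/funext => y; rewrite expr0].
    by rewrite -exprfctE.
  have h := is_deriveM dX dE.
  apply: (near_eq_is_derive (f := (fun x : R => x^-1 ^+ n) * (fun x : R => expR (- x^-1)))).
    near=> y; rewrite /flat ifT//=; last by near: y; exact: (lt_nbhsr x0).
    by rewrite -exprVn.
  refine (is_derive_eq h _).
  rewrite /flat x0 /GRing.scale/=; set E := expR _.
  have xx : x != 0 by rewrite gt_eqF.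
  case: n {dX h} => [|n].
    by rewrite /= !expr0; field.
  by rewrite /= -!exprVn; move: (x^-1) E (n.+1%:R) => y F c; rewrite !exprS; ring.
- rewrite !flat_le0 ?lexx// mulr0 subr0.
  (* At the origin the difference quotient from the right is [flat n.+1 h], which [flat_bound] makes
     a multiple of h at most. *)
  have H : (fun h : R => h^-1 *: ((flat n \o shift 0) (h *: 1) - flat n 0)) @ 0^' --> (0 : R).
    apply/cvgrPdist_lt => e e0.
    have F0 : 0 < (n.+2)`!%:R :> R by rewrite ltr0n fact_gt0.
    near=> h.
    rewrite sub0r normrN (flat_le0 n (lexx 0)) subr0 /= addr0 /GRing.scale/= mulr1.
    have [h0|h0] := leP h 0; first by rewrite flat_le0// mulr0 normr0.
    rewrite ger0_norm ?mulr_ge0 ?flat_ge0 ?invr_ge0 ?ltW//.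
    have -> : h^-1 * flat n h = flat n.+1 h.
      by rewrite /flat h0 exprS invfM mulrA.
    apply: (le_lt_trans (flat_bound n.+1 h0)).
    rewrite mulrC -ltr_pdivlMr//.
    apply: le_lt_trans (ler_norm _) _.
    near: h; apply: dnbhs0_lt; exact: divr_gt0.
  split; first by apply/cvg_ex; exists 0.
  exact/cvg_lim.
Unshelve. all: end_near. Qed.

Inductive flat_span : (R -> R) -> Prop :=
| flat_span0 : flat_span (fun=> 0)
| flat_spanD a n g : flat_span g -> flat_span (fun x => a * flat n x + g x).

Lemma flat_span_derive g : flat_span g ->
  exists2 g', flat_span g' & forall x : R, is_derive x 1 g (g' x).
Proof.
elim => [|a n {}g _ [g' sg' dg]].
  by exists (fun=> 0); [exact: flat_span0|move=> x; exact: is_derive_cst].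
exists (fun x => a * flat n.+2 x + (- a * n%:R * flat n.+1 x + g' x)).
  by apply: flat_spanD; exact: flat_spanD.
move=> x; have h := is_deriveD (is_deriveZ a (flat_derive n x)) (dg x).
by refine (is_derive_eq h _); rewrite /GRing.scale/=; ring.
Qed.

Lemma smooth1_flat : smooth1 (flat 0).
Proof.
exists flat_span; split; last exact: flat_span_derive.
rewrite (_ : flat 0 = fun x => 1 * flat 0 x + 0); first exact/flat_spanD/flat_span0.
by apply/funext => x; rewrite mul1r addr0.
Qed.

End smooth_line.

(** * Smooth functions on a normed space *)

Section smooth_functions.
Context {R : realType}.

(** A syntactic class of smooth functions: continuity, stability under derivatives, symmetry of
    mixed derivatives and, in the plane, measurability are proved by induction on the
    construction. *)
Inductive Sm {V : normedModType R} : (V -> R) -> Prop :=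
| Sm_cst c : Sm (fun=> c)
| Sm_lin (l : V -> R) : (forall x y, l (x + y) = l x + l y) ->
    (forall a x, l (a *: x) = a * l x) -> continuous l -> Sm l
| Sm_add f g : Sm f -> Sm g -> Sm (fun x => f x + g x)
| Sm_mul f g : Sm f -> Sm g -> Sm (fun x => f x * g x)
| Sm_comp h f : smooth1 h -> Sm f -> Sm (fun x => h (f x)).

Context {V : normedModType R}.
Implicit Types f g : V -> R.

Lemma Sm_continuous f : Sm f -> continuous f.
Proof.
elim=> [c|l _ _//|{}f g _ cf _ cg|{}f g _ cf _ cg|h {}f sh _ cf] x.
- exact: cst_continuous.
- by apply: continuousD; [exact: cf|exact: cg].
- by apply: continuousM; [exact: cf|exact: cg].
- by apply: continuous_comp; [exact: cf|exact: smooth1_continuous].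
Qed.

Lemma is_derive_line f x v df (s : R) : is_derive (x + s *: v) v f df ->
  is_derive s 1 (fun s : R => f (x + s *: v)) df.
Proof.
move=> [d1 d2].
have e : (fun h : R => h^-1 *: (((fun s : R => f (x + s *: v)) \o shift s) (h *: 1) - f (x + s *: v))) =
    (fun h : R => h^-1 *: ((f \o shift (x + s *: v)) (h *: v) - f (x + s *: v))).
  apply/funext => h /=; congr (_ *: (f _ - _)).
  by rewrite [h *: 1]mulr1 scalerDl addrCA.
by split; [rewrite /derivable e|rewrite /derive e].
Qed.

Lemma line_is_derive f x v df : is_derive (0 : R) 1 (fun s : R => f (x + s *: v)) df ->
  is_derive x v f df.
Proof.
move=> [d1 d2].
have e : (fun h : R => h^-1 *: (((fun s : R => f (x + s *: v)) \o shift 0) (h *: 1) - f (x + 0 *: v))) =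
    (fun h : R => h^-1 *: ((f \o shift x) (h *: v) - f x)).
  apply/funext => h /=.
  have -> : (h *: 1 + 0 : R) = h by rewrite addr0 [h *: 1]mulr1.
  by rewrite scale0r addr0 (addrC x).
by split; [move: d1; rewrite /derivable e|move: d2; rewrite /derive e].
Qed.

Lemma Sm_derive f v : Sm f ->
  exists2 g, Sm g & forall x, is_derive x v f (g x).
Proof.
elim=> [c|l lD lZ cl|{}f g _ [f' sf' df] _ [g' sg' dg]|{}f g sf [f' sf' df] sg [g' sg' dg]
  |h {}f sh sf [f' sf' df]].
- by exists (fun=> 0); [exact: Sm_cst|move=> x; exact: is_derive_cst].
- exists (fun=> l v); first exact: Sm_cst.
  move=> x; have H : (fun h : R => h^-1 *: ((l \o shift x) (h *: v) - l x)) @ 0^' --> l v.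
    apply: cvg_near_cst; near=> h => /=.
    rewrite lD lZ addrK /GRing.scale/= mulKf//; near: h; exact: nbhs_dnbhs_neq.
  by split; [apply/cvg_ex; exists (l v)|exact/cvg_lim].
- exists (fun x => f' x + g' x); first exact: Sm_add.
  by move=> x; exact: is_deriveD.
- exists (fun x => f x * g' x + g x * f' x).
    by apply: Sm_add; apply: Sm_mul.
  by move=> x; exact: (is_deriveM (df x) (dg x)).
- have [h' sh' dh] := smooth1_derive sh.
  exists (fun x => h' (f x) * f' x); first by apply: Sm_mul => //; exact: Sm_comp.
  move=> x; apply: line_is_derive.
  have dfx : is_derive (0 : R) 1 (fun s : R => f (x + s *: v)) (f' x).
    by apply: is_derive_line; rewrite scale0r addr0.
  have dhx : is_derive (f (x + (0 : R) *: v)) 1 h (h' (f x)).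
    by rewrite scale0r addr0.
  exact: (is_derive1_comp dhx dfx).
Unshelve. all: end_near. Qed.

Lemma Sm_derivable f x v : Sm f -> derivable f x v.
Proof. by move=> /(Sm_derive v)[g _ dg]; have [] := dg x. Qed.

Definition Dv (v : V) f : V -> R := fun x => 'D_v f x.

Lemma Sm_D f v : Sm f -> Sm (Dv v f).
Proof.
move=> /(Sm_derive v)[g sg dg]; rewrite (_ : Dv v f = g)//.
by apply/funext => x; have [_] := dg x.
Qed.

Lemma Sm_is_derive f x v : Sm f -> is_derive x v f (Dv v f x).
Proof. by move=> sf; split => //; exact: Sm_derivable. Qed.

Lemma Sm_smooth f : Sm f -> smooth f.
Proof.
move=> sf s /=; have {}sf : Sm (foldr (fun v h => 'D_v h) f s).
  by elim: s => //= v s; exact: (Sm_D v).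
by split; [exact: Sm_continuous|move=> x v; exact: Sm_derivable].
Qed.

Lemma derive_val_fun f v g : (forall x, is_derive x v f (g x)) -> Dv v f = g.
Proof. by move=> h; apply/funext => x; have [_] := h x. Qed.

(** Induction on the construction of [f]: the product and chain rules express both mixed derivatives
    by the same terms, symmetric in [v] and [w]. *)
Lemma Sm_DC f v w : Sm f -> Dv v (Dv w f) = Dv w (Dv v f).
Proof.
have D0 (c : R) u : Dv u (fun _ : V => c) = fun=> 0.
  by apply: derive_val_fun => x; exact: is_derive_cst.
elim=> [c|l lD lZ cl|{}f g sf ef sg eg|{}f g sf ef sg eg|h {}f sh sf ef].
- by rewrite !D0.
- have Dl u : Dv u l = fun=> l u.
    apply: derive_val_fun => x.
    have H : (fun h : R => h^-1 *: ((l \o shift x) (h *: u) - l x)) @ 0^' --> l u.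
      apply: cvg_near_cst; near=> h => /=.
      rewrite lD lZ addrK /GRing.scale/= mulKf//; near: h; exact: nbhs_dnbhs_neq.
    by split; [apply/cvg_ex; exists (l u)|exact/cvg_lim].
  by rewrite !Dl !D0.
- have DD u (a b : V -> R) : Sm a -> Sm b ->
      Dv u (fun x => a x + b x) = fun x => Dv u a x + Dv u b x.
    by move=> sa sb; apply: derive_val_fun => x; exact: is_deriveD (Sm_is_derive _ _ sa) (Sm_is_derive _ _ sb).
  have sfD u := Sm_D u sf; have sgD u := Sm_D u sg.
  rewrite (DD w f g sf sg) (DD v f g sf sg).
  rewrite [LHS](DD v (Dv w f) (Dv w g) (sfD w) (sgD w)) [RHS](DD w (Dv v f) (Dv v g) (sfD v) (sgD v)).
  by apply/funext => x; rewrite ef eg.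
- have DM u (a b : V -> R) : Sm a -> Sm b ->
      Dv u (fun x => a x * b x) = fun x => a x * Dv u b x + b x * Dv u a x.
    by move=> sa sb; apply: derive_val_fun => x; exact: is_deriveM (Sm_is_derive _ _ sa) (Sm_is_derive _ _ sb).
  have DD u (a b : V -> R) : Sm a -> Sm b ->
      Dv u (fun x => a x + b x) = fun x => Dv u a x + Dv u b x.
    by move=> sa sb; apply: derive_val_fun => x; exact: is_deriveD (Sm_is_derive _ _ sa) (Sm_is_derive _ _ sb).
  have sfD u := Sm_D u sf; have sgD u := Sm_D u sg.
  rewrite (DM w f g sf sg) (DM v f g sf sg).
  rewrite [LHS](DD v (fun x => f x * Dv w g x) (fun x => g x * Dv w f x) (Sm_mul sf (sgD w)) (Sm_mul sg (sfD w))).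
  rewrite [RHS](DD w (fun x => f x * Dv v g x) (fun x => g x * Dv v f x) (Sm_mul sf (sgD v)) (Sm_mul sg (sfD v))).
  apply/funext => x.
  have -> : Dv v (fun x => f x * Dv w g x) x = f x * Dv v (Dv w g) x + Dv w g x * Dv v f x.
    by rewrite [LHS](congr1 (@^~ x) (DM v f (Dv w g) sf (sgD w))).
  have -> : Dv v (fun x => g x * Dv w f x) x = g x * Dv v (Dv w f) x + Dv w f x * Dv v g x.
    by rewrite [LHS](congr1 (@^~ x) (DM v g (Dv w f) sg (sfD w))).
  have -> : Dv w (fun x => f x * Dv v g x) x = f x * Dv w (Dv v g) x + Dv v g x * Dv w f x.
    by rewrite [LHS](congr1 (@^~ x) (DM w f (Dv v g) sf (sgD v))).
  have -> : Dv w (fun x => g x * Dv v f x) x = g x * Dv w (Dv v f) x + Dv v f x * Dv w g x.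
    by rewrite [LHS](congr1 (@^~ x) (DM w g (Dv v f) sg (sfD v))).
  rewrite ef eg.
  move: (Dv w (Dv v g) x) (Dv w (Dv v f) x) (Dv w f x) (Dv w g x) (Dv v f x) (Dv v g x) (f x) (g x) => *.
  by ring.
- have [h' sh' dh] := smooth1_derive sh; have [h'' sh'' dh'] := smooth1_derive sh'.
  have DM u (a b : V -> R) : Sm a -> Sm b ->
      Dv u (fun x => a x * b x) = fun x => a x * Dv u b x + b x * Dv u a x.
    by move=> sa sb; apply: derive_val_fun => x; exact: is_deriveM (Sm_is_derive _ _ sa) (Sm_is_derive _ _ sb).
  have DC u (k k' : R -> R) : (forall x : R, is_derive x 1 k (k' x)) ->
      Dv u (fun x => k (f x)) = fun x => k' (f x) * Dv u f x.
    move=> dk; apply: derive_val_fun => x; apply: line_is_derive.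
    have dfx : is_derive (0 : R) 1 (fun s : R => f (x + s *: u)) (Dv u f x).
      by apply: is_derive_line; rewrite scale0r addr0; exact: Sm_is_derive.
    have dkx : is_derive (f (x + (0 : R) *: u)) 1 k (k' (f x)) by rewrite scale0r addr0.
    exact: (is_derive1_comp dkx dfx).
  have sfD u := Sm_D u sf.
  have sh'f := Sm_comp sh' sf.
  rewrite (DC w h h' dh) (DC v h h' dh).
  rewrite [LHS](DM v (fun x => h' (f x)) (Dv w f) sh'f (sfD w)).
  rewrite [RHS](DM w (fun x => h' (f x)) (Dv v f) sh'f (sfD v)).
  apply/funext => x.
  have -> : Dv v (fun x => h' (f x)) x = h'' (f x) * Dv v f x.
    by rewrite [LHS](congr1 (@^~ x) (DC v h' h'' dh')).
  have -> : Dv w (fun x => h' (f x)) x = h'' (f x) * Dv w f x.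
    by rewrite [LHS](congr1 (@^~ x) (DC w h' h'' dh')).
  rewrite ef; move: (Dv w (Dv v f) x) (Dv w f x) (Dv v f x) (h' (f x)) (h'' (f x)) => *.
  by ring.
Unshelve. all: end_near. Qed.

Lemma Sm_opp f : Sm f -> Sm (fun x => - f x).
Proof.
move=> sf; rewrite (_ : (fun x => _) = fun x => -1 * f x); last first.
  by apply/funext => x; rewrite mulN1r.
by apply: Sm_mul => //; exact: Sm_cst.
Qed.

Lemma Sm_sub f g : Sm f -> Sm g -> Sm (fun x => f x - g x).
Proof. by move=> sf sg; apply: Sm_add => //; exact: Sm_opp. Qed.

(** The space enters the construction of a smooth function through linear forms only, so composition
    with [A] has to be checked on these alone. It is applied to translations and to projections. *)
Lemma Sm_pull (W : normedModType R) (A : W -> V) f :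
  (forall l : V -> R, (forall x y, l (x + y) = l x + l y) ->
    (forall a x, l (a *: x) = a * l x) -> continuous l -> Sm (fun z => l (A z))) ->
  Sm f -> Sm (fun z => f (A z)).
Proof.
move=> hA; elim=> [c|l lD lZ cl|{}f g _ sf _ sg|{}f g _ sf _ sg|h {}f sh _ sf].
- exact: Sm_cst.
- exact: hA.
- exact: Sm_add.
- exact: Sm_mul.
- exact: Sm_comp.
Qed.

End smooth_functions.

Lemma Sm_smooth1 (R : realType) (g : R -> R) : Sm g -> smooth1 g.
Proof.
by move=> sg; exists Sm; split => // {sg}g /(Sm_derive (1 : R))[g' sg' dg]; exists g'.
Qed.

Lemma Sm_id (R : realType) : Sm (fun x : R => x).
Proof. by apply: Sm_lin => // x; exact: cvg_id. Qed.

Lemma smooth1_Sm (R : realType) (g : R -> R) : smooth1 g -> Sm g.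
Proof. by move=> sg; apply: (Sm_comp sg); exact: Sm_id. Qed.

(** * Smooth kernels in the plane *)

Section derivation_rules.
Context {R : realType} {V : normedModType R}.
Implicit Types f g : V -> R.

Lemma DvD v f g : Sm f -> Sm g -> Dv v (fun x => f x + g x) = fun x => Dv v f x + Dv v g x.
Proof.
move=> sf sg; apply: derive_val_fun => x.
exact: is_deriveD (Sm_is_derive _ _ sf) (Sm_is_derive _ _ sg).
Qed.

Lemma DvM v f g : Sm f -> Sm g ->
  Dv v (fun x => f x * g x) = fun x => f x * Dv v g x + g x * Dv v f x.
Proof.
move=> sf sg; apply: derive_val_fun => x.
exact: is_deriveM (Sm_is_derive _ _ sf) (Sm_is_derive _ _ sg).
Qed.

Lemma Dv_cst v (c : R) : Dv v (fun _ : V => c) = fun=> 0.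
Proof. by apply: derive_val_fun => x; exact: is_derive_cst. Qed.

Lemma DvZ v a f : Sm f -> Dv v (fun x => a * f x) = fun x => a * Dv v f x.
Proof.
move=> sf; rewrite DvM ?Dv_cst//; last exact: Sm_cst.
by apply/funext => x; rewrite mulr0 addr0.
Qed.

Lemma DvB v f g : Sm f -> Sm g -> Dv v (fun x => f x - g x) = fun x => Dv v f x - Dv v g x.
Proof.
move=> sf sg; rewrite DvD//; last exact: Sm_opp.
rewrite (_ : (fun x => - g x) = fun x => -1 * g x); last by apply/funext => x; rewrite mulN1r.
by rewrite DvZ//; apply/funext => x; rewrite mulN1r.
Qed.

Lemma Dv_comp v (k k' : R -> R) f : (forall x : R, is_derive x 1 k (k' x)) -> Sm f ->
  Dv v (fun x => k (f x)) = fun x => k' (f x) * Dv v f x.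
Proof.
move=> dk sf; apply: derive_val_fun => x; apply: line_is_derive.
have dfx : is_derive (0 : R) 1 (fun s : R => f (x + s *: v)) (Dv v f x).
  by apply: is_derive_line; rewrite scale0r addr0; exact: Sm_is_derive.
have dkx : is_derive (f (x + (0 : R) *: v)) 1 k (k' (f x)) by rewrite scale0r addr0.
exact: (is_derive1_comp dkx dfx).
Qed.

Lemma Dv_lin v (l : V -> R) : (forall x y, l (x + y) = l x + l y) ->
  (forall a x, l (a *: x) = a * l x) -> Dv v l = fun=> l v.
Proof.
move=> lD lZ; apply: derive_val_fun => x.
have H : (fun h : R => h^-1 *: ((l \o shift x) (h *: v) - l x)) @ 0^' --> l v.
  apply: cvg_near_cst; near=> h => /=.
  rewrite lD lZ addrK /GRing.scale/= mulKf//; near: h; exact: nbhs_dnbhs_neq.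
by split; [apply/cvg_ex; exists (l v)|exact/cvg_lim].
Unshelve. all: end_near. Qed.

End derivation_rules.

(** * Radial profiles *)

Section bumpf.
Context {R : realType}.

(** The argument stands for a squared radius, so the bump lives on an annulus. Vanishing up to 1/4
    makes the divisions by [s] below harmless, and vanishing from 1 on makes [theta] constant
    there. *)
Definition bumpf (s : R) : R := flat 0 (s - 4^-1) * flat 0 (1 - s).

Lemma Sm_bump : Sm bumpf.
Proof.
apply: Sm_mul; apply: (Sm_comp smooth1_flat).
  by apply: Sm_sub; [exact: Sm_id|exact: Sm_cst].
by apply: Sm_sub; [exact: Sm_cst|exact: Sm_id].
Qed.

Lemma smooth1_bump : smooth1 bumpf. Proof. exact: Sm_smooth1 Sm_bump. Qed.

Lemma bump_ge0 s : 0 <= bumpf s.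
Proof. by rewrite mulr_ge0 ?flat_ge0. Qed.

Lemma bump_lt s : s <= 4^-1 -> bumpf s = 0.
Proof. by move=> h; rewrite /bumpf flat_le0 ?mul0r// subr_le0. Qed.

Lemma bump_gt s : 1 <= s -> bumpf s = 0.
Proof. by move=> h; rewrite /bumpf [X in _ * X]flat_le0 ?mulr0// subr_le0. Qed.

Lemma bump_pos s : 4^-1 < s < 1 -> 0 < bumpf s.
Proof.
move=> /andP[h1 h2]; rewrite /bumpf /flat !subr_gt0 h1 h2 !expr0 !invr1 !mul1r.
by rewrite mulr_gt0 ?expR_gt0.
Qed.

(** Besides being the profile of the radial fields, it serves as the step of the cut-offs in
    time. *)
Definition theta (s : R) : R := Rintegral lebesgue_measure `[0, s]%classic bumpf.

Lemma thetaE s : theta s = Rintegral lebesgue_measure setT (bumpf \_ `[0, s]%classic).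
Proof. by rewrite /theta Rintegral_mkcond. Qed.

Lemma theta_small s : s <= 4^-1 -> theta s = 0.
Proof.
move=> h; rewrite thetaE (_ : bumpf \_ _ = fun=> 0).
  by rewrite /Rintegral integral0.
apply/funext => x; rewrite patchE; case: ifPn => //.
rewrite inE/= in_itv/= => /andP[_ xs]; rewrite bump_lt//; exact: le_trans h.
Qed.

Lemma theta_large s : 1 <= s -> theta s = theta 1.
Proof.
move=> h; rewrite !thetaE; congr Rintegral; apply/funext => x; rewrite !patchE.
have [x1|x1] := leP 1 x; first by rewrite (bump_gt x1) !if_same.
have -> : (x \in `[0, s]%classic) = (x \in `[0, (1 : R)]%classic) => //.
by apply/idP/idP; rewrite !inE/= !in_itv/= => /andP[-> _]; rewrite (le_trans (ltW x1)).
Qed.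

Lemma theta_derive (s : R) : is_derive s 1 theta (bumpf s).
Proof.
have [h|h] := ltP s 4^-1.
  rewrite bump_lt ?ltW//.
  apply: (@near_eq_is_derive _ _ _ (fun _ : R => 0 : R) theta s 1 0).
  by near=> y; rewrite theta_small// ltW//; near: y; exact: (lt_nbhsl h).
have s0 : 0 < s by apply: lt_le_trans h; rewrite invr_gt0.
have [|||d1 d2] := @continuous_FTC1_closed R bumpf 0 s (s + 1) _ _ s0.
- by rewrite ltrDl.
- apply: continuous_compact_integrable; first exact: segment_compact.
  by apply: continuous_subspaceT => x; exact: (smooth1_continuous smooth1_bump).
- exact: (smooth1_continuous smooth1_bump).
by split; [exact: d1|rewrite -derive1E; exact: d2].
Unshelve. all: end_near. Qed.

Lemma smooth1_theta : smooth1 theta.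
Proof.
exists (fun g => g = theta \/ smooth1 g); split; first by left.
move=> g [->|sg]; first by exists bumpf; [right; exact: smooth1_bump|exact: theta_derive].
by have [g' sg' dg] := smooth1_derive sg; exists g' => //; right.
Qed.

(** Functions that vanish up to 1/4 may be divided by [s] without losing smoothness; the class
    contains the derivative (g' - g / s) / s of such a quotient. *)
Inductive div_class : (R -> R) -> Prop :=
| div_base g : smooth1 g -> (forall s, s <= 4^-1 -> g s = 0) -> div_class g
| div_div g : div_class g -> div_class (fun s => g s / s)
| div_sub g h : div_class g -> div_class h -> div_class (fun s => g s - h s).

Lemma div_class0 g : div_class g -> forall s, s <= 4^-1 -> g s = 0.
Proof.
elim=> [//|{}g _ ih s hs|{}g h _ ihg _ ihh s hs]; first by rewrite ih// mul0r.
by rewrite ihg// ihh// subrr.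
Qed.

Lemma derive_small0 (g : R -> R) g' : (forall s, s <= 4^-1 -> g s = 0) ->
  (forall s : R, is_derive s 1 g (g' s)) -> continuous g' -> forall s, s <= 4^-1 -> g' s = 0.
Proof.
move=> g0 dg cg'.
have lt s : s < 4^-1 -> g' s = 0.
  move=> h; have [_ <-] := dg s.
  have e : \near s, (fun _ : R => 0 : R) s = g s.
    by near=> y; rewrite g0// ltW//; near: y; exact: (lt_nbhsl h).
  by have [_ <-] := near_eq_is_derive e (is_derive_cst (0 : R) s 1).
move=> s; rewrite le_eqVlt => /predU1P[->|]; last exact: lt.
have h1 : g' x @[x --> (4^-1 : R)^'-] --> g' 4^-1 by apply: cvg_at_left_filter; exact: cg'.
have h2 : g' x @[x --> (4^-1 : R)^'-] --> (0 : R).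
  apply: cvg_near_cst; near=> x; apply: lt; near: x; exact: nbhs_left_lt.
by apply: (cvg_unique _ h1 h2).
Unshelve. all: end_near. Qed.

Lemma quot_derive (g g' : R -> R) (s : R) : (forall s, s <= 4^-1 -> g s = 0) ->
  is_derive s 1 g (g' s) -> (s < 4^-1 -> g' s = 0) ->
  is_derive s 1 (fun s => g s / s) ((g' s - g s / s) / s).
Proof.
move=> g0 dg g'0.
have [h|h] := ltP s 4^-1.
  rewrite g'0// g0 ?ltW// mul0r subrr mul0r.
  apply: (@near_eq_is_derive _ _ _ (fun _ : R => 0 : R) _ s 1 0).
  by near=> y; rewrite g0 ?mul0r// ltW//; near: y; exact: (lt_nbhsl h).
have s0 : s != 0 by rewrite gt_eqF//; apply: lt_le_trans h; rewrite invr_gt0.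
have dV : is_derive s 1 (fun x : R => x^-1) (- s ^- 2 *: 1) by apply: is_deriveV.
refine (is_derive_eq (is_deriveM dg dV) _).
by rewrite /GRing.scale/=; field.
Unshelve. all: end_near. Qed.

Lemma div_class_derive g : div_class g ->
  exists2 g', div_class g' & forall s : R, is_derive s 1 g (g' s).
Proof.
elim=> [{}g sg g0|{}g cg [g' cg' dg]|{}g h _ [g' cg' dg] _ [h' ch' dh]].
- have [g' sg' dg] := smooth1_derive sg; exists g' => //; apply: div_base => //.
  exact: (derive_small0 g0 dg (smooth1_continuous sg')).
- exists (fun s => (g' s - g s / s) / s).
    by apply: div_div; apply: div_sub => //; exact: div_div.
  move=> s; apply: quot_derive => //; first exact: div_class0.
  by move=> h; exact: (div_class0 cg' (ltW h)).
- exists (fun s => g' s - h' s); first exact: div_sub.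
  by move=> s; exact: is_deriveB (dg s) (dh s).
Qed.

(* [x * quot (a |x|^2)] is the field [x / |x|^2] cut off near the origin. *)
Definition quot (s : R) : R := theta s / s.
Definition quot' (s : R) : R := (bumpf s - quot s) / s.

Lemma smooth1_quot : smooth1 quot.
Proof.
exists div_class; split; last exact: div_class_derive.
by apply: div_div; apply: div_base; [exact: smooth1_theta|exact: theta_small].
Qed.

Lemma derive_quot (s : R) : is_derive s 1 quot (quot' s).
Proof.
apply: (quot_derive (g' := bumpf)); [exact: theta_small|exact: theta_derive|].
by move=> /ltW/bump_lt.
Qed.

(** Both sides are the derivative of [s * quot s], which is [theta s]. This is the reason why the
    divergence of the field [hker] is a bump. *)
Lemma quotE s : quot s + s * quot' s = bumpf s.
Proof.
rewrite /quot'; have [->|s0] := eqVneq s 0; last by field.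
by rewrite /quot theta_small ?invr_ge0// mul0r mul0r addr0 bump_lt// invr_ge0.
Qed.

End bumpf.

(** * Smooth kernels with radial profiles *)

HB.lock Definition pd (R : realType) (i : 'I_2) (K : R * R -> R) : R * R -> R :=
  Dv (basis_vector i) K.

Section plane_kernels.
Context {R : realType}.
Notation e_ i := (basis_vector i : R * R).
Implicit Types K : R * R -> R.

Lemma Sm_fst : Sm (fun x : R * R => x.1).
Proof. by apply: Sm_lin => // x; exact: cvg_fst. Qed.

Lemma Sm_snd : Sm (fun x : R * R => x.2).
Proof. by apply: Sm_lin => // x; exact: cvg_snd. Qed.

Lemma Sm_meas K : Sm K -> measurable_fun setT (K : PL R -> R).
Proof.
elim=> [c|l lD lZ cl|f g _ mf _ mg|f g _ mf _ mg|h f sh _ mf].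
- exact: measurable_cst.
- have -> : l = (fun x : PL R => x.1 * l (1, 0) + x.2 * l (0, 1)).
    apply/funext => -[a b]; rewrite -!lZ -lD /=; congr l.
    have -> : (a, b) = (a * 1 + b * 0, a * 0 + b * 1) :> R * R.
      by rewrite !mulr1 !mulr0 addr0 add0r.
    by [].
  apply: measurable_funD; apply: measurable_funM => //;
    by [exact: measurable_fst|exact: measurable_snd].
- exact: measurable_funD.
- exact: measurable_funM.
- apply: (measurableT_comp (f := h)) => //.
  by apply: continuous_measurable_fun; exact: smooth1_continuous.
Qed.

Definition sker K : Prop := Sm K /\
  exists A : R, forall x, K x != 0 -> `|x.1| <= A /\ `|x.2| <= A.

Lemma sker_ker K : sker K -> ker (K : PL R -> R).
Proof.
move=> [sK [A hA]]; split; first exact: Sm_meas.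
pose B : set (R * R) := `[- A, A]%classic `*` `[- A, A]%classic.
have cB : compact B by apply: compact_setX; exact: segment_compact.
have : compact (K @` B).
  apply: continuous_compact => //; apply: continuous_subspaceT; exact: Sm_continuous.
move=> /compact_bounded[M [_ hM]]; exists A, (M + 1) => x.
have [->|K0] := eqVneq (K x) 0.
  rewrite normr0 boxE; case: ifP => [/andP[h1 h2]|_]; last by rewrite mulr0.
  have : `|K x| <= M + 1.
    apply: hM; first by rewrite ltrDl.
    by exists x => //; split; rewrite /= in_itv/= -ler_norml.
  by rewrite mulr1; apply: le_trans.
have [h1 h2] := hA _ K0; rewrite boxE h1 h2 mulr1; apply: hM; first by rewrite ltrDl.
by exists x => //; split; rewrite /= in_itv/= -ler_norml.
Qed.

Lemma pdE i K : pd i K = Dv (e_ i) K.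
Proof. by rewrite pd.unlock. Qed.

Lemma sker_pd i K : sker K -> sker (pd i K).
Proof.
move=> [sK [A hA]]; split; first by rewrite pdE; exact: Sm_D.
exists A => x D0; apply: contrapT => H; move/eqP: D0; apply.
rewrite pdE /Dv.
have e : \near x, (fun _ : R * R => 0 : R) x = K x.
  have : [set x : R * R | A < `|x.1|] x \/ [set x : R * R | A < `|x.2|] x.
    by rewrite /=; have [h1|] := leP `|x.1| A; [have [h2|] := leP `|x.2| A; [case: H|right]|left].
  case=> [hx|hx].
  - near=> y; apply/esym/eqP; apply: contrapT => /negP /hA[h _].
    have : A < `|y.1|; last by rewrite ltNge h.
    near: y; apply: (@cvgr_gt _ _ (nbhs x) _ (fun y : R * R => `|y.1|) `|x.1|) => //.
    by apply: cvg_norm; exact: cvg_fst.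
  - near=> y; apply/esym/eqP; apply: contrapT => /negP /hA[_ h].
    have : A < `|y.2|; last by rewrite ltNge h.
    near: y; apply: (@cvgr_gt _ _ (nbhs x) _ (fun y : R * R => `|y.2|) `|x.2|) => //.
    by apply: cvg_norm; exact: cvg_snd.
by have [_] := near_eq_is_derive e (is_derive_cst (0 : R) x (e_ i)).
Unshelve. all: end_near. Qed.

Lemma pdC i j K : sker K -> pd i (pd j K) = pd j (pd i K).
Proof. by move=> [sK _]; rewrite !pdE; exact: Sm_DC. Qed.

Lemma sker_C1 i K : sker K -> C1 i (K : PL R -> R) (pd i K).
Proof.
move=> [sK _] x; rewrite pdE; split.
  by move=> s; apply: is_derive_line; exact: Sm_is_derive.
move=> s; apply: continuous_comp; last exact: (Sm_continuous (Sm_D _ sK)).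
by apply: continuousD; [exact: cst_continuous|exact: scalel_continuous].
Qed.

Lemma skerD K K' : sker K -> sker K' -> sker (fun x => K x + K' x).
Proof.
move=> [sK [A hA]] [sK' [A' hA']]; split; first exact: Sm_add.
exists (Num.max A A') => x; have [->|K0] := eqVneq (K x) 0.
  by rewrite add0r => /hA'[h1 h2]; rewrite !le_max h1 h2 !orbT.
by have [h1 h2] := hA _ K0; rewrite !le_max h1 h2.
Qed.

Lemma skerZ a K : sker K -> sker (fun x => a * K x).
Proof.
move=> [sK [A hA]]; split; first by apply: Sm_mul => //; exact: Sm_cst.
by exists A => x; rewrite mulf_eq0 negb_or => /andP[_ /hA].
Qed.

Lemma skerB K K' : sker K -> sker K' -> sker (fun x => K x - K' x).
Proof.
move=> kK kK'; rewrite (_ : (fun x => _) = fun x => K x + -1 * K' x).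
  by apply: skerD => //; exact: skerZ.
by apply/funext => x; rewrite mulN1r.
Qed.

Definition crd (i : 'I_2) (x : R * R) : R := if i == 0 then x.1 else x.2.

Definition r2 (x : R * R) : R := x.1 ^+ 2 + x.2 ^+ 2.

Lemma Sm_crd i : Sm (crd i).
Proof. by rewrite /crd; case: (i == 0); [exact: Sm_fst|exact: Sm_snd]. Qed.

Lemma pd_crd i j : pd j (crd i) = fun=> (i == j)%:R.
Proof.
rewrite !pdE Dv_lin; first by apply/funext => x; rewrite /crd /basis_vector;
  move: i j => [[|[|//]] hi] [[|[|//]] hj].
- by move=> x y; rewrite /crd; case: ifP.
- by move=> a x; rewrite /crd; case: ifP.
Qed.

Lemma Sm_r2 : Sm r2.
Proof.
by apply: Sm_add; under eq_fun do rewrite expr2; apply: Sm_mul;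
  [exact: Sm_fst|exact: Sm_fst|exact: Sm_snd|exact: Sm_snd].
Qed.

Lemma r2E : r2 = fun x => crd 0 x * crd 0 x + crd 1 x * crd 1 x.
Proof. by apply/funext => x; rewrite /r2 /crd /= !expr2. Qed.

Lemma pd_r2 j : pd j r2 = fun x => 2 * crd j x.
Proof.
have s0 := Sm_crd 0; have s1 := Sm_crd 1.
rewrite r2E pdE DvD; [|exact: Sm_mul..].
rewrite !DvM// -(pdE j (crd 0)) -(pdE j (crd 1)) !pd_crd.
apply/funext => x; move: j => [[|[|//]] hj]; rewrite /crd /=; ring.
Qed.

Definition scal (a : R) (h : R -> R) (x : R * R) : R := h (a * r2 x).

Lemma Sm_scal a h : smooth1 h -> Sm (scal a h).
Proof. by move=> sh; apply: Sm_comp => //; apply: Sm_mul; [exact: Sm_cst|exact: Sm_r2]. Qed.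

Lemma pd_scal a h h' j : (forall s : R, is_derive s 1 h (h' s)) ->
  pd j (scal a h) = fun x => 2 * a * crd j x * h' (a * r2 x).
Proof.
move=> dh; rewrite !pdE /scal (Dv_comp _ dh); last first.
  by apply: Sm_mul; [exact: Sm_cst|exact: Sm_r2].
rewrite DvZ; last exact: Sm_r2.
rewrite -(pdE j r2) pd_r2.
by apply/funext => x; ring.
Qed.

Definition hker (a : R) (i : 'I_2) (x : R * R) : R := a * (crd i x * scal a quot x).

Lemma Sm_hker a i : Sm (hker a i).
Proof.
apply: Sm_mul; first exact: Sm_cst.
by apply: Sm_mul; [exact: Sm_crd|exact: Sm_scal smooth1_quot].
Qed.

Lemma pd_hker a i j : pd j (hker a i) = fun x =>
  a * ((i == j)%:R * scal a quot x + 2 * a * crd i x * crd j x * quot' (a * r2 x)).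
Proof.
have sc := Sm_crd i; have sq := Sm_scal a (@smooth1_quot R).
rewrite !pdE /hker DvZ; last exact: Sm_mul.
rewrite DvM// -(pdE j (crd i)) -(pdE j (scal a quot)) pd_crd (pd_scal _ _ derive_quot).
by apply/funext => x; ring.
Qed.

Lemma div_hker a x : \sum_(i < 2) pd i (hker a i) x = 2 * a * bumpf (a * r2 x).
Proof.
rewrite big_ord_recl big_ord1 !pd_hker /= -quotE /scal /r2 /crd /=.
ring.
Qed.

Lemma hker_large a i x : 0 < a -> 1 <= a * r2 x -> hker a i x = crd i x * (theta 1 / r2 x).
Proof.
move=> a0 h; rewrite /hker /scal /quot theta_large//.
have r0 : r2 x != 0 by apply/eqP => r0; move: h; rewrite r0 mulr0 ler10.
by field; rewrite r0 gt_eqF.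
Qed.

(** Outside a disc both fields equal the same multiple of x / |x|^2, the gradient of the logarithm,
    whatever the parameter. The difference therefore has compact support, while its divergence is a
    difference of two bumps. *)
Definition kk (a b : R) (i : 'I_2) (x : R * R) : R := hker a i x - hker b i x.

Lemma r2_ge (x : R * R) : x.1 ^+ 2 <= r2 x /\ x.2 ^+ 2 <= r2 x.
Proof. by rewrite /r2 lerDl lerDr !sqr_ge0. Qed.

Lemma r2_box (b : R) x : 0 < b -> b ^+ 2 * r2 x < 1 -> `|x.1| <= b^-1 /\ `|x.2| <= b^-1.
Proof.
move=> b0 h; have [h1 h2] := r2_ge x.
have g (y : R) : y ^+ 2 <= r2 x -> `|y| <= b^-1.
  move=> hy; rewrite -(@ler_pXn2r _ 2)// ?nnegrE ?invr_ge0 ?(ltW b0)// real_normK ?num_real//.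
  rewrite (le_trans hy)// exprVn -[leRHS]mul1r ler_pdivlMr ?exprn_gt0// mulrC.
  exact: ltW.
by split; exact: g.
Qed.

Lemma sker_kk a b i : 0 < b -> b <= a -> sker (kk (a ^+ 2) (b ^+ 2) i).
Proof.
move=> b0 ba; have a0 := lt_le_trans b0 ba; split.
  by apply: Sm_sub; exact: Sm_hker.
exists b^-1 => x H; apply: r2_box => //; rewrite ltNge; apply/negP => h.
move/eqP : H; apply; rewrite /kk !hker_large ?subrr ?exprn_gt0//.
have r0 : 0 <= r2 x by rewrite addr_ge0 ?sqr_ge0.
apply: (le_trans h); rewrite ler_wpM2r// lerXn2r ?nnegrE ?(ltW b0) ?(ltW a0)//.
Qed.

(** The divergence of the field [hker (a ^+ 2)]: a radial bump of width 1 / a whose mass does not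
    depend on a. The parameter is squared because the profiles are functions of the squared
    radius. *)
Definition rho (a : R) (x : R * R) : R := 2 * a ^+ 2 * bumpf (a ^+ 2 * r2 x).

Lemma rho_box a x : 0 < a -> rho a x != 0 -> `|x.1| <= a^-1 /\ `|x.2| <= a^-1.
Proof.
move=> a0 H; apply: r2_box => //; rewrite ltNge; apply/negP => h.
by move/eqP : H; apply; rewrite /rho bump_gt// mulr0.
Qed.

Lemma sker_rho a : 0 < a -> sker (rho a).
Proof.
move=> a0; split; last by exists a^-1 => x; exact: rho_box.
by apply: Sm_mul; [exact: Sm_cst|exact: (Sm_scal _ smooth1_bump)].
Qed.

Lemma rho_ge0 a x : 0 <= rho a x.
Proof. by rewrite mulr_ge0 ?bump_ge0// mulr_ge0// sqr_ge0. Qed.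

Lemma rho_even a x : rho a (- x) = rho a x.
Proof. by rewrite /rho /r2 /= !sqrrN. Qed.

Lemma div_kk a b x : \sum_(i < 2) pd i (kk (a ^+ 2) (b ^+ 2) i) x = rho a x - rho b x.
Proof.
rewrite /rho -!div_hker -sumrB; apply: eq_bigr => i _.
by rewrite !pdE /kk DvB//; exact: Sm_hker.
Qed.

(** A radial field is a gradient, so its Jacobian is symmetric. This symmetry lies behind the bounds
    of Riesz transform type and behind the projection onto divergence free fields. *)
Lemma kk_sym a b i j : pd j (kk a b i) = pd i (kk a b j).
Proof.
rewrite !pdE /kk !DvB; try exact: Sm_hker.
rewrite -!pdE !pd_hker; apply/funext => x.
by rewrite (eq_sym j i); ring.
Qed.

(** The difference of the two bumps is the divergence of the compactly supported field [kk], hence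
    has integral zero. *)
Lemma rho_mass a b : 0 < b -> b <= a -> Int lam2 (rho a) = Int lam2 (rho b).
Proof.
move=> b0 ba; have a0 := lt_le_trans b0 ba.
have La := ker_L1 (sker_ker (sker_rho a0)); have Lb := ker_L1 (sker_ker (sker_rho b0)).
apply/eqP; rewrite -subr_eq0 -IntB//; apply/eqP.
rewrite (@eq_Int _ _ _ _ _ (fun x : PL R => \sum_(i < 2) pd i (kk (a ^+ 2) (b ^+ 2) i) x)); last first.
  by move=> x; rewrite div_kk.
have sk i := sker_kk i b0 ba.
rewrite Int_sum; last by move=> i; exact: ker_L1 (sker_ker (sker_pd i (sk i))).
apply: big1 => i _; apply: (Int_C1 (sker_C1 i (sk i))).
- exact: ker_L1 (sker_ker (sk i)).
- exact: ker_L1 (sker_ker (sker_pd i (sk i))).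
Qed.

Lemma rho_mass_pos : 0 < Int lam2 (rho 1).
Proof.
have L := ker_L1 (sker_ker (sker_rho ltr01)).
rewrite lt_neqAle Int_ge0 ?andbT; last by move=> x; exact: rho_ge0.
apply/eqP => /esym H; have ae0 := Int_eq0_ae L (rho_ge0 1) H.
(* On the square of half-width 1/10 around [c] the squared radius stays between 0.29 and 0.65,
   inside the interval where [bumpf] is positive. *)
pose c : PL R := (6 / 10, 3 / 10).
have mb : measurable_fun setT (fun x : PL R => box 10^-1 (x + (- c))).
  by apply: meas_shift; exact: meas_box.
have : Int lam2 (fun x : PL R => box 10^-1 (x + (- c))) = 0.
  rewrite -[RHS](Int0 lam2); apply: ae_eq_Int => //.
  apply: ae_imp ae0 => x h /h {}h; rewrite boxE; case: ifP => // /andP[/= h1 h2].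
  move: h; rewrite /rho expr1n mul1r mulr1.
  suff B0 : 0 < bumpf (r2 x) by move/eqP; rewrite mulf_eq0 pnatr_eq0/= gt_eqF.
  apply: bump_pos; rewrite /r2.
  move: h1 h2; rewrite !ler_norml => /andP[h1 h2] /andP[h3 h4].
  by apply/andP; split; nra.
rewrite Int_shift; last exact: meas_box.
by rewrite Int_box ?invr_ge0// => /eqP; rewrite mulf_eq0 pnatr_eq0/= expf_eq0/= invr_eq0 pnatr_eq0.
Qed.

Lemma rho_bound : exists C : R, forall a x, 0 < a ->
  `|rho a x| <= C * a ^+ 2 /\ forall j, `|pd j (rho a) x| <= C * a ^+ 3.
Proof.
have [b' sb' db] := smooth1_derive (@smooth1_bump R).
have bd (h : R -> R) : smooth1 h -> exists C : R, forall s : R, 0 <= s <= 1 -> `|h s| <= C.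
  move=> sh; have : compact (h @` `[0, 1]%classic).
    apply: continuous_compact; last exact: segment_compact.
    by apply: continuous_subspaceT; exact: smooth1_continuous.
  move=> /compact_bounded[M [_ hM]]; exists (M + 1) => s hs.
  by apply: hM; [rewrite ltrDl|exists s => //=; rewrite in_itv].
have [C1 hC1] := bd _ (@smooth1_bump R); have [C2 hC2] := bd _ sb'.
have C10 : 0 <= C1 by apply: le_trans (hC1 0 _); rewrite ?lexx ?ler01.
have C20 : 0 <= C2 by apply: le_trans (hC2 0 _); rewrite ?lexx ?ler01.
exists (2 * C1 + 4 * C2) => a x a0.
have r0 : 0 <= a ^+ 2 * r2 x by rewrite mulr_ge0 ?sqr_ge0// addr_ge0 ?sqr_ge0.
have a20 : 0 <= a ^+ 2 by exact: sqr_ge0.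
split.
  rewrite /rho normrM ger0_norm; last by rewrite mulr_ge0.
  have : `|bumpf (a ^+ 2 * r2 x)| <= C1.
    have [h|h] := leP (a ^+ 2 * r2 x) 1; first by apply: hC1; rewrite r0.
    by rewrite bump_gt ?normr0// ltW.
  by move=> h; have := ler_wpM2l a20 h; nra.
move=> j; rewrite (_ : pd j (rho a) = fun x => 2 * a ^+ 2 * (2 * a ^+ 2 * crd j x * b' (a ^+ 2 * r2 x))); last first.
  rewrite !pdE /rho -/(scal (a ^+ 2) bumpf) DvZ; last exact: Sm_scal smooth1_bump.
  by rewrite -pdE (pd_scal _ _ db).
have [h|h] := leP (a ^+ 2 * r2 x) 1; last first.
  have -> : b' (a ^+ 2 * r2 x) = 0.
    set s := a ^+ 2 * r2 x in h *; have [_ <-] := db s.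
    have e : \near s, (fun _ : R => 0 : R) s = bumpf s.
      by near=> y; rewrite bump_gt// ltW//; near: y; exact: (lt_nbhsr h).
    by have [_ ->] := near_eq_is_derive e (is_derive_cst (0 : R) s 1).
  by rewrite !mulr0 normr0 mulr_ge0 ?exprn_ge0 ?(ltW a0)//; nra.
have hb : `|b' (a ^+ 2 * r2 x)| <= C2 by apply: hC2; rewrite r0.
have hc : `|crd j x| <= a^-1.
  have [h1 h2] := r2_ge x.
  have g (y : R) : y ^+ 2 <= r2 x -> `|y| <= a^-1.
    move=> hy; rewrite -(@ler_pXn2r _ 2)// ?nnegrE ?invr_ge0 ?(ltW a0)// real_normK ?num_real//.
    by rewrite (le_trans hy)// exprVn -[leRHS]mul1r ler_pdivlMr ?exprn_gt0// mulrC.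
  by rewrite /crd; case: ifP => _; exact: g.
rewrite (_ : 2 * a ^+ 2 * _ = 4 * a ^+ 3 * ((a * crd j x) * b' (a ^+ 2 * r2 x))); last by ring.
rewrite normrM ger0_norm ?mulr_ge0 ?exprn_ge0 ?(ltW a0)//.
have : `|a * crd j x * b' (a ^+ 2 * r2 x)| <= 1 * C2.
  rewrite normrM ler_pM// normrM (ger0_norm (ltW a0)).
  by rewrite -ler_pdivlMl// mulr1.
have a3 : 0 <= a ^+ 3 by rewrite exprn_ge0 ?ltW.
move=> hh; have := ler_wpM2l a3 hh; nra.
Unshelve. all: end_near. Qed.

End plane_kernels.

(** * Estimates for correlations *)

Section weighted_averages.
Context d1 d2 (T1 : measurableType d1) (T2 : measurableType d2) (R : realType).
Context (m1 : {sigma_finite_measure set T1 -> \bar R}).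
Context (m2 : {sigma_finite_measure set T2 -> \bar R}).

(** The Cauchy-Schwarz inequality for the measure |k| dy, obtained by splitting |k| into two square
    roots. *)
Lemma CS_weight (k F : T2 -> R) : L1 m2 k -> measurable_fun setT F ->
  L1 m2 (fun y => `|k y| * F y ^+ 2) ->
  L1 m2 (fun y => k y * F y) /\
  Int m2 (fun y => k y * F y) ^+ 2 <= Int m2 (fun y => `|k y|) * Int m2 (fun y => `|k y| * F y ^+ 2).
Proof.
move=> Lk mF LkF; have mk := mabs (L1_meas Lk).
have msq : measurable_fun setT (fun y => Num.sqrt `|k y|).
  have ms : measurable_fun setT (@Num.sqrt R : measurableTypeR R -> measurableTypeR R).
    by apply: continuous_measurable_fun; exact: sqrt_continuous.
  exact: (mcomp ms mk).
have Lf : L2 m2 (fun y => Num.sqrt `|k y|).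
  by split=> //; under eq_fun do rewrite sqr_sqrtr//; exact: L1_abs.
have Lg : L2 m2 (fun y => Num.sqrt `|k y| * F y).
  split; first exact: measurable_funM.
  by under eq_fun do rewrite exprMn sqr_sqrtr//.
have E y : `|k y * F y| = `|Num.sqrt `|k y| * (Num.sqrt `|k y| * F y)|.
  by rewrite mulrA -expr2 sqr_sqrtr// !normrM normr_id.
have Lp : L1 m2 (fun y => k y * F y).
  apply: (L1_le _ (L1_abs (L2M Lf Lg))); first by apply: measurable_funM => //; exact: (L1_meas Lk).
  by move=> y; rewrite E.
split=> //; rewrite -real_normK ?num_real//.
have h : `|Int m2 (fun y => k y * F y)| <= N2 m2 (fun y => Num.sqrt `|k y|) * N2 m2 (fun y => Num.sqrt `|k y| * F y).
  apply: le_trans (CS Lf Lg); rewrite (le_trans (abs_Int Lp))//.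
  by rewrite (eq_Int m2 (g := (fun y => `|Num.sqrt `|k y| * (Num.sqrt `|k y| * F y)|))).
apply: (@le_trans _ _ ((N2 m2 (fun y => Num.sqrt `|k y|) * N2 m2 (fun y => Num.sqrt `|k y| * F y)) ^+ 2)).
  by rewrite lerXn2r// nnegrE mulr_ge0// N2_ge0.
rewrite exprMn !N2sq (eq_Int m2 (g := (fun y => `|k y|))); last by move=> y; rewrite sqr_sqrtr.
rewrite le_eqVlt; apply/orP; left; apply/eqP; congr (_ * _).
by apply: eq_Int => y; rewrite exprMn sqr_sqrtr.
Qed.

(** Minkowski's inequality for superpositions, from the weighted Cauchy-Schwarz inequality and
    Tonelli's theorem. The norms of the sections are bounded only where [k] does not vanish: a
    kernel of small support then sees small translations only. *)
Lemma N2_average (k : T2 -> R) (F : T1 -> T2 -> R) (C : R) : L1 m2 k ->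
  measurable_fun setT (fun p => F p.1 p.2) ->
  (forall y, L2 m1 (F^~ y)) -> (forall y, k y != 0 -> N2 m1 (F^~ y) <= C) -> 0 <= C ->
  (forall x, L1 m2 (fun y => `|k y| * F x y ^+ 2)) ->
  L2 m1 (fun x => Int m2 (fun y => k y * F x y)) /\
  N2 m1 (fun x => Int m2 (fun y => k y * F x y)) <= Int m2 (fun y => `|k y|) * C.
Proof.
move=> Lk mF LF hC C0 LkF.
have mk := L1_meas Lk.
have mFx x : measurable_fun setT (F x) by exact: mslice mF.
pose I := Int m2 (fun y => `|k y|).
have I0 : 0 <= I by apply: Int_ge0.
have mI : measurable_fun setT (fun x => Int m2 (fun y => k y * F x y)).
  apply: (meas_Int m2 (F := fun x y => k y * F x y)); apply: measurable_funM => //.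
  exact: (mcomp mk measurable_snd).
have mG : measurable_fun setT (fun p : T1 * T2 => `|k p.2| * F p.1 p.2 ^+ 2).
  apply: measurable_funM; last exact: measurable_funX.
  by apply: mabs; exact: (mcomp mk measurable_snd).
have hb y : Int m1 (fun x => `|k y| * F x y ^+ 2) <= `|k y| * C ^+ 2.
  have [->|k0] := eqVneq (k y) 0; first by under eq_Int do rewrite normr0 mul0r; rewrite normr0 mul0r Int0.
  rewrite IntZ; last exact: (LF y).2.
  by rewrite ler_wpM2l// -N2sq lerXn2r ?nnegrE ?N2_ge0//; exact: hC.
have [LG hG] := tonelli_le (F := fun x y => `|k y| * F x y ^+ 2) (g := fun y => `|k y| * C ^+ 2)
  mG (fun x y => mulr_ge0 (normr_ge0 _) (sqr_ge0 _)) (fun y => L1Z _ (LF y).2) (L1Zr _ (L1_abs Lk)) hb.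
have {}hG : Int m1 (fun x => Int m2 (fun y => `|k y| * F x y ^+ 2)) <= I * C ^+ 2.
  by rewrite -IntZr//; last exact: L1_abs.
have pw x : (Int m2 (fun y => k y * F x y)) ^+ 2 <= I * Int m2 (fun y => `|k y| * F x y ^+ 2).
  by have [_] := CS_weight Lk (mFx x) (LkF x).
have LH : L2 m1 (fun x => Int m2 (fun y => k y * F x y)).
  split=> //; apply: (L1_le _ (L1Z I LG)); first exact: measurable_funX.
  by move=> x; rewrite ger0_norm ?sqr_ge0.
split=> //; rewrite -(@ler_pXn2r _ 2)// ?nnegrE ?N2_ge0 ?mulr_ge0//.
rewrite N2sq exprMn -/I; apply: (@le_trans _ _ (I * (I * C ^+ 2))); last by rewrite mulrA -expr2.
apply: le_trans (ler_wpM2l I0 hG); rewrite -IntZ//.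
by apply: le_Int => //; [exact: LH.2|exact: L1Z].
Qed.

End weighted_averages.

Section convolution_estimates.
Context {R : realType}.
Notation RM := (measurableTypeR R).
Implicit Types K f g : PL R -> R.

Lemma ker_opp K : ker K -> ker (fun x : PL R => K (- x)).
Proof.
move=> [mK [A [C hK]]]; split.
  have -> : (fun x : PL R => K (- x)) = (fun x : PL R => K ((0, 0) - x)).
    by apply/funext => -[a b]; rewrite psubE /= !sub0r.
  by apply: (mcomp mK); apply: m2B.
exists A, C => x; apply: (le_trans (hK _)); rewrite !boxE /= !normrN.
by rewrite lexx.
Qed.

Lemma meas_shift2 f : measurable_fun setT f ->
  measurable_fun setT (fun p : PL R * PL R => f (p.1 + p.2)).
Proof. by move=> mf; apply: (mcomp mf); apply: m2D. Qed.

Lemma meas_sub2 f : measurable_fun setT f ->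
  measurable_fun setT (fun p : PL R * PL R => f (p.2 - p.1)).
Proof. by move=> mf; apply: (mcomp mf); apply: m2B. Qed.

Lemma addPC (x z : PL R) : x + z = z + x.
Proof. by rewrite !paddE addrC [x.2 + _]addrC. Qed.

Lemma L2_shiftl x f : L2 lam2 f -> L2 lam2 (fun z : PL R => f (x + z)).
Proof. by move=> Lf; under eq_fun do rewrite addPC; exact: L2_shift. Qed.

Lemma N2_shiftl x f : measurable_fun setT f -> N2 lam2 (fun z : PL R => f (x + z)) = N2 lam2 f.
Proof. by move=> mf; under eq_fun do rewrite addPC; exact: N2_shift. Qed.

Lemma L1_shiftl x f : L1 lam2 f -> L1 lam2 (fun z : PL R => f (x + z)).
Proof. by move=> Lf; under eq_fun do rewrite addPC; exact: L1_shift. Qed.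

Lemma cv_bd K f x : ker K -> L2 lam2 f -> `|cv K f x| <= N2 lam2 K * N2 lam2 f.
Proof.
move=> kK Lf; rewrite cv_shiftE; [|exact: kK.1|exact: Lf.1].
rewrite -(N2_shiftl x Lf.1); apply: CSr; [exact: ker_L2|exact: L2_shiftl].
Qed.

Lemma cv_bd1 K f x C : ker K -> (forall x, `|K x| <= C) -> L1 lam2 f ->
  `|cv K f x| <= C * Int lam2 (fun y => `|f y|).
Proof.
move=> kK hK Lf; rewrite -IntZ; last exact: L1_abs.
rewrite cvE; apply: abs_Int_le; [apply: cv_L1 => //; exact: L1_Lloc|by apply: L1Z; exact: L1_abs|].
by move=> y; rewrite normrM ler_wpM2r.
Qed.

Lemma ker_sqr_L1 K f x : ker K -> L2 lam2 f -> L1 lam2 (fun z : PL R => `|K z| * f (x + z) ^+ 2).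
Proof.
move=> kK Lf; have [_ [C [_ _ hC _ _]]] := ker_bd kK.
apply: (L1_bd (C := C)); [exact: mabs kK.1|by move=> z; rewrite normr_id|].
exact: (L2_shiftl x Lf).2.
Qed.

Lemma cv_L2 K f : ker K -> L2 lam2 f ->
  L2 lam2 (cv K f) /\ N2 lam2 (cv K f) <= Int lam2 (fun z => `|K z|) * N2 lam2 f.
Proof.
move=> kK Lf.
have -> : cv K f = fun x => Int lam2 (fun z => K z * f (x + z)).
  by apply/funext => x; rewrite cv_shiftE//; [exact: kK.1|exact: Lf.1].
apply: (@N2_average _ _ _ _ R lam2 lam2 K (fun x z : PL R => f (x + z))).
- exact: ker_L1.
- exact: meas_shift2 Lf.1.
- by move=> z; exact: L2_shift.
- by move=> z _; rewrite N2_shift//; exact: Lf.1.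
- exact: N2_ge0.
- by move=> x; exact: ker_sqr_L1.
Qed.

Lemma cv_abs_le K f x : ker K -> Lloc f ->
  `|cv K f x| <= cv (fun x => `|K x|) (fun x => `|f x|) x.
Proof.
move=> kK Lf; rewrite cvE; apply: (le_trans (abs_Int (cv_L1 x kK Lf))).
by rewrite !cvE le_eqVlt; apply/orP; left; apply/eqP; apply: eq_Int => y; rewrite normrM.
Qed.

Lemma cv_L1L1 K f : ker K -> L1 lam2 f ->
  L1 lam2 (cv K f) /\
  Int lam2 (fun x => `|cv K f x|) <= Int lam2 (fun z => `|K z|) * Int lam2 (fun x => `|f x|).
Proof.
move=> kK Lf; have mf := L1_meas Lf.
have mF : measurable_fun setT (fun p : PL R * PL R => `|K p.2| * `|f (p.1 + p.2)|).
  apply: measurable_funM; first by apply: mabs; exact: (mcomp kK.1 measurable_snd).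
  by apply: mabs; exact: meas_shift2.
have kL1 := L1_abs (ker_L1 kK).
have hb (y : PL R) : Int lam2 (fun x : PL R => `|K y| * `|f (x + y)|) <=
    `|K y| * Int lam2 (fun x : PL R => `|f x|).
  rewrite IntZ; last by apply: L1_abs; exact: L1_shift.
  by rewrite (Int_shift y (mabs mf)).
have [L h] := @tonelli_le _ _ _ _ R lam2 lam2 (fun x z : PL R => `|K z| * `|f (x + z)|)
  (fun z : PL R => `|K z| * Int lam2 (fun x : PL R => `|f x|)) mF
  (fun x y => mulr_ge0 (normr_ge0 _) (normr_ge0 _)) (fun z => L1Z _ (L1_abs (L1_shift z Lf)))
  (L1Zr _ kL1) hb.
have E x : cv (fun x => `|K x|) (fun x => `|f x|) x = Int lam2 (fun z => `|K z| * `|f (x + z)|).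
  by rewrite cv_shiftE//; apply: mabs => //; exact: kK.1.
have mc : measurable_fun setT (cv K f) by apply: meas_cv => //; exact: kK.1.
have pw x : `|cv K f x| <= Int lam2 (fun z => `|K z| * `|f (x + z)|).
  by rewrite -E; apply: cv_abs_le => //; exact: L1_Lloc.
have Lc : L1 lam2 (cv K f) by exact: (L1_le mc L pw).
split=> //; rewrite -IntZr//; apply: le_trans h.
by apply: le_Int => //; exact: L1_abs.
Qed.

Lemma cv_L1L2 K f : ker K -> L1 lam2 f ->
  L2 lam2 (cv K f) /\
  N2 lam2 (cv K f) <= N2 lam2 (fun z : PL R => K (- z)) * Int lam2 (fun x => `|f x|).
Proof.
move=> kK Lf; have mf := L1_meas Lf.
have kO := ker_opp kK.
have E (y x : PL R) : K (y - x) = (fun z : PL R => K (- z)) (x + (- y)).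
  by rewrite /= opprD opprK addrC.
have -> : cv K f = fun x => Int lam2 (fun y => f y * K (y - x)).
  by apply/funext => x; rewrite cvE; apply: eq_Int => y; rewrite mulrC.
rewrite mulrC.
apply: (@N2_average _ _ _ _ R lam2 lam2 f (fun x y : PL R => K (y - x))).
- exact: Lf.
- exact: meas_sub2 kK.1.
- move=> y; have h := L2_shift (- y) (ker_L2 kO); move: h.
  by under eq_fun do rewrite -E.
- move=> y _; under eq_fun do rewrite E.
  by rewrite (N2_shift (- y) kO.1).
- exact: N2_ge0.
- move=> x; have [_ [C [_ C0 hC _ _]]] := ker_bd kK.
  under eq_fun do rewrite mulrC.
  apply: (L1_bd (C := C ^+ 2)); last exact: L1_abs.
  + by apply: measurable_funX; exact: meas_ker_sub kK.1.
  + by move=> y; rewrite normrX lerXn2r ?nnegrE//; exact: hC.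
Qed.

(** Fubini's theorem. The adjoint carries the reflected kernel, which is the kernel itself in the
    later application to the even kernel [mm n]. *)
Lemma cv_adj K f g : ker K -> Lloc f -> Lloc g ->
  L1 lam2 (fun x => `|g x| * cv (fun x => `|K x|) (fun x => `|f x|) x) ->
  Int lam2 (fun x => g x * cv K f x) = Int lam2 (fun y => f y * cv (fun z : PL R => K (- z)) g y).
Proof.
move=> kK Lf Lg L; have mg := Lg.1.
have kA := ker_abs kK.
have LfA : Lloc (fun x => `|f x|).
  split; first exact: mabs Lf.1.
  move=> a; have := L1_abs (Lf.2 a).
  by under eq_fun do rewrite normrM (ger0_norm (box_ge0 _ _)).
have F : L1 (lam2 \x lam2)%E (fun p : PL R * PL R => g p.1 * (K (p.2 - p.1) * f p.2)).
  apply: (@prodL1 _ _ _ _ R lam2 lam2 (fun x y : PL R => g x * (K (y - x) * f y))).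
  - apply: measurable_funM; first exact: (mcomp mg measurable_fst).
    apply: measurable_funM; first exact: meas_sub2 kK.1.
    exact: (mcomp Lf.1 measurable_snd).
  - by move=> x; apply: L1Z; exact: cv_L1.
  - have -> // : (fun x => Int lam2 (fun y => `|g x * (K (y - x) * f y)|)) =
      (fun x => `|g x| * cv (fun x => `|K x|) (fun x => `|f x|) x).
    apply/funext => x;rewrite !cvE -IntZ; last exact: (cv_L1 x kA LfA).
    by apply: eq_Int => y; rewrite !normrM.
transitivity (Int lam2 (fun x : PL R => Int lam2 (fun y : PL R => g x * (K (y - x) * f y)))).
  by apply: eq_Int => x; rewrite IntZ ?cvE//; exact: (cv_L1 x kK Lf).
rewrite (@fubE _ _ _ _ R lam2 lam2 (fun x y : PL R => g x * (K (y - x) * f y)) F).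
have ko := ker_opp kK.
apply: eq_Int => y; rewrite cvE -IntZ; last exact: (cv_L1 y ko Lg).
by apply: eq_Int => x; rewrite opprB; ring.
Qed.

End convolution_estimates.

(** * Mollifiers *)

Definition mass {R : realType} : R := Int lam2 (@rho R 1).

HB.lock Definition mol (R : realType) (a : R) (x : R * R) : R := mass^-1 * rho a x.

Section mollifiers.
Context {R : realType}.
Implicit Types (a : R) (x : R * R).
Notation mass := (@mass R).
Notation RM := (measurableTypeR R).
Notation e_ i := (basis_vector i : R * R).

Lemma molE a : mol a = fun x => mass^-1 * rho a x.
Proof. by apply/funext => x; rewrite mol.unlock. Qed.

Lemma sker_mol a : 0 < a -> sker (mol a).
Proof. by move=> a0; rewrite molE; apply: skerZ; exact: sker_rho. Qed.

Lemma ker_mol a : 0 < a -> ker (mol a : PL R -> R).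
Proof. by move=> a0; exact: sker_ker (sker_mol a0). Qed.

Lemma ker_pd_mol a i : 0 < a -> ker (pd i (mol a) : PL R -> R).
Proof. by move=> a0; apply: sker_ker; apply: sker_pd; exact: sker_mol. Qed.

Lemma mol_ge0 a x : 0 <= mol a x.
Proof. by rewrite molE mulr_ge0 ?rho_ge0// invr_ge0 ltW// rho_mass_pos. Qed.

Lemma mol_even a x : mol a (- x) = mol a x.
Proof. by rewrite molE rho_even. Qed.

Lemma Int_mol a : 0 < a -> Int lam2 (mol a) = 1.
Proof.
move=> a0; rewrite molE IntZ; last exact: ker_L1 (sker_ker (sker_rho a0)).
have -> : Int lam2 (rho a) = mass.
  by have [h|/ltW h] := leP 1 a; [exact: rho_mass|apply/esym; exact: rho_mass].
by rewrite mulVf// gt_eqF// rho_mass_pos.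
Qed.

Lemma Int_abs_mol a : 0 < a -> Int lam2 (fun x => `|mol a x|) = 1.
Proof. by move=> a0; rewrite -(Int_mol a0); apply: eq_Int => x; rewrite ger0_norm// mol_ge0. Qed.

Lemma pd_mol a j : 0 < a -> pd j (mol a) = fun x => mass^-1 * pd j (rho a) x.
Proof. by move=> a0; rewrite !pdE molE DvZ//; have [] := sker_rho a0. Qed.

Lemma mol_support a x : 0 < a -> mol a x != 0 -> `|x.1| <= a^-1 /\ `|x.2| <= a^-1.
Proof.
move=> a0 h; apply: rho_box => //; apply: contra_neq h => h.
by rewrite molE h mulr0.
Qed.

(** The square is doubled for the derivative, since a derivative is seen to vanish at a point only
    if the mollifier vanishes in a neighbourhood. *)
Lemma mol_bound : exists2 C : R, 0 <= C & forall (a : R) (x : R * R), 0 < a ->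
  `|mol a x| <= C * a ^+ 2 * box a^-1 x /\ forall j, `|pd j (mol a) x| <= C * a ^+ 3 * box (2 * a^-1) x.
Proof.
have [C hC] := @rho_bound R; exists (mass^-1 * `|C|).
  by rewrite mulr_ge0// invr_ge0 ltW// rho_mass_pos.
move=> a x a0; have [h1 h2] := hC a x a0.
have m0 : 0 <= mass^-1 by rewrite invr_ge0 ltW// rho_mass_pos.
have hCC n : C * a ^+ n <= `|C| * a ^+ n.
  by rewrite ler_wpM2r ?ler_norm// exprn_ge0// ltW.
split=> [|j].
  have [->|k0] := eqVneq (mol a x) 0.
    by rewrite normr0 mulr_ge0 ?box_ge0// mulr_ge0 ?sqr_ge0// mulr_ge0.
  have [h3 h4] := mol_support a0 k0; rewrite boxE h3 h4 mulr1.
  rewrite molE normrM ger0_norm// -mulrA ler_wpM2l//; exact: le_trans (hCC _).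
rewrite boxE; case: ifPn => [_|hx].
  rewrite mulr1 pd_mol// normrM ger0_norm// -mulrA ler_wpM2l//.
  exact: le_trans (h2 j) (hCC _).
have -> : pd j (mol a) x = 0.
  rewrite pdE /Dv.
  have e : \near x, (fun _ : R * R => 0 : R) x = mol a x.
    have ai : a^-1 < 2 * a^-1 by rewrite ltr_pMl ?invr_gt0// ltr1n.
    have : [set x : R * R | a^-1 < `|x.1|] x \/ [set x : R * R | a^-1 < `|x.2|] x.
      by move: hx; rewrite negb_and -!ltNge => /orP[h|h]; [left|right]; exact: lt_trans h.
    case=> [h|h].
    - near=> y; apply/esym/eqP; apply: contrapT => /negP /(mol_support a0)[g _].
      have : a^-1 < `|y.1|; last by rewrite ltNge g.
      near: y; apply: (@cvgr_gt _ _ (nbhs x) _ (fun y : R * R => `|y.1|) `|x.1|) => //.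
      by apply: cvg_norm; exact: cvg_fst.
    - near=> y; apply/esym/eqP; apply: contrapT => /negP /(mol_support a0)[_ g].
      have : a^-1 < `|y.2|; last by rewrite ltNge g.
      near: y; apply: (@cvgr_gt _ _ (nbhs x) _ (fun y : R * R => `|y.2|) `|x.2|) => //.
      by apply: cvg_norm; exact: cvg_snd.
  by have [_ ->] := near_eq_is_derive e (is_derive_cst (0 : R) x (e_ j)).
by rewrite normr0 mulr0.
Unshelve. all: end_near. Qed.

Lemma mol_diffE a (f : PL R -> R) (x : PL R) : 0 < a -> L2 lam2 f ->
  cv (mol a) f x - f x = Int lam2 (fun z : PL R => mol a z * (f (x + z) - f x)).
Proof.
move=> a0 Lf; have kK := ker_mol a0.
have L1z : L1 lam2 (fun z : PL R => mol a z * f (x + z)).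
  by apply: L2M; [exact: ker_L2|exact: L2_shiftl].
rewrite cv_shiftE; [|exact: kK.1|exact: Lf.1].
have -> : f x = Int lam2 (fun z : PL R => mol a z * f x).
  by rewrite IntZr ?Int_mol ?mul1r//; exact: ker_L1.
rewrite -IntB//; last by apply: L1Zr; exact: ker_L1.
apply: eq_Int => z; rewrite mulrBr; congr (_ - _ * _).
by rewrite IntZr ?Int_mol ?mul1r//; exact: ker_L1.
Qed.

(** The mollification error is an average of increments over the translations in the support of the
    mollifier, and these have a small modulus. *)
Lemma mol_near (f : PL R -> R) (e : R) : L2 lam2 f -> 0 < e -> exists A : R, forall a : R, 0 < a -> A <= a ->
  L2 lam2 (fun x => cv (mol a) f x - f x) /\ N2 lam2 (fun x => cv (mol a) f x - f x) <= e.
Proof.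
move=> Lf e0; have [d d0 hd] := dtr_small Lf e0.
exists (2 * d^-1) => a a0 ha; have kK := ker_mol a0.
have -> : (fun x : PL R => cv (mol a) f x - f x) = fun x => Int lam2 (fun z : PL R => mol a z * (f (x + z) - f x)).
  by apply/funext => x; exact: mol_diffE.
rewrite -[leRHS]mul1r -(Int_abs_mol a0).
apply: (@N2_average _ _ _ _ R lam2 lam2 (mol a) (fun x z : PL R => f (x + z) - f x)).
- exact: ker_L1.
- by apply: measurable_funB; [exact: meas_shift2 Lf.1|exact: (mcomp Lf.1 measurable_fst)].
- by move=> z; exact: L2_dtr.
- move=> z /(mol_support a0)[h1 h2].
  have h : a^-1 < d.
    rewrite -(invrK d) ltf_pV2 ?posrE ?invr_gt0//.
    by apply: lt_le_trans ha; rewrite ltr_pMl ?invr_gt0// ltr1n.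
  by apply/ltW/hd; [exact: le_lt_trans h|exact: le_lt_trans h].
- exact: ltW.
- move=> x; have [_ [C [_ _ hC _ _]]] := ker_bd kK.
  have -> : (fun z : PL R => `|mol a z| * (f (x + z) - f x) ^+ 2) =
    (fun z : PL R => `|mol a z| * f (x + z) ^+ 2 + ((- 2 * f x) * (`|mol a z| * f (x + z)) + f x ^+ 2 * `|mol a z|)).
    by apply/funext => z; ring.
  apply: L1D; first exact: ker_sqr_L1.
  apply: L1D; last by apply: L1Z; apply: L1_abs; exact: ker_L1.
  by apply: L1Z; apply: L2M; [apply: L2_abs; exact: ker_L2|exact: L2_shiftl].
Qed.

(** The parameter of [mol] is an inverse length: [rh n] concentrates at a point as n grows, while
    [sg n] spreads over the plane. *)
Definition rh (n : nat) : R * R -> R := mol n.+1%:R.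
Definition sg (n : nat) : R * R -> R := mol n.+1%:R^-1.

Lemma sker_rh n : sker (rh n). Proof. exact: sker_mol. Qed.
Lemma sker_sg n : sker (sg n). Proof. by apply: sker_mol; rewrite invr_gt0. Qed.
Lemma ker_rh n : ker (rh n : PL R -> R). Proof. exact: ker_mol. Qed.
Lemma ker_sg n : ker (sg n : PL R -> R). Proof. by apply: ker_mol; rewrite invr_gt0. Qed.
Lemma ker_pd_rh n i : ker (pd i (rh n) : PL R -> R). Proof. exact: ker_pd_mol. Qed.
Lemma ker_pd_sg n i : ker (pd i (sg n) : PL R -> R). Proof. by apply: ker_pd_mol; rewrite invr_gt0. Qed.

Lemma Int_abs_rh n : Int lam2 (fun x => `|rh n x|) = 1. Proof. exact: Int_abs_mol. Qed.
Lemma Int_abs_sg n : Int lam2 (fun x => `|sg n x|) = 1.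
Proof. by apply: Int_abs_mol; rewrite invr_gt0. Qed.

Lemma N2_cv_rh n f : L2 lam2 f -> L2 lam2 (cv (rh n) f) /\ N2 lam2 (cv (rh n) f) <= N2 lam2 f.
Proof. by move=> Lf; have := cv_L2 (ker_rh n) Lf; rewrite Int_abs_rh mul1r. Qed.

Lemma N2_cv_sg n f : L2 lam2 f -> L2 lam2 (cv (sg n) f) /\ N2 lam2 (cv (sg n) f) <= N2 lam2 f.
Proof. by move=> Lf; have := cv_L2 (ker_sg n) Lf; rewrite Int_abs_sg mul1r. Qed.

Lemma rh_cvg f : L2 lam2 f -> (fun n => N2 lam2 (fun x => cv (rh n) f x - f x)) @ \oo --> (0 : R).
Proof.
move=> Lf; apply/cvgrPdist_le => e e0.
have [A hA] := mol_near Lf e0.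
near=> n; rewrite sub0r normrN ger0_norm ?N2_ge0//.
apply: (hA _ _ _).2 => //.
apply: (@le_trans _ _ n%:R); last by rewrite ler_nat.
by near: n; exact: nbhs_infty_ger.
Unshelve. all: end_near. Qed.

(** In the plane, a mollifier of width n + 1 has height of order (n + 1)^-2 on an area of order (n +
    1)^2. *)
Lemma N2_sg_bound : exists2 C : R, 0 <= C & forall n, N2 lam2 (fun z : PL R => sg n (- z)) <= C * n.+1%:R^-1.
Proof.
have [C C0 hC] := mol_bound; exists (2 * C) => [|n]; first by rewrite mulr_ge0.
set a : R := n.+1%:R^-1; have a0 : 0 < a by rewrite invr_gt0.
under eq_fun do rewrite [sg n _]mol_even.
have a00 := ltW a0.
rewrite -(@ler_pXn2r _ 2)// ?nnegrE; [|exact: N2_ge0|exact: mulr_ge0 (mulr_ge0 _ C0) a00].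
rewrite N2sq.
have kK := ker_mol a0.
have -> : (2 * C * a) ^+ 2 = Int lam2 (fun x => (C * a ^+ 2) ^+ 2 * box a^-1 x).
  rewrite IntZ; last exact: L1_box.
  rewrite Int_box ?invr_ge0 ?(ltW a0)//; by field; rewrite gt_eqF.
apply: le_Int; [exact: (ker_L2 kK).2|by apply: L1Z; exact: L1_box|].
move=> x; have [h _] := hC a x a0; rewrite -real_normK ?num_real//.
have -> : (C * a ^+ 2) ^+ 2 * box a^-1 x = (C * a ^+ 2 * box a^-1 x) ^+ 2.
  by rewrite boxE; case: ifP => _; ring.
by rewrite lerXn2r ?nnegrE//; exact: le_trans h.
Qed.

Lemma cvg_truncate (f : PL R -> R) : L2 lam2 f ->
  (fun n : nat => N2 lam2 (fun x : PL R => f x - box n%:R x * f x)) @ \oo --> (0 : R).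
Proof.
move=> Lf; have [mf LF] := Lf.
have h : (fun n => Int lam2 (fun x : PL R => (f x - box n%:R x * f x) ^+ 2)) @ \oo --> Int lam2 (fun _ : PL R => 0 : R).
  apply: (Int_dct (g := fun x : PL R => f x ^+ 2) _ _ LF _).2.
  - move=> n; apply: measurable_funX; apply: measurable_funB => //.
    by apply: measurable_funM => //; exact: meas_box.
  - move=> x; apply: cvg_near_cst; near=> n.
    rewrite boxE ifT ?mul1r ?subrr ?expr0n//; apply/andP; split;
      by near: n; exact: nbhs_infty_ger.
  - by move=> n x; rewrite boxE; case: ifP => _;
      rewrite ?mul1r ?subrr ?expr0n/= ?normr0 ?mul0r ?subr0 ?sqr_ge0// ger0_norm ?sqr_ge0.
rewrite -(sqrtr0 R) -(Int0 lam2).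
exact: (cvg_comp _ _ h (@sqrt_continuous R _)).
Unshelve. all: end_near. Qed.

(** Outside a large square [f] is small in L2, uniformly after averaging. Its restriction to the
    square is integrable, and averaging an integrable function costs only the L2 norm of the kernel,
    which decays by [N2_sg_bound]. *)
Lemma sg_cvg f : L2 lam2 f -> (fun n => N2 lam2 (cv (sg n) f)) @ \oo --> (0 : R).
Proof.
move=> Lf; apply/cvgrPdist_le => e e0.
have /cvgrPdist_le/(_ (e / 2)) := cvg_truncate Lf.
have e20 : 0 < e / 2 by rewrite divr_gt0.
move=> /(_ e20)[k _ /(_ k (leqnn k))] /=; rewrite sub0r normrN ger0_norm ?N2_ge0// => hk.
have L1k := (L2_Lloc Lf).2 k%:R.
have L2k : L2 lam2 (fun x => box k%:R x * f x).
  by apply: (L2_bd (C := 1)) => //; [exact: meas_box|move=> x; exact: box_le1].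
have [C C0 hC] := N2_sg_bound.
set I := Int lam2 (fun x => `|box k%:R x * f x|).
have I0 : 0 <= I by exact: Int_ge0.
near=> n; rewrite sub0r normrN ger0_norm ?N2_ge0//.
have -> : cv (sg n) f = (fun x => cv (sg n) (fun x => f x - box k%:R x * f x) x + cv (sg n) (fun x => box k%:R x * f x) x).
  rewrite (cvB (ker_sg n)); [|exact: L2_Lloc..].
  by apply/funext => x; rewrite subrK.
have Ld := L2B Lf L2k.
have [h1 h2] := N2_cv_sg n Ld.
have [h3 h4] := cv_L1L2 (ker_sg n) L1k.
apply: (le_trans (N2D h1 h3)); rewrite [leRHS](splitr e); apply: lerD; first exact: le_trans hk.
apply: (le_trans h4); apply: (@le_trans _ _ (C * I * n.+1%:R^-1)).
  by rewrite mulrAC ler_wpM2r.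
rewrite ler_pdivrMr// -ler_pdivrMl//.
apply: (@le_trans _ _ n%:R); last by rewrite ler_nat.
by near: n; exact: nbhs_infty_ger.
Unshelve. all: end_near. Qed.

End mollifiers.

(** * Weak derivatives *)

Section weak_derivatives.
Context {R : realType}.
Notation RM := (measurableTypeR R).
Notation e_ i := (basis_vector i : R * R).
Implicit Types f g F G : PL R -> R.

(* [f' = partial_i f] in the sense of distributions, tested against mollifiers only. *)
Definition wd (i : 'I_2) f f' : Prop :=
  forall n (x : PL R), cv (pd i (rh n)) f x = - cv (rh n) f' x.

Lemma cvg_sub0 (u : nat -> R) (l : R) : (fun n => u n - l) @ \oo --> (0 : R) -> u @ \oo --> l.
Proof.
move=> h; apply/cvgrPdist_le => e e0; move/cvgrPdist_le : h => /(_ e e0).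
by apply: filterS => n; rewrite sub0r normrN distrC.
Qed.

Lemma seq_cvg_eq (u v : nat -> R) (a b : R) : u =1 v -> u @ \oo --> a -> v @ \oo --> b -> a = b.
Proof. by move=> /funext -> c1 c2; exact: (cvg_unique _ c1 c2). Qed.

Lemma wd_C1 i f f' n : Lloc f -> wd i f f' -> C1 i (cv (rh n) f) (cv (rh n) f').
Proof.
move=> Lf h; have := C1_cv (ker_rh n) (ker_pd_rh n i) (sker_C1 i (sker_rh n)) Lf.
by congr C1; apply/funext => x; rewrite h opprK.
Qed.

Lemma C1_shift i F F' (z : PL R) : C1 i F F' -> C1 i (fun x => F (x + z)) (fun x => F' (x + z)).
Proof.
move=> CF x; have [h1 h2] := CF (x + z).
have E (G : PL R -> R) : (fun s : R => G (x + s *: e_ i + z)) = (fun s : R => G (x + z + s *: e_ i)).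
  by apply/funext => s; rewrite addrAC.
split; last by rewrite (E F').
by move=> s; rewrite (E F) addrAC; exact: h1.
Qed.

Lemma IBP_ker i L F F' x : sker L -> C1 i F F' -> Lloc F -> Lloc F' ->
  cv (pd i L) F x = - cv L F' x.
Proof.
move=> sL CF LF LF'; have CL := C1_shift (- x) (sker_C1 i sL).
have kL := sker_ker sL; have kpL := sker_ker (sker_pd i sL).
rewrite !cvE -[RHS]opprK; apply/eqP; rewrite -eqr_oppLR opprK; apply/eqP/esym.
rewrite (IBP CL CF) ?opprK//.
- exact: (cv_L1 x kL LF).
- exact: (cv_L1 x kpL LF).
- exact: (cv_L1 x kL LF').
Qed.

Lemma C1_wd i F F' : C1 i F F' -> Lloc F -> Lloc F' -> wd i F F'.
Proof. by move=> CF LF LF' n x; rewrite (IBP_ker _ (sker_rh n) CF). Qed.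

Lemma cv_cvg (L : PL R -> R) (f_ : nat -> PL R -> R) f x : ker L -> L2 lam2 f -> (forall n, L2 lam2 (f_ n)) ->
  (fun n => N2 lam2 (fun x => f_ n x - f x)) @ \oo --> (0 : R) ->
  (fun n => cv L (f_ n) x) @ \oo --> cv L f x.
Proof.
move=> kL Lf Lfn cf.
apply: cvg_sub0; apply: (@norm_cvg0 _ R); apply: (@cvg0_le _ _ (fun n => N2 lam2 L * N2 lam2 (fun x => f_ n x - f x))).
    move=> n; rewrite normr_ge0 /=.
    rewrite (_ : cv L (f_ n) x - cv L f x = cv L (fun x => f_ n x - f x) x).
      by apply: cv_bd => //; exact: L2B.
    by rewrite cvB//; exact: L2_Lloc.
  by rewrite -[X in _ --> X](mulr0 (N2 lam2 L)); apply: cvgM => //; exact: cvg_cst.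
Qed.

(** Testing with mollifiers determines the derivative against every smooth kernel: the mollified
    function has the mollified derivative in the classical sense, and both sides pass to the limit
    in L2. *)
Lemma wd_ker i L f f' x : sker L -> L2 lam2 f -> L2 lam2 f' -> wd i f f' ->
  cv (pd i L) f x = - cv L f' x.
Proof.
move=> sL Lf Lf' h; have kL := sker_ker sL; have kpL := sker_ker (sker_pd i sL).
have c1 := cv_cvg (x := x) kpL Lf (fun n => (N2_cv_rh n Lf).1) (rh_cvg Lf).
have c2 := cv_cvg (x := x) kL Lf' (fun n => (N2_cv_rh n Lf').1) (rh_cvg Lf').
have E n : cv (pd i L) (cv (rh n) f) x = - cv L (cv (rh n) f') x.
  apply: IBP_ker => //; first exact: wd_C1 (L2_Lloc Lf) h.
  - exact: L2_Lloc (N2_cv_rh n Lf).1.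
  - exact: L2_Lloc (N2_cv_rh n Lf').1.
exact: (seq_cvg_eq E c1 (cvgN c2)).
Qed.

Lemma wdB i f f' g g' : Lloc f -> Lloc f' -> Lloc g -> Lloc g' -> wd i f f' -> wd i g g' ->
  wd i (fun x => f x - g x) (fun x => f' x - g' x).
Proof.
move=> ? ? ? ? h1 h2 n x; rewrite (cvB (ker_pd_rh n i))// (cvB (ker_rh n))//.
by rewrite h1 h2 opprB addrC opprK.
Qed.

Lemma N2_cvg (f_ : nat -> PL R -> R) f : L2 lam2 f -> (forall n, L2 lam2 (f_ n)) ->
  (fun n => N2 lam2 (fun x => f_ n x - f x)) @ \oo --> (0 : R) ->
  (fun n => N2 lam2 (f_ n)) @ \oo --> N2 lam2 f.
Proof.
move=> Lf Lfn cf.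
apply: cvg_sub0; apply: (@norm_cvg0 _ R); apply: cvg0_le cf => n; rewrite normr_ge0/=; exact: N2_tri.
Qed.

Lemma L1_cvgM (f_ g_ : nat -> PL R -> R) f g : L2 lam2 f -> L2 lam2 g ->
  (forall n, L2 lam2 (f_ n)) -> (forall n, L2 lam2 (g_ n)) ->
  (fun n => N2 lam2 (fun x => f_ n x - f x)) @ \oo --> (0 : R) ->
  (fun n => N2 lam2 (fun x => g_ n x - g x)) @ \oo --> (0 : R) ->
  (fun n => Int lam2 (fun x => `|f_ n x * g_ n x - f x * g x|)) @ \oo --> (0 : R).
Proof.
move=> Lf Lg Lfn Lgn cf cg.
have cgn := N2_cvg Lg Lgn cg.
apply: (@cvg0_le _ _ (fun n => N2 lam2 (fun x => f_ n x - f x) * N2 lam2 (g_ n) +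
  N2 lam2 f * N2 lam2 (fun x => g_ n x - g x))); last first.
  rewrite [X in _ --> X](_ : _ = 0 * N2 lam2 g + N2 lam2 f * 0); last by rewrite mul0r mulr0 addr0.
  by apply: cvgD; apply: cvgM => //; exact: cvg_cst.
move=> n; have d1 := L2B (Lfn n) Lf; have d2 := L2B (Lgn n) Lg.
rewrite Int_ge0//=.
apply: le_trans (lerD (CS d1 (Lgn n)) (CS Lf d2)).
rewrite -IntD; [|exact: L1_abs (L2M _ _)..].
apply: le_Int; [apply: L1_abs; apply: L1B; exact: L2M|by apply: L1D; apply: L1_abs; exact: L2M|].
move=> x; apply: le_trans (ler_normD _ _).
by rewrite le_eqVlt; apply/orP; left; apply/eqP; congr `|_|; ring.
Qed.

Lemma cv_cvg1 (L : PL R -> R) (f_ : nat -> PL R -> R) f x : ker L -> L1 lam2 f -> (forall n, L1 lam2 (f_ n)) ->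
  (fun n => Int lam2 (fun x => `|f_ n x - f x|)) @ \oo --> (0 : R) ->
  (fun n => cv L (f_ n) x) @ \oo --> cv L f x.
Proof.
move=> kL Lf Lfn cf; have [_ [C [_ _ hC _ _]]] := ker_bd kL.
apply: cvg_sub0; apply: (@norm_cvg0 _ R); apply: (@cvg0_le _ _ (fun n => C * Int lam2 (fun x => `|f_ n x - f x|))).
    move=> n; rewrite normr_ge0 /=.
    rewrite (_ : cv L (f_ n) x - cv L f x = cv L (fun x => f_ n x - f x) x).
      by apply: cv_bd1 => //; exact: L1B.
    by rewrite cvB//; exact: L1_Lloc.
  by rewrite -[X in _ --> X](mulr0 C); apply: cvgM => //; exact: cvg_cst.
Qed.

(** Classical product rule for the mollified factors. Their products converge in L1, which is enough
    against a bounded kernel. *)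
Lemma wd_prod i L f f' g g' x : sker L -> L2 lam2 f -> L2 lam2 f' -> L2 lam2 g -> L2 lam2 g' ->
  wd i f f' -> wd i g g' ->
  cv (pd i L) (fun x => f x * g x) x = - cv L (fun x => f' x * g x + f x * g' x) x.
Proof.
move=> sL Lf Lf' Lg Lg' hf hg; have kL := sker_ker sL; have kpL := sker_ker (sker_pd i sL).
have rL (h : PL R -> R) (Lh : L2 lam2 h) n := (N2_cv_rh n Lh).1.
have c1 := cv_cvg1 (x := x) kpL (L2M Lf Lg) (fun n => L2M (rL _ Lf n) (rL _ Lg n))
  (L1_cvgM Lf Lg (rL _ Lf) (rL _ Lg) (rh_cvg Lf) (rh_cvg Lg)).
have c2 := cv_cvg1 (x := x) kL (L2M Lf' Lg) (fun n => L2M (rL _ Lf' n) (rL _ Lg n))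
  (L1_cvgM Lf' Lg (rL _ Lf') (rL _ Lg) (rh_cvg Lf') (rh_cvg Lg)).
have c3 := cv_cvg1 (x := x) kL (L2M Lf Lg') (fun n => L2M (rL _ Lf n) (rL _ Lg' n))
  (L1_cvgM Lf Lg' (rL _ Lf) (rL _ Lg') (rh_cvg Lf) (rh_cvg Lg')).
have E n : cv (pd i L) (fun x => cv (rh n) f x * cv (rh n) g x) x =
    - (cv L (fun x => cv (rh n) f' x * cv (rh n) g x) x + cv L (fun x => cv (rh n) f x * cv (rh n) g' x) x).
  rewrite (IBP_ker _ sL (C1M (wd_C1 n (L2_Lloc Lf) hf) (wd_C1 n (L2_Lloc Lg) hg))).
  - by rewrite cvD//; apply: L1_Lloc; apply: L2M; exact: rL.
  - by apply: L1_Lloc; apply: L2M; exact: rL.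
  - by apply: L1_Lloc; apply: L1D; apply: L2M; exact: rL.
rewrite (seq_cvg_eq E c1 (cvgN (cvgD c2 c3))).
by rewrite cvD//; apply: L1_Lloc; exact: L2M.
Qed.

End weak_derivatives.

(** * The anisotropic product estimate *)

Section lines.
Context {R : realType}.
Notation RM := (measurableTypeR R).
Notation e_ i := (basis_vector i : R * R).
Implicit Types f g F G K : PL R -> R.

Lemma line0E (a b s : R) : (a, b) + s *: e_ 0 = (a + s, b) :> PL R.
Proof. by rewrite paddE /= /GRing.scale/= mulr1 mulr0 addr0. Qed.

Lemma line1E (a b s : R) : (a, b) + s *: e_ 1 = (a, b + s) :> PL R.
Proof. by rewrite paddE /= /GRing.scale/= mulr1 mulr0 addr0. Qed.

Lemma L1_seg_cont (l : R) (g : R -> R) : continuous g -> L1 lam (fun s => seg l s * g s).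
Proof.
move=> cg.
have : compact (g @` `[0, l]%classic).
  by apply: continuous_compact; [exact: continuous_subspaceT|exact: segment_compact].
move=> /compact_bounded[M [_ hM]].
apply: (L1_le _ (L1Z (M + 1) (L1_seg l))).
  apply: measurable_funM; first exact: meas_seg.
  exact: continuous_measurable_fun.
move=> s; rewrite normrM mulrC (ger0_norm (seg_ge0 _ _)) /seg.
case: ifPn => [hs|_]; last by rewrite !mulr0.
rewrite !mulr1; apply: hM; first by rewrite ltrDl.
by exists s => //=; rewrite in_itv/=.
Qed.

(** Integrating the derivative of (s - l) g (s + t) over a segment of length l bounds l |g t| by the
    integral of |g| plus l times that of |g'|; dividing by a large l removes the first term. *)
Lemma abs_le_Int_derive (g g' : R -> R) (t : R) : (forall s : R, is_derive s 1 g (g' s)) ->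
  continuous g' -> L1 lam (g : RM -> R) -> L1 lam (g' : RM -> R) ->
  `|g t| <= Int lam (fun s : RM => `|g' s|).
Proof.
move=> dg cg' Lg Lg'; have cg := is_derive_cont dg.
set I := Int lam (fun s : RM => `|g s|); set J := Int lam (fun s : RM => `|g' s|).
have I0 : 0 <= I by exact: Int_ge0.
have h l : 0 < l -> l * `|g t| <= I + l * J.
  move=> l0.
  have dsh (s : R) : is_derive s 1 (fun s : R => s + t) 1.
    have h := is_deriveD (is_derive_id s 1) (is_derive_cst t s 1); refine (is_derive_eq h _).
    by rewrite addr0.
  have dG (s : R) : is_derive s 1 (fun s => (s - l) * g (s + t)) (g (s + t) + (s - l) * g' (s + t)).
    have d1 : is_derive s 1 (fun s : R => s - l) 1.
      have h := is_deriveB (is_derive_id s 1) (is_derive_cst l s 1); refine (is_derive_eq h _).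
      by rewrite subr0.
    have d2 : is_derive s 1 (fun s => g (s + t)) (g' (s + t)).
      have dgs : is_derive ((fun s : R => s + t) s) 1 g (g' (s + t)) := dg (s + t).
      refine (is_derive_eq (@is_derive1_comp _ g (fun s : R => s + t) _ _ _ dgs (dsh s)) _).
      by rewrite mulr1.
    refine (is_derive_eq (is_deriveM d1 d2) _).
    by rewrite /GRing.scale/= mulr1 addrC.
  have csh : continuous (fun s : R => s + t) := is_derive_cont dsh.
  have cgs : continuous (fun s : R => g (s + t)).
    by move=> s; apply: continuous_comp; [exact: csh|exact: cg].
  have cg's : continuous (fun s : R => g' (s + t)).
    by move=> s; apply: continuous_comp; [exact: csh|exact: cg'].
  have csl : continuous (fun s : R => s - l).
    by move=> s; apply: cvgB; [exact: cvg_id|exact: cvg_cst].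
  have cG : continuous (fun s => g (s + t) + (s - l) * g' (s + t)).
    by move=> s; apply: cvgD; [exact: cgs|apply: cvgM; [exact: csl|exact: cg's]].
  have := FTC_seg l0 dG cG; rewrite subrr mul0r !add0r mulNr opprK => E.
  rewrite -(ger0_norm (ltW l0)) -normrM -E (ger0_norm (ltW l0)).
  have Lgs := L1_abs (L1_shift1 t Lg); have Lg's := L1_abs (L1_shift1 t Lg').
  rewrite /I /J -(Int_shift1 t (mabs (L1_meas Lg)) (fun=> normr_ge0 _)).
  rewrite -(Int_shift1 t (mabs (L1_meas Lg')) (fun=> normr_ge0 _)).
  rewrite -IntZ// -IntD//; last exact: L1Z.
  apply: abs_Int_le; [exact: L1_seg_cont|by apply: L1D => //; exact: L1Z|].
  move=> s; rewrite normrM (ger0_norm (seg_ge0 _ _)) /seg.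
  case: ifPn => [/andP[s0 sl]|_]; last by rewrite mul0r addr_ge0 ?mulr_ge0 ?(ltW l0).
  rewrite mul1r (le_trans (ler_normD _ _))// lerD2l normrM ler_wpM2r//.
  by rewrite ler_norml; apply/andP; split; lra.
rewrite leNgt; apply/negP => H.
have d0 : 0 < `|g t| - J by rewrite subr_gt0.
(* This length makes l (|g t| - J) equal to I + 1, against the bound I. *)
have l0 : 0 < (I + 1) / (`|g t| - J) by rewrite divr_gt0// ltr_wpDl.
have := h _ l0.
rewrite -subr_ge0 => h1.
have : 0 <= I - (I + 1) / (`|g t| - J) * (`|g t| - J) by move: h1; set y := _ / _ => h1; nra.
rewrite mulfVK ?gt_eqF//; lra.
Qed.

(** Square integrability is asked on every line and not on almost every one, because it feeds
    pointwise bounds by integrals over lines; mollified functions have this property. *)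
Definition reg F : Prop := L2 lam2 F /\ forall i (x : PL R),
  L2 lam (fun s : RM => F (x + s *: e_ i)) /\ continuous (fun s : R => F (x + s *: e_ i)).

Lemma crdB_line i (y x : PL R) (s : R) : crd i (y - (x + s *: e_ i)) = crd i (y - x) - s.
Proof.
move: y x => [y1 y2] [x1 x2]; rewrite !psubE paddE /crd /basis_vector.
by case: (i == 0); rewrite /= /GRing.scale/= mulr1 opprD addrA.
Qed.

Lemma box_coord (A : R) i x : box A x <= box1 A (crd i x).
Proof.
rewrite boxE /box1 /crd; case: ifPn => [/andP[h1 h2]|_]; first by case: (i == 0); rewrite ?h1 ?h2.
by case: (i == 0); case: ifP.
Qed.

(** As the point moves along a line, a fixed y lies in the support of the kernel only for parameters
    in an interval of length 2 A. Weighted Cauchy-Schwarz and Tonelli then bound the squared norm on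
    the line by a multiple of the squared norm of [f] in the plane. *)
Lemma reg_cv K f : sker K -> L2 lam2 f -> reg (cv K f).
Proof.
move=> sK Lf; have kK := sker_ker sK; have mf := Lf.1.
split; first exact: (cv_L2 kK Lf).1.
move=> i x; split; last first.
  have := C1_cv kK (sker_ker (sker_pd i sK)) (sker_C1 i sK) (L2_Lloc Lf).
  by move=> /(_ x)[d _]; exact: is_derive_cont d.
have [A [C [A0 C0 _ _ hC]]] := ker_bd kK.
have mK := kK.1.
have ml : measurable_fun setT (fun p : RM * PL R => p.2 - (x + p.1 *: e_ i)).
  by apply: m2B; [exact: measurable_snd|apply: meas_line => //; exact: measurable_fst].
pose I := Int lam2 (fun y => `|K y|).
pose G := fun (s : RM) (y : PL R) => `|K (y - (x + s *: e_ i))| * f y ^+ 2.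
have mG : measurable_fun setT (fun p : RM * PL R => G p.1 p.2).
  apply: measurable_funM; first by apply: mabs; exact: (mcomp mK ml).
  by apply: measurable_funX; exact: (mcomp mf measurable_snd).
have G0 s y : 0 <= G s y by rewrite mulr_ge0 ?sqr_ge0.
have hb (y : PL R) (s : RM) : `|K (y - (x + s *: e_ i))| <= C * box1 A (s - crd i (y - x)).
  apply: (le_trans (hC _)); apply: ler_wpM2l => //; apply: (le_trans (box_coord A i _)).
  by rewrite crdB_line /box1 distrC.
have Lb (y : PL R) : L1 lam (fun s : RM => C * box1 A (s - crd i (y - x))).
  by apply: L1Z; apply: (L1_shift1 (- crd i (y - x))); exact: L1_box1.
have mKs (y : PL R) : measurable_fun setT (fun s : RM => K (y - (x + s *: e_ i))).
  by apply: (mcomp mK); apply: m2B => //; apply: meas_line.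
have LK (y : PL R) : L1 lam (fun s : RM => `|K (y - (x + s *: e_ i))|).
  by apply: (L1_le _ (Lb y)) => [|s]; [exact: mabs|rewrite normr_id].
have IK (y : PL R) : Int lam (fun s : RM => `|K (y - (x + s *: e_ i))|) <= C * (2 * A).
  apply: (@le_trans _ _ (Int lam (fun s : RM => C * box1 A (s - crd i (y - x))))).
    by apply: le_Int.
  rewrite IntZ; last by apply: (L1_shift1 (- crd i (y - x))); exact: L1_box1.
  rewrite (Int_shift1 (- crd i (y - x)) (meas_box1 A)) ?Int_box1// => t.
  by rewrite /box1; case: ifP.
have [LG hG] := @tonelli_le _ _ _ _ R lam lam2 G (fun y => C * (2 * A) * f y ^+ 2) mG G0
  (fun y => L1Zr _ (LK y)) (L1Z _ Lf.2)
  (fun y => eq_rect_r (fun t => t <= _) (ler_wpM2r (sqr_ge0 (f y)) (IK y)) (IntZr (f y ^+ 2) (LK y))).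
have mc : measurable_fun setT (fun s : RM => cv K f (x + s *: e_ i)).
  by apply: (mcomp (meas_cv mK mf)); apply: meas_line.
split=> //; apply: (L1_le _ (L1Z I LG)); first exact: measurable_funX.
move=> s; rewrite ger0_norm ?sqr_ge0// !cvE.
have LKz : L1 lam2 (fun y : PL R => K (y - (x + s *: e_ i))) by exact: (L1_shift (- (x + s *: e_ i)) (ker_L1 kK)).
have LKf : L1 lam2 (fun y : PL R => `|K (y - (x + s *: e_ i))| * f y ^+ 2).
  by apply: (cv_L1 _ (ker_abs kK)); exact: L1_Lloc Lf.2.
have [_] := CS_weight LKz mf LKf.
by rewrite (Int_shift (- (x + s *: e_ i)) (mabs mK)).
Qed.

Lemma line_average i (k : RM -> R) (F : PL R -> R) (l C : R) : measurable_fun setT k -> 0 <= C ->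
  (forall s, `|k s| <= C * seg l s) -> L2 lam2 F ->
  (forall (x : PL R), continuous (fun s : R => F (x + s *: e_ i))) ->
  L2 lam2 (fun x : PL R => Int lam (fun s : RM => k s * F (x + s *: e_ i))) /\
  N2 lam2 (fun x : PL R => Int lam (fun s : RM => k s * F (x + s *: e_ i))) <=
    Int lam (fun s => `|k s|) * N2 lam2 F.
Proof.
move=> mk C0 hk LF cF.
have Lk : L1 lam k by apply: (L1_le mk (L1Z C (L1_seg l))).
apply: (@N2_average _ _ _ _ R lam2 lam k (fun (x : PL R) (s : RM) => F (x + s *: e_ i))) => //.
- by apply: (mcomp LF.1); apply: meas_line; [exact: measurable_fst|exact: measurable_snd].
- by move=> s; exact: (L2_shift (s *: e_ i) LF).
- by move=> s _; rewrite (N2_shift (s *: e_ i) LF.1).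
- exact: N2_ge0.
- move=> x; have c2 : continuous (fun s : R => F (x + s *: e_ i) ^+ 2).
    by move=> s; apply: cvgM; exact: cF.
  apply: (L1_le _ (L1Z C (L1_seg_cont l c2))).
    by apply: measurable_funM; [exact: mabs|exact: continuous_measurable_fun].
  move=> s; rewrite normrM normr_id (ger0_norm (sqr_ge0 _)) mulrA ler_wpM2r ?sqr_ge0//.
Qed.

Lemma dtr_opp f (z : PL R) : measurable_fun setT f -> dtr f (- z) = dtr f z.
Proof.
move=> mf; have mz : measurable_fun setT (fun x : PL R => f (x + z) - f x).
  by apply: measurable_funB => //; exact: meas_shift.
rewrite /dtr -(N2_shift (- z) mz) -N2N; congr N2; apply/funext => x.
by rewrite subrK opprB.
Qed.

(** An increment along an axis is the integral of translates of the derivative over the segment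
    travelled. *)
Lemma dtr_C1 i F F' (h : R) : C1 i F F' -> L2 lam2 F -> L2 lam2 F' ->
  dtr F (h *: e_ i) <= `|h| * N2 lam2 F'.
Proof.
move=> CF LF LF'.
have main (h' : R) : 0 < h' -> dtr F (h' *: e_ i) <= h' * N2 lam2 F'.
  move=> h0; have sb (s : RM) : `|seg h' s| <= 1 * seg h' s by rewrite ger0_norm ?seg_ge0// mul1r.
  have [_] := line_average (i := i) (meas_seg h') ler01 sb LF' (fun x => (CF x).2).
  rewrite (eq_Int _ (g := seg h')); last by move=> s; rewrite ger0_norm// seg_ge0.
  rewrite Int_seg//; apply: le_trans; rewrite le_eqVlt; apply/orP; left; apply/eqP.
  rewrite /dtr; congr N2; apply/funext => x.
  by have [d c] := CF x; rewrite (FTC_seg h0 d c) scale0r addr0.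
have [h0|h0|->] := ltgtP h 0.
- rewrite ltr0_norm// -(opprK h) scaleNr dtr_opp; last exact: LF.1.
  by rewrite opprK; apply: main; rewrite oppr_gt0.
- by rewrite gtr0_norm//; exact: main.
- rewrite normr0 mul0r scale0r /dtr.
  by under eq_fun do rewrite addr0 subrr; rewrite N2_0.
Qed.

Lemma dtr_wd i f f' (h : R) : L2 lam2 f -> L2 lam2 f' -> wd i f f' ->
  dtr f (h *: e_ i) <= `|h| * N2 lam2 f'.
Proof.
move=> Lf Lf' w; pose F n := cv (rh n) f; pose F' n := cv (rh n) f'.
have LF n : L2 lam2 (F n) := (N2_cv_rh n Lf).1.
have b n : dtr (F n) (h *: e_ i) <= `|h| * N2 lam2 f'.
  apply: le_trans (dtr_C1 h (wd_C1 n (L2_Lloc Lf) w) (LF n) (N2_cv_rh n Lf').1) _.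
  by rewrite ler_wpM2l//; exact: (N2_cv_rh n Lf').2.
have c : (fun n => dtr (F n) (h *: e_ i)) @ \oo --> dtr f (h *: e_ i).
  apply: N2_cvg; [exact: L2_dtr|by move=> n; exact: L2_dtr|].
  apply: (@cvg0_le _ _ (fun n => 2 * N2 lam2 (fun x => F n x - f x))); last first.
    by rewrite -[X in _ --> X](mulr0 2); apply: cvgM; [exact: cvg_cst|exact: rh_cvg].
  move=> n; rewrite N2_ge0/=; apply: le_trans (dtr_le (h *: e_ i) (L2B (LF n) Lf)).
  rewrite le_eqVlt; apply/orP; left; apply/eqP; congr N2; apply/funext => x.
  by move: (F n _) (F n x) (f _) (f x) => a b0 c d; ring.
apply: (@closed_cvg _ _ \oo _ (fun n => dtr (F n) (h *: e_ i)) [set t | t <= `|h| * N2 lam2 f']) c.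
- exact: closed_le.
- by near=> n; exact: b.
Unshelve. all: end_near. Qed.

(** By the one-dimensional bound on rows, F^2 is dominated by a function [A] of the second
    coordinate alone; on columns, G^2 is dominated by a function [B] of the first alone. The
    integral of the product of [A] and [B] over the plane splits into a product of two integrals. *)
Lemma aniso_reg F F' G G' : C1 0 F F' -> C1 1 G G' -> reg F -> reg F' -> reg G -> reg G' ->
  L2 lam2 (fun x => F x * G x) /\ N2 lam2 (fun x => F x * G x) ^+ 2 <=
    4 * (N2 lam2 F * N2 lam2 F') * (N2 lam2 G * N2 lam2 G').
Proof.
move=> CF CG [LF rF] [LF' rF'] [LG rG] [LG' rG'].
pose A (b : RM) := Int lam (fun a : RM => `|2 * (F (a, b) * F' (a, b))|).
pose B (a : RM) := Int lam (fun b : RM => `|2 * (G (a, b) * G' (a, b))|).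
have [LA IA] := Int2_21 (L1_abs (L1Z 2 (L2M LF LF'))).
have [LB IB] := Int2_12 (L1_abs (L1Z 2 (L2M LG LG'))).
have hA (a b : R) : F (a, b) ^+ 2 <= A b.
  have [d c] := CF (0, b).
  have [l1 c1] := rF 0 (0, b); have [l2 c2] := rF' 0 (0, b).
  have E (H : PL R -> R) : (fun s : R => H ((0, b) + s *: e_ 0)) = (fun s : R => H (s, b)).
    by apply/funext => s; rewrite line0E add0r.
  have E' (s : R) : (0, b) + s *: e_ 0 = (s, b) :> PL R by rewrite line0E add0r.
  move: l1 l2 c1 c2 d c; rewrite !E => l1 l2 c1 c2 d c.
  have := @abs_le_Int_derive (fun s => F (s, b) * F (s, b)) (fun s => 2 * (F (s, b) * F' (s, b))) a _ _ l1.2 _.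
  rewrite -expr2 ger0_norm ?sqr_ge0//; apply.
  - move=> s; have ds := d s; rewrite E' in ds; refine (is_derive_eq (is_deriveM ds ds) _).
    by rewrite /GRing.scale/=; ring.
  - by move=> s; apply: cvgM; [exact: cvg_cst|apply: cvgM; [exact: c1|exact: c2]].
  - by apply: L1Z; exact: L2M.
have hB (a b : R) : G (a, b) ^+ 2 <= B a.
  have [d c] := CG (a, 0).
  have [l1 c1] := rG 1 (a, 0); have [l2 c2] := rG' 1 (a, 0).
  have E (H : PL R -> R) : (fun s : R => H ((a, 0) + s *: e_ 1)) = (fun s : R => H (a, s)).
    by apply/funext => s; rewrite line1E add0r.
  have E' (s : R) : (a, 0) + s *: e_ 1 = (a, s) :> PL R by rewrite line1E add0r.
  move: l1 l2 c1 c2 d c; rewrite !E => l1 l2 c1 c2 d c.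
  have := @abs_le_Int_derive (fun s => G (a, s) * G (a, s)) (fun s => 2 * (G (a, s) * G' (a, s))) b _ _ l1.2 _.
  rewrite -expr2 ger0_norm ?sqr_ge0//; apply.
  - move=> s; have ds := d s; rewrite E' in ds; refine (is_derive_eq (is_deriveM ds ds) _).
    by rewrite /GRing.scale/=; ring.
  - by move=> s; apply: cvgM; [exact: cvg_cst|apply: cvgM; [exact: c1|exact: c2]].
  - by apply: L1Z; exact: L2M.
have A0 b : 0 <= A b by exact: Int_ge0.
have B0 a : 0 <= B a by exact: Int_ge0.
have LAB : L1 lam2 (fun x : PL R => A x.2 * B x.1).
  apply: (prodL1 (m1 := lam) (m2 := lam) (F := fun a b => A b * B a)).
  - by apply: measurable_funM; [exact: (mcomp (L1_meas LA) measurable_snd)|exact: (mcomp (L1_meas LB) measurable_fst)].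
  - by move=> a; exact: L1Zr.
  - rewrite (_ : (fun x => _) = (fun x => Int lam A * B x)); first exact: L1Z.
    apply/funext => x; rewrite -IntZr//; apply: eq_Int => y.
    by rewrite ger0_norm// mulr_ge0.
have mFG : measurable_fun setT (fun x : PL R => F x * G x).
  by apply: measurable_funM; [exact: LF.1|exact: LG.1].
have pw (x : PL R) : (F x * G x) ^+ 2 <= A x.2 * B x.1.
  by case: x => a b; rewrite exprMn ler_pM ?sqr_ge0.
have LFG : L2 lam2 (fun x => F x * G x).
  split=> //; apply: (L1_le _ LAB); first exact: measurable_funX.
  by move=> x; rewrite ger0_norm ?sqr_ge0.
split=> //; rewrite N2sq; apply: (@le_trans _ _ (Int lam2 (fun x : PL R => A x.2 * B x.1))).
  by apply: le_Int => //; exact: LFG.2.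
have -> : Int lam2 (fun x : PL R => A x.2 * B x.1) = Int lam A * Int lam B.
  rewrite -(Int2_12 LAB).2 -IntZ//; apply: eq_Int => a /=.
  by rewrite IntZr.
rewrite /A /B IA IB.
have e (f g : PL R -> R) : L2 lam2 f -> L2 lam2 g ->
    0 <= Int lam2 (fun x => `|2 * (f x * g x)|) <= 2 * (N2 lam2 f * N2 lam2 g).
  move=> Lf Lg; rewrite Int_ge0//=.
  rewrite (eq_Int _ (g := fun x => 2 * `|f x * g x|)); last by move=> x; rewrite normrM ger0_norm.
  rewrite IntZ; last by apply: L1_abs; exact: L2M.
  by rewrite ler_wpM2l//; exact: CS.
have /andP[a1 a2] := e _ _ LF LF'; have /andP[b1 b2] := e _ _ LG LG'.
apply: (@le_trans _ _ ((2 * (N2 lam2 F * N2 lam2 F')) * (2 * (N2 lam2 G * N2 lam2 G')))).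
  exact: ler_pM.
by rewrite le_eqVlt; apply/orP; left; apply/eqP; ring.
Qed.

(** The regular case applied to mollifications; the products converge in L1 and lower semicontinuity
    of the L2 norm preserves the bound. *)
Lemma aniso f f' g g' : L2 lam2 f -> L2 lam2 f' -> L2 lam2 g -> L2 lam2 g' ->
  wd 0 f f' -> wd 1 g g' ->
  L2 lam2 (fun x => f x * g x) /\ N2 lam2 (fun x => f x * g x) ^+ 2 <=
    4 * (N2 lam2 f * N2 lam2 f') * (N2 lam2 g * N2 lam2 g').
Proof.
move=> Lf Lf' Lg Lg' wf wg.
set M := (X in _ /\ _ <= X).
have M0 : 0 <= M by rewrite !mulr_ge0 ?N2_ge0.
have rr h n : L2 lam2 h -> reg (cv (rh n) h) by move=> Lh; apply: reg_cv => //; exact: sker_rh.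
have H n := aniso_reg (wd_C1 n (L2_Lloc Lf) wf) (wd_C1 n (L2_Lloc Lg) wg)
  (rr _ n Lf) (rr _ n Lf') (rr _ n Lg) (rr _ n Lg').
have rL (h : PL R -> R) (Lh : L2 lam2 h) n := (N2_cv_rh n Lh).1.
have Hb n : N2 lam2 (fun x => cv (rh n) f x * cv (rh n) g x) <= Num.sqrt M.
  rewrite -(@ler_pXn2r _ 2)// ?nnegrE ?N2_ge0 ?sqrtr_ge0// (sqr_sqrtr M0).
  have [_ Hn] := H n; apply: (le_trans Hn); rewrite /M.
  have c (h : PL R -> R) (Lh : L2 lam2 h) := (N2_cv_rh n Lh).2.
  apply: ler_pM; rewrite ?mulr_ge0 ?N2_ge0//.
    by rewrite ler_wpM2l//; apply: ler_pM; rewrite ?N2_ge0//; exact: c.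
  by apply: ler_pM; rewrite ?N2_ge0//; exact: c.
have [L h] : L2 lam2 (fun x => f x * g x) /\ N2 lam2 (fun x => f x * g x) <= Num.sqrt M.
  apply: (L2_lsc (f_ := fun n x => cv (rh n) f x * cv (rh n) g x)).
  - by move=> n; exact: (H n).1.
  - exact: Hb.
  - exact: L2M.
  - by move=> n; apply: L2M; exact: rL.
  - by apply: L1_cvgM => //; try (exact: rh_cvg); exact: rL.
split=> //; rewrite -(sqr_sqrtr M0) lerXn2r ?nnegrE ?N2_ge0 ?sqrtr_ge0//.
Qed.

End lines.

(** * Kernels of the pressure *)

(* [KK n] is the field [x / |x|^2] truncated to the scales between [1/n] and [n]; it is a
   gradient, and its divergence is [mm n]. *)
HB.lock Definition KK (R : realType) (n : nat) (i : 'I_2) (x : R * R) : R :=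
  mass^-1 * kk (n.+1%:R ^+ 2) (n.+1%:R^-1 ^+ 2) i x.

Section kernel_estimates.
Context {R : realType}.
Notation KK := (@KK R).
Notation RM := (measurableTypeR R).
Notation e_ i := (basis_vector i : R * R).
Implicit Types f g F G K : PL R -> R.
Local Opaque N2 rh sg.

Lemma KKE n i : KK n i = fun x : R * R => mass^-1 * kk (n.+1%:R ^+ 2) (n.+1%:R^-1 ^+ 2) i x.
Proof. by apply/funext => x; rewrite KK.unlock. Qed.

(* Subtracting the mollifier [sg n] at the large scale [n] makes the mean of [rh n] vanish, so
   that the result is the divergence of a field of compact support. *)
Definition mm (n : nat) (x : R * R) : R := rh n x - sg n x.

Lemma sker_KK n i : sker (KK n i).
Proof.
rewrite KKE; apply: skerZ; apply: sker_kk; first by rewrite invr_gt0.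
by apply: (@le_trans _ _ 1); rewrite ?invf_le1 ?ler1n ?ltr0n.
Qed.

Lemma sker_mm n : sker (mm n).
Proof. by apply: skerB; [exact: sker_rh|exact: sker_sg]. Qed.

Lemma ker_mm n : ker (mm n : PL R -> R). Proof. exact: sker_ker (sker_mm n). Qed.

Lemma ker_pd K i : sker K -> ker (pd i K : PL R -> R).
Proof. by move=> sK; apply: sker_ker; exact: sker_pd. Qed.

Lemma sker_pdKK n i j : sker (pd j (KK n i)). Proof. by apply: sker_pd; exact: sker_KK. Qed.

Lemma ker_pdKK n i j : ker (pd j (KK n i) : PL R -> R). Proof. exact: sker_ker (sker_pdKK n i j). Qed.

Lemma Sm_kk (a b : R) i : Sm (kk a b i).
Proof. by apply: Sm_sub; exact: Sm_hker. Qed.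

Lemma pd_KK n i j : pd j (KK n i) = fun x => mass^-1 * pd j (kk (n.+1%:R ^+ 2) (n.+1%:R^-1 ^+ 2) i) x.
Proof. by rewrite !pdE KKE DvZ//; exact: Sm_kk. Qed.

Lemma KK_sym n i j : pd j (KK n i) = pd i (KK n j).
Proof. by rewrite !pd_KK kk_sym. Qed.

Lemma mmE n : mm n = fun x => pd 0 (KK n 0) x + pd 1 (KK n 1) x.
Proof.
Transparent rh sg.
apply/funext => x; rewrite /mm /rh /sg !molE -mulrBr -div_kk big_ord_recl big_ord1 mulrDr !pd_KK.
by congr (_ + _ * pd _ (kk _ _ _) _); apply/val_inj.
Opaque rh sg.
Qed.

Lemma mm_even n x : mm n (- x) = mm n x.
Proof. Transparent rh sg. by rewrite /mm /rh /sg !mol_even. Opaque rh sg. Qed.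

Lemma cv_mm n f : Lloc f -> cv (mm n) f = fun x => cv (rh n) f x - cv (sg n) f x.
Proof.
move=> Lf; have kN : ker (fun x : PL R => -1 * sg n x) by apply: kerZ; exact: ker_sg.
have -> : mm n = (fun x : PL R => rh n x + -1 * sg n x).
  by apply/funext => x; rewrite /mm mulN1r.
rewrite (cvDl (ker_rh n) kN Lf); apply/funext => x.
by rewrite (cvZl _ (ker_sg n) Lf) mulN1r.
Qed.

Local Opaque mm.

Lemma N2_cv_mm n f : L2 lam2 f -> L2 lam2 (cv (mm n) f) /\ N2 lam2 (cv (mm n) f) <= 2 * N2 lam2 f.
Proof.
move=> Lf; split; first exact: (cv_L2 (ker_mm n) Lf).1.
rewrite cv_mm; last exact: L2_Lloc.
have [h1 h2] := N2_cv_rh n Lf; have [h3 h4] := N2_cv_sg n Lf.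
have h5 := N2B h1 h3; apply: (le_trans h5).
have -> : 2 * N2 lam2 f = N2 lam2 f + N2 lam2 f by rewrite mulr_natl.
exact: (lerD h2 h4).
Qed.

Lemma mm_cvg f : L2 lam2 f -> (fun n => N2 lam2 (fun x => cv (mm n) f x - f x)) @ \oo --> (0 : R).
Proof.
move=> Lf.
apply: (@cvg0_le _ _ (fun n => N2 lam2 (fun x => cv (rh n) f x - f x) + N2 lam2 (cv (sg n) f))); last first.
  by rewrite -[X in _ --> X](addr0 0); apply: cvgD; [exact: rh_cvg|exact: sg_cvg].
move=> n; rewrite N2_ge0/= cv_mm; last exact: L2_Lloc.
have [h1 _] := N2_cv_rh n Lf; have [h3 _] := N2_cv_sg n Lf.
apply: le_trans (N2B (L2B h1 Lf) h3); rewrite le_eqVlt; apply/orP; left; apply/eqP; congr N2.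
by apply/funext => x; rewrite addrAC.
Qed.

Lemma C1_cv_sker i K f : sker K -> Lloc f -> C1 i (cv K f) (fun x => - cv (pd i K) f x).
Proof.
by move=> sK Lf; apply: C1_cv => //; [exact: sker_ker|exact: ker_pd|exact: sker_C1].
Qed.

Lemma ler_of_sqr (a b : R) : 0 <= a -> 0 <= b -> a ^+ 2 <= b ^+ 2 -> a <= b.
Proof. by move=> a0 b0; rewrite ler_pXn2r. Qed.

(** Two integrations by parts exchange the directions i and j; the symmetry of the Jacobian of
    [KK n] turns one of the mixed entries into the other. *)
Lemma KK_cross n i j f : L2 lam2 f ->
  Int lam2 (fun x => cv (pd j (KK n i)) f x ^+ 2) =
  Int lam2 (fun x => cv (pd i (KK n i)) f x * cv (pd j (KK n j)) f x).
Proof.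
move=> Lf; have Ll := L2_Lloc Lf.
have LK k : L2 lam2 (cv (KK n k) f) by exact: (cv_L2 (sker_ker (sker_KK n k)) Lf).1.
have Lp k l : L2 lam2 (cv (pd k (KK n l)) f) by exact: (cv_L2 (ker_pdKK n l k) Lf).1.
have Lpp k l m : L2 lam2 (cv (pd m (pd k (KK n l))) f).
  by apply: (cv_L2 _ Lf).1; apply: ker_pd; exact: sker_pdKK.
have C k := C1_cv_sker k (sker_KK n i) Ll.
have Cj := C1_cv_sker j (sker_pdKK n j i) Ll.
have Ci := C1_cv_sker i (sker_pdKK n j j) Ll.
have e1 := IBP (C j) Cj (L2M (LK i) (Lp i j)) (L2M (L2N (Lp j i)) (Lp i j)) (L2M (LK i) (L2N (Lpp i j j))).
have e2 := IBP (C i) Ci (L2M (LK i) (Lp j j)) (L2M (L2N (Lp i i)) (Lp j j)) (L2M (LK i) (L2N (Lpp j j i))).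
rewrite (pdC i j (sker_KK n j)) e1 in e2; move/oppr_inj : e2 => e2.
move: e2; rewrite (KK_sym n j i) => e2.
have e3 : Int lam2 (fun x => - cv (pd j (KK n i)) f x * cv (pd j (KK n i)) f x) =
    - Int lam2 (fun x => cv (pd j (KK n i)) f x ^+ 2).
  by rewrite -IntN; [apply: eq_Int => x; rewrite mulNr expr2|exact: (Lp j i).2].
have e4 : Int lam2 (fun x => - cv (pd i (KK n i)) f x * cv (pd j (KK n j)) f x) =
    - Int lam2 (fun x => cv (pd i (KK n i)) f x * cv (pd j (KK n j)) f x).
  by rewrite -IntN; [apply: eq_Int => x; rewrite mulNr|exact: L2M].
exact: oppr_inj (etrans (esym e3) (etrans e2 e4)).
Qed.

(** The squared norms of the four entries of the Jacobian add up to the squared norm of the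
    divergence, which is [cv (mm n) f]. This is the L2 bound for second derivatives of an inverse
    Laplacian, obtained without Fourier transform. *)
Lemma KK_bound n i j f : L2 lam2 f ->
  L2 lam2 (cv (pd j (KK n i)) f) /\ N2 lam2 (cv (pd j (KK n i)) f) <= 2 * N2 lam2 f.
Proof.
move=> Lf; have Ll := L2_Lloc Lf.
have Lp k l : L2 lam2 (cv (pd k (KK n l)) f) by exact: (cv_L2 (ker_pdKK n l k) Lf).1.
split=> //; apply: le_trans (N2_cv_mm n Lf).2.
apply: ler_of_sqr; [exact: N2_ge0|exact: N2_ge0|].
rewrite [leLHS]N2sq [leRHS]N2sq.
have [a aE] : exists a : 'I_2 -> 'I_2 -> R,
    forall k l, Int lam2 (fun x => cv (pd l (KK n k)) f x ^+ 2) = a k l by eexists.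
have a0 k l : 0 <= a k l by rewrite -aE; apply: Int_ge0 => x; exact: sqr_ge0.
have -> : Int lam2 (fun x => cv (mm n) f x ^+ 2) = a 0 0 + 2 * a 0 1 + a 1 1.
  have h0 := etrans (esym (aE 0 0)) (KK_cross n 0 0 Lf).
  have h1 := etrans (esym (aE 0 1)) (KK_cross n 0 1 Lf).
  have h2 := etrans (esym (aE 1 1)) (KK_cross n 1 1 Lf).
  rewrite h0 h1 h2.
  have L (c d e g : 'I_2) : L1 lam2 (fun x => cv (pd c (KK n d)) f x * cv (pd e (KK n g)) f x) by exact: L2M.
  have e1 := IntZ 2 (L 0 0 1 1); rewrite -e1.
  have e2 := IntD (L 0 0 0 0) (L1Z 2 (L 0 0 1 1)); rewrite -e2.
  have e3 := IntD (L1D (L 0 0 0 0) (L1Z 2 (L 0 0 1 1))) (L 1 1 1 1); rewrite -e3.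
  rewrite mmE; have e4 := (cvDl (ker_pdKK n 0 0) (ker_pdKK n 1 1) Ll); rewrite e4.
  apply: eq_Int => x; move: (cv (pd 0 (KK n 0)) f x) (cv (pd 1 (KK n 1)) f x) => p q.
  ring.
have a01 : a 1 0 = a 0 1 by rewrite -!aE (KK_sym n 1 0).
rewrite aE.
have := a0 0 0; have := a0 0 1; have := a0 1 1.
have [h1|h1] : i = 0 \/ i = 1 by move: i => [[|[|//]] hi]; [left|right]; exact/val_inj.
- have [h2|h2] : j = 0 \/ j = 1 by move: j => [[|[|//]] hj]; [left|right]; exact/val_inj.
  + by rewrite h1 h2; lra.
  + by rewrite h1 h2; lra.
- have [h2|h2] : j = 0 \/ j = 1 by move: j => [[|[|//]] hj]; [left|right]; exact/val_inj.
  + by rewrite h1 h2 a01; lra.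
  + by rewrite h1 h2; lra.
Qed.

Lemma cv_translate K f (z x : PL R) : measurable_fun setT K -> measurable_fun setT f ->
  cv K (fun y => f (y + z)) x = cv K f (x + z).
Proof.
move=> mK mf; rewrite !cv_shiftE//; last exact: meas_shift.
by apply: eq_Int => y; rewrite addrAC.
Qed.

(** Fubini's theorem: correlations commute with averages along a line because they commute with
    translations. *)
Lemma cv_line_average i K f (k : RM -> R) x : ker K -> L1 lam k -> L1 lam2 f ->
  (forall y : PL R, L1 lam (fun s : RM => k s * f (y + s *: e_ i))) ->
  cv K (fun y => Int lam (fun s : RM => k s * f (y + s *: e_ i))) x =
  Int lam (fun s : RM => k s * cv K f (x + s *: e_ i)).
Proof.
move=> kK Lk Lf Ls; have mf := L1_meas Lf; have mK := kK.1.
have [_ [C [_ C0 hC _ _]]] := ker_bd kK.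
have ml : measurable_fun setT (fun p : PL R * RM => p.1 + p.2 *: e_ i).
  by apply: meas_line; [exact: measurable_fst|exact: measurable_snd].
have Lsh (s : RM) : L1 lam2 (fun y : PL R => f (y + s *: e_ i)) := L1_shift (s *: e_ i) Lf.
pose F (y : PL R) (s : RM) : R := K (y - x) * (k s * f (y + s *: e_ i)).
have mF : measurable_fun setT (fun p : PL R * RM => F p.1 p.2).
  apply: measurable_funM; first exact: (mcomp (meas_ker_sub x mK) measurable_fst).
  apply: measurable_funM; first exact: (mcomp (L1_meas Lk) measurable_snd).
  exact: (mcomp mf ml).
have FE (s : RM) : F^~ s = (fun y : PL R => k s * (K (y - x) * f (y + s *: e_ i))).
  by apply/funext => y; rewrite /F; ring.
have LFs (s : RM) : L1 lam2 (F^~ s).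
  by rewrite FE; apply: L1Z; apply: (cv_L1 x kK); exact: L1_Lloc.
have LF : L1 (lam2 \x lam)%E (fun p : PL R * RM => F p.1 p.2).
  apply: (prodL1r mF LFs).
  apply: (L1_le _ (L1Z (C * Int lam2 (fun y => `|f y|)) (L1_abs Lk))).
    apply: (meas_Int lam2 (F := fun (s : RM) (y : PL R) => `|F y s|)).
    by apply: mabs; apply: (mcomp mF (g := fun p => (p.2, p.1))); exact: measurable_fun_pair.
  move=> s; rewrite ger0_norm; last exact: Int_ge0.
  rewrite -(Int_shift (s *: e_ i) (mabs mf)) -IntZ; last by apply: L1_abs; exact: Lsh.
  rewrite -IntZr; last by apply: L1Z; apply: L1_abs; exact: Lsh.
  apply: le_Int; [by apply: L1_abs|by apply: L1Zr; apply: L1Z; apply: L1_abs; exact: Lsh|].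
  move=> y; rewrite /F !normrM mulrCA [leRHS]mulrC ler_wpM2l// ler_wpM2r//.
have := fubE LF.
have <- : cv K (fun y => Int lam (fun s : RM => k s * f (y + s *: e_ i))) x = Int lam2 (fun y => Int lam (F y)).
  by rewrite cvE; apply: eq_Int => y; rewrite /F IntZ.
move=> ->; apply: eq_Int => s; rewrite FE IntZ; last by apply: (cv_L1 x kK); exact: L1_Lloc.
rewrite -cvE; by congr (_ * _); have := cv_translate (s *: e_ i) x mK mf.
Qed.

(** Integrate the derivative of (s - l) F (x + s e_i) over the segment. A point value is thereby
    expressed by averages of the function and of its derivative. *)
Lemma C1_average i F F' (l : R) (x : PL R) : 0 < l -> C1 i F F' ->
  (forall y : PL R, continuous (fun s : R => F (y + s *: e_ i))) ->
  l * F x = Int lam (fun s : RM => seg l s * F (x + s *: e_ i)) +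
    Int lam (fun s : RM => seg l s * (s - l) * F' (x + s *: e_ i)).
Proof.
move=> l0 CF cF; have [d c] := CF x.
have dG (s : R) : is_derive s 1 (fun s => (s - l) * F (x + s *: e_ i))
    (F (x + s *: e_ i) + (s - l) * F' (x + s *: e_ i)).
  have d1 : is_derive s 1 (fun s : R => s - l) 1.
    have h := is_deriveB (is_derive_id s 1) (is_derive_cst l s 1); refine (is_derive_eq h _).
    by rewrite subr0.
  refine (is_derive_eq (is_deriveM d1 (d s)) _).
  by rewrite /GRing.scale/= mulr1 addrC.
have csl : continuous (fun s : R => s - l).
  by move=> s; apply: cvgB; [exact: cvg_id|exact: cvg_cst].
have c2 : continuous (fun s : R => (s - l) * F' (x + s *: e_ i)).
  by move=> s; apply: cvgM; [exact: csl|exact: c].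
have cG : continuous (fun s : R => F (x + s *: e_ i) + (s - l) * F' (x + s *: e_ i)).
  by move=> s; apply: cvgD; [exact: cF|exact: c2].
have := FTC_seg l0 dG cG; rewrite subrr mul0r !add0r mulNr opprK scale0r addr0 => <-.
rewrite -IntD; [|exact: L1_seg_cont|].
  by apply: eq_Int => s; rewrite mulrDr mulrA.
by have := L1_seg_cont l c2; under eq_fun do rewrite mulrA.
Qed.

Lemma sq_le_line i F F' (x : PL R) (t : R) : C1 i F F' -> reg F -> reg F' ->
  F (x + t *: e_ i) ^+ 2 <= Int lam (fun s : RM => `|2 * (F (x + s *: e_ i) * F' (x + s *: e_ i))|).
Proof.
move=> CF [LF rF] [LF' rF'].
have [d c] := CF x; have [l1 c1] := rF i x; have [l2 c2] := rF' i x.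
have := @abs_le_Int_derive R (fun s => F (x + s *: e_ i) * F (x + s *: e_ i))
  (fun s => 2 * (F (x + s *: e_ i) * F' (x + s *: e_ i))) t _ _ l1.2 _.
rewrite -expr2 ger0_norm ?sqr_ge0//; apply.
- move=> s; refine (is_derive_eq (is_deriveM (d s) (d s)) _).
  by rewrite /GRing.scale/=; ring.
- by move=> s; apply: cvgM; [exact: cvg_cst|apply: cvgM; [exact: c1|exact: c2]].
- by apply: L1Z; exact: L2M.
Qed.

Lemma KK_sq_arith (N p r l M M' : R) : 0 <= M -> M = l * M' -> 0 <= p -> 0 <= r ->
  p ^+ 2 <= 2 * (M * M') * (l * M ^+ 2) ->
  r ^+ 2 <= 2 * (M * M') * (4 * l ^+ 2) * (l * M' ^+ 2) ->
  l * N <= 2 * p + 2 * r -> l * N <= l * (10 * (M * M')).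
Proof.
move=> M0 lE p0 r0 hp hr h.
have m0 : 0 <= M ^+ 4 by rewrite exprn_ge0.
have m2 : 0 <= M ^+ 2 by rewrite exprn_ge0.
have {}hp : p <= 2 * M ^+ 2.
  apply: ler_of_sqr => //; first by rewrite mulr_ge0.
  have -> : (2 * M ^+ 2) ^+ 2 = 4 * M ^+ 4 by ring.
  apply: (le_trans hp); have -> : 2 * (M * M') * (l * M ^+ 2) = 2 * M ^+ 4 by rewrite lE; ring.
  by apply: ler_wpM2r => //; rewrite ler_nat.
have {}hr : r <= 3 * M ^+ 2.
  apply: ler_of_sqr => //; first by rewrite mulr_ge0.
  have -> : (3 * M ^+ 2) ^+ 2 = 9 * M ^+ 4 by ring.
  apply: (le_trans hr); have -> : 2 * (M * M') * (4 * l ^+ 2) * (l * M' ^+ 2) = 8 * M ^+ 4 by rewrite lE; ring.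
  by apply: ler_wpM2r => //; rewrite ler_nat.
have -> : l * (10 * (M * M')) = 10 * M ^+ 2 by rewrite lE; ring.
lra.
Qed.

Section square.
Variables (u u' : PL R -> R) (M M' : R).
Hypotheses (Cu : C1 0 u u') (ru : reg u) (ru' : reg u').
Hypotheses (M0 : 0 < M) (M'0 : 0 < M') (hM : N2 lam2 u <= M) (hM' : N2 lam2 u' <= M').

(** Each value of u^2 on the column is bounded by the integral of |2 u u'| over its row; integrating
    over the rows leaves an integral over the plane, the same for all columns. *)
Lemma column_sq (x : PL R) : Int lam (fun s : RM => u (x + s *: e_ 1) ^+ 2) <= 2 * (M * M').
Proof.
have [Lu hu] := ru; have [Lu' hu'] := ru'.
have LA := L1_abs (L1Z 2 (L2M Lu Lu')).
have [LB IB] := Int2_21 LA.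
pose B (b : RM) := Int lam (fun a : RM => `|2 * (u (a, b) * u' (a, b))|).
case: x => a b.
apply: (@le_trans _ _ (Int lam (fun s : RM => B (s + b)))).
  apply: le_Int; [exact: (hu 1 (a, b)).1.2|exact: (L1_shift1 b LB)|].
  move=> s; have := sq_le_line (0, b + s) a Cu ru ru'.
  rewrite line0E add0r line1E => h; apply: (le_trans h).
  rewrite /B addrC le_eqVlt; apply/orP; left; apply/eqP; apply: eq_Int => t.
  by rewrite line0E add0r.
rewrite (Int_shift1 b (L1_meas LB)); last by move=> t; exact: Int_ge0.
rewrite /B IB (eq_Int _ (g := fun x => 2 * `|u x * u' x|)); last by move=> y; rewrite normrM ger0_norm.
rewrite IntZ; last by apply: L1_abs; exact: L2M.
rewrite ler_wpM2l//; apply: (le_trans (CS Lu Lu')).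
by apply: ler_pM; rewrite ?N2_ge0.
Qed.

Lemma seg_average_L1 (l : R) (v : PL R -> R) : 0 < l -> reg v ->
  L1 lam2 (fun x : PL R => Int lam (fun s : RM => seg l s * v (x + s *: e_ 1) ^+ 2)) /\
  Int lam2 (fun x : PL R => Int lam (fun s : RM => seg l s * v (x + s *: e_ 1) ^+ 2)) <= l * N2 lam2 v ^+ 2.
Proof.
move=> l0 [Lv hv]; rewrite N2sq -[in l * _](Int_seg l0) -IntZr; last exact: L1_seg.
apply: (@tonelli_le _ _ _ _ R lam2 lam (fun (x : PL R) (s : RM) => seg l s * v (x + s *: e_ 1) ^+ 2)).
- apply: measurable_funM; first exact: (mcomp (meas_seg l) measurable_snd).
  apply: measurable_funX; apply: (mcomp Lv.1).
  by apply: meas_line; [exact: measurable_fst|exact: measurable_snd].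
- by move=> x s; rewrite mulr_ge0 ?seg_ge0 ?sqr_ge0.
- by move=> s; apply: L1Z; exact: (L2_shift (s *: e_ 1) Lv).2.
- by apply: L1Zr; exact: L1_seg.
- move=> s; rewrite IntZ; last exact: (L2_shift (s *: e_ 1) Lv).2.
  by rewrite (Int_shift (s *: e_ 1) (L1_meas Lv.2)).
Qed.

Let f (x : PL R) := u x * u x.
Let f' (x : PL R) := 2 * (u x * u' x).

(** The vertical averages of u^2 are integrable, and bounded by [column_sq]; hence they lie in L2,
    which is not known of u^2 itself. *)
Lemma seg_average_sq (l : R) : 0 < l ->
  let V := fun x : PL R => Int lam (fun s : RM => seg l s * f (x + s *: e_ 1)) in
  L2 lam2 V /\ N2 lam2 V ^+ 2 <= 2 * (M * M') * (l * M ^+ 2).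
Proof.
move=> l0 V; have [Lu hu] := ru.
have [LV IV] : L1 lam2 V /\ Int lam2 V <= l * N2 lam2 u ^+ 2.
  have := seg_average_L1 l0 ru; rewrite /V /f.
  by under [X in L1 _ X]eq_fun do under eq_Int do rewrite expr2.
have V0 x : 0 <= V x by apply: Int_ge0 => s; rewrite mulr_ge0 ?seg_ge0// /f -expr2 sqr_ge0.
have hV x : V x <= 2 * (M * M').
  apply: le_trans (column_sq x); apply: le_Int0.
  - apply: measurable_funM; first exact: meas_seg.
    by have := L1_meas (hu 1 x).1.2.
  - exact: (hu 1 x).1.2.
  - move=> s; rewrite mulr_ge0 ?seg_ge0 -?expr2 ?sqr_ge0//= -[leRHS]mul1r.
    by rewrite /f -expr2 ler_wpM2r ?sqr_ge0// /seg; case: ifP.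
have LV2 : L2 lam2 V.
  by apply: (L2_of_bdL1 (C := 2 * (M * M'))) => // x; rewrite ger0_norm.
split=> //; rewrite N2sq.
apply: (@le_trans _ _ (Int lam2 (fun x => 2 * (M * M') * V x))).
  by apply: le_Int; [exact: LV2.2|exact: L1Z|move=> x; rewrite expr2 ler_wpM2r].
rewrite IntZ//; apply: ler_wpM2l; first by rewrite !mulr_ge0// ltW.
apply: (le_trans IV); rewrite ler_wpM2l ?(ltW l0)//.
by rewrite lerXn2r ?nnegrE ?N2_ge0 ?(ltW M0).
Qed.

(** Cauchy-Schwarz on the vertical segment separates [u], controlled by [column_sq], from [u'],
    whose squares are summed by Tonelli's theorem. *)
Lemma seg_average_dsq (l : R) : 0 < l ->
  let W := fun x : PL R => Int lam (fun s : RM => seg l s * (s - l) * f' (x + s *: e_ 1)) in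
  L2 lam2 W /\ N2 lam2 W ^+ 2 <= 2 * (M * M') * (4 * l ^+ 2) * (l * M' ^+ 2).
Proof.
move=> l0 W; have [Lu hu] := ru; have [Lu' hu'] := ru'.
have [LV IV] := seg_average_L1 l0 ru'.
set V := (fun x : PL R => Int _ _) in LV IV.
pose c := 2 * (M * M') * (4 * l ^+ 2).
have c0 : 0 <= c by rewrite !mulr_ge0 ?(ltW M0) ?(ltW M'0) ?exprn_ge0 ?(ltW l0).
have hW x : W x ^+ 2 <= c * V x.
  pose g1 (s : RM) := u (x + s *: e_ 1).
  pose g2 (s : RM) := seg l s * (2 * (s - l)) * u' (x + s *: e_ 1).
  have Lg1 : L2 lam g1 := (hu 1 x).1.
  have mk : measurable_fun setT (fun s : RM => seg l s * (2 * (s - l))).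
    apply: measurable_funM; first exact: meas_seg.
    by apply: measurable_funM => //; exact: measurable_funB.
  have bk (s : RM) : `|seg l s * (2 * (s - l))| <= 2 * l * seg l s.
    rewrite /seg; case: ifPn => [/andP[s0 sl]|_]; last by rewrite mul0r mulr0 normr0.
    by rewrite mul1r mulr1 normrM ger0_norm// ler_wpM2l// ler_norml; apply/andP; split; lra.
  have bk1 (s : RM) : `|seg l s * (2 * (s - l))| <= 2 * l.
    apply: (le_trans (bk s)); rewrite -[leRHS]mulr1 ler_wpM2l ?mulr_ge0 ?(ltW l0)//.
    by rewrite /seg; case: ifP.
  have Lg2 : L2 lam g2 by apply: (L2_bd mk bk1); exact: (hu' 1 x).1.
  have cu : continuous (fun s : R => u' (x + s *: e_ 1) ^+ 2).
    by move=> s; apply: cvgM; exact: (hu' 1 x).2.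
  have E : W x = Int lam (fun s => g1 s * g2 s).
    by apply: eq_Int => s; rewrite /f' /g1 /g2; ring.
  have h := CSr Lg1 Lg2; rewrite -E in h.
  have h1 : N2 lam g1 ^+ 2 <= 2 * (M * M') by rewrite N2sq; exact: column_sq.
  have LS : L1 lam (fun s : RM => seg l s * u' (x + s *: e_ 1) ^+ 2) by exact: L1_seg_cont.
  have h2 : N2 lam g2 ^+ 2 <= 4 * l ^+ 2 * V x.
    rewrite N2sq /V -IntZ//; apply: le_Int; [exact: Lg2.2|exact: L1Z|].
    move=> s; rewrite /g2 exprMn [leRHS]mulrA; apply: ler_wpM2r; first exact: sqr_ge0.
    rewrite /seg; case: ifPn => [/andP[s0 sl]|_]; last by rewrite mul0r mulr0 expr0n.
    by rewrite mul1r mulr1; nra.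
  rewrite -real_normK ?num_real//.
  apply: (@le_trans _ _ ((N2 lam g1 * N2 lam g2) ^+ 2)).
    by rewrite lerXn2r ?nnegrE ?mulr_ge0 ?N2_ge0.
  by rewrite exprMn /c -mulrA ler_pM ?sqr_ge0.
have mW : measurable_fun setT W.
  apply: (meas_Int lam (F := fun (x : PL R) (s : RM) => seg l s * (s - l) * f' (x + s *: e_ 1))).
  have ml : measurable_fun setT (fun p : PL R * RM => p.1 + p.2 *: e_ 1).
    by apply: meas_line; [exact: measurable_fst|exact: measurable_snd].
  apply: measurable_funM.
    apply: measurable_funM; first exact: (mcomp (meas_seg l) measurable_snd).
    by apply: measurable_funB => //; exact: measurable_snd.
  apply: measurable_funM => //.
  by apply: measurable_funM; [exact: (mcomp Lu.1 ml)|exact: (mcomp Lu'.1 ml)].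
have LW : L2 lam2 W.
  split=> //; apply: (L1_le _ (L1Z c LV)); first exact: measurable_funX.
  by move=> x; rewrite ger0_norm ?sqr_ge0.
split=> //; rewrite N2sq; apply: (@le_trans _ _ (Int lam2 (fun x => c * V x))).
  by apply: le_Int => //; [exact: LW.2|exact: L1Z].
rewrite IntZ//; apply: ler_wpM2l => //; apply: (le_trans IV).
by rewrite ler_wpM2l ?(ltW l0)// lerXn2r ?nnegrE ?N2_ge0 ?(ltW M'0).
Qed.

Lemma C1_sq : C1 0 f f'.
Proof.
have h := C1M Cu Cu; have -> // : f' = (fun x => u' x * u x + u x * u' x).
by apply/funext => x; rewrite /f'; ring.
Qed.

Lemma L1_sq : L1 lam2 f /\ L1 lam2 f'.
Proof. by split; [exact: L2M ru.1 ru.1|apply: L1Z; exact: L2M ru.1 ru'.1]. Qed.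

(** [KK_bound] does not apply to f = u^2, which is only known to be integrable. The vertical
    derivative of the transform of [f] by [k] is the transform of [f'] by [q]; hence l times the
    first transform is the transform of the vertical average [V] of [f] plus that of an average [W]
    of [f'], and both averages lie in L2. *)
Lemma KK_sq_reg n : L2 lam2 (cv (pd 0 (KK n 0)) f) /\ N2 lam2 (cv (pd 0 (KK n 0)) f) <= 10 * (M * M').
Proof.
have [Lf Lf'] := L1_sq; have Ll := L1_Lloc Lf; have Ll' := L1_Lloc Lf'.
set k := pd 0 (KK n 0); set q := pd 1 (KK n 0).
have sk : sker k by exact: sker_pdKK.
have sq : sker q by exact: sker_pdKK.
have kk := sker_ker sk; have kq := sker_ker sq.
have L2k : L2 lam2 (cv k f) := (cv_L1L2 kk Lf).1.
split=> //.
(* The length for which the bounds of [V] and [W] have the same order. *)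
pose l := M / M'; have l0 : 0 < l by rewrite divr_gt0.
have [LV hV] := seg_average_sq l0; have [LW hW] := seg_average_dsq l0.
set V := (fun x : PL R => Int _ _) in LV hV.
set W := (fun x : PL R => Int _ _) in LW hW.
have cf (y : PL R) : continuous (fun s : R => f (y + s *: e_ 1)).
  by move=> s; apply: cvgM; exact: (ru.2 1 y).2.
have cf' (y : PL R) : continuous (fun s : R => f' (y + s *: e_ 1)).
  move=> s; apply: cvgM; first exact: cvg_cst.
  by apply: cvgM; [exact: (ru.2 1 y).2|exact: (ru'.2 1 y).2].
have csl : continuous (fun s : R => s - l).
  by move=> s; apply: cvgB; [exact: cvg_id|exact: cvg_cst].
have Lsl : L1 lam (fun s : RM => seg l s * (s - l)) by exact: L1_seg_cont.
(* The vertical derivative falling on the kernel is exchanged with the horizontal one already there,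
   and the latter is moved onto [f]. *)
have H1 : C1 1 (cv k f) (cv q f').
  have := C1_cv_sker 1 sk Ll; congr C1; apply/funext => x.
  have e : pd 1 k = pd 0 q by rewrite /k /q pdC//; exact: sker_KK.
  have e2 := IBP_ker x sq C1_sq Ll Ll'.
  by rewrite e e2 opprK.
have cH (y : PL R) : continuous (fun s : R => cv k f (y + s *: e_ 1)).
  by have [d _] := H1 y; exact: is_derive_cont d.
have E x : l * cv k f x = cv k V x + cv q W x.
  have e1 := C1_average x l0 H1 cH; rewrite e1; congr (_ + _).
  - have := @cv_line_average 1 k f (seg l) x kk (L1_seg l) Lf => -> // y.
    exact: L1_seg_cont.
  - have := @cv_line_average 1 q f' (fun s => seg l s * (s - l)) x kq Lsl Lf' => -> // y.
    have c2 : continuous (fun s : R => (s - l) * f' (y + s *: e_ 1)).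
      by move=> s; apply: cvgM; [exact: csl|exact: cf'].
    by have := L1_seg_cont l c2; under eq_fun do rewrite mulrA.
have [a1 b1] := KK_bound n 0 0 LV; have [a2 b2] := KK_bound n 0 1 LW.
have h : l * N2 lam2 (cv k f) <= 2 * N2 lam2 V + 2 * N2 lam2 W.
  have e3 := N2Z l L2k; rewrite (gtr0_norm l0) in e3; rewrite -e3.
  have e4 : (fun x => l * cv k f x) = (fun x => cv k V x + cv q W x) by apply/funext.
  rewrite e4; have e5 := N2D a1 a2; apply: (le_trans e5); exact: (lerD b1 b2).
have lE : M = l * M' by rewrite /l mulfVK// gt_eqF.
rewrite -(ler_pM2l l0).
exact: (KK_sq_arith (ltW M0) lE (N2_ge0 _ _) (N2_ge0 _ _) hV hW h).
Qed.

End square.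

Lemma KK_sq n u u' M M' : L2 lam2 u -> L2 lam2 u' -> wd 0 u u' ->
  N2 lam2 u <= M -> N2 lam2 u' <= M' ->
  L2 lam2 (cv (pd 0 (KK n 0)) (fun x => u x * u x)) /\
  N2 lam2 (cv (pd 0 (KK n 0)) (fun x => u x * u x)) <= 10 * (M * M').
Proof.
move=> Lu Lu' wu hM hM'; have kk := ker_pdKK n 0 0.
have L := L2M Lu Lu.
have LL : L2 lam2 (cv (pd 0 (KK n 0)) (fun x => u x * u x)) := (cv_L1L2 kk L).1.
split=> //.
(* Both bounds are raised by e because the segment length M / M' asks for positive bounds; e is
   removed at the end. *)
have main (e : R) : 0 < e -> N2 lam2 (cv (pd 0 (KK n 0)) (fun x => u x * u x)) <= 10 * ((M + e) * (M' + e)).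
  move=> e0.
  have Me : 0 < M + e by rewrite ltr_wpDl// (le_trans _ hM)// N2_ge0.
  have Me' : 0 < M' + e by rewrite ltr_wpDl// (le_trans _ hM')// N2_ge0.
  pose um m := cv (rh m) u.
  have Lm m : L2 lam2 (um m) := (N2_cv_rh m Lu).1.
  have Lum m : L1 lam2 (fun x => um m x * um m x) by exact: L2M.
  have hM1 m : N2 lam2 (um m) <= M + e.
    by apply: (le_trans (N2_cv_rh m Lu).2); apply: (le_trans hM); rewrite lerDl ltW.
  have hM2 m : N2 lam2 (cv (rh m) u') <= M' + e.
    by apply: (le_trans (N2_cv_rh m Lu').2); apply: (le_trans hM'); rewrite lerDl ltW.
  have H m := KK_sq_reg (wd_C1 m (L2_Lloc Lu) wu) (reg_cv (sker_rh m) Lu)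
    (reg_cv (sker_rh m) Lu') Me Me' (hM1 m) (hM2 m) n.
  have Hc := L1_cvgM Lu Lu Lm Lm (rh_cvg Lu) (rh_cvg Lu).
  apply: (L2_lsc (f_ := fun m => cv (pd 0 (KK n 0)) (fun x => um m x * um m x)) _ _ _ _ _).2.
  - by move=> m; exact: (H m).1.
  - by move=> m; exact: (H m).2.
  - exact: (cv_L1L1 kk L).1.
  - by move=> m; exact: (cv_L1L1 kk (Lum m)).1.
  - apply: (@cvg0_le _ _ (fun m => Int lam2 (fun z => `|pd 0 (KK n 0) z|) * Int lam2 (fun x => `|um m x * um m x - u x * u x|))); last first.
      by rewrite -[X in _ --> X](mulr0 (Int lam2 (fun z => `|pd 0 (KK n 0) z|))); apply: cvgM => //; exact: cvg_cst.
    move=> m; apply/andP; split; first exact: Int_ge0.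
    have := (cv_L1L1 kk (L1B (Lum m) L)).2.
    by rewrite (cvB kk (L1_Lloc (Lum m)) (L1_Lloc L)).
have M00 : 0 <= M by apply: le_trans hM; exact: N2_ge0.
have M0' : 0 <= M' by apply: le_trans hM'; exact: N2_ge0.
move: main; move: (N2 lam2 (cv _ _)) => X main.
rewrite leNgt; apply/negP => hX.
pose d := X - 10 * (M * M'); have d0 : 0 < d by rewrite subr_gt0.
pose e := Num.min 1 (d / (10 * (M + M' + 2))).
have s0 : 0 < 10 * (M + M' + 2) by lra.
have e0 : 0 < e by rewrite lt_min ltr01 divr_gt0.
have e1 : e <= 1 by rewrite ge_min lexx.
have e2 : e * (10 * (M + M' + 2)) <= d by rewrite -ler_pdivlMr// ge_min lexx orbT.
have := main e e0; have -> : X = d + 10 * (M * M') by rewrite /d subrK.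
nra.
Qed.

End kernel_estimates.

(** * The transport commutator *)

Section commutator.
Context {R : realType}.
Notation RM := (measurableTypeR R).
Notation e_ i := (basis_vector i : R * R).
Local Opaque N2 rh sg mm.

Lemma Int_bilinear (k : PL R -> R) (A B : PL R -> PL R -> R) (C : R) (H : PL R -> R) : L1 lam2 k ->
  measurable_fun setT (fun p : PL R * PL R => A p.1 p.2) ->
  measurable_fun setT (fun p : PL R * PL R => B p.1 p.2) ->
  (forall z, L2 lam2 (A^~ z)) -> (forall z, L2 lam2 (B^~ z)) ->
  (forall z, k z != 0 -> N2 lam2 (A^~ z) * N2 lam2 (B^~ z) <= C) ->
  measurable_fun setT H ->
  (forall x, `|H x| <= Int lam2 (fun z => `|k z| * `|A x z * B x z|)) ->
  L1 lam2 H /\ Int lam2 (fun x => `|H x|) <= Int lam2 (fun z => `|k z|) * C.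
Proof.
move=> Lk mA mB LA LB hC mH hH; have mk := L1_meas Lk.
have mF : measurable_fun setT (fun p : PL R * PL R => `|k p.2| * `|A p.1 p.2 * B p.1 p.2|).
  apply: measurable_funM; first by apply: mabs; exact: (mcomp mk measurable_snd).
  by apply: mabs; exact: measurable_funM.
have hb z : Int lam2 (fun x => `|k z| * `|A x z * B x z|) <= `|k z| * C.
  have [k0|k0] := eqVneq (k z) 0.
    have -> : (fun x => `|k z| * `|A x z * B x z|) = (fun=> 0).
      by apply/funext => x; rewrite k0 normr0 mul0r.
    by rewrite k0 normr0 mul0r Int0.
  rewrite IntZ; last by apply: L1_abs; exact: L2M.
  by rewrite ler_wpM2l//; apply: le_trans (hC _ k0); exact: CS.
have LFz z : L1 lam2 (fun x => `|k z| * `|A x z * B x z|).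
  by apply: L1Z; apply: L1_abs; exact: L2M.
have F0 (x z : PL R) : 0 <= `|k z| * `|A x z * B x z| by rewrite mulr_ge0.
have [L h] := @tonelli_le _ _ _ _ R lam2 lam2 (fun x z : PL R => `|k z| * `|A x z * B x z|)
  (fun z : PL R => `|k z| * C) mF F0 LFz (L1Zr _ (L1_abs Lk)) hb.
have LH : L1 lam2 H := L1_le mH L hH.
split=> //; rewrite -IntZr; last exact: L1_abs.
by apply: le_trans h; apply: le_Int => //; exact: L1_abs.
Qed.

Lemma comm_arith (C p q r I1 I2 I3 I4 : R) : 0 <= C -> 0 <= q -> 0 <= r ->
  I1 <= 2 * C * p -> I2 <= p -> I3 <= q -> I4 <= 2 * C * r ->
  I1 + I2 + I3 + I4 <= (2 * C + 1) * (p + q + r).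
Proof.
move=> C0 q0 r0 h1 h2 h3 h4.
have : 0 <= C * q by rewrite mulr_ge0.
move: h1 h4 => h1 h4 h5; rewrite mulrDl !mulrDr mul1r.
have -> : 2 * C * q = 2 * (C * q) by rewrite mulrA.
lra.
Qed.

Lemma cv_pd_mm n i (f : PL R -> R) : Lloc f -> cv (pd i (mm n)) f = fun x => cv (pd i (rh n)) f x - cv (pd i (sg n)) f x.
Proof.
move=> Lf; have kN : ker (fun x : PL R => -1 * pd i (sg n) x) by apply: kerZ; exact: ker_pd_sg.
have -> : pd i (mm n) = (fun x : PL R => pd i (rh n) x + -1 * pd i (sg n) x).
  Transparent mm. rewrite !pdE /mm DvB; [|exact: (sker_rh n).1|exact: (sker_sg n).1]. Opaque mm.
  by apply/funext => x; rewrite mulN1r.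
rewrite (cvDl (ker_pd_rh n i) kN Lf); apply/funext => x.
by rewrite (cvZl _ (ker_pd_sg n i) Lf) mulN1r.
Qed.

Lemma Int_pd_mol : exists2 C : R, 0 <= C & forall (a : R) j, 0 < a ->
  Int lam2 (fun x : PL R => `|pd j (mol a) x|) <= C * a.
Proof.
have [C C0 hC] := @mol_bound R; exists (16 * C) => [|a j a0]; first by rewrite mulr_ge0.
have -> : 16 * C * a = Int lam2 (fun x : PL R => C * a ^+ 3 * box (2 * a^-1) x).
  rewrite IntZ; last exact: L1_box.
  by rewrite Int_box ?mulr_ge0 ?invr_ge0 ?(ltW a0)//; field; rewrite gt_eqF.
apply: le_Int; [by apply: L1_abs; apply: ker_L1; exact: ker_pd_mol|by apply: L1Z; exact: L1_box|].
by move=> x; exact: (hC a x a0).2.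
Qed.

Lemma ker_increment_L1 (k f g : PL R -> R) (a b : R) (x : PL R) : ker k -> L2 lam2 f -> L2 lam2 g ->
  L1 lam2 (fun z => k z * ((f (x + z) - a) * (g (x + z) - b))).
Proof.
move=> kk Lf Lg; have [_ [C [_ _ hC _ _]]] := ker_bd kk.
have Lfg := L1_bd kk.1 hC (L1_shiftl x (L2M Lf Lg)).
have L' (h : PL R -> R) : L2 lam2 h -> L1 lam2 (fun z => k z * h (x + z)).
  by move=> Lh; apply: L2M; [exact: ker_L2|exact: L2_shiftl].
have := L1D (L1B (L1B Lfg (L1Z a (L' _ Lg))) (L1Z b (L' _ Lf))) (L1Zr (a * b) (ker_L1 kk)).
rewrite (_ : (fun z => _) = (fun z => k z * ((f (x + z) - a) * (g (x + z) - b))))//.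
apply/funext => z; move: (k z) (f (x + z)) (g (x + z)) => p q r; ring.
Qed.

Variables (u0 u1 du0 du1 w dw : PL R -> R).
Hypotheses (Lu0 : L2 lam2 u0) (Lu1 : L2 lam2 u1) (Ldu0 : L2 lam2 du0) (Ldu1 : L2 lam2 du1).
Hypotheses (Lw : L2 lam2 w) (Ldw : L2 lam2 dw).
Hypotheses (wu0 : wd 0 u0 du0) (wu1 : wd 0 u1 du1) (wv1 : wd 1 u1 (fun x => - du0 x)) (ww : wd 0 w dw).

(** [K0] and [K1] stand for the two derivatives of one kernel. Up to sign this is the mollification
    of div(u w) minus the transport by [u] of the mollification of [w]. *)
Definition comm (K0 K1 : PL R -> R) (x : PL R) : R :=
  cv K0 (fun y => u0 y * w y) x + cv K1 (fun y => u1 y * w y) x -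
  (u0 x * cv K0 w x + u1 x * cv K1 w x).

Let T1 n (x : PL R) := Int lam2 (fun z : PL R => pd 1 (rh n) z * ((u1 (x + z) - u1 x) * (w (x + z) - w x))).
Let T2 n (x : PL R) := Int lam2 (fun z : PL R => rh n z * (du0 (x + z) * (w (x + z) - w x))).
Let T3 n (x : PL R) := Int lam2 (fun z : PL R => rh n z * ((u0 (x + z) - u0 x) * dw (x + z))).

(** The vertical derivative stays on the kernel and meets a product of increments, as none is known
    for [w]; the horizontal one is moved onto the product [u0 w], whose factors have horizontal
    derivatives in L2. Incompressibility cancels the terms in which [w x] multiplies the mollified
    [du0]. *)
Lemma comm_rhE n x : comm (pd 0 (rh n)) (pd 1 (rh n)) x = T1 n x - T2 n x - T3 n x.
Proof.
have kr := ker_rh (R := R) n; have kp := ker_pd_rh (R := R) n 1.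
have L (k f : PL R -> R) : ker k -> L1 lam2 f -> L1 lam2 (fun z => k z * f (x + z)).
  move=> kk Lf; have [_ [C [_ _ hC _ _]]] := ker_bd kk.
  by apply: (L1_bd kk.1 hC); exact: L1_shiftl.
have L' (k f : PL R -> R) : ker k -> L2 lam2 f -> L1 lam2 (fun z => k z * f (x + z)).
  by move=> kk Lf; apply: L2M; [exact: ker_L2|exact: L2_shiftl].
have E (k f : PL R -> R) : ker k -> measurable_fun setT f -> Int lam2 (fun z => k z * f (x + z)) = cv k f x.
  by move=> kk mf; rewrite cv_shiftE//; exact: kk.1.
have I0 : Int lam2 (pd 1 (@rh R n)) = 0.
  by apply: (Int_C1 (sker_C1 1 (sker_rh n))); exact: ker_L1.
have t1 : T1 n x = cv (pd 1 (rh n)) (fun y => u1 y * w y) x - u1 x * cv (pd 1 (rh n)) w x - w x * cv (rh n) du0 x.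
  have Luw := L2M Lu1 Lw.
  have La := L _ _ kp Luw; have Lb := L1Z (u1 x) (L' _ _ kp Lw).
  have Lc := L1Z (w x) (L' _ _ kp Lu1); have Ld := L1Zr (u1 x * w x) (ker_L1 kp).
  have e : T1 n x = Int lam2 (fun z : PL R => pd 1 (rh n) z * (u1 (x + z) * w (x + z)) -
      u1 x * (pd 1 (rh n) z * w (x + z)) - w x * (pd 1 (rh n) z * u1 (x + z)) + pd 1 (rh n) z * (u1 x * w x)).
    apply: eq_Int => z; move: (pd 1 (rh n) z) (u1 (x + z)) (u1 x) (w (x + z)) (w x) => k a b c d; ring.
  rewrite e (IntD (L1B (L1B La Lb) Lc) Ld) (IntB (L1B La Lb) Lc) (IntB La Lb).
  have -> : Int lam2 (fun z : PL R => pd 1 (rh n) z * (u1 x * w x)) = 0.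
    by rewrite (IntZr _ (ker_L1 kp)) I0 mul0r.
  rewrite addr0 (IntZ _ (L' _ _ kp Lw)) (IntZ _ (L' _ _ kp Lu1)).
  rewrite (E _ _ kp (L1_meas Luw)) (E _ _ kp Lw.1) (E _ _ kp Lu1.1); congr (_ - _ * _).
  have h := wv1 n x; rewrite h.
  by have h2 := cvN kr (L2_Lloc Ldu0); rewrite h2 opprK.
have t2 : T2 n x = cv (rh n) (fun y => du0 y * w y) x - w x * cv (rh n) du0 x.
  have Luw := L2M Ldu0 Lw.
  have La := L _ _ kr Luw; have Lb := L1Z (w x) (L' _ _ kr Ldu0).
  have e : T2 n x = Int lam2 (fun z : PL R => rh n z * (du0 (x + z) * w (x + z)) - w x * (rh n z * du0 (x + z))).
    apply: eq_Int => z; move: (rh n z) (du0 (x + z)) (w (x + z)) (w x) => k a c d; ring.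
  rewrite e (IntB La Lb) (IntZ _ (L' _ _ kr Ldu0)).
  by rewrite (E _ _ kr (L1_meas Luw)) (E _ _ kr Ldu0.1).
have t3 : T3 n x = cv (rh n) (fun y => u0 y * dw y) x - u0 x * cv (rh n) dw x.
  have Luw := L2M Lu0 Ldw.
  have La := L _ _ kr Luw; have Lb := L1Z (u0 x) (L' _ _ kr Ldw).
  have e : T3 n x = Int lam2 (fun z : PL R => rh n z * (u0 (x + z) * dw (x + z)) - u0 x * (rh n z * dw (x + z))).
    apply: eq_Int => z; move: (rh n z) (u0 (x + z)) (dw (x + z)) (u0 x) => k a c d; ring.
  rewrite e (IntB La Lb) (IntZ _ (L' _ _ kr Ldw)).
  by rewrite (E _ _ kr (L1_meas Luw)) (E _ _ kr Ldw.1).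
rewrite t1 t2 t3 /comm.
have h1 := wd_prod x (sker_rh n) Lu0 Ldu0 Lw Ldw wu0 ww.
have h2 : cv (rh n) (fun y => du0 y * w y + u0 y * dw y) x =
    cv (rh n) (fun y => du0 y * w y) x + cv (rh n) (fun y => u0 y * dw y) x.
  by have h := cvD kr (L1_Lloc (L2M Ldu0 Lw)) (L1_Lloc (L2M Lu0 Ldw)); rewrite h.
have h3 := ww n x; rewrite h1 h2 h3.
move: (cv _ _ x) (cv _ _ x) (cv _ _ x) (cv _ _ x) (cv _ _ x) (cv _ _ x) (u0 x) (u1 x) (w x) => a b c d e f g h i.
ring.
Qed.

(** The whole gradient of [u1] is known, its vertical part being minus the horizontal derivative of
    [u0]; so increments of [u1] are of the order of the translation. *)
Lemma dtr_u1 (a : R) (z : PL R) : 0 <= a -> `|z.1| <= a -> `|z.2| <= a ->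
  dtr u1 z <= a * (N2 lam2 du0 + N2 lam2 du1).
Proof.
move=> a0 h1 h2.
have -> : z = z.1 *: e_ 0 + z.2 *: e_ 1.
  by rewrite paddE /basis_vector /= /GRing.scale/= !mulr1 !mulr0 addr0 add0r; case: (z).
have e := dtrD (z.1 *: e_ 0) (z.2 *: e_ 1) Lu1; apply: (le_trans e).
rewrite addrC mulrDr; apply: lerD.
  have h := dtr_wd z.2 Lu1 (L2N Ldu0) wv1; rewrite N2N in h.
  by apply: (le_trans h); rewrite ler_wpM2r ?N2_ge0.
have h := dtr_wd z.1 Lu1 Ldu1 wu1.
by apply: (le_trans h); rewrite ler_wpM2r ?N2_ge0.
Qed.

(** The mass of order n of the differentiated mollifier is compensated by increments of [u1] of
    order 1 / n; the other terms carry an increment of [w] or [u0], and the part with [sg n] is of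
    order 1 / n. The moduli are parameters since the estimate is used twice, with crude bounds for
    domination and with small ones for convergence. *)
Lemma comm_est (C : R) : 0 <= C ->
  (forall (a : R) j, 0 < a -> Int lam2 (fun x : PL R => `|pd j (mol a) x|) <= C * a) ->
  forall n (e1 e2 : R),
  (forall z : PL R, `|z.1| <= 2 * n.+1%:R^-1 -> `|z.2| <= 2 * n.+1%:R^-1 -> dtr w z <= e1 /\ dtr u0 z <= e2) ->
  L1 lam2 (comm (pd 0 (mm n)) (pd 1 (mm n))) /\
  Int lam2 (fun x => `|comm (pd 0 (mm n)) (pd 1 (mm n)) x|) <=
    (2 * C + 1) * ((N2 lam2 du0 + N2 lam2 du1) * e1 + e2 * N2 lam2 dw +
      (N2 lam2 u0 + N2 lam2 u1) * N2 lam2 w * n.+1%:R^-1).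
Proof.
move=> C0 hC n e1 e2 he.
set a : R := n.+1%:R; have a0 : 0 < a by [].
have kr := ker_rh (R := R) n; have kp := ker_pd_rh (R := R) n 1.
have Luw := L2M Lu0 Lw; have Lvw := L2M Lu1 Lw.
have mT1 : measurable_fun setT (fun p : PL R * PL R => u1 (p.1 + p.2) - u1 p.1).
  by apply: measurable_funB; [exact: meas_shift2 Lu1.1|exact: (mcomp Lu1.1 measurable_fst)].
have mTw : measurable_fun setT (fun p : PL R * PL R => w (p.1 + p.2) - w p.1).
  by apply: measurable_funB; [exact: meas_shift2 Lw.1|exact: (mcomp Lw.1 measurable_fst)].
have mTu : measurable_fun setT (fun p : PL R * PL R => u0 (p.1 + p.2) - u0 p.1).
  by apply: measurable_funB; [exact: meas_shift2 Lu0.1|exact: (mcomp Lu0.1 measurable_fst)].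
have mtr (f : PL R -> R) : measurable_fun setT f -> measurable_fun setT (fun p : PL R * PL R => f p.2).
  by move=> mf; exact: (mcomp mf measurable_snd).
have small (z : PL R) : rh n z != 0 -> dtr w z <= e1 /\ dtr u0 z <= e2.
  move=> /(mol_support a0)[h1 h2]; apply: he.
    by apply: (le_trans h1); rewrite ler_peMl ?invr_ge0 ?(ltW a0)// ler1n.
  by apply: (le_trans h2); rewrite ler_peMl ?invr_ge0 ?(ltW a0)// ler1n.
have [C' C'0 hC'] := @mol_bound R.
have smallp (z : PL R) : pd 1 (rh n) z != 0 -> `|z.1| <= 2 * a^-1 /\ `|z.2| <= 2 * a^-1.
  move=> nz; have := (hC' a z a0).2 1; rewrite boxE; case: ifP => [/andP[]//|_].
  by rewrite mulr0 normr_le0 => /eqP h; move: nz; rewrite [pd 1 _ z]h eqxx.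
have absI (k : PL R -> R) (F : PL R -> R) : ker k -> L1 lam2 (fun z => k z * F z) ->
    `|Int lam2 (fun z => k z * F z)| <= Int lam2 (fun z => `|k z| * `|F z|).
  move=> kk L; apply: (le_trans (abs_Int L)).
  by rewrite le_eqVlt; apply/orP; left; apply/eqP; apply: eq_Int => z; rewrite normrM.
pose D := N2 lam2 du0 + N2 lam2 du1.
have D0 : 0 <= D by rewrite addr_ge0 ?N2_ge0.
have t1 : L1 lam2 (T1 n) /\ Int lam2 (fun x => `|T1 n x|) <= Int lam2 (fun z => `|pd 1 (rh n) z|) * (2 * a^-1 * D * e1).
  apply: (@Int_bilinear (pd 1 (rh n)) (fun x z => u1 (x + z) - u1 x) (fun x z => w (x + z) - w x)) => //.
  - exact: ker_L1.
  - by move=> z; exact: L2_dtr.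
  - by move=> z; exact: L2_dtr.
  - move=> z /smallp[h1 h2]; apply: ler_pM; rewrite ?N2_ge0//.
      by apply: dtr_u1 => //; rewrite mulr_ge0 ?invr_ge0 ?(ltW a0).
    exact: (he z h1 h2).1.
  - apply: (meas_Int lam2 (F := fun x z : PL R => pd 1 (rh n) z * ((u1 (x + z) - u1 x) * (w (x + z) - w x)))).
    by apply: measurable_funM; [exact: mtr kp.1|exact: measurable_funM].
  - move=> x; apply: absI => //.
    exact: ker_increment_L1.
have t2 : L1 lam2 (T2 n) /\ Int lam2 (fun x => `|T2 n x|) <= Int lam2 (fun z => `|rh n z|) * (D * e1).
  apply: (@Int_bilinear (rh n) (fun x z => du0 (x + z)) (fun x z => w (x + z) - w x)) => //.
  - exact: ker_L1.
  - exact: meas_shift2 Ldu0.1.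
  - by move=> z; exact: L2_shift.
  - by move=> z; exact: L2_dtr.
  - move=> z /small[h1 h2]; apply: ler_pM; rewrite ?N2_ge0//.
    by rewrite (N2_shift z Ldu0.1) lerDl N2_ge0.
  - apply: (meas_Int lam2 (F := fun x z : PL R => rh n z * (du0 (x + z) * (w (x + z) - w x)))).
    apply: measurable_funM; first exact: mtr kr.1.
    by apply: measurable_funM => //; exact: meas_shift2 Ldu0.1.
  - move=> x; apply: absI => //.
    by have := ker_increment_L1 0 (w x) x kr Ldu0 Lw; under eq_fun do rewrite subr0.
have t3 : L1 lam2 (T3 n) /\ Int lam2 (fun x => `|T3 n x|) <= Int lam2 (fun z => `|rh n z|) * (e2 * N2 lam2 dw).
  apply: (@Int_bilinear (rh n) (fun x z => u0 (x + z) - u0 x) (fun x z => dw (x + z))) => //.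
  - exact: ker_L1.
  - exact: meas_shift2 Ldw.1.
  - by move=> z; exact: L2_dtr.
  - by move=> z; exact: L2_shift.
  - move=> z /small[h1 h2]; apply: ler_pM; rewrite ?N2_ge0//.
    by rewrite (N2_shift z Ldw.1).
  - apply: (meas_Int lam2 (F := fun x z : PL R => rh n z * ((u0 (x + z) - u0 x) * dw (x + z)))).
    apply: measurable_funM; first exact: mtr kr.1.
    by apply: measurable_funM => //; exact: meas_shift2 Ldw.1.
  - move=> x; apply: absI => //.
    by have := ker_increment_L1 (u0 x) 0 x kr Lu0 Ldw; under eq_fun do rewrite subr0.
have pg (j : 'I_2) (f : PL R -> R) : L2 lam2 f ->
    [/\ L1 lam2 (cv (pd j (sg n)) (fun y => f y * w y)),
       Int lam2 (fun x => `|cv (pd j (sg n)) (fun y => f y * w y) x|) <= C * a^-1 * (N2 lam2 f * N2 lam2 w),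
       L1 lam2 (fun x => f x * cv (pd j (sg n)) w x) &
       Int lam2 (fun x => `|f x * cv (pd j (sg n)) w x|) <= C * a^-1 * (N2 lam2 f * N2 lam2 w)].
  move=> Lf; have ai0 : 0 < a^-1 by rewrite invr_gt0.
  have hk := hC a^-1 j ai0; have ks := ker_pd_sg (R := R) n j.
  have Lfw := L2M Lf Lw.
  have [c1 c2] := cv_L1L1 ks Lfw; have [c3 c4] := cv_L2 ks Lw.
  have NN : 0 <= N2 lam2 f * N2 lam2 w by rewrite mulr_ge0 ?N2_ge0.
  split=> //; last 2 first.
  - exact: L2M.
  - apply: (le_trans (CS Lf c3)); rewrite mulrCA; apply: ler_wpM2l; first exact: N2_ge0.
    by apply: (le_trans c4); apply: ler_wpM2r => //; exact: N2_ge0.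
  - apply: (le_trans c2); apply: ler_pM => //; [exact: Int_ge0|exact: Int_ge0|exact: CS].
have [g1 g2 g3 g4] := pg 0 _ Lu0; have [g5 g6 g7 g8] := pg 1 _ Lu1.
pose S (x : PL R) := comm (pd 0 (sg n)) (pd 1 (sg n)) x.
have LS : L1 lam2 S by apply: L1B; exact: L1D.
have L4 := L1D (L1D (L1_abs g1) (L1_abs g5)) (L1D (L1_abs g3) (L1_abs g7)).
have IS : Int lam2 (fun x => `|S x|) <= 2 * C * ((N2 lam2 u0 + N2 lam2 u1) * N2 lam2 w * a^-1).
  apply: (@le_trans _ _ (C * a^-1 * (N2 lam2 u0 * N2 lam2 w) + C * a^-1 * (N2 lam2 u1 * N2 lam2 w) +
    (C * a^-1 * (N2 lam2 u0 * N2 lam2 w) + C * a^-1 * (N2 lam2 u1 * N2 lam2 w)))); last first.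
    rewrite le_eqVlt; apply/orP; left; apply/eqP.
    by move: (a^-1) (N2 _ u0) (N2 _ u1) (N2 _ w) => p q r t; ring.
  have h := lerD (lerD g2 g6) (lerD g4 g8); apply: le_trans h.
  have i1 := IntD (L1_abs g1) (L1_abs g5); have i2 := IntD (L1_abs g3) (L1_abs g7).
  rewrite -i1 -i2.
  have i3 := IntD (L1D (L1_abs g1) (L1_abs g5)) (L1D (L1_abs g3) (L1_abs g7)); rewrite -i3.
  apply: le_Int; [exact: L1_abs|exact: L4|].
  move=> x; rewrite /S /comm; apply: (le_trans (ler_normB _ _)).
  by apply: lerD; exact: ler_normD.
have E : comm (pd 0 (mm n)) (pd 1 (mm n)) = fun x => T1 n x - T2 n x - T3 n x - S x.
  apply/funext => x; have e := comm_rhE n x; rewrite -e /S /comm.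
  have f1 := cv_pd_mm n 0 (L1_Lloc Luw); have f2 := cv_pd_mm n 1 (L1_Lloc Lvw).
  have f3 := cv_pd_mm n 0 (L2_Lloc Lw); have f4 := cv_pd_mm n 1 (L2_Lloc Lw).
  rewrite f1 f2 f3 f4.
  move: (cv _ _ x) (cv _ _ x) (cv _ _ x) (cv _ _ x) (cv _ _ x) (cv _ _ x) (cv _ _ x) (cv _ _ x) (u0 x) (u1 x) => p q r s t v k l m o.
  ring.
have [a1 b1] := t1; have [a2 b2] := t2; have [a3 b3] := t3.
have L12 := L1B a1 a2; have L123 := L1B L12 a3.
split; rewrite E; first exact: L1B.
have L5 := L1D (L1D (L1D (L1_abs a1) (L1_abs a2)) (L1_abs a3)) (L1_abs LS).
apply: (@le_trans _ _ (Int lam2 (fun x => `|T1 n x| + `|T2 n x| + `|T3 n x| + `|S x|))).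
  apply: le_Int => //; first by apply: L1_abs; exact: L1B.
  move=> x; apply: (le_trans (ler_normB _ _)); rewrite lerD2r.
  apply: (le_trans (ler_normB _ _)); rewrite lerD2r; exact: ler_normB.
have i1 := IntD (L1D (L1D (L1_abs a1) (L1_abs a2)) (L1_abs a3)) (L1_abs LS).
have i2 := IntD (L1D (L1_abs a1) (L1_abs a2)) (L1_abs a3).
have i3 := IntD (L1_abs a1) (L1_abs a2).
rewrite i1 i2 i3.
have hI : Int lam2 (fun x : PL R => `|pd 1 (rh n) x|) <= C * a := hC a 1 a0.
have hR := @Int_abs_rh R n.
have [e10 e20] : 0 <= e1 /\ 0 <= e2.
  have [h1 h2] : dtr w (0, 0) <= e1 /\ dtr u0 (0, 0) <= e2.
    by apply: he; rewrite normr0 mulr_ge0 ?invr_ge0.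
  by split; [exact: le_trans (dtr_ge0 _ _) h1|exact: le_trans (dtr_ge0 _ _) h2].
have b1' : Int lam2 (fun x => `|T1 n x|) <= 2 * C * (D * e1).
  apply: (le_trans b1); apply: (@le_trans _ _ (C * a * (2 * a^-1 * D * e1))).
    by apply: ler_wpM2r => //; rewrite !mulr_ge0 ?invr_ge0.
  by rewrite le_eqVlt; apply/orP; left; apply/eqP; field; rewrite gt_eqF.
rewrite hR mul1r in b2; rewrite hR mul1r in b3.
have r1 : 0 <= e2 * N2 lam2 dw by rewrite mulr_ge0 ?N2_ge0.
have r2 : 0 <= (N2 lam2 u0 + N2 lam2 u1) * N2 lam2 w * a^-1.
  by rewrite !mulr_ge0 ?invr_ge0 ?addr_ge0 ?N2_ge0.
exact: (comm_arith C0 r1 r2 b1' b2 b3 IS).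
Qed.

(** Moduli of continuity are replaced by twice the norms. The outcome is uniform in n, which later
    allows dominated convergence in time. *)
Lemma comm_bd (C : R) : 0 <= C ->
  (forall (a : R) j, 0 < a -> Int lam2 (fun x : PL R => `|pd j (mol a) x|) <= C * a) ->
  forall n, Int lam2 (fun x => `|comm (pd 0 (mm n)) (pd 1 (mm n)) x|) <=
    (2 * C + 1) * ((N2 lam2 du0 + N2 lam2 du1) * (2 * N2 lam2 w) + 2 * N2 lam2 u0 * N2 lam2 dw +
      (N2 lam2 u0 + N2 lam2 u1) * N2 lam2 w).
Proof.
move=> C0 hC n.
have [_ h] := comm_est C0 hC (fun (z : PL R) (_ : `|z.1| <= 2 * n.+1%:R^-1) (_ : `|z.2| <= 2 * n.+1%:R^-1) =>
  conj (dtr_le z Lw) (dtr_le z Lu0)).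
apply: (le_trans h); apply: ler_wpM2l; first by rewrite addr_ge0 ?mulr_ge0.
rewrite lerD2l ler_piMr//; first by rewrite mulr_ge0 ?addr_ge0 ?N2_ge0.
by rewrite invf_le1 ?ler1n.
Qed.

Lemma comm_cvg : (fun n => Int lam2 (fun x => `|comm (pd 0 (mm n)) (pd 1 (mm n)) x|)) @ \oo --> (0 : R).
Proof.
have [C C0 hC] := Int_pd_mol.
set D := N2 lam2 du0 + N2 lam2 du1; set E := N2 lam2 dw; set F := (N2 lam2 u0 + N2 lam2 u1) * N2 lam2 w.
have D0 : 0 <= D by rewrite addr_ge0 ?N2_ge0.
have E0 : 0 <= E by exact: N2_ge0.
have F0 : 0 <= F by rewrite mulr_ge0 ?addr_ge0 ?N2_ge0.
have K0 : 0 < (2 * C + 1) * (D + E + F + 1).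
  apply: mulr_gt0; apply: ltr_wpDl => //; first by rewrite mulr_ge0.
  exact: (addr_ge0 (addr_ge0 D0 E0) F0).
have K1 : 0 <= 2 * C + 1 by rewrite addr_ge0 ?mulr_ge0.
apply/cvgrPdist_le => e e0.
pose d := e / ((2 * C + 1) * (D + E + F + 1)); have d0 : 0 < d by rewrite divr_gt0.
have [d1 d10 h1] := dtr_small Lw d0; have [d2 d20 h2] := dtr_small Lu0 d0.
near=> n; rewrite sub0r normrN ger0_norm; last exact: Int_ge0.
have [m0 m1] : 2 * n.+1%:R^-1 < Num.min d1 d2 /\ n.+1%:R^-1 <= d.
  have nn : (n%:R : R) <= n.+1%:R by rewrite ler_nat.
  split.
    rewrite ltr_pdivrMr// -ltr_pdivrMl ?lt_min ?d10// mulrC.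
    apply: lt_le_trans nn; near: n; exact: nbhs_infty_gtr.
  rewrite -[leRHS]invrK lef_pV2 ?posrE ?invr_gt0//.
  apply: le_trans nn; near: n; exact: nbhs_infty_ger.
have hz (z : PL R) : `|z.1| <= 2 * n.+1%:R^-1 -> `|z.2| <= 2 * n.+1%:R^-1 -> dtr w z <= d /\ dtr u0 z <= d.
  rewrite lt_min in m0; have /andP[m2 m3] := m0 => z1 z2.
  split; apply/ltW; [apply: h1|apply: h2]; by [exact: le_lt_trans z1 _|exact: le_lt_trans z2 _].
have [_ h] := comm_est C0 hC hz; apply: (le_trans h).
apply: (@le_trans _ _ ((2 * C + 1) * (D * d + d * E + F * d))).
  apply: (ler_wpM2l K1).
  by rewrite lerD2l; exact: (ler_wpM2l F0).
have -> : e = (2 * C + 1) * (D + E + F + 1) * d by rewrite /d mulrC divfK ?gt_eqF.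
rewrite -mulrA; apply: (ler_wpM2l K1).
by rewrite !mulrDl mul1r [d * E]mulrC lerDl; exact: ltW.
Unshelve. all: end_near. Qed.

End commutator.

(** * The truncated energy *)

Section truncated_square.
Context {R : realType}.
Implicit Types e s : R.

(* A truncation of [s ^ 2 / 2] whose derivative is bounded, so that it may be multiplied by a
   force that is only integrable. *)
Definition beta (e s : R) : R := s ^+ 2 / (2 * (1 + e * s ^+ 2)).
Definition beta1 (e s : R) : R := s / (1 + e * s ^+ 2) ^+ 2.
Definition beta2 (e s : R) : R := (1 - 3 * (e * s ^+ 2)) / (1 + e * s ^+ 2) ^+ 3.

Lemma beta_den e s : 0 <= e -> 1 <= 1 + e * s ^+ 2.
Proof. by move=> e0; rewrite lerDl mulr_ge0 ?sqr_ge0. Qed.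

Lemma beta_den0 e s : 0 <= e -> 1 + e * s ^+ 2 != 0.
Proof. by move=> e0; rewrite gt_eqF// (lt_le_trans ltr01)// beta_den. Qed.

Lemma is_derive_den e (s : R) : is_derive s 1 (fun s : R => 1 + e * s ^+ 2) (2 * e * s).
Proof.
have h1 := is_deriveM (is_derive_id s 1) (is_derive_id s 1).
have h := is_deriveD (is_derive_cst (1 : R) s 1) (is_deriveM (is_derive_cst e s 1) h1).
refine (is_derive_eq h _); rewrite /GRing.scale/=; ring.
Qed.

Lemma beta_derive e (s : R) : 0 <= e -> is_derive s 1 (beta e) (beta1 e s).
Proof.
move=> e0; have n0 := beta_den0 s e0.
have n2 : 2 * (1 + e * s ^+ 2) != 0 by rewrite mulf_neq0 ?pnatr_eq0.
have d2 : is_derive s 1 (fun s : R => 2 * (1 + e * s ^+ 2)) (2 * (2 * e * s)).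
  refine (is_derive_eq (is_deriveM (is_derive_cst (2 : R) s 1) (is_derive_den e s)) _).
  by rewrite scaler0 addr0.
have dV := @is_deriveV R (fun s : R => 2 * (1 + e * s ^+ 2)) s _ 1 n2 d2.
have ds : is_derive s 1 (fun s : R => s * s) (s + s).
  by refine (is_derive_eq (is_deriveM (is_derive_id s 1) (is_derive_id s 1)) _); rewrite /GRing.scale/= mulr1.
refine (is_derive_eq (is_deriveM ds dV) _); rewrite /GRing.scale/= /beta1; field.
exact: n0.
Qed.

Lemma beta1_derive e (s : R) : 0 <= e -> is_derive s 1 (beta1 e) (beta2 e s).
Proof.
move=> e0; have n0 := beta_den0 s e0.
have n2 : (1 + e * s ^+ 2) * (1 + e * s ^+ 2) != 0 by rewrite mulf_neq0.
have d2 : is_derive s 1 (fun s : R => (1 + e * s ^+ 2) * (1 + e * s ^+ 2)) _ :=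
  is_deriveM (is_derive_den e s) (is_derive_den e s).
have dV := @is_deriveV R (fun s : R => (1 + e * s ^+ 2) * (1 + e * s ^+ 2)) s _ 1 n2 d2.
have h := is_deriveM (is_derive_id s 1) dV.
refine (is_derive_eq h _); rewrite /GRing.scale/= /beta2; field.
exact: n0.
Qed.

Lemma beta2_continuous e : 0 <= e -> continuous (beta2 e).
Proof.
move=> e0 s.
have cd : {for s, continuous (fun s : R => 1 + e * s ^+ 2)}.
  by apply: (is_derive_cont (H' := fun s => 2 * e * s)); exact: is_derive_den.
have cs : {for s, continuous (fun s : R => e * s ^+ 2)}.
  by apply: cvgM; [exact: cvg_cst|apply: cvgM; exact: cvg_id].
apply: cvgM.
  by apply: cvgB; [exact: cvg_cst|apply: cvgM; [exact: cvg_cst|exact: cs]].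
apply: cvgV; first by rewrite expf_neq0// beta_den0.
by under eq_fun do rewrite expr2; apply: cvgM; [exact: cd|apply: cvgM; exact: cd].
Qed.

Lemma beta1_continuous e : 0 <= e -> continuous (beta1 e).
Proof. by move=> e0; apply: (is_derive_cont (H' := beta2 e)) => s; exact: beta1_derive. Qed.

Lemma beta_continuous e : 0 <= e -> continuous (beta e).
Proof. by move=> e0; apply: (is_derive_cont (H' := beta1 e)) => s; exact: beta_derive. Qed.

Lemma beta_ge0 e s : 0 <= e -> 0 <= beta e s.
Proof.
move=> e0; rewrite /beta divr_ge0 ?sqr_ge0// mulr_ge0//; exact: le_trans ler01 (beta_den s e0).
Qed.

Lemma beta_le e s : 0 <= e -> beta e s <= s ^+ 2.
Proof.
move=> e0; have d := beta_den s e0; rewrite /beta ler_pdivrMr; last by rewrite mulr_gt0 ?(lt_le_trans ltr01 d).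
have := sqr_ge0 s; nra.
Qed.

Lemma beta0 e : beta e 0 = 0. Proof. by rewrite /beta expr0n/= mul0r. Qed.

Lemma abs_le_den e s : 0 < e -> `|s| <= (1 + e^-1) * (1 + e * s ^+ 2).
Proof.
move=> e0; have -> : (1 + e^-1) * (1 + e * s ^+ 2) = 1 + e * s ^+ 2 + e^-1 + s ^+ 2.
  by field; rewrite gt_eqF.
have h1 : `|s| <= 1 + s ^+ 2.
  by rewrite -real_normK ?num_real//; have := sqr_ge0 (`|s| - 1); have := normr_ge0 s; nra.
have h2 : 0 <= e * s ^+ 2 by rewrite mulr_ge0 ?sqr_ge0 ?ltW.
have h3 : 0 <= e^-1 by rewrite invr_ge0 ltW.
lra.
Qed.

Lemma beta1_le e s : 0 <= e -> `|beta1 e s| <= `|s|.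
Proof.
move=> e0; have d := beta_den s e0.
rewrite /beta1 normrM normfV [X in _ * X^-1]ger0_norm ?exprn_ge0 ?(le_trans ler01)//.
by rewrite ler_pdivrMr ?exprn_gt0 ?(lt_le_trans ltr01)// ler_peMr// exprn_ege1.
Qed.

Lemma beta1_bd e s : 0 < e -> `|beta1 e s| <= 1 + e^-1.
Proof.
move=> e0; have d := beta_den s (ltW e0); have h := abs_le_den s e0.
have d0 : 0 < 1 + e * s ^+ 2 by exact: lt_le_trans ltr01 d.
have c0 : 0 <= 1 + e^-1 by rewrite addr_ge0 ?invr_ge0 ?ltW.
rewrite /beta1 normrM normfV [X in _ * X^-1]ger0_norm ?exprn_ge0 ?(ltW d0)//.
rewrite ler_pdivrMr ?exprn_gt0//; apply: (le_trans h); apply: ler_wpM2l => //.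
by rewrite expr2 ler_peMr// ltW.
Qed.

Lemma beta_bd e s : 0 < e -> `|beta e s| <= (1 + e^-1) * `|s|.
Proof.
move=> e0; have d := beta_den s (ltW e0); have h := abs_le_den s e0.
have d0 : 0 < 1 + e * s ^+ 2 by exact: lt_le_trans ltr01 d.
rewrite ger0_norm ?beta_ge0 ?(ltW e0)// /beta ler_pdivrMr ?mulr_gt0//.
have -> : (1 + e^-1) * `|s| * (2 * (1 + e * s ^+ 2)) = `|s| * (2 * ((1 + e^-1) * (1 + e * s ^+ 2))) by ring.
rewrite -[leLHS]real_normK ?num_real// [leLHS]expr2; apply: ler_wpM2l => //.
apply: (le_trans h).
have p : 0 <= (1 + e^-1) * (1 + e * s ^+ 2) by rewrite mulr_ge0 ?(ltW d0)// addr_ge0 ?invr_ge0 ?(ltW e0).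
lra.
Qed.

Lemma beta2_bd e s : 0 <= e -> `|beta2 e s| <= 1.
Proof.
move=> e0; have d := beta_den s e0; rewrite /beta2; move: d.
have x0 : 0 <= e * s ^+ 2 by rewrite mulr_ge0 ?sqr_ge0.
move: x0; move: (e * s ^+ 2) => x x0 d.
have p : 0 < (1 + x) ^+ 3 by rewrite exprn_gt0// (lt_le_trans ltr01).
have E : (1 + x) ^+ 3 = 1 + 3 * x + 3 * x ^+ 2 + x ^+ 3 by ring.
have x2 : 0 <= x ^+ 2 by rewrite sqr_ge0.
have x3 : 0 <= x ^+ 3 by rewrite exprn_ge0.
rewrite ler_norml ler_pdivrMr// ler_pdivlMr// E; apply/andP; split; lra.
Qed.

(** The third bound makes the defect vanish with [e] where [s] stays bounded; the second one
    controls it elsewhere. *)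
Lemma beta2_def e s : 0 <= e -> 0 <= 1 - beta2 e s /\ 1 - beta2 e s <= 2 /\
  1 - beta2 e s <= 6 * (e * s ^+ 2).
Proof.
move=> e0; have := beta2_bd s e0; rewrite ler_norml => /andP[h1 h2].
split; first by lra. split; first by lra.
have d := beta_den s e0; rewrite /beta2.
have x0 : 0 <= e * s ^+ 2 by rewrite mulr_ge0 ?sqr_ge0.
move: x0 d; move: (e * s ^+ 2) => x x0 d.
have p : 0 < (1 + x) ^+ 3 by rewrite exprn_gt0// (lt_le_trans ltr01).
have E : (1 + x) ^+ 3 = 1 + 3 * x + 3 * x ^+ 2 + x ^+ 3 by ring.
have x2 : 0 <= x ^+ 2 by rewrite sqr_ge0.
have x3 : 0 <= x ^+ 3 by rewrite exprn_ge0.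
have x4 : 0 <= x ^+ 4 by rewrite exprn_ge0.
rewrite lerBlDr -lerBlDl ler_pdivlMr//.
have -> : (1 - 6 * x) * (1 + x) ^+ 3 = 1 - 3 * x - 15 * x ^+ 2 - 17 * x ^+ 3 - 6 * x ^+ 4 by ring.
lra.
Qed.

End truncated_square.

Lemma cvg_dist0 (R : realType) (u b : nat -> R) (l : R) : (forall n, `|u n - l| <= b n) ->
  b @ \oo --> (0 : R) -> u @ \oo --> l.
Proof.
move=> h cb; apply/cvgrPdist_le => e e0; move/cvgrPdist_le : cb => /(_ e e0).
apply: filterS => n; rewrite sub0r normrN distrC => hb; apply: (le_trans (h n)).
exact: le_trans (ler_norm _) hb.
Qed.

(** * The energy of one mollified component *)

Section scalar_energy.
Context {R : realType}.
Notation RM := (measurableTypeR R).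
Notation e_ i := (basis_vector i : R * R).
Local Opaque N2 rh sg mm beta beta1 beta2.
Variables (w dw : PL R -> R) (n : nat) (e : R).
Hypotheses (Lw : L2 lam2 w) (Ldw : L2 lam2 dw) (ww : wd 0 w dw) (e0 : 0 < e).

Let v := cv (mm n) w.
Let p := cv (mm n) dw.
Let dv (j : 'I_2) := fun x => - cv (pd j (mm n)) w x.
Let b1 (x : PL R) := beta1 e (v x).
Let b2 (x : PL R) := beta2 e (v x).

Let Lv : L2 lam2 v. Proof. exact: (N2_cv_mm n Lw).1. Qed.
Let Lp : L2 lam2 p. Proof. exact: (N2_cv_mm n Ldw).1. Qed.
Let Ldv j : L2 lam2 (dv j).
Proof. by apply: L2N; exact: (cv_L2 (ker_pd j (sker_mm n)) Lw).1. Qed.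

Let mb1 : measurable_fun setT b1.
Proof.
have mb : measurable_fun setT (beta1 e : measurableTypeR R -> measurableTypeR R).
  by apply: continuous_measurable_fun; exact: beta1_continuous (ltW e0).
exact: (mcomp mb Lv.1).
Qed.

Lemma meas_beta2 : measurable_fun setT b2.
Proof.
have mb : measurable_fun setT (beta2 e : measurableTypeR R -> measurableTypeR R).
  by apply: continuous_measurable_fun; exact: beta2_continuous (ltW e0).
exact: (mcomp mb Lv.1).
Qed.

Lemma beta1_L2 : L2 lam2 b1 /\ N2 lam2 b1 <= 2 * N2 lam2 w.
Proof.
have h x : `|b1 x| <= `|v x| by exact: beta1_le (ltW e0).
split; first exact: (L2_le mb1 Lv h).
apply: le_trans (N2_cv_mm n Lw).2; exact: (N2_le mb1 Lv h).
Qed.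

Lemma beta2_bound x : `|b2 x| <= 1. Proof. exact: beta2_bd (ltW e0). Qed.

Lemma mollified_C1 j : C1 j v (dv j).
Proof. exact: (C1_cv_sker j (sker_mm n) (L2_Lloc Lw)). Qed.

Lemma mollified_d0 : dv 0 = p.
Proof. by apply/funext => x; rewrite /dv (wd_ker x (sker_mm n) Lw Ldw ww) opprK. Qed.

Lemma beta1_C1 j : C1 j b1 (fun x => b2 x * dv j x).
Proof.
exact: C1_comp (fun s => beta1_derive s (ltW e0)) (beta2_continuous (ltW e0)) (mollified_C1 j).
Qed.

Lemma beta_C1 j : C1 j (fun x => beta e (v x)) (fun x => b1 x * dv j x).
Proof.
exact: C1_comp (fun s => beta_derive s (ltW e0)) (beta1_continuous (ltW e0)) (mollified_C1 j).
Qed.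

Lemma beta2_dv_L2 j : L2 lam2 (fun x => b2 x * dv j x) /\
  N2 lam2 (fun x => b2 x * dv j x) <= N2 lam2 (dv j).
Proof.
split; first exact: (L2_bd meas_beta2 beta2_bound).
by have := N2_bd meas_beta2 beta2_bound (Ldv j); rewrite mul1r.
Qed.

Lemma beta1_IBP j F F' : C1 j F F' -> L2 lam2 F -> L2 lam2 F' ->
  Int lam2 (fun x => b1 x * F' x) = - Int lam2 (fun x => b2 x * dv j x * F x).
Proof.
move=> CF LF LF'; have [Lb _] := beta1_L2; have [Lb2 _] := beta2_dv_L2 j.
exact: (IBP (beta1_C1 j) CF (L2M Lb LF) (L2M Lb2 LF) (L2M Lb LF')).
Qed.

Lemma beta1_cv_pd j g : L2 lam2 g ->
  Int lam2 (fun x => b1 x * cv (pd j (mm n)) g x) = Int lam2 (fun x => b2 x * dv j x * cv (mm n) g x).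
Proof.
move=> Lg; have [Lm _] := N2_cv_mm n Lg.
have Lpm := L2N (cv_L2 (ker_pd j (sker_mm n)) Lg).1.
have h := beta1_IBP (C1_cv_sker j (sker_mm n) (L2_Lloc Lg)) Lm Lpm.
apply: oppr_inj; rewrite -h -IntN; last first.
  by apply: L2M; [exact: beta1_L2.1|exact: (cv_L2 (ker_pd j (sker_mm n)) Lg).1].
by apply: eq_Int => x; rewrite mulrN.
Qed.

Lemma beta1_cv_pd_le j g : L2 lam2 g ->
  `|Int lam2 (fun x => b1 x * cv (pd j (mm n)) g x)| <= 2 * N2 lam2 (dv j) * N2 lam2 g.
Proof.
move=> Lg; rewrite (beta1_cv_pd j Lg); have [h1 h2] := beta2_dv_L2 j; have [h3 h4] := N2_cv_mm n Lg.
apply: (le_trans (CSr h1 h3)).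
have -> : 2 * N2 lam2 (dv j) * N2 lam2 g = N2 lam2 (dv j) * (2 * N2 lam2 g) by rewrite mulrCA mulrA.
by apply: ler_pM => //; exact: N2_ge0.
Qed.

Lemma diffusion_term :
  Int lam2 (fun x => b1 x * cv (pd 0 (mm n)) dw x) = Int lam2 (fun x => b2 x * p x ^+ 2).
Proof. by rewrite (beta1_cv_pd 0 Ldw) mollified_d0; apply: eq_Int => x; rewrite expr2 mulrA. Qed.

(** Moving the even kernel [mm n] onto [b1] produces a function with a horizontal derivative in L2,
    which can be the first factor in [aniso]. Each factor 4 comes from two mollifications by [mm n],
    each of which may double the norm. *)
Lemma mollified_beta1 : let G := cv (mm n) b1 in let G' := cv (mm n) (fun x => b2 x * p x) in
  [/\ L2 lam2 G, L2 lam2 G', wd 0 G G', N2 lam2 G <= 4 * N2 lam2 w & N2 lam2 G' <= 4 * N2 lam2 dw].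
Proof.
move=> G G'; have [Lb h1] := beta1_L2; have [] := beta2_dv_L2 0; rewrite mollified_d0 => Lb2 h2.
have [LG hG] := N2_cv_mm n Lb; have [LG' hG'] := N2_cv_mm n Lb2.
have hp := (N2_cv_mm n Ldw).2.
have C : C1 0 b1 (fun x => b2 x * p x) by have := beta1_C1 0; rewrite mollified_d0.
have wb := C1_wd C (L2_Lloc Lb) (L2_Lloc Lb2).
have CG : C1 0 G G'.
  have := C1_cv_sker 0 (sker_mm n) (L2_Lloc Lb); congr C1; apply/funext => x.
  by rewrite (wd_ker x (sker_mm n) Lb Lb2 wb) opprK.
split=> //; first exact: C1_wd CG (L2_Lloc LG) (L2_Lloc LG').
- have -> : 4 * N2 lam2 w = 2 * (2 * N2 lam2 w) by move: (N2 _ _) => a; ring.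
  by apply: (le_trans hG); apply: ler_wpM2l.
- have -> : 4 * N2 lam2 dw = 2 * (2 * N2 lam2 dw) by move: (N2 _ _) => a; ring.
  by apply: (le_trans hG'); apply: ler_wpM2l => //; exact: le_trans hp.
Qed.

Section transport.
Variables (u0 u1 du0 du1 : PL R -> R).
Hypotheses (Lu0 : L2 lam2 u0) (Lu1 : L2 lam2 u1) (Ldu0 : L2 lam2 du0) (Ldu1 : L2 lam2 du1).
Hypotheses (wu0 : wd 0 u0 du0) (wu1 : wd 0 u1 du1) (wv1 : wd 1 u1 (fun x => - du0 x)).

Lemma beta_L2 : L2 lam2 (fun x => beta e (v x)).
Proof.
have mb : measurable_fun setT (beta e : measurableTypeR R -> measurableTypeR R).
  by apply: continuous_measurable_fun; exact: beta_continuous (ltW e0).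
apply: (L2_le (mcomp mb Lv.1) (L2Z (1 + e^-1) Lv)) => x.
apply: (le_trans (beta_bd (v x) e0)); rewrite normrM [in leRHS]ger0_norm//.
by rewrite addr_ge0 ?invr_ge0 ?(ltW e0).
Qed.

(** The integrand is u . grad of beta(v) and [u] is divergence free. The field [u] is mollified to
    allow the integration by parts, and the mollification is removed in L2. *)
Lemma transport_zero : Int lam2 (fun x => b1 x * (u0 x * dv 0 x + u1 x * dv 1 x)) = 0.
Proof.
have b1d x : `|b1 x| <= 1 + e^-1 by exact: beta1_bd.
have Lb j : L2 lam2 (fun x => b1 x * dv j x) by exact: (L2_bd mb1 b1d).
have Lbeta := beta_L2.
pose A (u : PL R -> R) j (m : nat) := Int lam2 (fun x => cv (rh m) u x * (b1 x * dv j x)).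
have moll m : A u0 0 m + A u1 1 m = 0.
  rewrite /A.
  have [L0 _] := N2_cv_rh m Lu0; have [L1' _] := N2_cv_rh m Lu1; have [L2' _] := N2_cv_rh m Ldu0.
  have C0 := wd_C1 m (L2_Lloc Lu0) wu0; have C1' := wd_C1 m (L2_Lloc Lu1) wv1.
  have N : cv (rh m) (fun x => - du0 x) = (fun x => - cv (rh m) du0 x).
    exact: cvN (ker_rh m) (L2_Lloc Ldu0).
  rewrite N in C1'.
  have i0 := IBP C0 (beta_C1 0) (L2M L0 Lbeta) (L2M L2' Lbeta) (L2M L0 (Lb 0)).
  have i1 := IBP C1' (beta_C1 1) (L2M L1' Lbeta) (L2M (L2N L2') Lbeta) (L2M L1' (Lb 1)).
  rewrite i0 i1.
  have -> : Int lam2 (fun x => - cv (rh m) du0 x * beta e (v x)) =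
      - Int lam2 (fun x => cv (rh m) du0 x * beta e (v x)).
    by rewrite -IntN; [apply: eq_Int => x; rewrite mulNr|exact: L2M].
  by rewrite opprK addNr.
have lim (u : PL R -> R) j : L2 lam2 u -> A u j @ \oo -->
    Int lam2 (fun x => u x * (b1 x * dv j x)).
  move=> Lu; apply: (@cvg_dist0 _ _ (fun m => N2 lam2 (fun x => cv (rh m) u x - u x) * N2 lam2 (fun x => b1 x * dv j x))); last first.
    rewrite -[X in _ --> X](mul0r (N2 lam2 (fun x => b1 x * dv j x))).
    by apply: cvgM; [exact: rh_cvg|exact: cvg_cst].
  move=> m; have [Lm _] := N2_cv_rh m Lu.
  rewrite -(IntB (L2M Lm (Lb j)) (L2M Lu (Lb j))).
  apply: le_trans (CSr (L2B Lm Lu) (Lb j)).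
  rewrite le_eqVlt; apply/orP; left; apply/eqP; congr `|_|; apply: eq_Int => x.
  by rewrite mulrBl.
have -> : Int lam2 (fun x => b1 x * (u0 x * dv 0 x + u1 x * dv 1 x)) =
    Int lam2 (fun x => u0 x * (b1 x * dv 0 x)) + Int lam2 (fun x => u1 x * (b1 x * dv 1 x)).
  rewrite -(IntD (L2M Lu0 (Lb 0)) (L2M Lu1 (Lb 1))); apply: eq_Int => x.
  by move: (b1 x) (u0 x) (u1 x) (dv 0 x) (dv 1 x) => a b c d f; ring.
have c : (fun m => A u0 0 m + A u1 1 m) @ \oo --> Int lam2 (fun x => u0 x * (b1 x * dv 0 x)) +
    Int lam2 (fun x => u1 x * (b1 x * dv 1 x)).
  by apply: cvgD; exact: lim.
have c0 : (fun _ : nat => 0 : R) @ \oo --> (0 : R) by exact: cvg_cst.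
exact: (seq_cvg_eq moll c c0).
Qed.

(** After the commutator is split off, the remainder is the integral of [transport_zero]; the factor
    1 + 1/e is the uniform bound of [beta1 e], paired with the L1 norm. *)
Lemma transport_term :
  Int lam2 (fun x => b1 x * (cv (pd 0 (mm n)) (fun y => u0 y * w y) x + cv (pd 1 (mm n)) (fun y => u1 y * w y) x))
    <= (1 + e^-1) * Int lam2 (fun x => `|comm u0 u1 w (pd 0 (mm n)) (pd 1 (mm n)) x|).
Proof.
pose Q := comm u0 u1 w (pd 0 (mm n)) (pd 1 (mm n)).
have b1d x : `|b1 x| <= 1 + e^-1 by exact: beta1_bd.
have Lpd j : L2 lam2 (cv (pd j (mm n)) w) by exact: (cv_L2 (ker_pd j (sker_mm n)) Lw).1.
have LQ : L1 lam2 Q.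
  apply: L1B; last by apply: L1D; apply: L2M.
  by apply: L1D; [exact: (cv_L1L1 (ker_pd 0 (sker_mm n)) (L2M Lu0 Lw)).1|exact: (cv_L1L1 (ker_pd 1 (sker_mm n)) (L2M Lu1 Lw)).1].
have LbQ := L1_bd mb1 b1d LQ.
have Lz : L1 lam2 (fun x => b1 x * (u0 x * dv 0 x + u1 x * dv 1 x)).
  by apply: (L1_bd mb1 b1d); apply: L1D; apply: L2M.
have -> : Int lam2 (fun x => b1 x * (cv (pd 0 (mm n)) (fun y => u0 y * w y) x + cv (pd 1 (mm n)) (fun y => u1 y * w y) x)) =
    Int lam2 (fun x => b1 x * Q x) - Int lam2 (fun x => b1 x * (u0 x * dv 0 x + u1 x * dv 1 x)).
  rewrite -(IntB LbQ Lz); apply: eq_Int => x; rewrite /Q /comm /dv.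
  move: (b1 x) (u0 x) (u1 x) (cv _ _ x) (cv _ _ x) (cv _ _ x) (cv _ _ x) => a b c d f g h; ring.
rewrite transport_zero subr0 -(IntZ _ (L1_abs LQ)).
apply: le_trans (ler_norm _) _; apply: (abs_Int_le LbQ (L1Z _ (L1_abs LQ))) => x.
by rewrite normrM ler_wpM2r.
Qed.

End transport.

End scalar_energy.

(** * The energy estimate at a fixed time *)

Section vector_energy.
Context {R : realType}.
Notation RM := (measurableTypeR R).
Notation KK := (@KK R).
Local Opaque N2 rh sg mm beta beta1 beta2.
Implicit Types u U du dU : 'I_2 -> PL R -> R.

(* The conditions met at almost every time by a weak solution [u] and [du = partial_1 u]; the
   last one expresses that [u] is divergence free. *)
Definition slice u du : Prop :=
  [/\ forall i, L2 lam2 (u i), forall i, L2 lam2 (du i), forall i, wd 0 (u i) (du i)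
    & wd 1 (u 1) (fun x => - du 0 x)].

Lemma slice_sub u du U dU : slice u du -> slice U dU ->
  slice (fun i x => u i x - U i x) (fun i x => du i x - dU i x).
Proof.
move=> [Lu Ldu wu wv] [LU LdU wU wV]; split.
- by move=> i; exact: L2B.
- by move=> i; exact: L2B.
- by move=> i; apply: wdB => //; exact: L2_Lloc.
- have h := wdB (L2_Lloc (Lu 1)) (L2_Lloc (L2N (Ldu 0))) (L2_Lloc (LU 1)) (L2_Lloc (L2N (LdU 0))) wv wV.
  have -> // : (fun x => - (du 0 x - dU 0 x)) = (fun x => - du 0 x - - dU 0 x).
  by apply/funext => x; rewrite opprB opprK addrC.
Qed.

Lemma le_of_sqr_le (a b c : R) : 0 <= b -> a ^+ 2 <= c -> c <= b ^+ 2 -> a <= b.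
Proof.
move=> b0 h1 h2; have [a0|a0] := leP 0 a; last exact: le_trans (ltW a0) b0.
by apply: ler_of_sqr => //; exact: le_trans h1 h2.
Qed.

Lemma aniso_arith (a b c d M D : R) : 0 <= a <= M -> 0 <= c <= M -> 0 <= b <= D -> 0 <= d <= D ->
  4 * (a * b) * (c * d) <= (2 * M * D) ^+ 2.
Proof.
move=> /andP[a0 aM] /andP[c0 cM] /andP[b0 bD] /andP[d0 dD].
have -> : 4 * (a * b) * (c * d) = (2 * (a * b)) * (2 * (c * d)) by ring.
have -> : (2 * M * D) ^+ 2 = (2 * (M * D)) * (2 * (M * D)) by ring.
by apply: ler_pM; rewrite ?mulr_ge0//; apply: ler_wpM2l => //; apply: ler_pM.
Qed.

(** Here c is the defect 1 - beta2, p approximates g, and m is a cutting level. Where g^2 exceeds m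
    the bound c <= 2 is used; elsewhere g^2 is at most m and c at most 6 e v^2. *)
Lemma defect_arith (c p g m e v : R) : 0 <= e -> 0 <= m -> 0 <= c -> c <= 2 -> c <= 6 * (e * v ^+ 2) ->
  c * p ^+ 2 <= 4 * (p - g) ^+ 2 + 4 * (if m < g ^+ 2 then g ^+ 2 else 0) + 12 * e * m * v ^+ 2.
Proof.
move=> e0 m0 c0 c2 c6.
have h1 : c * p ^+ 2 <= 2 * c * (p - g) ^+ 2 + 2 * c * g ^+ 2.
  have : 0 <= c * (p - 2 * g) ^+ 2 by rewrite mulr_ge0 ?sqr_ge0.
  by move=> h; nra.
have h2 : 2 * c * (p - g) ^+ 2 <= 4 * (p - g) ^+ 2.
  by rewrite ler_wpM2r ?sqr_ge0//; lra.
have h3 : 0 <= 12 * e * m * v ^+ 2 by exact: mulr_ge0 (mulr_ge0 (mulr_ge0 _ e0) m0) (sqr_ge0 v).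
have g0 := sqr_ge0 g; have v0 := sqr_ge0 v.
case: ifPn => [_|]; first by nra.
rewrite -leNgt => h4.
have : c * g ^+ 2 <= 6 * (e * v ^+ 2) * m by apply: ler_pM.
lra.
Qed.

(** Young's inequality term by term: [d] is the dissipation, a quarter of whose square is allowed on
    the right, and [y] is the norm that Gronwall's lemma will control. *)
Lemma stretch_arith (y d M A a1 a2 a3 a4 b S : R) : 0 <= y -> 0 <= d -> 0 <= M -> 0 <= A ->
  a1 ^+ 2 <= 4 * (y * d) * (M * A) -> a2 ^+ 2 <= 4 * (y * d) * (M * A) ->
  a3 ^+ 2 <= 4 * (y * d) * (M * A) -> a4 ^+ 2 <= 64 * (y * d) * (M * A) ->
  b ^+ 2 <= 64 * (y * d) * (y * d) ->
  S <= 4 * d * a1 + 4 * d * a2 + 4 * d * a3 + d * a4 + A * b ->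
  S <= d ^+ 2 / 4 + (64 * 65 * ((1 + M) * A * y)) ^+ 2 / 2.
Proof.
move=> y0 d0 M0 A0 h1 h2 h3 h4 h5 hS.
pose h := M * A * y; have hh : 0 <= h by rewrite !mulr_ge0.
have P (a : R) : a ^+ 2 <= 4 * (y * d) * (M * A) -> a <= d / 128 + 128 * h.
  move=> ha; apply: (le_of_sqr_le _ ha); first by rewrite addr_ge0 ?mulr_ge0.
  rewrite -subr_ge0; have -> : (d / 128 + 128 * h) ^+ 2 - 4 * (y * d) * (M * A) = (d / 128 - 128 * h) ^+ 2.
    by rewrite /h; field.
  exact: sqr_ge0.
have {}h1 := P _ h1; have {}h2 := P _ h2; have {}h3 := P _ h3.
have {}h4 : a4 <= 4 * (d / 128 + 128 * h).
  have -> : a4 = 4 * (a4 / 4) by field.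
  apply: ler_wpM2l => //; apply: P.
  have -> : (a4 / 4) ^+ 2 = a4 ^+ 2 / 16 by field.
  rewrite ler_pdivrMr//; apply: (le_trans h4); rewrite le_eqVlt; apply/orP; left; apply/eqP; ring.
have {}h5 : b <= 8 * (y * d).
  apply: (le_of_sqr_le _ h5); first by rewrite !mulr_ge0.
  by rewrite le_eqVlt; apply/orP; left; apply/eqP; ring.
pose k := (1 + M) * A * y; have k0 : 0 <= k by rewrite !mulr_ge0 ?addr_ge0.
have hk : h <= k by rewrite /h /k -!mulrA ler_wpM2r ?mulr_ge0// lerDr.
have Ak : A * y <= k by rewrite /k -mulrA ler_peMl ?mulr_ge0// lerDl.
have s1 : 4 * d * a1 + 4 * d * a2 + 4 * d * a3 + d * a4 <= 16 * (d * (d / 128 + 128 * h)).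
  have := ler_wpM2l d0 h1; have := ler_wpM2l d0 h2; have := ler_wpM2l d0 h3; have := ler_wpM2l d0 h4.
  rewrite -!mulrA; move: (d * a1) (d * a2) (d * a3) (d * a4) => x1 x2 x3 x4.
  rewrite [d * (4 * _)]mulrCA; move: (d * _) => z; lra.
have s2 : A * b <= 8 * (d * k).
  apply: (le_trans (ler_wpM2l A0 h5)); have -> : A * (8 * (y * d)) = 8 * (d * (A * y)) by ring.
  by rewrite ler_wpM2l// ler_wpM2l.
have s3 : 16 * (d * (d / 128 + 128 * h)) <= d ^+ 2 / 8 + 2048 * (d * k).
  have -> : 16 * (d * (d / 128 + 128 * h)) = d ^+ 2 / 8 + 2048 * (d * h) by field.
  by rewrite lerD2l; apply: (ler_wpM2l (ler0n _ _)); exact: ler_wpM2l.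
rewrite -/k; apply: (le_trans hS); apply: (le_trans (lerD (le_trans s1 s3) s2)).
(* The cross terms amount to 2048 + 8 times d k, which is below half of 64 * 65 times d k; half of
   this square therefore absorbs them and spends d^2 / 8. *)
have : 0 <= (d / 2 - 64 * 65 * k) ^+ 2 by exact: sqr_ge0.
have -> : (d / 2 - 64 * 65 * k) ^+ 2 = d ^+ 2 / 4 - 4160 * (d * k) + (64 * 65 * k) ^+ 2 by field.
have dk : 0 <= d * k by rewrite mulr_ge0.
have d2 := sqr_ge0 d; move: dk d2; move: (d * k) (d ^+ 2) ((64 * 65 * k) ^+ 2) => x z t; lra.
Qed.

Lemma stretch_final (y0 y1 d0 d1 M A s00 s10 s11 s01 t00 t10 t11 t01 B : R) :
  t00 + t10 + t11 + t01 + B <= (d0 + d1) ^+ 2 / 4 + (64 * 65 * ((1 + M) * A * (y0 + y1))) ^+ 2 / 2 ->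
  s00 <= t00 -> s10 <= t10 -> s11 <= t11 -> s01 <= t01 + B ->
  s00 + s01 + (s10 + s11) <= (d0 ^+ 2 + d1 ^+ 2) / 2 + (64 * 65 * ((1 + M) * A)) ^+ 2 * (y0 ^+ 2 + y1 ^+ 2).
Proof.
move=> h h00 h10 h11 h01.
have e1 : (d0 + d1) ^+ 2 / 4 <= (d0 ^+ 2 + d1 ^+ 2) / 2.
  by have := sqr_ge0 (d0 - d1); nra.
have e2 : (64 * 65 * ((1 + M) * A * (y0 + y1))) ^+ 2 / 2 <= (64 * 65 * ((1 + M) * A)) ^+ 2 * (y0 ^+ 2 + y1 ^+ 2).
  have -> : (64 * 65 * ((1 + M) * A * (y0 + y1))) ^+ 2 / 2 = (64 * 65 * ((1 + M) * A)) ^+ 2 * ((y0 + y1) ^+ 2 / 2) by field.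
  apply: ler_wpM2l; first exact: sqr_ge0.
  by have := sqr_ge0 (y0 - y1); nra.
lra.
Qed.

(** Young's inequality with weight [mu] separates the pressure norm [NP] from the defect norms [c0]
    and [c1]; the rest only collects terms. *)
Lemma static_arith (mu K T0 T1 S00 S01 S10 S11 P0 P1 p0 p1 R0 R1 R' q0 q1 w0 w1 d0 d1 A NP c0 c1 e0 e1 t0 t1 c : R) :
  0 < mu -> 0 <= K ->
  T0 <= c * q0 -> T1 <= c * q1 ->
  S00 + S01 + (S10 + S11) <= (d0 + d1) / 2 + A * (w0 + w1) ->
  P0 + P1 <= NP * (c0 + c1) -> c0 ^+ 2 <= 2 * R0 -> c1 ^+ 2 <= 2 * R' ->
  R0 <= 4 * e0 + 4 * t0 + K * w0 -> R1 <= 4 * e1 + 4 * t1 + K * w1 -> R' <= 4 * e0 + 4 * t0 + K * w1 ->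
  0 <= t0 -> 0 <= t1 -> 0 <= e0 -> 0 <= e1 -> 0 <= w0 -> 0 <= w1 -> 0 <= d0 -> 0 <= d1 ->
  T0 + S00 + S01 + P0 - (p0 - R0) + (T1 + S10 + S11 + P1 - (p1 - R1)) <=
  c * (q0 + q1) + (d0 - p0 + (d1 - p1)) + A * (w0 + w1) + 2 * mu * NP ^+ 2 +
  (1 + mu^-1) * (8 * (e0 + e1) + 8 * (t0 + t1) + K * (w0 + w1)).
Proof.
move=> mu0 K0 hT0 hT1 hS hP hc0 hc1 hR0 hR1 hR' t00 t10 e00 e10 w00 w10 d00 d10.
have i0 : 0 < mu^-1 by rewrite invr_gt0.
have yo (x r : R) : x ^+ 2 <= 2 * r -> NP * x <= mu * NP ^+ 2 + mu^-1 * r.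
  move=> hx; have h : 0 <= mu^-1 * (mu * NP - x / 2) ^+ 2 by rewrite mulr_ge0 ?sqr_ge0 ?ltW.
  have E : mu^-1 * (mu * NP - x / 2) ^+ 2 = mu * NP ^+ 2 - NP * x + mu^-1 * (x ^+ 2 / 4) by field; rewrite gt_eqF.
  have r0 : 0 <= r by have := le_trans (sqr_ge0 x) hx; rewrite pmulr_rge0.
  have : mu^-1 * (x ^+ 2 / 4) <= mu^-1 * r.
    by rewrite ler_pM2l// ler_pdivrMr//; apply: (le_trans hx); lra.
  lra.
have y0 := yo _ _ hc0; have y1 := yo _ _ hc1.
have m0 : mu^-1 * R0 <= mu^-1 * (4 * e0 + 4 * t0 + K * w0) by rewrite ler_pM2l.
have m1 : mu^-1 * R' <= mu^-1 * (4 * e0 + 4 * t0 + K * w1) by rewrite ler_pM2l.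
have k0 : 0 <= K * w0 by rewrite mulr_ge0.
have k1 : 0 <= K * w1 by rewrite mulr_ge0.
have m2 : mu^-1 * (4 * e0 + 4 * t0 + K * w0) + mu^-1 * (4 * e0 + 4 * t0 + K * w1) <=
    mu^-1 * (8 * (e0 + e1) + 8 * (t0 + t1) + K * (w0 + w1)).
  rewrite -mulrDr ler_pM2l// mulrDr; lra.
have m3 : NP * (c0 + c1) = NP * c0 + NP * c1 by rewrite mulrDr.
have m4 : c * (q0 + q1) = c * q0 + c * q1 by rewrite mulrDr.
rewrite [X in _ <= _ + X]mulrDl mul1r [in X in _ <= _ + (X + _)]mulrDr.
lra.
Qed.

(** Incompressibility gives [u 1] a vertical derivative, so each product containing it is in L2 by
    [aniso] and [KK_bound] applies. The square of [u 0] is treated by [KK_sq], which covers exactly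
    the entry k = j = 0. *)
Lemma KK_quadratic n u du M k j : slice u du -> (forall i, N2 lam2 (u i) <= M) ->
  L2 lam2 (cv (pd j (KK n k)) (fun x => u k x * u j x)) /\
  N2 lam2 (cv (pd j (KK n k)) (fun x => u k x * u j x)) <= 10 * (M * (N2 lam2 (du 0) + N2 lam2 (du 1))).
Proof.
move=> [Lu Ldu wu wv] hM.
set D := _ + _.
have M0 : 0 <= M by exact: le_trans (N2_ge0 _ _) (hM 0).
have D0 : 0 <= D by rewrite addr_ge0 ?N2_ge0.
have bd i : 0 <= N2 lam2 (u i) <= M by rewrite N2_ge0 hM.
have N0 f : 0 <= N2 lam2 f by exact: N2_ge0.
have I2 := ordinal2.
have gen (F : PL R -> R) l m : L2 lam2 F -> N2 lam2 F ^+ 2 <= (2 * M * D) ^+ 2 ->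
    L2 lam2 (cv (pd m (KK n l)) F) /\ N2 lam2 (cv (pd m (KK n l)) F) <= 10 * (M * D).
  move=> LF hF; have [h1 h2] := KK_bound n l m LF; split=> //; apply: (le_trans h2).
  have MD0 : 0 <= M * D by rewrite mulr_ge0.
  have h3 : N2 lam2 F <= 2 * (M * D).
    by apply: (@le_of_sqr_le _ _ ((2 * M * D) ^+ 2)); rewrite ?mulr_ge0// mulrA.
  apply: (@le_trans _ _ (2 * (2 * (M * D)))); first exact: ler_wpM2l.
  by rewrite mulrA ler_wpM2r// -natrM ler_nat.
have wv' := N2N lam2 (du 0).
have a01 : L2 lam2 (fun x => u 0 x * u 1 x) /\ N2 lam2 (fun x => u 0 x * u 1 x) ^+ 2 <= (2 * M * D) ^+ 2.
  have [h1 h2] := aniso (Lu 0) (Ldu 0) (Lu 1) (L2N (Ldu 0)) (wu 0) wv; split=> //.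
  apply: (le_trans h2); rewrite wv'.
  by apply: aniso_arith; rewrite ?bd ?N0//= lerDl; exact: N0.
have [h|h] := I2 k; have [h'|h'] := I2 j; rewrite h h'.
- have [h1 h2] := KK_sq n (Lu 0) (Ldu 0) (wu 0) (hM 0) (lexx _); split=> //; apply: (le_trans h2).
  by rewrite ler_wpM2l// ler_wpM2l// lerDl; exact: N0.
- exact: gen a01.1 a01.2.
- have -> : (fun x => u 1 x * u 0 x) = (fun x => u 0 x * u 1 x) by apply/funext => x; rewrite mulrC.
  exact: gen a01.1 a01.2.
- have [h1 h2] := aniso (Lu 1) (Ldu 1) (Lu 1) (L2N (Ldu 0)) (wu 1) wv; apply: gen => //.
  apply: (le_trans h2); rewrite wv'; apply: aniso_arith; rewrite ?bd ?N0//=.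
    by rewrite lerDr; exact: N0.
  by rewrite lerDl; exact: N0.
Qed.

Section difference.
Variables (u du U dU : 'I_2 -> PL R -> R) (D2 : PL R -> R) (M : R).
Hypotheses (su : slice u du) (sU : slice U dU).
Hypotheses (LD2 : L2 lam2 D2) (wD2 : wd 1 (U 0) D2).
Hypotheses (hu : forall i, N2 lam2 (u i) <= M) (hU : forall i, N2 lam2 (U i) <= M).

Let w i := fun x : PL R => u i x - U i x.
Let dw i := fun x : PL R => du i x - dU i x.
Let f k j := fun x : PL R => u k x * u j x - U k x * U j x.

Let Lu i : L2 lam2 (u i). Proof. by case: su. Qed.
Let LU i : L2 lam2 (U i). Proof. by case: sU. Qed.
Let LdU i : L2 lam2 (dU i). Proof. by case: sU. Qed.
Let wV : wd 1 (U 1) (fun x => - dU 0 x). Proof. by case: sU. Qed.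
Let sw : slice w dw. Proof. exact: slice_sub. Qed.
Let Lw i : L2 lam2 (w i). Proof. by case: sw. Qed.
Let Ldw i : L2 lam2 (dw i). Proof. by case: sw. Qed.
Let ww i : wd 0 (w i) (dw i). Proof. by case: sw. Qed.
Let wv1 : wd 1 (w 1) (fun x => - dw 0 x). Proof. by case: sw. Qed.
Let Lf k j : L1 lam2 (f k j). Proof. by apply: L1B; exact: L2M. Qed.
Let M0 : 0 <= M. Proof. exact: le_trans (N2_ge0 _ _) (hu 0). Qed.

(** An approximation of the inverse Laplacian of the second derivatives of the difference of the two
    tensors: the difference of the pressures up to sign. *)
Definition pressure n (x : PL R) : R :=
  cv (pd 0 (KK n 0)) (f 0 0) x + cv (pd 1 (KK n 0)) (f 0 1) x +
  (cv (pd 0 (KK n 1)) (f 1 0) x + cv (pd 1 (KK n 1)) (f 1 1) x).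

Definition dpressure n i (x : PL R) : R :=
  - cv (pd i (pd 0 (KK n 0))) (f 0 0) x + - cv (pd i (pd 1 (KK n 0))) (f 0 1) x +
  (- cv (pd i (pd 0 (KK n 1))) (f 1 0) x + - cv (pd i (pd 1 (KK n 1))) (f 1 1) x).

Lemma pressure_C1 n i : C1 i (pressure n) (dpressure n i).
Proof.
by apply: C1D; apply: C1D; apply: C1_cv_sker; by [exact: sker_pdKK|exact: L1_Lloc].
Qed.

Lemma dpressure_L2 n i : L2 lam2 (dpressure n i).
Proof.
have H k j : L2 lam2 (fun x => - cv (pd i (pd j (KK n k))) (f k j) x).
  by apply: L2N; apply: (cv_L1L2 _ (Lf k j)).1; apply: ker_pd; exact: sker_pdKK.
by apply: L2D; apply: L2D.
Qed.

Lemma pressure_bound n : L2 lam2 (pressure n) /\ N2 lam2 (pressure n) <=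
  40 * (M * (N2 lam2 (du 0) + N2 lam2 (du 1) + (N2 lam2 (dU 0) + N2 lam2 (dU 1)))).
Proof.
set d := N2 lam2 (du 0) + _; set D := N2 lam2 (dU 0) + _.
have H k j : L2 lam2 (cv (pd j (KK n k)) (f k j)) /\
    N2 lam2 (cv (pd j (KK n k)) (f k j)) <= 10 * (M * (d + D)).
  have [h1 h2] := KK_quadratic n k j su hu; have [h3 h4] := KK_quadratic n k j sU hU.
  have E : cv (pd j (KK n k)) (f k j) = fun x => cv (pd j (KK n k)) (fun x => u k x * u j x) x -
      cv (pd j (KK n k)) (fun x => U k x * U j x) x.
    exact: (cvB (ker_pdKK n k j) (L1_Lloc (L2M (Lu k) (Lu j))) (L1_Lloc (L2M (LU k) (LU j)))).
  rewrite E; split; first exact: L2B.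
  have h5 := N2B h1 h3; apply: (le_trans h5); rewrite mulrDr mulrDr; exact: lerD.
have [a1 b1] := H 0 0; have [a2 b2] := H 0 1; have [a3 b3] := H 1 0; have [a4 b4] := H 1 1.
have c1 := N2D a1 a2; have c2 := N2D a3 a4.
split; first exact: L2D (L2D a1 a2) (L2D a3 a4).
have c3 := N2D (L2D a1 a2) (L2D a3 a4); apply: (le_trans c3).
have h := lerD (le_trans c1 (lerD b1 b2)) (le_trans c2 (lerD b3 b4)); apply: (le_trans h).
move: (M * (d + D)) => t; lra.
Qed.

Definition tail (m : R) (g : PL R -> R) : R :=
  Int lam2 (fun x => if m < g x ^+ 2 then g x ^+ 2 else 0).

(* The time derivative of [cv (mm n) (w i)]: applying the Leray projection to the test function
   [mm n] produces the pressure term. *)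
Definition mollified_force n i (x : PL R) : R :=
  cv (pd 0 (mm n)) (f i 0) x + cv (pd 1 (mm n)) (f i 1) x + dpressure n i x - cv (pd 0 (mm n)) (dw i) x.

Section fixed.
Variables (n : nat) (e : R).
Hypothesis e0 : 0 < e.
Notation v i := (cv (mm n) (w i)).
Notation p i := (cv (mm n) (dw i)).
Notation b1 i := (fun x : PL R => beta1 e (v i x)).
Notation b2 i := (fun x : PL R => beta2 e (v i x)).

Definition defect i k : R := Int lam2 (fun x => (1 - b2 i x) * p k x ^+ 2).

Let Lp i : L2 lam2 (p i). Proof. exact: (N2_cv_mm n (Ldw i)).1. Qed.

Lemma defect_L1 i g : L2 lam2 g -> L1 lam2 (fun x => (1 - b2 i x) * g x ^+ 2).
Proof.
move=> Lg; have mb : measurable_fun setT (b2 i) by exact: (meas_beta2 n (Lw i) e0).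
apply: (L1_bd (C := 2)); [by apply: measurable_funB|move=> x|exact: Lg.2].
have [h1 [h2 _]] := beta2_def (v i x) (ltW e0); by rewrite ger0_norm.
Qed.

Lemma defect_le i k (m : R) : 0 <= m -> defect i k <=
  4 * N2 lam2 (fun x => p k x - dw k x) ^+ 2 + 4 * tail m (dw k) + 48 * e * m * N2 lam2 (w i) ^+ 2.
Proof.
move=> m0.
have Ld := L2B (Lp k) (Ldw k).
have mt : measurable_fun setT (fun x => if m < dw k x ^+ 2 then dw k x ^+ 2 else 0).
  apply: measurable_fun_ifT => //; last exact: measurable_funX (Ldw k).1.
  by apply: measurable_fun_ltr => //; exact: measurable_funX (Ldw k).1.
have Lt : L1 lam2 (fun x => if m < dw k x ^+ 2 then dw k x ^+ 2 else 0).
  apply: (L1_le mt (Ldw k).2) => x; case: ifP => _; first by rewrite ger0_norm ?sqr_ge0.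
  by rewrite normr0 sqr_ge0.
have [Lv hv] := N2_cv_mm n (Lw i).
(* 48 = 12 * 4, because correlation with [mm n] may double the L2 norm. *)
have h1 : 48 * e * m * N2 lam2 (w i) ^+ 2 >= 12 * e * m * Int lam2 (fun x => v i x ^+ 2).
  rewrite -N2sq; have -> : 48 * e * m * N2 lam2 (w i) ^+ 2 = 12 * e * m * (2 * N2 lam2 (w i)) ^+ 2.
    by move: (N2 _ _) => t; ring.
  apply: ler_wpM2l; first by rewrite !mulr_ge0 ?(ltW e0).
  by rewrite lerXn2r ?nnegrE ?mulr_ge0 ?N2_ge0.
apply: le_trans (lerD (lexx _) h1); rewrite N2sq /tail.
have La := L1Z 4 Ld.2; have Lb := L1Z 4 Lt; have Lc := L1Z (12 * e * m) Lv.2.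
have i1 := IntZ 4 Ld.2; have i2 := IntZ 4 Lt; have i3 := IntZ (12 * e * m) Lv.2.
rewrite -i1 -i2 -i3; have i4 := IntD La Lb; rewrite -i4.
have i5 := IntD (L1D La Lb) Lc; rewrite -i5.
apply: le_Int; [exact: defect_L1|by apply: L1D => //; exact: L1D|].
move=> x; have [d1 [d2 d3]] := beta2_def (v i x) (ltW e0).
exact: defect_arith (ltW e0) m0 d1 d2 d3.
Qed.

Let Lb1 i : L2 lam2 (b1 i). Proof. exact: (beta1_L2 n (Lw i) e0).1. Qed.

Lemma dv1E : (fun x => - cv (pd 1 (mm n)) (w 1) x) = (fun x => - p 0 x).
Proof.
apply/funext => x; have h := wd_ker x (sker_mm n) (Lw 1) (L2N (Ldw 0)) wv1; rewrite h opprK.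
by have h2 := cvN (ker_mm n) (L2_Lloc (Ldw 0)); rewrite h2.
Qed.

Lemma one_sub_b2_L2 i g : L2 lam2 g -> L2 lam2 (fun x => (1 - b2 i x) * g x) /\
  N2 lam2 (fun x => (1 - b2 i x) * g x) ^+ 2 <= 2 * Int lam2 (fun x => (1 - b2 i x) * g x ^+ 2).
Proof.
move=> Lg; have mb : measurable_fun setT (b2 i) by exact: (meas_beta2 n (Lw i) e0).
have L : L2 lam2 (fun x => (1 - b2 i x) * g x).
  apply: (L2_bd (C := 2) _ _ Lg); [by apply: measurable_funB|move=> x].
  have [h1 [h2 _]] := beta2_def (v i x) (ltW e0); by rewrite ger0_norm.
have Ld := defect_L1 i Lg.
split=> //; rewrite N2sq; have i1 := IntZ 2 Ld; rewrite -i1.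
apply: le_Int; [exact: L.2|exact: L1Z|move=> x].
have [h1 [h2 _]] := beta2_def (v i x) (ltW e0).
rewrite exprMn [leRHS]mulrA; apply: ler_wpM2r; first exact: sqr_ge0.
by rewrite expr2; apply: ler_wpM2r.
Qed.

(** After integration by parts the pressure is paired with the derivatives of the two components,
    weighted by [b2 0] and [b2 1]. The vertical derivative of the second component is [- p 0], so
    that the unweighted parts cancel and only the two defects remain. *)
Lemma pressure_term : Int lam2 (fun x => b1 0 x * dpressure n 0 x) + Int lam2 (fun x => b1 1 x * dpressure n 1 x) <=
  N2 lam2 (pressure n) * (N2 lam2 (fun x => (1 - b2 0 x) * p 0 x) + N2 lam2 (fun x => (1 - b2 1 x) * p 0 x)).
Proof.
have [LP _] := pressure_bound n; have LdP := dpressure_L2 n.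
have i0 := beta1_IBP n (Lw 0) e0 (pressure_C1 n 0) LP (LdP 0).
have i1 := beta1_IBP n (Lw 1) e0 (pressure_C1 n 1) LP (LdP 1).
rewrite i0 i1.
have d0 := mollified_d0 n (Lw 0) (Ldw 0) (ww 0).
have mb i : measurable_fun setT (b2 i) by exact: (meas_beta2 n (Lw i) e0).
have [L0 _] := one_sub_b2_L2 0 (Lp 0); have [L1' _] := one_sub_b2_L2 1 (Lp 0).
have E0 : Int lam2 (fun x => b2 0 x * (- cv (pd 0 (mm n)) (w 0) x) * pressure n x) =
    Int lam2 (fun x => p 0 x * pressure n x) - Int lam2 (fun x => (1 - b2 0 x) * p 0 x * pressure n x).
  rewrite -(IntB (L2M (Lp 0) LP) (L2M L0 LP)); apply: eq_Int => x.
  have h : - cv (pd 0 (mm n)) (w 0) x = p 0 x := congr1 (fun F => F x) d0.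
  by rewrite h; move: (b2 0 x) (p 0 x) (pressure n x) => a b c; ring.
have E1 : Int lam2 (fun x => b2 1 x * (- cv (pd 1 (mm n)) (w 1) x) * pressure n x) =
    Int lam2 (fun x => (1 - b2 1 x) * p 0 x * pressure n x) - Int lam2 (fun x => p 0 x * pressure n x).
  rewrite -(IntB (L2M L1' LP) (L2M (Lp 0) LP)); apply: eq_Int => x.
  have h : - cv (pd 1 (mm n)) (w 1) x = - p 0 x := congr1 (fun F => F x) dv1E.
  by rewrite h; move: (b2 1 x) (p 0 x) (pressure n x) => a b c; ring.
rewrite E0 E1.
have c0 := le_trans (ler_norm _) (CSr L0 LP).
have c1 := CSr L1' LP; rewrite ler_norml in c1; have /andP[c2 _] := c1.
move: c0 c2; move: (Int _ _) (Int _ _) (Int _ _) (N2 _ _) (N2 _ _) (N2 _ _) => a b c g h k.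
have -> : h * (k + g) = k * h + g * h by ring.
move: (g * h) (k * h) => s t; lra.
Qed.

(** One term of w . grad U, up to sign and in divergence form, tested with the truncated
    component. *)
Definition stretch i j := Int lam2 (fun x => b1 i x * cv (pd j (mm n)) (fun y => w j y * U i y) x).

(* Only [stretch 0 1] contains a vertical derivative that is not controlled: there the
   divergence condition turns [partial_2 w_2] into [- partial_1 w_1], and [partial_2 U_1] is
   square integrable by assumption. *)
Lemma stretch_bound : stretch 0 0 + stretch 0 1 + (stretch 1 0 + stretch 1 1) <=
  (N2 lam2 (dw 0) ^+ 2 + N2 lam2 (dw 1) ^+ 2) / 2 +
  (64 * 65 * ((1 + M) * (N2 lam2 D2 + N2 lam2 (dU 0)))) ^+ 2 * (N2 lam2 (w 0) ^+ 2 + N2 lam2 (w 1) ^+ 2).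
Proof.
set A := N2 lam2 D2 + _.
pose y := N2 lam2 (w 0) + N2 lam2 (w 1); pose d := N2 lam2 (dw 0) + N2 lam2 (dw 1).
have N0 (g : PL R -> R) : 0 <= N2 lam2 g by exact: N2_ge0.
have y0 : 0 <= y by rewrite addr_ge0.
have d0 : 0 <= d by rewrite addr_ge0.
have A0 : 0 <= A by rewrite addr_ge0.
have I2 := ordinal2.
have wy i : N2 lam2 (w i) <= y by have [->|->] := I2 i; rewrite ?lerDl ?lerDr.
have dd i : N2 lam2 (dw i) <= d by have [->|->] := I2 i; rewrite ?lerDl ?lerDr.
have pd' : N2 lam2 (p 0) <= 2 * d.
  by apply: (le_trans (N2_cv_mm n (Ldw 0)).2); rewrite ler_wpM2l.
have nU := N2N lam2 (dU 0); have nw := N2N lam2 (dw 0).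
have prod4 (a b c g a' b' c' g' k : R) : 0 <= k -> 0 <= a <= a' -> 0 <= b <= b' -> 0 <= c <= c' -> 0 <= g <= g' ->
    k * (a * b) * (c * g) <= k * (a' * b') * (c' * g').
  move=> k0 /andP[? ?] /andP[? ?] /andP[? ?] /andP[? ?].
  by apply: ler_pM; rewrite ?mulr_ge0//; [apply: ler_wpM2l => //; apply: ler_pM|apply: ler_pM].
have DA : 0 <= N2 lam2 D2 <= A by rewrite N0 lerDl N0.
have EA : 0 <= N2 lam2 (dU 0) <= A by rewrite N0 lerDr N0.
have [L00 n00] := aniso (Lw 0) (Ldw 0) (LU 0) LD2 (ww 0) wD2.
have [L10 n10] := aniso (Lw 0) (Ldw 0) (LU 1) (L2N (LdU 0)) (ww 0) wV.
have [L11 n11] := aniso (Lw 1) (Ldw 1) (LU 1) (L2N (LdU 0)) (ww 1) wV.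
rewrite nU in n10 n11.
have k00 := le_trans n00 (prod4 _ _ _ _ y d M A 4 (ler0n _ _) _ _ _ _).
have k10 := le_trans n10 (prod4 _ _ _ _ y d M A 4 (ler0n _ _) _ _ _ _).
have k11 := le_trans n11 (prod4 _ _ _ _ y d M A 4 (ler0n _ _) _ _ _ _).
have bw i : 0 <= N2 lam2 (w i) <= y by rewrite N0 wy.
have bd i : 0 <= N2 lam2 (dw i) <= d by rewrite N0 dd.
have bU i : 0 <= N2 lam2 (U i) <= M by rewrite N0 hU.
have {}k00 := k00 (bw 0) (bd 0) (bU 0) DA.
have {}k10 := k10 (bw 0) (bd 0) (bU 1) EA.
have {}k11 := k11 (bw 1) (bd 1) (bU 1) EA.
have s00 : stretch 0 0 <= 4 * d * N2 lam2 (fun x => w 0 x * U 0 x).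
  have := beta1_cv_pd_le n (Lw 0) e0 0 L00; rewrite (mollified_d0 n (Lw 0) (Ldw 0) (ww 0)) => h.
  apply: (le_trans (le_trans (ler_norm _) h)); apply: ler_wpM2r => //.
  have -> : 4 * d = 2 * (2 * d) by ring.
  exact: ler_wpM2l.
have s10 : stretch 1 0 <= 4 * d * N2 lam2 (fun x => w 0 x * U 1 x).
  have := beta1_cv_pd_le n (Lw 1) e0 0 L10; rewrite (mollified_d0 n (Lw 1) (Ldw 1) (ww 1)) => h.
  apply: (le_trans (le_trans (ler_norm _) h)); apply: ler_wpM2r => //.
  have -> : 4 * d = 2 * (2 * d) by ring.
  rewrite ler_wpM2l//; apply: (le_trans (N2_cv_mm n (Ldw 1)).2); rewrite ler_wpM2l//; exact: dd.
have s11 : stretch 1 1 <= 4 * d * N2 lam2 (fun x => w 1 x * U 1 x).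
  have := beta1_cv_pd_le n (Lw 1) e0 1 L11; rewrite dv1E N2N => h.
  apply: (le_trans (le_trans (ler_norm _) h)); apply: ler_wpM2r => //.
  have -> : 4 * d = 2 * (2 * d) by ring.
  exact: ler_wpM2l.
have [LG LG' wG hG hG'] := mollified_beta1 n (Lw 0) (Ldw 0) (ww 0) e0.
set G := cv (mm n) _ in LG wG hG.
have [LGU nGU] := aniso LG LG' (LU 0) LD2 wG wD2.
have [LGw nGw] := aniso LG LG' (Lw 1) (L2N (Ldw 0)) wG wv1.
rewrite nw in nGw.
have bG : 0 <= N2 lam2 G <= 4 * y by rewrite N0 (le_trans hG)// ler_wpM2l.
have bG' : 0 <= N2 lam2 (cv (mm n) (fun x => b2 0 x * p 0 x)) <= 4 * d.
  by rewrite N0 (le_trans hG')// ler_wpM2l.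
have kGU := le_trans nGU (prod4 _ _ _ _ (4 * y) (4 * d) M A 4 (ler0n _ _) bG bG' (bU 0) DA).
have kGw := le_trans nGw (prod4 _ _ _ _ (4 * y) (4 * d) y d 4 (ler0n _ _) bG bG' (bw 1) (bd 0)).
(* The differentiated product is only integrable, so the kernel is moved onto [b1 0]; the resulting
   [G] has a horizontal derivative in L2, and [aniso] applies to its products with [U 0] and with
   [w 1]. *)
have s01 : stretch 0 1 <= d * N2 lam2 (fun x => G x * U 0 x) + A * N2 lam2 (fun x => G x * w 1 x).
  have LF : L1 lam2 (fun x => - dw 0 x * U 0 x + w 1 x * D2 x) by apply: L1D; apply: L2M => //; exact: L2N.
  have [_ [C [_ _ hC _ _]]] := ker_bd (ker_mm (R := R) n).
  have b1d x : `|b1 0 x| <= 1 + e^-1 by exact: beta1_bd.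
  have E : stretch 0 1 = - Int lam2 (fun x => (- dw 0 x * U 0 x + w 1 x * D2 x) * G x).
    have -> : stretch 0 1 = - Int lam2 (fun x => b1 0 x * cv (mm n) (fun x => - dw 0 x * U 0 x + w 1 x * D2 x) x).
      rewrite -IntN; last by apply: (L1_bd (Lb1 0).1 b1d); exact: (cv_L1L1 (ker_mm n) LF).1.
      apply: eq_Int => x; have h := wd_prod x (sker_mm n) (Lw 1) (L2N (Ldw 0)) (LU 0) LD2 wv1 wD2.
      by rewrite h mulrN.
    congr (- _).
    have LK := (cv_L1L1 (ker_abs (ker_mm n)) (L1_abs LF)).1.
    have La : L1 lam2 (fun x => `|b1 0 x| * cv (fun x => `|mm n x|) (fun x => `|- dw 0 x * U 0 x + w 1 x * D2 x|) x).
      apply: (L1_bd (C := 1 + e^-1) (mabs (Lb1 0).1) _ LK) => x; by rewrite normr_id.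
    have h := cv_adj (ker_mm n) (L1_Lloc LF) (L2_Lloc (Lb1 0)) La.
    have ev : (fun z : PL R => mm n (- z)) = mm n by apply/funext => z; rewrite mm_even.
    by rewrite ev in h; rewrite h.
  have La : L1 lam2 (fun x => dw 0 x * (G x * U 0 x)) by exact: L2M.
  have Lc : L1 lam2 (fun x => D2 x * (G x * w 1 x)) by exact: L2M.
  have E2 : stretch 0 1 = Int lam2 (fun x => dw 0 x * (G x * U 0 x)) - Int lam2 (fun x => D2 x * (G x * w 1 x)).
    rewrite E -(IntB La Lc) -IntN.
      by apply: eq_Int => x; move: (dw 0 x) (U 0 x) (w 1 x) (D2 x) (G x) => a b c g h; ring.
    have L3 := L1B Lc La.
    have -> // : (fun x => (- dw 0 x * U 0 x + w 1 x * D2 x) * G x) = (fun x => D2 x * (G x * w 1 x) - dw 0 x * (G x * U 0 x)).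
    by apply/funext => x; move: (dw 0 x) (U 0 x) (w 1 x) (D2 x) (G x) => a b c g h; ring.
  rewrite E2; apply: lerD.
    apply: (le_trans (le_trans (ler_norm _) (CSr (Ldw 0) LGU))); exact: ler_wpM2r.
  have := CSr LD2 LGw; rewrite ler_norml => /andP[h _].
  rewrite lerNl; apply: le_trans h; rewrite lerN2; apply: ler_wpM2r => //.
  by have /andP[] := DA.
have h64 : 4 * (4 * y * (4 * d)) * (M * A) = 64 * (y * d) * (M * A) by ring.
have h64' : 4 * (4 * y * (4 * d)) * (y * d) = 64 * (y * d) * (y * d) by ring.
rewrite h64 in kGU; rewrite h64' in kGw.
have S := stretch_arith y0 d0 M0 A0 k00 k10 k11 kGU kGw (lexx _).
exact: (stretch_final S s00 s10 s11 s01).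
Qed.

Lemma energy_term i : Int lam2 (fun x => b1 i x * mollified_force n i x) =
  Int lam2 (fun x => b1 i x * (cv (pd 0 (mm n)) (fun y => u 0 y * w i y) x + cv (pd 1 (mm n)) (fun y => u 1 y * w i y) x))
  + stretch i 0 + stretch i 1 + Int lam2 (fun x => b1 i x * dpressure n i x)
  - (N2 lam2 (p i) ^+ 2 - defect i i).
Proof.
have kp j := ker_pd j (sker_mm (R := R) n).
have La j : L1 lam2 (fun y => u j y * w i y) by exact: L2M.
have Lb j : L1 lam2 (fun y => w j y * U i y) by exact: L2M.
have Lca j := (cv_L1L2 (kp j) (La j)).1; have Lcb j := (cv_L1L2 (kp j) (Lb j)).1.
(* The splitting u_i u_j - U_i U_j = u_j w_i + w_j U_i puts [u] into the transport part only;
   vertical derivatives are then required of [U] and not of [u 0]. *)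
have fE j : cv (pd j (mm n)) (f i j) = fun x => cv (pd j (mm n)) (fun y => u j y * w i y) x +
    cv (pd j (mm n)) (fun y => w j y * U i y) x.
  have h := cvD (kp j) (L1_Lloc (La j)) (L1_Lloc (Lb j)); rewrite -h; congr cv.
  by apply/funext => x; rewrite /f /w; ring.
have Ldw' : L2 lam2 (cv (pd 0 (mm n)) (dw i)) by exact: (cv_L2 (kp 0) (Ldw i)).1.
have I1 := L2M (Lb1 i) (L2D (Lca 0) (Lca 1)).
have I2 := L2M (Lb1 i) (Lcb 0); have I3 := L2M (Lb1 i) (Lcb 1).
have I4 := L2M (Lb1 i) (dpressure_L2 n i); have I5 := L2M (Lb1 i) Ldw'.
have mb : measurable_fun setT (b2 i) by exact: (meas_beta2 n (Lw i) e0).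
have E5 : Int lam2 (fun x => b1 i x * cv (pd 0 (mm n)) (dw i) x) = N2 lam2 (p i) ^+ 2 - defect i i.
  have h := diffusion_term n (Lw i) (Ldw i) (ww i) e0; rewrite h N2sq /defect.
  have h2 := IntB (Lp i).2 (defect_L1 i (Lp i)); rewrite -h2; apply: eq_Int => x.
  by move: (b2 i x) (p i x) => a b; ring.
rewrite -E5 /stretch.
have j1 := IntD I1 I2; have j2 := IntD (L1D I1 I2) I3; have j3 := IntD (L1D (L1D I1 I2) I3) I4.
have j4 := IntB (L1D (L1D (L1D I1 I2) I3) I4) I5.
rewrite -j1 -j2 -j3 -j4; apply: eq_Int => x; rewrite /mollified_force !fE.
move: (cv _ _ x) (cv _ _ x) (cv _ _ x) (cv _ _ x) (cv _ _ x) (dpressure n i x) (b1 i x) => a b c g h k l.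
ring.
Qed.

Definition transport_commutator i := comm (u 0) (u 1) (w i) (pd 0 (mm n)) (pd 1 (mm n)).

(** Only the term with the squared norms of [w] is to survive. The commutators, the dissipation
    differences and the mollification errors vanish as n grows; then the tails and the factor e m
    vanish together; the pressure term is removed last, with [mu]. *)
Lemma static_estimate (m mu : R) : 0 <= m -> 0 < mu ->
  Int lam2 (fun x => b1 0 x * mollified_force n 0 x) + Int lam2 (fun x => b1 1 x * mollified_force n 1 x) <=
  (1 + e^-1) * (Int lam2 (fun x => `|transport_commutator 0 x|) + Int lam2 (fun x => `|transport_commutator 1 x|))
  + (N2 lam2 (dw 0) ^+ 2 - N2 lam2 (p 0) ^+ 2 + (N2 lam2 (dw 1) ^+ 2 - N2 lam2 (p 1) ^+ 2))
  + (64 * 65 * ((1 + M) * (N2 lam2 D2 + N2 lam2 (dU 0)))) ^+ 2 * (N2 lam2 (w 0) ^+ 2 + N2 lam2 (w 1) ^+ 2)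
  + 2 * mu * N2 lam2 (pressure n) ^+ 2
  + (1 + mu^-1) * (8 * (N2 lam2 (fun x => p 0 x - dw 0 x) ^+ 2 + N2 lam2 (fun x => p 1 x - dw 1 x) ^+ 2)
     + 8 * (tail m (dw 0) + tail m (dw 1)) + 48 * e * m * (N2 lam2 (w 0) ^+ 2 + N2 lam2 (w 1) ^+ 2)).
Proof.
move=> m0 mu0; rewrite !energy_term.
have [Lu' Ldu' wu' wv'] := su.
have t i := transport_term n (Lw i) e0 (Lu' 0) (Lu' 1) (Ldu' 0) (wu' 0) wv'.
have t0 := t 0; have t1 := t 1; rewrite -/(transport_commutator 0) in t0; rewrite -/(transport_commutator 1) in t1.
have sb := stretch_bound; have pt := pressure_term.
have [_ c0] := one_sub_b2_L2 0 (Lp 0); have [_ c1] := one_sub_b2_L2 1 (Lp 0).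
have r00 := defect_le 0 0 m0; have r11 := defect_le 1 1 m0; have r10 := defect_le 1 0 m0.
have tp g : 0 <= tail m g by apply: Int_ge0 => x; case: ifP => // _; exact: sqr_ge0.
have q := fun g : PL R -> R => sqr_ge0 (N2 lam2 g).
rewrite -/(defect 0 0) in c0; rewrite -/(defect 1 0) in c1.
have S := (static_arith (N2 lam2 (p 0) ^+ 2) (N2 lam2 (p 1) ^+ 2) mu0 (mulr_ge0 (mulr_ge0 (ler0n _ 48) (ltW e0)) m0) t0 t1 sb pt c0 c1 r00 r11 r10 (tp _) (tp _) (q _) (q _) (q _) (q _) (q _) (q _)).
exact: S.
Qed.

End fixed.
End difference.
End vector_energy.

(** * Calculus in time *)

Section time_calculus.
Context {R : realType}.
Notation RM := (measurableTypeR R).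
Implicit Types (b g : RM -> R) (F : R -> R) (l t : R).

(** The integral starts at -1 so that the antiderivative is differentiable at 0 from both sides. *)
Lemma antiderivative_gt (g : R -> R) : continuous g ->
  exists G : R -> R, forall s : R, -1 < s -> is_derive s 1 G (g s).
Proof.
move=> cg; exists (fun x => \int[lebesgue_measure]_(t in [set` `[(-1)%R, x]]) (g t))%R => s s1.
have ss : s < s + 1 by rewrite ltrDl.
have ig : lebesgue_measure.-integrable `[(-1)%R, s + 1] (EFin \o g).
  apply: continuous_compact_integrable; first exact: segment_compact.
  exact: continuous_subspaceT.
have [d1 d2] := continuous_FTC1_closed ss ig s1 (cg s).
rewrite derive1E in d2; exact: (DeriveDef d1 d2).
Qed.

Definition prim b t : R := Int lam (fun s => seg t s * b s).

Lemma meas_seg2 : measurable_fun setT (fun p : RM * RM => seg p.1 p.2).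
Proof.
apply: measurable_fun_ifT => //; apply: measurable_and; apply: measurable_fun_ler => //.
Qed.

Lemma meas_prim b : measurable_fun setT b -> measurable_fun setT (fun t : RM => prim b t).
Proof.
move=> mb; apply: (meas_Int lam (F := fun (t s : RM) => seg t s * b s)).
apply: measurable_funM; first exact: meas_seg2.
exact: (mcomp mb measurable_snd).
Qed.

Lemma seg_le1 t s : `|seg t s| <= 1 :> R.
Proof. by rewrite /seg; case: ifP; rewrite ?normr1 ?normr0. Qed.

Lemma L1_segM t b : L1 lam b -> L1 lam (fun s => seg t s * b s).
Proof. by move=> Lb; exact: (L1_bd (meas_seg t) (seg_le1 t) Lb). Qed.

Lemma prim0 b : measurable_fun setT b -> prim b 0 = 0.
Proof.
move=> mb; have E : prim b 0 = Int lam (fun _ : RM => (0 : R)); last by rewrite E Int0.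
apply: ae_eq_Int => //; first by apply: measurable_funM => //; exact: meas_seg.
exists [set (0 : R)]; split; [exact: measurable_set1|exact: lebesgue_measure_set1|].
move=> x /= h; apply: contrapT => x0; apply: h => _; rewrite /seg; case: ifP; rewrite ?mul0r// => /andP[h1 h2].
by exfalso; apply: x0; apply/eqP; rewrite eq_le h1 h2.
Qed.

Lemma prim_bound b t : L1 lam b -> `|prim b t| <= Int lam (fun s => `|b s|).
Proof.
move=> Lb; apply: abs_Int_le; [exact: L1_segM|exact: L1_abs|move=> s].
by rewrite normrM ler_piMl ?seg_le1.
Qed.

Lemma L1_seg_continuous t g : continuous (g : R -> R) -> L1 lam (fun s => seg t s * g s).
Proof.
move=> cg.
have mE : measurable (`[0, t]%classic : set RM) by exact: measurable_itv.
have := @continuous_compact_integrable R g (`[0, t]) (@segment_compact R 0 t) (continuous_subspaceT cg).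
move=> /(integrable_mkcond _ mE) ig.
rewrite /L1 (_ : _ \o _ = (EFin \o g) \_ (`[0, t]%classic))//.
by apply/funext => x /=; rewrite patchE /seg in_seg; case: ifP; rewrite ?mul1r ?mul0r.
Qed.

Lemma continuous_approx_seg b t : L1 lam b -> exists g : nat -> RM -> R,
  (forall n, continuous (g n : R -> R)) /\
  (fun n => Int lam (fun s => seg t s * `|b s - g n s|)) @ \oo --> (0 : R).
Proof.
move=> Lb; pose E := (`[0, t]%classic : set RM).
have mE : measurable E by exact: measurable_itv.
have iE : lam.-integrable E (EFin \o b) by exact: integrableS Lb.
have [//||g_ [cg ig cvg]] := @approximation_continuous_integrable R E b _ _ iE.
  have hE := @lebesgue_measure_itv R `[0, t]%R.
  apply: (@eq_ind_r _ _ (fun y => y < +oo)%E _ _ hE).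
  by rewrite /=; case: ifPn => // _; rewrite -EFinB ltry.
exists g_; split=> //.
have /fine_cvgP[_ c] := cvg.
rewrite (_ : (fun n => _) = (fun n => fine (\int[lebesgue_measure]_(z in E) `|(b z - g_ n z)%:E|)%E)) //.
apply/funext => n; rewrite !IntDef /Rintegral; congr fine.
rewrite [RHS]integral_mkcond; apply: eq_integral => x _.
by rewrite patchE /seg in_seg; case: ifP; rewrite ?mul1r ?mul0r.
Qed.

Lemma continuous_bounded_itv (F : R -> R) K : 0 <= K -> continuous F ->
  exists2 C, 0 <= C & forall x, `|x| <= K -> `|F x| <= C.
Proof.
move=> K0 cF; have KK' : - K <= K by rewrite (le_trans _ K0)// oppr_le0.
have cn : {within `[- K, K], continuous (fun x => `|F x|)}.
  apply: continuous_subspaceT => x; apply: cvg_norm; exact: cF.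
have [c _ h] := EVT_max KK' cn.
by exists `|F c| => // x; rewrite ler_norml => hx; apply: h; rewrite in_itv.
Qed.

Lemma seg_sub t s r : s <= t -> seg s r <= seg t r :> R.
Proof.
move=> st; rewrite /seg; case: ifP => [/andP[-> h]|_]; last by case: ifP.
by rewrite (le_trans h st).
Qed.

(** The chain rule for absolutely continuous functions: it is classical for continuous integrands,
    and [b] is approximated by such in L1 on the segment, which makes the primitives converge
    uniformly there. *)
Lemma prim_chain b F (F' : R -> R) t : L1 lam b -> (forall s : R, is_derive s 1 F (F' s)) ->
  continuous F' -> 0 < t -> F (prim b t) - F 0 = prim (fun s => F' (prim b s) * b s) t.
Proof.
move=> Lb dF cF' t0.
have mb := L1_meas Lb.
have [g [cg cvg]] := continuous_approx_seg t Lb.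
have mg n : measurable_fun setT (g n : RM -> R) by apply: continuous_measurable_fun; exact: cg.
pose d n := Int lam (fun s => seg t s * `|b s - g n s|).
have Lg n : L1 lam (fun s => seg t s * g n s) by exact: L1_seg_continuous.
have Ld n : L1 lam (fun s => seg t s * `|b s - g n s|).
  have := L1_abs (L1B (L1_segM t Lb) (Lg n)).
  rewrite (_ : (fun x => _) = (fun s => seg t s * `|b s - g n s|))//.
  by apply/funext => s; rewrite -mulrBr normrM (ger0_norm (seg_ge0 t s)).
have dist n s : s <= t -> `|prim b s - prim (g n) s| <= d n.
  move=> st; have Lgs : L1 lam (fun r => seg s r * g n r) by exact: L1_seg_continuous.
  have Lbs := L1_segM s Lb.
  rewrite /prim -(IntB Lbs Lgs); apply: abs_Int_le; [exact: L1B|exact: Ld|move=> r].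
  by rewrite -mulrBr normrM (ger0_norm (seg_ge0 s r)) ler_wpM2r ?seg_sub.
have [D D0 hD] : exists2 D, 0 < D & forall n, d n <= D.
  have /pinfty_ex_gt0[D D0 h] := cvg_seq_bounded (cvgP _ cvg).
  by exists D => // n; apply: (le_trans (ler_norm _)); exact: h.
pose K := Int lam (fun s => `|b s|) + D.
have IB0 : 0 <= Int lam (fun s => `|b s|) by exact: Int_ge0.
have K0 : 0 <= K by rewrite addr_ge0// ltW.
have [C C0 hC] := continuous_bounded_itv K0 cF'.
have bP s : `|prim b s| <= K by apply: (le_trans (prim_bound s Lb)); rewrite lerDl ltW.
have bG n s : s <= t -> `|prim (g n) s| <= K.
  move=> st; have -> : prim (g n) s = prim b s - (prim b s - prim (g n) s) by rewrite opprB addrCA subrr addr0.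
  apply: (le_trans (ler_normB _ _)); apply: lerD; first exact: prim_bound.
  exact: le_trans (dist n s st) (hD n).
have cvP s : s <= t -> (fun n => prim (g n) s) @ \oo --> prim b s.
  move=> st; apply: (@cvg_dist0 _ _ d); last exact: cvg.
  by move=> n; rewrite distrC dist.
have mF' (h : RM -> R) : measurable_fun setT h -> measurable_fun setT (fun s => F' (h s)).
  by move=> mh; apply: mcomp mh; apply: continuous_measurable_fun; exact: cF'.
have mP n : measurable_fun setT (fun s : RM => prim (g n) s) by exact: meas_prim.
have cF := is_derive_cont dF.
have E n : F (prim (g n) t) - F 0 = prim (fun s => F' (prim (g n) s) * g n s) t.
  have [G dG] := antiderivative_gt (cg n).
  have cG (s : R) : -1 < s -> {for s, continuous G}.
    move=> s1; apply: differentiable_continuous; apply/derivable1_diffP.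
    by have [] := dG s s1.
  have PG s : 0 <= s -> prim (g n) s = G s - G 0.
    rewrite le_eqVlt => /orP[/eqP <-|s0]; first by rewrite subrr prim0.
    by apply: FTC_seg_gt => // r _; exact: cg.
  pose H s := F (G s - G 0).
  have dH (s : R) : -1 < s -> is_derive s 1 H (F' (G s - G 0) * g n s).
    move=> s1; have h1 := dG s s1; pose k (s : R) := G s - G 0.
    have h2 : is_derive (k s) 1 F (F' (k s)) := dF (k s).
    have h3 : is_derive s 1 k (g n s).
      have h4 := is_deriveB h1 (is_derive_cst (G 0) s (1 : R)); apply: (is_derive_eq h4); exact: subr0.
    have h4 := is_derive1_comp h2 h3; exact: h4.
  have := FTC_seg_gt t0 dH; rewrite /H subrr -PG ?(ltW t0)// => <-.
    apply: eq_Int => s; rewrite /seg; case: ifP; rewrite ?mul0r// => /andP[s0 _]; by rewrite PG.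
  move=> s s1; apply: cvgM; last exact: cg.
  apply: (cvg_comp (fun s => G s - G 0) F'); last exact: cF'.
  by apply: cvgB; [exact: cG|exact: cvg_cst].
have c1 : (fun n => prim (fun s => F' (prim (g n) s) * g n s) t) @ \oo --> F (prim b t) - F 0.
  have -> : (fun n => prim (fun s => F' (prim (g n) s) * g n s) t) = (fun n => F (prim (g n) t) - F 0).
    by apply/funext => n; rewrite E.
  apply: cvgB; last exact: cvg_cst.
  by apply: (cvg_comp (fun n => prim (g n) t) F); [exact: cvP|exact: cF].
have u := cvg_unique (@Rhausdorff R) c1; apply: u; clear c1.
(* The error of replacing the approximate primitive inside [F'], which vanishes by dominated
   convergence; the error from the last factor is at most C times the L1 distance [d n]. *)
pose r n s := seg t s * `|F' (prim (g n) s) - F' (prim b s)| * `|b s|.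
have mr n : measurable_fun setT (r n : RM -> R).
  apply: measurable_funM; last exact: mabs.
  apply: measurable_funM; first exact: meas_seg.
  by apply: mabs; apply: measurable_funB; apply: mF' => //; exact: meas_prim.
have rb n s : `|r n s| <= (C + C) * `|b s|.
  rewrite ger0_norm ?mulr_ge0 ?seg_ge0//; apply: ler_wpM2r => //.
  rewrite /seg; case: ifP => [/andP[_ st]|_]; last by rewrite mul0r addr_ge0.
  rewrite mul1r; apply: (le_trans (ler_normB _ _)); apply: lerD; apply: hC => //.
  exact: bG.
have [_ cr] : L1 lam (fun=> 0 : R) /\ (fun n => Int lam (r n)) @ \oo --> Int lam (fun _ : RM => (0 : R)).
  apply: (Int_dct (g := fun s => (C + C) * `|b s|)) => //; last by apply: L1Z; exact: L1_abs.
  move=> s; have [st|st] := leP s t; last first.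
    rewrite (_ : (fun n => r n s) = fun=> 0); first exact: cvg_cst.
    by apply/funext => n; rewrite /r /seg [s <= t]leNgt st andbF !mul0r.
  have -> : (0 : R) = seg t s * `|F' (prim b s) - F' (prim b s)| * `|b s| by rewrite subrr normr0 mulr0 mul0r.
  apply: cvgM; last exact: cvg_cst.
  apply: cvgM; first exact: cvg_cst.
  apply: cvg_norm; apply: cvgB; last exact: cvg_cst.
  by apply: (cvg_comp (fun n => prim (g n) s) F'); [exact: cvP|exact: cF'].
rewrite Int0 in cr.
have LF n : L1 lam (fun s => seg t s * (F' (prim (g n) s) * g n s)).
  apply: (L1_le (g := fun s => C * `|seg t s * g n s|)).
  - apply: measurable_funM; first exact: meas_seg.
    by apply: measurable_funM => //; exact: mF'.
  - by apply: L1Z; exact: L1_abs.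
  - move=> s; rewrite !normrM mulrCA; have [st|st] := leP s t; first by apply: ler_wpM2r; rewrite ?mulr_ge0// hC// bG.
    by rewrite /seg [s <= t]leNgt st andbF !normr0 !mul0r !mulr0.
have LFb : L1 lam (fun s => seg t s * (F' (prim b s) * b s)).
  apply: L1_segM; apply: (L1_bd (C := C)) => //; first by apply: mF'; exact: meas_prim.
  by move=> s; exact: hC.
have Lr n : L1 lam (r n) by apply: (L1_le (mr n) (L1Z (C + C) (L1_abs Lb))).
apply: (@cvg_dist0 _ _ (fun n => C * d n + Int lam (r n))); last first.
  rewrite -[X in _ --> X](_ : C * 0 + 0 = 0); last by rewrite mulr0 addr0.
  by apply: cvgD => //; apply: cvgMr; exact: cvg.
move=> n; rewrite /prim -(IntB (LF n) LFb) -(IntZ C (Ld n)) -(IntD (L1Z C (Ld n)) (Lr n)).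
apply: abs_Int_le; [exact: L1B|by apply: L1D => //; exact: L1Z|move=> s].
rewrite /r /seg; case: ifP => [/andP[_ st]|_]; last by rewrite !mul0r subrr normr0 mulr0 addr0.
rewrite !mul1r.
have -> : F' (prim (g n) s) * g n s - F' (prim b s) * b s =
  - (F' (prim (g n) s) * (b s - g n s)) + (F' (prim (g n) s) - F' (prim b s)) * b s by ring.
apply: (le_trans (ler_normD _ _)); rewrite normrN !normrM; apply: lerD => //.
by apply: ler_wpM2r => //; apply: hC; exact: bG.
Qed.

Lemma prim_ge0 b t : (forall s, 0 <= b s) -> 0 <= prim b t.
Proof. by move=> b0; apply: Int_ge0 => s; rewrite mulr_ge0 ?seg_ge0. Qed.

Lemma prim_power b k t : L1 lam b -> 0 <= t ->
  prim (fun s => prim b s ^+ k * b s) t = k.+1%:R^-1 * prim b t ^+ k.+1.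
Proof.
move=> Lb; rewrite le_eqVlt => /orP[/eqP <-|t0].
  rewrite !prim0 ?expr0n ?mulr0//; first exact: L1_meas Lb.
  apply: measurable_funM; last exact: L1_meas Lb.
  by apply: measurable_funX; apply: meas_prim; exact: L1_meas Lb.
have d (s : R) : is_derive s 1 (fun s => k.+1%:R^-1 * s ^+ k.+1) (s ^+ k).
  have h := is_deriveZ (k.+1%:R^-1) (is_deriveX k.+1 (is_derive_id s (1 : R))).
  rewrite exprfctE in h.
  refine (is_derive_eq h _); rewrite /GRing.scale /= mulr1.
  by rewrite mulrA mulVf ?mul1r// pnatr_eq0.
have c : continuous (fun s : R => s ^+ k) by move=> s; exact: exprn_continuous.
by have <- := prim_chain Lb d c t0; rewrite expr0n mulr0 subr0.
Qed.

(** Iterating the inequality k times bounds the right-hand side by C P^(k+1) / (k+1)! with P the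
    primitive of [b], and this tends to zero. No continuity of [y] enters, as the inequality is used
    under the integral only. *)
Lemma gronwall b (y : RM -> R) C : L1 lam b -> (forall s, 0 <= b s) -> measurable_fun setT y ->
  (forall s, 0 <= y s <= C) ->
  {ae lam, forall t : RM, 0 < t -> y t <= prim (fun s => b s * y s) t} ->
  forall t : R, prim (fun s => b s * y s) t = 0.
Proof.
move=> Lb b0 my yC h.
have Lby : L1 lam (fun s => b s * y s).
  rewrite (_ : (fun s => _) = fun s => y s * b s); last by apply/funext => s; exact: mulrC.
  apply: (L1_bd (C := C)) => // s; by have /andP[h0 h1] := yC s; rewrite ger0_norm.
have mb := L1_meas Lb; have mP := meas_prim mb.
have P0 s : 0 <= prim b s by exact: prim_ge0.
have PB s : `|prim b s| <= Int lam (fun s => `|b s|) by exact: prim_bound.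
have Lp k : L1 lam (fun s => prim b s ^+ k * b s).
  apply: (L1_bd (C := (Int lam (fun s => `|b s|)) ^+ k)) => //; first exact: measurable_funX.
  by move=> s; rewrite normrX lerXn2r ?nnegrE// (le_trans _ (PB s)).
have key k t : 0 <= t -> prim (fun s => b s * y s) t <= C * (k.+1`!%:R^-1 * prim b t ^+ k.+1).
  elim: k t => [|k ih] t t0.
    rewrite invr1 mul1r expr1 /prim -(IntZ C (L1_segM t Lb)).
    apply: le_Int; [exact: L1_segM|by apply: L1Z; exact: L1_segM|move=> s].
    have -> : C * (seg t s * b s) = seg t s * (b s * C) by ring.
    apply: ler_wpM2l; first exact: seg_ge0.
    by rewrite ler_wpM2l//; have /andP[] := yC s.
  have -> : C * (k.+2`!%:R^-1 * prim b t ^+ k.+2) =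
      prim (fun s => C * k.+1`!%:R^-1 * (prim b s ^+ k.+1 * b s)) t.
    have -> : prim (fun s => C * k.+1`!%:R^-1 * (prim b s ^+ k.+1 * b s)) t =
        C * k.+1`!%:R^-1 * prim (fun s => prim b s ^+ k.+1 * b s) t.
      have L := L1_segM t (Lp k.+1); rewrite /prim -(IntZ _ L); apply: eq_Int => s; by rewrite mulrCA.
    rewrite (prim_power k.+1 Lb t0) factS natrM invfM; ring.
  apply: (@le_trans _ _ (prim (fun s => b s * (if 0 <= s then y s else 0)) t)).
    rewrite le_eqVlt; apply/orP; left; apply/eqP; apply: eq_Int => s; rewrite /seg.
    by case: (0 <= s) => //=; rewrite !mul0r.
  have hae : {ae lam, forall s : RM, seg t s * (b s * y s) <= seg t s * (C * k.+1`!%:R^-1 * (prim b s ^+ k.+1 * b s))}.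
    have n0 : {ae lam, forall s : RM, s <> 0}.
      exists [set (0 : R)]; split; [exact: measurable_set1|exact: lebesgue_measure_set1|].
      by move=> x /= h1; apply: contrapT => x0; apply: h1.
    apply: filterS2 h n0 => s hs s0; rewrite /seg; case: ifP; rewrite ?mul0r ?mul1r// => /andP[s1 s2].
    have s3 : 0 < s by rewrite lt_neqAle s1 andbT eq_sym; apply/eqP.
    have h1 := le_trans (hs s3) (ih s s1).
    have h2 := ler_wpM2l (b0 s) h1; apply: (le_trans h2).
    by rewrite le_eqVlt; apply/orP; left; apply/eqP; ring.
  have La : L1 lam (fun s => seg t s * (b s * (if 0 <= s then y s else 0))).
    have -> : (fun s : RM => seg t s * (b s * (if 0 <= s then y s else 0))) = (fun s => seg t s * (b s * y s)).
      by apply/funext => s; rewrite /seg; case: (0 <= s) => //=; rewrite !mul0r.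
    exact: L1_segM.
  have Lc := L1_segM t (L1Z (C * k.+1`!%:R^-1) (Lp k.+1)).
  rewrite -subr_ge0 /prim -(IntB Lc La).
  (* The pointwise inequality holds almost everywhere only, so the difference is replaced by its
     positive part. *)
  have -> : Int lam (fun x : RM => seg t x * (C * k.+1`!%:R^-1 * (prim b x ^+ k.+1 * b x)) -
       seg t x * (b x * (if 0 <= x then y x else 0))) =
       Int lam (fun x : RM => Num.max 0 (seg t x * (C * k.+1`!%:R^-1 * (prim b x ^+ k.+1 * b x)) -
       seg t x * (b x * (if 0 <= x then y x else 0)))).
    have m1 := L1_meas (L1B Lc La).
    apply: ae_eq_Int => //; first exact: measurable_maxr.
    apply: filterS hae => s hs _; rewrite max_r// subr_ge0; apply: le_trans hs.
    by rewrite /seg; case: (0 <= s) => //=; rewrite !mul0r.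
  by apply: Int_ge0 => s; rewrite le_max lexx.
move=> t; have [t0|t0] := ltP t 0.
  rewrite /prim (_ : (fun s => _) = fun=> 0) ?Int0//; apply/funext => s.
  rewrite /seg; case: ifP; rewrite ?mul0r// => /andP[s0 s1].
  by have := lt_le_trans t0 (le_trans s0 s1); rewrite ltxx.
apply/eqP; rewrite eq_le; apply/andP; split; last first.
  by apply: prim_ge0 => s; rewrite mulr_ge0//; have /andP[] := yC s.
have c : (fun k => C * (k.+1`!%:R^-1 * prim b t ^+ k.+1)) @ \oo --> (0 : R).
  rewrite -[X in _ --> X](mulr0 C); apply: cvgMr.
  have h0 := cvg_series_cvg_0 (is_cvg_series_exp_coeff (prim b t)).
  rewrite -cvg_shiftS in h0; move: h0.
  rewrite (_ : (fun n => exp_coeff _ _) = (fun k => k.+1`!%:R^-1 * prim b t ^+ k.+1))//.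
  by apply/funext => k; rewrite /exp_coeff/= mulrC.
have -> : (0 : R) = lim ((fun k => C * (k.+1`!%:R^-1 * prim b t ^+ k.+1)) @ \oo) by rewrite (cvg_lim _ c).
by apply: limr_ge; [exact: cvgP c|apply: nearW => k; exact: key].
Qed.

End time_calculus.

(** * Cut-offs in time *)

Section time_cutoff.
Context {R : realType}.
Notation RM := (measurableTypeR R).
Implicit Types (d a b s t T : R).

(** A smooth step that rises between a and a + d. Its height is theta 1 instead of 1; this common
    factor is divided out in [time_primitive]. *)
Definition ramp d a s : R := theta ((s - a) / d).
Definition ramp' d a s : R := d^-1 * bumpf ((s - a) / d).

Lemma ramp_derive d a (s : R) : is_derive s 1 (ramp d a) (ramp' d a s).
Proof.
pose k (s : R) := (s - a) / d.
have h1 : is_derive s 1 k d^-1.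
  have h := is_deriveZ d^-1 (is_deriveB (is_derive_id s (1 : R)) (is_derive_cst a s (1 : R))).
  have e : (d^-1 \*: (id - cst a)) = k by apply/funext => x; rewrite /k mulrC.
  by rewrite e in h; refine (is_derive_eq h _); rewrite subr0 /GRing.scale/= mulr1.
have h2 : is_derive (k s) 1 theta (bumpf (k s)) := theta_derive (k s).
have h3 := is_derive1_comp h2 h1; refine (is_derive_eq h3 _); exact: mulrC.
Qed.

Lemma bump_continuous : continuous (@bumpf R).
Proof. exact: smooth1_continuous (@smooth1_bump R). Qed.

Lemma ramp'_continuous d a : continuous (ramp' d a).
Proof.
move=> s; apply: cvgMr; apply: (cvg_comp (fun s => (s - a) / d) (@bumpf R)); last exact: bump_continuous.
by apply: cvgM; [apply: cvgB; [exact: cvg_id|exact: cvg_cst]|exact: cvg_cst].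
Qed.

Lemma smooth1_ramp d a : smooth1 (ramp d a).
Proof.
apply: Sm_smooth1; apply: (Sm_comp (@smooth1_theta R)).
apply: Sm_mul; last exact: Sm_cst.
by apply: Sm_sub; [exact: Sm_id|exact: Sm_cst].
Qed.

Lemma ramp'_ge0 d a s : 0 <= d -> 0 <= ramp' d a s.
Proof. by move=> d0; rewrite mulr_ge0 ?invr_ge0// bump_ge0. Qed.

Lemma ramp'_support d a s : 0 < d -> ramp' d a s != 0 -> a < s < a + d.
Proof.
move=> d0 h; apply/andP; split; rewrite ltNge; apply/negP => h1; move/eqP : h; apply.
  rewrite /ramp' bump_lt ?mulr0// (@le_trans _ _ 0)//.
  by rewrite pmulr_lle0 ?invr_gt0// subr_le0.
by rewrite /ramp' bump_gt ?mulr0// ler_pdivlMr// mul1r lerBrDl.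
Qed.

Lemma ramp_small d a s : 0 < d -> s <= a -> ramp d a s = 0.
Proof.
move=> d0 h; rewrite /ramp theta_small// (@le_trans _ _ 0)//.
by rewrite pmulr_lle0 ?invr_gt0// subr_le0.
Qed.

Lemma ramp_large d a s : 0 < d -> a + d <= s -> ramp d a s = theta 1.
Proof. by move=> d0 h; rewrite /ramp theta_large// ler_pdivlMr// mul1r lerBrDl. Qed.

Lemma theta_mono : {homo (@theta R) : x y / x <= y}.
Proof.
move=> x y xy; apply: (@ger0_derive1_le_oo R (@theta R) (x - 1) (y + 1)) => //.
- by move=> z _; have [] := theta_derive z.
- by move=> z _; rewrite derive1E; have [_ ->] := theta_derive z; exact: bump_ge0.
- by move=> z _; exact: (is_derive_cont (@theta_derive R)).
- by rewrite in_itv/=; apply/andP; split; lra.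
- by rewrite in_itv/=; apply/andP; split; lra.
Qed.

Lemma theta_bound s : 0 <= theta s <= (theta 1 : R).
Proof.
apply/andP; split.
  have [h|h] := leP s 4^-1; first by rewrite theta_small.
  by rewrite -(theta_small (lexx (4^-1 : R))); apply: theta_mono; exact: ltW.
have [h|h] := leP 1 s; first by rewrite theta_large.
by apply: theta_mono; exact: ltW.
Qed.

Lemma theta1_gt0 : 0 < theta 1 :> R.
Proof.
have c : {within `[4^-1, 1], continuous (@theta R)}.
  by apply: continuous_subspaceT; exact: (is_derive_cont (@theta_derive R)).
have lt1 : (4^-1 < 1 :> R) by rewrite invf_lt1// ltr1n.
have [z z1] := MVT lt1 (fun x _ => theta_derive x) c.
rewrite [theta 4^-1]theta_small// subr0 => ->.
by rewrite mulr_gt0 ?subr_gt0// bump_pos; move: z1; rewrite in_itv.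
Qed.

Lemma ramp_bound d a s : `|ramp d a s| <= theta 1.
Proof. by have /andP[h1 h2] := theta_bound ((s - a) / d); rewrite ger0_norm. Qed.

Lemma meas_ramp d a : measurable_fun setT (ramp d a : RM -> R).
Proof. by apply: continuous_measurable_fun; exact: (is_derive_cont (@ramp_derive d a)). Qed.

Lemma meas_ramp' d a : measurable_fun setT (ramp' d a : RM -> R).
Proof. by apply: continuous_measurable_fun; exact: ramp'_continuous. Qed.

Lemma ramp'_seg d a s : 0 < d -> 0 <= a -> seg (a + d) s * ramp' d a s = ramp' d a s.
Proof.
move=> d0 a0; have [->|h] := eqVneq (ramp' d a s) 0; first by rewrite mulr0.
have /andP[h1 h2] := ramp'_support d0 h.
by rewrite /seg (le_trans a0 (ltW h1)) (ltW h2) mul1r.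
Qed.

Lemma L1_ramp' d a : 0 < d -> 0 <= a -> L1 lam (ramp' d a : RM -> R).
Proof.
move=> d0 a0; have := L1_seg_continuous (a + d) (@ramp'_continuous d a).
by rewrite (_ : (fun s => _) = ramp' d a)//; apply/funext => s; exact: ramp'_seg.
Qed.

Lemma Int_ramp' d a : 0 < d -> 0 <= a -> Int lam (ramp' d a : RM -> R) = theta 1.
Proof.
move=> d0 a0; have ad : 0 < a + d by rewrite ltr_wpDl.
have := FTC_seg ad (@ramp_derive d a) (@ramp'_continuous d a).
rewrite (ramp_small d0 a0) (ramp_large d0 (lexx _)) subr0 => <-.
by apply: eq_Int => s; rewrite ramp'_seg.
Qed.

Lemma ramp'_average d a (g : RM -> R) v e C : 0 < d -> 0 <= a -> measurable_fun setT g ->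
  (forall s, `|g s| <= C) ->
  {ae lam, forall s : RM, a < s < a + d -> `|g s - v| <= e} ->
  `|Int lam (fun s => ramp' d a s * g s) - theta 1 * v| <= theta 1 * e.
Proof.
move=> d0 a0 mg gC h.
have Lr := L1_ramp' d0 a0; have mr := @meas_ramp' d a.
have Lg : L1 lam (fun s : RM => ramp' d a s * g s).
  have := L1_bd mg gC Lr; rewrite (_ : (fun s => g s * _) = (fun s => ramp' d a s * g s))//.
  by apply/funext => s; exact: mulrC.
rewrite -(Int_ramp' d0 a0) -!(IntZr _ Lr) -(IntB Lg (L1Zr v Lr)).
have Lb := L1B Lg (L1Zr v Lr).
apply: (le_trans (abs_Int Lb)).
rewrite -subr_ge0 -(IntB (L1Zr e Lr) (L1_abs Lb)).
have La := L1B (L1Zr e Lr) (L1_abs Lb); have ma := L1_meas La.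
have -> : Int lam (fun x : RM => ramp' d a x * e - `|ramp' d a x * g x - ramp' d a x * v|) =
  Int lam (fun x : RM => Num.max 0 (ramp' d a x * e - `|ramp' d a x * g x - ramp' d a x * v|)).
  apply: ae_eq_Int => //; first exact: measurable_maxr.
  apply: filterS h => s hs _; rewrite max_r// subr_ge0 -mulrBr normrM.
  have r0 := ramp'_ge0 a s (ltW d0); rewrite (ger0_norm r0).
  have [->|h1] := eqVneq (ramp' d a s) 0; first by rewrite !mul0r.
  by apply: ler_wpM2l => //; apply: hs; exact: ramp'_support.
by apply: Int_ge0 => s; rewrite le_max lexx.
Qed.

Definition right_limit (g : RM -> R) (a v : R) : Prop := forall e : R, 0 < e -> exists2 h : R, 0 < h &
  {ae lam, forall s : RM, a < s < a + h -> `|g s - v| <= e}.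

Lemma ramp'_average_cvg (d : nat -> R) (a : nat -> R) p (g : RM -> R) v C :
  (forall n, 0 < d n) -> (forall n, 0 <= p <= a n) -> (fun n => a n + d n) @ \oo --> p ->
  measurable_fun setT g -> (forall s, `|g s| <= C) -> right_limit g p v ->
  (fun n => Int lam (fun s => ramp' (d n) (a n) s * g s)) @ \oo --> theta 1 * v.
Proof.
move=> d0 pa cad mg gC gv; apply/cvgrPdist_le => e e0.
have t0 := theta1_gt0.
have [h h0 H] := gv (e / theta 1) (divr_gt0 e0 t0).
move/cvgrPdist_lt : cad => /(_ h h0); apply: filterS => n hn.
have /andP[p0 pan] := pa n.
rewrite distrC; have -> : e = theta 1 * (e / theta 1) by field; rewrite gt_eqF.
apply: (ramp'_average (C := C)) => //; first exact: le_trans pan.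
apply: filterS H => s Hs /andP[s1 s2]; apply: Hs; rewrite (le_lt_trans pan s1)/=.
move: hn; rewrite ltr_distlC => /andP[_ hn]; exact: lt_trans hn.
Qed.

Lemma harmonic_cvg h : (fun n => h / n.+1%:R) @ \oo --> (0 : R).
Proof. by rewrite -[X in _ --> X](mulr0 h); apply: cvgMr; exact: cvg_harmonic. Qed.

(* The cut-offs increase on the right of [0] and decrease on the right of [t], so only one-sided
   limits of [g] enter; they need to hold almost everywhere only, since [g] is a measurable
   version of a continuous function. *)
Lemma time_primitive (g B : RM -> R) T C g0 t v : measurable_fun setT g -> (forall s, `|g s| <= C) ->
  L1 lam B -> 0 < t < T ->
  (forall d a b, 0 < d -> 0 < a -> a < b -> b + d < T ->
    Int lam (fun s => (ramp' d a s - ramp' d b s) * g s) =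
    - Int lam (fun s => (ramp d a s - ramp d b s) * B s)) ->
  right_limit g 0 g0 -> right_limit g t v -> v - g0 = prim B t.
Proof.
move=> mg gC LB /andP[t0 tT] H c0 ct.
(* Widths up to half the distance from t to the ends of the interval let the rising ramp start
   before t and the one at t end before T. *)
pose h := Num.min t (T - t) / 2.
have h0 : 0 < h by rewrite divr_gt0// lt_min t0 subr_gt0.
have ht : h < t by rewrite ltr_pdivrMr// (le_lt_trans (_ : _ <= t)) ?ge_min ?lexx// ltr_pMr// ltr1n.
have hT : h < T - t.
  by rewrite ltr_pdivrMr// (le_lt_trans (_ : _ <= T - t)) ?ge_min ?lexx ?orbT// ltr_pMr ?subr_gt0// ltr1n.
pose d n := h / n.+1%:R.
have d0 n : 0 < d n by rewrite divr_gt0.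
have dh n : d n <= h by rewrite ler_pdivrMr// ler_peMr ?ler1n// ltW.
have cd : d @ \oo --> (0 : R) by exact: harmonic_cvg.
have A0 := @ramp'_average_cvg d d 0 g g0 C d0 _ _ mg gC c0.
have {}A0 : (fun n => Int lam (fun s => ramp' (d n) (d n) s * g s)) @ \oo --> theta 1 * g0.
  apply: A0 => [n|]; first by rewrite lexx ltW.
  by rewrite -[X in _ --> X](addr0 0); apply: cvgD.
have At := @ramp'_average_cvg d (fun=> t) t g v C d0 _ _ mg gC ct.
have {}At : (fun n => Int lam (fun s => ramp' (d n) t s * g s)) @ \oo --> theta 1 * v.
  apply: At => [n|]; first by rewrite lexx ltW.
  by rewrite -[X in _ --> X](addr0 t); apply: cvgD => //; exact: cvg_cst.
have mB := L1_meas LB.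
have cB : (fun n => Int lam (fun s => (ramp (d n) (d n) s - ramp (d n) t s) * B s)) @ \oo -->
    Int lam (fun s => theta 1 * seg t s * B s).
  apply: (@Int_dct_ae _ _ _ lam (fun n s => (ramp (d n) (d n) s - ramp (d n) t s) * B s)
    (fun s => theta 1 * seg t s * B s) (fun s => (theta 1 + theta 1) * `|B s|)).
  - by move=> n; apply: measurable_funM => //; apply: measurable_funB; exact: meas_ramp.
  - by apply: measurable_funM => //; apply: measurable_funM => //; exact: meas_seg.
  - by apply: L1Z; exact: L1_abs.
  have n0 : {ae lam, forall s : RM, s <> 0}.
    exists [set (0 : R)]; split; [exact: measurable_set1|exact: lebesgue_measure_set1|].
    by move=> x /= h1; apply: contrapT => x0; apply: h1.
  apply: filterS n0 => s s0; split; last first.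
    move=> n; rewrite normrM ler_wpM2r//; apply: (le_trans (ler_normB _ _)).
    by apply: lerD; exact: ramp_bound.
  apply: cvgM; last exact: cvg_cst.
  apply: cvg_near_cst.
  have [sneg|spos] := ltP s 0.
    apply: nearW => n; rewrite /seg leNgt sneg/= mulr0 !ramp_small ?subrr//.
      exact: le_trans (ltW sneg) (ltW t0).
    exact: le_trans (ltW sneg) (ltW (d0 n)).
  have {s0}spos : 0 < s by rewrite lt_neqAle spos andbT eq_sym; apply/eqP.
  have s20 : 0 < s / 2 by rewrite divr_gt0.
  have N1 : \forall n \near \oo, d n + d n <= s.
    move/cvgrPdist_lt : cd => /(_ _ s20); apply: filterS => n.
    by rewrite sub0r normrN ger0_norm ?(ltW (d0 n))// => h1; lra.
  have [st|st] := leP s t.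
    apply: filterS N1 => n h1; rewrite /seg (ltW spos) st mulr1 [X in _ - X]ramp_small// subr0.
    exact: ramp_large.
  have ts0 : 0 < s - t by rewrite subr_gt0.
  have N2' : \forall n \near \oo, t + d n <= s.
    move/cvgrPdist_lt : cd => /(_ _ ts0); apply: filterS => n.
    by rewrite sub0r normrN ger0_norm ?(ltW (d0 n))// => h1; lra.
  apply: filterS2 N1 N2' => n h1 h2; rewrite /seg [s <= t]leNgt st andbF mulr0.
  by rewrite !ramp_large// subrr.
have L1g n a : 0 <= a -> L1 lam (fun s : RM => ramp' (d n) a s * g s).
  move=> a0; have := L1_bd mg gC (L1_ramp' (d0 n) a0).
  by rewrite (_ : (fun s => g s * _) = (fun s => ramp' (d n) a s * g s))//; apply/funext => s; exact: mulrC.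
have E n : Int lam (fun s => ramp' (d n) (d n) s * g s) - Int lam (fun s => ramp' (d n) t s * g s) =
    - Int lam (fun s => (ramp (d n) (d n) s - ramp (d n) t s) * B s).
  rewrite -(IntB (L1g n _ (ltW (d0 n))) (L1g n _ (ltW t0))) -H//.
  - by apply: eq_Int => s; rewrite mulrBl.
  - exact: le_lt_trans ht.
  - by have := dh n; lra.
have e : theta 1 * g0 - theta 1 * v = - Int lam (fun s => theta 1 * seg t s * B s).
  by apply: (seq_cvg_eq E); [exact: cvgB|exact: cvgN].
have t10 := theta1_gt0.
have e2 : Int lam (fun s => theta 1 * seg t s * B s) = theta 1 * prim B t.
  by rewrite /prim -(IntZ (theta 1) (L1_segM t LB)); apply: eq_Int => s; rewrite mulrA.
rewrite e2 in e; apply: (mulfI (lt0r_neq0 t10)).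
by rewrite mulrBr; apply: oppr_inj; rewrite opprB e.
Qed.

(** Lebesgue's differentiation theorem: the derivative of the primitive is [B] almost everywhere,
    and zero near each interior time. *)
Lemma prim_eq0_ae (B : RM -> R) T : L1 lam B -> (forall t, 0 < t < T -> prim B t = 0) ->
  {ae lam, forall t : RM, 0 < t < T -> B t = 0}.
Proof.
move=> LB h.
have LB' (y : R) : lebesgue_measure.-integrable [set` Interval (BLeft 0) (BRight y)] (EFin \o B).
  by apply: integrableS LB => //; exact: measurable_itv.
have ll : locally_integrable [set: R] B.
  by apply: open_integrable_locally => //; exact: openT.
have := FTC1 LB' ll; apply: (@filterS _ _ (ae_filter_ringOfSetsType (@lebesgue_measure R))) => t ht /andP[t0 tT].
have {}ht := ht ltac:(by rewrite (@lte_fin R)); have [_ <-] := ht.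
rewrite derive1E.
have E (x : R) : (\int[lebesgue_measure]_(s in [set` Interval (BLeft 0) (BRight x)]) B s)%R = prim B x.
  rewrite /prim !IntDef Rintegral_mkcond; apply: eq_Rintegral => s _.
  by rewrite patchE in_seg /seg; case: ifP; rewrite ?mul1r ?mul0r.
have [//] : is_derive t 1 (fun x : R => (\int[lebesgue_measure]_(s in [set` Interval (BLeft 0) (BRight x)]) B s)%R) 0.
apply: (@near_eq_is_derive _ _ _ (fun _ : R => 0 : R)).
near=> y; rewrite E h//; apply/andP; split.
  by near: y; exact: (lt_nbhsr t0).
by near: y; exact: (lt_nbhsl tT).
Unshelve. all: end_near. Qed.

(** An instance of [time_primitive] with the zero function for [g] shows that the primitive of [B]
    vanishes. *)
Lemma time_fundamental (B : RM -> R) T : L1 lam B ->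
  (forall d a b, 0 < d -> 0 < a -> a < b -> b + d < T ->
    Int lam (fun s => (ramp d a s - ramp d b s) * B s) = 0) ->
  {ae lam, forall t : RM, 0 < t < T -> B t = 0}.
Proof.
move=> LB H; apply: prim_eq0_ae => // t tT.
have rl a : right_limit (fun=> 0) a 0.
  by move=> e e0; exists 1 => //; apply: aeW => s _; rewrite subrr normr0 ltW.
have C0 (s : RM) : `|0 : R| <= 0 by rewrite normr0.
have := @time_primitive (fun=> 0) B T 0 0 t 0 (measurable_cst (0 : R)) C0 LB tT.
rewrite subrr => <- // d a b d0 a0 ab bT.
rewrite H// oppr0 (_ : (fun s => _) = fun=> 0) ?Int0//.
by apply/funext => s; rewrite mulr0.
Qed.

End time_cutoff.

(** * The evolution of the truncated energy *)

Section evolution.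
Context {R : realType}.
Notation RM := (measurableTypeR R).
Notation KK := (@KK R).
Local Opaque N2 rh sg mm beta beta1 beta2.

Definition jmeas (F : RM -> PL R -> R) : Prop := measurable_fun setT (fun p : RM * PL R => F p.1 p.2).

Lemma jmeasD F G : jmeas F -> jmeas G -> jmeas (fun s x => F s x + G s x).
Proof. exact: measurable_funD. Qed.

Lemma jmeasB F G : jmeas F -> jmeas G -> jmeas (fun s x => F s x - G s x).
Proof. exact: measurable_funB. Qed.

Lemma jmeasM F G : jmeas F -> jmeas G -> jmeas (fun s x => F s x * G s x).
Proof. exact: measurable_funM. Qed.

Lemma jmeasN F : jmeas F -> jmeas (fun s x => - F s x).
Proof. exact: measurableT_comp. Qed.

Lemma jmeas_abs F : jmeas F -> jmeas (fun s x => `|F s x|).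
Proof. exact: mabs. Qed.

Lemma jmeas_comp (h : R -> R) F : continuous h -> jmeas F -> jmeas (fun s x => h (F s x)).
Proof. by move=> ch mF; apply: (mcomp (f := (h : RM -> R)) _ mF); exact: continuous_measurable_fun. Qed.

Lemma jmeas_time (k : RM -> R) : measurable_fun setT k -> jmeas (fun s _ => k s).
Proof. by move=> mk; exact: mcomp mk measurable_fst. Qed.

Lemma jmeas_Int F : jmeas F -> measurable_fun setT (fun s => Int lam2 (F s)).
Proof. by move=> mF; exact: (meas_Int lam2 (F := F)). Qed.

Lemma jmeas_sqr F : jmeas F -> jmeas (fun s x => F s x ^+ 2).
Proof. by move=> mF; exact: measurable_funX. Qed.

Lemma jmeas_N2sq F : jmeas F -> measurable_fun setT (fun s => N2 lam2 (F s) ^+ 2).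
Proof.
move=> mF; have := jmeas_Int (jmeas_sqr mF).
by rewrite (_ : (fun s => _) = (fun s => N2 lam2 (F s) ^+ 2))//; apply/funext => s; rewrite N2sq.
Qed.

Lemma jmeas_N2 F : jmeas F -> measurable_fun setT (fun s => N2 lam2 (F s)).
Proof.
move=> mF; have h : measurable_fun setT (Num.sqrt : RM -> R).
  by apply: continuous_measurable_fun; exact: sqrt_continuous.
have := mcomp h (jmeas_N2sq mF).
rewrite (_ : (fun s => _) = (fun s => N2 lam2 (F s)))//.
by apply/funext => s; rewrite sqrtr_sqr ger0_norm// N2_ge0.
Qed.

Lemma jmeas_cv K F : measurable_fun setT K -> jmeas F -> jmeas (fun s => cv K (F s)).
Proof.
move=> mK mF.
have := meas_Int lam2 (F := fun (p : RM * PL R) (y : PL R) => K (y - p.2) * F p.1 y).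
rewrite (_ : (fun p => Int _ _) = (fun p : RM * PL R => cv K (F p.1) p.2)); last by apply/funext => p; rewrite cvE.
apply; apply: measurable_funM.
  apply: (mcomp mK); apply: m2B; first exact: measurable_snd.
  exact: (mcomp measurable_snd measurable_fst).
apply: (mcomp2 mF); last exact: measurable_snd.
exact: (mcomp measurable_fst measurable_fst).
Qed.

Variables (u du U dU : RM -> 'I_2 -> PL R -> R) (D2 : RM -> PL R -> R) (M T : R).
Hypotheses (mu : forall i, jmeas (fun s => u s i)) (mdu : forall i, jmeas (fun s => du s i))
  (mU : forall i, jmeas (fun s => U s i)) (mdU : forall i, jmeas (fun s => dU s i)) (mD2 : jmeas D2).
Hypotheses (su : forall s, slice (u s) (du s)) (sU : forall s, slice (U s) (dU s)).
Hypotheses (LD2 : forall s, L2 lam2 (D2 s)) (wD2 : forall s, wd 1 (U s 0) (D2 s)).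
Hypotheses (hu : forall s i, N2 lam2 (u s i) <= M) (hU : forall s i, N2 lam2 (U s i) <= M).
Hypotheses (idu : forall i, L1 lam (fun s => seg T s * N2 lam2 (du s i) ^+ 2))
  (idU : forall i, L1 lam (fun s => seg T s * N2 lam2 (dU s i) ^+ 2))
  (iD2 : L1 lam (fun s => seg T s * N2 lam2 (D2 s) ^+ 2)).

Notation w s i := (fun x : PL R => u s i x - U s i x).
Notation dw s i := (fun x : PL R => du s i x - dU s i x).
Notation f s k j := (fun x : PL R => u s k x * u s j x - U s k x * U s j x).
Notation B n i s x := (mollified_force (u s) (du s) (U s) (dU s) n i x).
Notation V n i s := (cv (mm n) (w s i)).

(** A single integrable weight in time of which multiples dominate all quantities below, uniformly
    in the mollification. The summand 1 makes it dominate bounded quantities too. *)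
Definition load (s : RM) : R := 1 + (N2 lam2 (du s 0) ^+ 2 + N2 lam2 (du s 1) ^+ 2) +
  (N2 lam2 (dU s 0) ^+ 2 + N2 lam2 (dU s 1) ^+ 2) + N2 lam2 (D2 s) ^+ 2.

Let M0 : 0 <= M. Proof. exact: le_trans (N2_ge0 _ _) (hu 0 0). Qed.
Let Lu s i : L2 lam2 (u s i). Proof. by case: (su s). Qed.
Let LU s i : L2 lam2 (U s i). Proof. by case: (sU s). Qed.
Let Ldu s i : L2 lam2 (du s i). Proof. by case: (su s). Qed.
Let LdU s i : L2 lam2 (dU s i). Proof. by case: (sU s). Qed.
Let Lw s i : L2 lam2 (w s i). Proof. exact: L2B. Qed.
Let Ldw s i : L2 lam2 (dw s i). Proof. exact: L2B. Qed.
Let Lf s k j : L1 lam2 (f s k j). Proof. by apply: L1B; exact: L2M. Qed.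
Let mw i : jmeas (fun s => w s i). Proof. exact: jmeasB. Qed.
Let mdw i : jmeas (fun s => dw s i). Proof. exact: jmeasB. Qed.
Let mf k j : jmeas (fun s => f s k j). Proof. by apply: jmeasB; exact: jmeasM. Qed.

Lemma load_ge1 s : 1 <= load s.
Proof. by rewrite /load -!addrA lerDl !addr_ge0 ?sqr_ge0. Qed.

Lemma load_ge0 s : 0 <= load s. Proof. exact: le_trans ler01 (load_ge1 s). Qed.

Lemma meas_load : measurable_fun setT load.
Proof.
by apply: measurable_funD; [apply: measurable_funD; [apply: measurable_funD => //|]|];
  try (apply: measurable_funD); exact: jmeas_N2sq.
Qed.

Lemma L1_load : L1 lam (fun s => seg T s * load s).
Proof.
have := L1D (L1D (L1D (L1_seg T) (L1D (idu 0) (idu 1))) (L1D (idU 0) (idU 1))) iD2.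
by rewrite (_ : (fun s => _) = (fun s => seg T s * load s))//; apply/funext => s; rewrite /load; ring.
Qed.

Lemma N2w_bound s i : N2 lam2 (w s i) <= 2 * M.
Proof.
have h := N2B (Lu s i) (LU s i); apply: (le_trans h).
by have := hu s i; have := hU s i; lra.
Qed.

Lemma self_le_sqr (a b : R) : a ^+ 2 <= b -> a <= 1 + b.
Proof. by move=> h; have := sqr_ge0 (a - 1); nra. Qed.

Lemma N2dw_bound s i : N2 lam2 (dw s i) <= 2 * load s.
Proof.
have h := N2B (Ldu s i) (LdU s i); apply: (le_trans h).
have I2 := ordinal2.
have q := fun g : PL R -> R => sqr_ge0 (N2 lam2 g).
have h1 : N2 lam2 (du s i) <= load s.
  have := @self_le_sqr (N2 lam2 (du s i)) _ (lexx _); rewrite /load.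
  have := q (du s 0); have := q (du s 1); have := q (dU s 0); have := q (dU s 1); have := q (D2 s).
  by have [->|->] := I2 i; lra.
have h2 : N2 lam2 (dU s i) <= load s.
  have := @self_le_sqr (N2 lam2 (dU s i)) _ (lexx _); rewrite /load.
  have := q (du s 0); have := q (du s 1); have := q (dU s 0); have := q (dU s 1); have := q (D2 s).
  by have [->|->] := I2 i; lra.
lra.
Qed.

Lemma Int_f_bound s k j : Int lam2 (fun x => `|f s k j x|) <= 2 * M ^+ 2.
Proof.
have a1 := L1_abs (L2M (Lu s k) (Lu s j)); have a2 := L1_abs (L2M (LU s k) (LU s j)).
apply: (@le_trans _ _ (Int lam2 (fun x => `|u s k x * u s j x| + `|U s k x * U s j x|))).
  apply: le_Int; [exact: L1_abs|exact: L1D|move=> x; exact: ler_normB].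
rewrite (IntD a1 a2).
have h1 := CS (Lu s k) (Lu s j); have h2 := CS (LU s k) (LU s j).
have mm2 (a b : R) : 0 <= a <= M -> 0 <= b <= M -> a * b <= M ^+ 2.
  by move=> /andP[? ?] /andP[? ?]; rewrite expr2; apply: ler_pM.
have -> : 2 * M ^+ 2 = M ^+ 2 + M ^+ 2 by ring.
by apply: lerD; [apply: (le_trans h1)|apply: (le_trans h2)]; apply: mm2; rewrite N2_ge0 ?hu ?hU.
Qed.

(** The L2 bound serves the pairing with [beta1] in space, the pointwise bound the integration in
    time at a fixed point of the plane. *)
Definition controlled (H : RM -> PL R -> R) : Prop := jmeas H /\ exists C : R, 0 <= C /\ forall s,
  [/\ L2 lam2 (H s), N2 lam2 (H s) <= C * load s & forall x, `|H s x| <= C * load s].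

Lemma controlledD H H' : controlled H -> controlled H' -> controlled (fun s x => H s x + H' s x).
Proof.
move=> [m [C [C0 h]]] [m' [C' [C'0 h']]]; split; first exact: jmeasD.
exists (C + C'); split; first exact: addr_ge0.
move=> s; have [a1 a2 a3] := h s; have [b1 b2 b3] := h' s; split; first exact: L2D.
  have k := N2D a1 b1; by rewrite mulrDl (le_trans k)// lerD.
by move=> x; rewrite mulrDl (le_trans (ler_normD _ _))// lerD.
Qed.

Lemma controlledN H : controlled H -> controlled (fun s x => - H s x).
Proof.
move=> [m [C [C0 h]]]; split; first exact: jmeasN.
exists C; split=> // s; have [a1 a2 a3] := h s; split; first exact: L2N.
  by rewrite N2N.
by move=> x; rewrite normrN.
Qed.

Lemma controlled_f K k j : ker K -> controlled (fun s => cv K (f s k j)).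
Proof.
move=> kK; split; first exact: (jmeas_cv kK.1).
have [_ [C [_ C0 hC _ _]]] := ker_bd kK.
pose c := Num.max C (N2 lam2 (fun z : PL R => K (- z))).
have c0 : 0 <= c by rewrite le_max C0.
exists (c * (2 * M ^+ 2)); split; first by rewrite !mulr_ge0// sqr_ge0.
move=> s; have [L h] := cv_L1L2 kK (Lf s k j).
have I0 : 0 <= Int lam2 (fun x => `|f s k j x|) by exact: Int_ge0.
have b a : 0 <= a <= c -> a * Int lam2 (fun x => `|f s k j x|) <= c * (2 * M ^+ 2) * load s.
  move=> /andP[a0 ac]; apply: (@le_trans _ _ (c * (2 * M ^+ 2))).
    by apply: ler_pM => //; exact: Int_f_bound.
  by rewrite ler_peMr ?load_ge1// !mulr_ge0// sqr_ge0.
split=> //.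
  by apply: (le_trans h); apply: b; rewrite N2_ge0/= le_max lexx orbT.
by move=> x; apply: (le_trans (cv_bd1 x kK hC (Lf s k j))); apply: b; rewrite C0/= le_max lexx.
Qed.

Lemma controlled_dw K i : ker K -> controlled (fun s => cv K (dw s i)).
Proof.
move=> kK; split; first exact: (jmeas_cv kK.1).
pose c := Num.max (Int lam2 (fun z => `|K z|)) (N2 lam2 K).
have c0 : 0 <= c by rewrite le_max N2_ge0 orbT.
exists (c * 2); split; first by rewrite !mulr_ge0.
move=> s; have [L h] := cv_L2 kK (Ldw s i).
have b a : 0 <= a <= c -> a * N2 lam2 (dw s i) <= c * 2 * load s.
  by move=> /andP[a0 ac]; rewrite -mulrA; apply: ler_pM; rewrite ?N2_ge0//; exact: N2dw_bound.
split=> //.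
  by apply: (le_trans h); apply: b; rewrite Int_ge0//= le_max lexx.
by move=> x; apply: (le_trans (cv_bd x kK (Ldw s i))); apply: b; rewrite N2_ge0/= le_max lexx orbT.
Qed.

Lemma controlled_force n i : controlled (fun s x => B n i s x).
Proof.
have kp j := ker_pd j (sker_mm (R := R) n).
have k2 j k l : ker (pd j (pd k (KK n l)) : PL R -> R) by apply: ker_pd; exact: sker_pdKK.
rewrite /mollified_force /dpressure.
apply: controlledD; last by apply: controlledN; exact: controlled_dw.
apply: controlledD; first by apply: controlledD; exact: controlled_f.
by apply: controlledD; apply: controlledD; apply: controlledN; exact: controlled_f.
Qed.

Section energy_identity.
Variables (n : nat) (i : 'I_2) (e : R).
Hypothesis e0 : 0 < e.

Let mV : jmeas (fun s => V n i s).
Proof. by apply: jmeas_cv; [exact: (ker_mm n).1|exact: mw]. Qed.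

Let mb1 : jmeas (fun s x => beta1 e (V n i s x)).
Proof. exact: (jmeas_comp (beta1_continuous (ltW e0)) mV). Qed.

Lemma power_bound : exists2 C : R, 0 <= C & forall s, L1 lam2 (fun x => beta1 e (V n i s x) * B n i s x) /\
  Int lam2 (fun x => `|beta1 e (V n i s x) * B n i s x|) <= C * load s.
Proof.
have [mB [C [C0 hC]]] := controlled_force n i.
exists (4 * M * C); first by rewrite !mulr_ge0.
move=> s; have [L h _] := hC s.
have [Lb hb] := beta1_L2 n (Lw s i) e0.
split; first exact: L2M.
have k := CS Lb L; apply: (le_trans k); rewrite -[leRHS]mulrA; apply: ler_pM; rewrite ?N2_ge0//.
apply: (le_trans hb); have := N2w_bound s i; lra.
Qed.

(** At each point of the plane the mollified difference is a primitive in time of the force, so the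
    chain rule applies pointwise; Fubini's theorem then exchanges space and time. *)
Lemma energy_identity t : 0 < t -> t <= T ->
  {ae lam, forall s : RM, 0 < s < T -> forall x, V n i s x = prim (fun r => B n i r x) s} ->
  (forall x, V n i t x = prim (fun r => B n i r x) t) ->
  Int lam2 (fun x => beta e (V n i t x)) =
  prim (fun s => Int lam2 (fun x => beta1 e (V n i s x) * B n i s x)) t.
Proof.
move=> t0 tT hV ht.
have [mB [C [C0 hC]]] := controlled_force n i.
have [C' C'0 hC'] := power_bound.
pose b x s := seg T s * B n i s x.
have mb x : measurable_fun setT (b x).
  apply: measurable_funM; first exact: meas_seg.
  apply: (mcomp2 mB); [exact: measurable_id|exact: measurable_cst].
have Lb x : L1 lam (b x).
  apply: (L1_le (mb x) (L1Z C L1_load)) => s.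
  rewrite normrM (ger0_norm (seg_ge0 T s)) mulrCA; apply: ler_wpM2l; first exact: seg_ge0.
  by have [_ _ ->] := hC s.
have Pb x s : s <= T -> prim (b x) s = prim (fun r => B n i r x) s.
  move=> sT; apply: eq_Int => r; rewrite /b /seg; case: ifP; rewrite ?mul0r// => /andP[r0 rs].
  by rewrite r0 (le_trans rs sT) !mul1r.
have E x : beta e (V n i t x) = Int lam (fun s => seg t s * (beta1 e (V n i s x) * B n i s x)).
  rewrite ht -Pb//.
  have := prim_chain (Lb x) (fun s => beta_derive s (ltW e0)) (beta1_continuous (ltW e0)) t0.
  rewrite beta0 subr0 => ->.
  apply: ae_eq_Int.
  - apply: measurable_funM; first exact: meas_seg.
    apply: measurable_funM => //.
    have c : measurable_fun setT (beta1 e : RM -> R).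
      by apply: continuous_measurable_fun; exact: (beta1_continuous (ltW e0)).
    by apply: (mcomp c); exact: meas_prim.
  - apply: measurable_funM; first exact: meas_seg.
    apply: measurable_funM.
      by apply: (mcomp2 mb1); [exact: measurable_id|exact: measurable_cst].
    by apply: (mcomp2 mB); [exact: measurable_id|exact: measurable_cst].
  have n0 : {ae lam, forall s : RM, s <> 0 /\ s <> t}.
    have a (r : R) : {ae lam, forall s : RM, s <> r}.
      exists [set r]; split; [exact: measurable_set1|exact: lebesgue_measure_set1|].
      by move=> y /= h1; apply: contrapT => x0; apply: h1.
    by apply: filterS2 (a 0) (a t).
  apply: filterS2 hV n0 => s hs [s0 st] _; rewrite /seg; case: ifP; rewrite ?mul0r// => /andP[h1 h2].
  have s1 : 0 < s by rewrite lt_neqAle h1 andbT eq_sym; apply/eqP.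
  have s2 : s < t by rewrite lt_neqAle h2 andbT; apply/eqP.
  have sT := lt_le_trans s2 tT.
  rewrite !mul1r /= hs ?s1// Pb ?(ltW sT)//; congr (_ * _).
  by rewrite /b /seg h1 (ltW sT) mul1r.
have Lp : L1 (lam \x lam2)%E (fun p : RM * PL R => seg t p.1 * (beta1 e (V n i p.1 p.2) * B n i p.1 p.2)).
  apply: (prodL1 (F := fun s x => seg t s * (beta1 e (V n i s x) * B n i s x))).
  - apply: measurable_funM; first exact: (mcomp (meas_seg t) measurable_fst).
    exact: (jmeasM mb1 mB).
  - by move=> s; apply: L1Z; exact: (hC' s).1.
  - apply: (L1_le _ (L1Z C' L1_load)).
      apply: jmeas_Int; apply: jmeas_abs; apply: (jmeasM (F := fun s _ => seg t s)); first by apply: jmeas_time; exact: meas_seg.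
      exact: (jmeasM mb1 mB).
    move=> s; rewrite ger0_norm; last exact: Int_ge0.
    have [h1 h2] := hC' s.
    rewrite (@eq_Int _ _ _ _ _ (fun x => seg t s * `|beta1 e (V n i s x) * B n i s x|)); last first.
      by move=> x; rewrite normrM (ger0_norm (seg_ge0 t s)).
    rewrite (IntZ _ (L1_abs h1)) mulrCA; apply: ler_pM; rewrite ?seg_ge0 ?Int_ge0//.
    exact: seg_sub.
rewrite (@eq_Int _ _ _ _ _ _ E).
have h := fubE (F := fun s x => seg t s * (beta1 e (V n i s x) * B n i s x)) Lp.
rewrite -h; apply: eq_Int => s.
by rewrite (IntZ (seg t s) (hC' s).1).
Qed.

End energy_identity.

Definition dominated (b : RM -> R) : Prop := measurable_fun setT b /\
  exists2 C : R, 0 <= C & forall s, `|b s| <= C * load s.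

Lemma dominated_L1 b t : t <= T -> dominated b -> L1 lam (fun s => seg t s * b s).
Proof.
move=> tT [mb [C C0 hC]].
apply: (L1_le _ (L1Z C L1_load)); first by apply: measurable_funM => //; exact: meas_seg.
move=> s; rewrite normrM (ger0_norm (seg_ge0 t s)) mulrCA; apply: ler_pM => //; [exact: seg_ge0|exact: seg_sub].
Qed.

Lemma dominatedD b b' : dominated b -> dominated b' -> dominated (fun s => b s + b' s).
Proof.
move=> [m [C C0 h]] [m' [C' C'0 h']]; split; first exact: measurable_funD.
exists (C + C'); first exact: addr_ge0.
by move=> s; rewrite mulrDl (le_trans (ler_normD _ _))// lerD.
Qed.

Lemma dominatedZ a b : dominated b -> dominated (fun s => a * b s).
Proof.
move=> [m [C C0 h]]; split; first by apply: measurable_funM.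
exists (`|a| * C); first exact: mulr_ge0.
by move=> s; rewrite normrM -mulrA ler_wpM2l.
Qed.

Lemma dominated_load : dominated load.
Proof. by split; [exact: meas_load|exists 1 => // s; rewrite mul1r ger0_norm// load_ge0]. Qed.

Lemma primD b b' t : t <= T -> dominated b -> dominated b' ->
  prim (fun s => b s + b' s) t = prim b t + prim b' t.
Proof.
move=> tT h h'; rewrite /prim -(IntD (dominated_L1 tT h) (dominated_L1 tT h')).
by apply: eq_Int => s; rewrite mulrDr.
Qed.

Lemma primZ a b t : t <= T -> dominated b -> prim (fun s => a * b s) t = a * prim b t.
Proof.
move=> tT h; rewrite /prim -(IntZ a (dominated_L1 tT h)).
by apply: eq_Int => s; rewrite mulrCA.
Qed.

Lemma prim_le b b' t : t <= T -> dominated b -> dominated b' -> (forall s, b s <= b' s) ->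
  prim b t <= prim b' t.
Proof.
move=> tT h h' hb; apply: le_Int; [exact: dominated_L1|exact: dominated_L1|move=> s].
by apply: ler_wpM2l => //; exact: seg_ge0.
Qed.

Lemma prim_cvg0 (r : nat -> RM -> R) C t : t <= T -> (forall n, measurable_fun setT (r n)) ->
  (forall n s, `|r n s| <= C * load s) -> (forall s, (fun n => r n s) @ \oo --> (0 : R)) ->
  (fun n => prim (r n) t) @ \oo --> (0 : R).
Proof.
move=> tT mr hr cr.
have [_ c] : L1 lam (fun=> 0 : R) /\ (fun n => prim (r n) t) @ \oo --> Int lam (fun _ : RM => (0 : R)).
  apply: (Int_dct (f_ := fun n s => seg t s * r n s) (g := fun s => C * (seg T s * load s))).
  - by move=> n; apply: measurable_funM => //; exact: meas_seg.
  - by move=> s; rewrite -[X in _ --> X](mulr0 (seg t s)); apply: cvgMr; exact: cr.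
  - by apply: L1Z; exact: L1_load.
  - move=> n s; rewrite normrM (ger0_norm (seg_ge0 t s)) mulrCA.
    by apply: ler_pM => //; [exact: seg_ge0|exact: seg_sub].
by rewrite Int0 in c.
Qed.

Lemma sqr_le_load s i : N2 lam2 (du s i) ^+ 2 <= load s /\ N2 lam2 (dU s i) ^+ 2 <= load s /\
  N2 lam2 (D2 s) ^+ 2 <= load s.
Proof.
have I2 := ordinal2.
have q := fun g : PL R -> R => sqr_ge0 (N2 lam2 g).
have q1 := q (du s 0); have q2 := q (du s 1); have q3 := q (dU s 0); have q4 := q (dU s 1); have q5 := q (D2 s).
rewrite /load; by have [->|->] := I2 i; split; [|split| |split]; lra.
Qed.

Lemma le_sqr_sum2 (a b c : R) : 0 <= a -> a <= b + c -> a ^+ 2 <= 2 * (b ^+ 2 + c ^+ 2).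
Proof.
move=> a0 h; apply: (@le_trans _ _ ((b + c) ^+ 2)); first by rewrite lerXn2r ?nnegrE// (le_trans a0).
by have := sqr_ge0 (b - c); nra.
Qed.

Lemma N2dw_sqr s i : N2 lam2 (dw s i) ^+ 2 <= 4 * load s.
Proof.
have h := le_sqr_sum2 (N2_ge0 _ _) (N2B (Ldu s i) (LdU s i)); apply: (le_trans h).
have [h1 [h2 _]] := sqr_le_load s i; lra.
Qed.

Notation Q n s := (Int lam2 (fun x => `|transport_commutator (u s) (U s) n 0 x|) +
  Int lam2 (fun x => `|transport_commutator (u s) (U s) n 1 x|)).
Notation P n s := (N2 lam2 (dw s 0) ^+ 2 - N2 lam2 (cv (mm n) (dw s 0)) ^+ 2 +
  (N2 lam2 (dw s 1) ^+ 2 - N2 lam2 (cv (mm n) (dw s 1)) ^+ 2)).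
Notation E n s := (N2 lam2 (fun x => cv (mm n) (dw s 0) x - dw s 0 x) ^+ 2 +
  N2 lam2 (fun x => cv (mm n) (dw s 1) x - dw s 1 x) ^+ 2).

Lemma meas_commutator n i : measurable_fun setT (fun s =>
  Int lam2 (fun x => `|transport_commutator (u s) (U s) n i x|)).
Proof.
have kp j := ker_pd j (sker_mm (R := R) n).
apply: jmeas_Int; apply: jmeas_abs; rewrite /transport_commutator /comm.
apply: jmeasB; apply: jmeasD.
- by apply: jmeas_cv; [exact: (kp 0).1|exact: jmeasM].
- by apply: jmeas_cv; [exact: (kp 1).1|exact: jmeasM].
- by apply: jmeasM => //; apply: jmeas_cv; [exact: (kp 0).1|exact: mw].
- by apply: jmeasM => //; apply: jmeas_cv; [exact: (kp 1).1|exact: mw].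
Qed.

(** Uniform in n, hence a majorant for dominated convergence in time; the convergence at a fixed
    time is [commutator_cvg]. *)
Lemma commutator_bound : exists2 C : R, 0 <= C & forall n i s,
  Int lam2 (fun x => `|transport_commutator (u s) (U s) n i x|) <= C * load s.
Proof.
have [C C0 hC] := @Int_pd_mol R.
exists ((2 * C + 1) * (8 * M * 2 + 2 * M * 2 + 4 * M ^+ 2)).
  by rewrite mulr_ge0// ?addr_ge0 ?mulr_ge0 ?sqr_ge0.
move=> n i s; have [Lu' Ldu' wu' wv'] := su s.
have [_ _ ww' _] := slice_sub (su s) (sU s).
have h := comm_bd (Lu' 0) (Lu' 1) (Ldu' 0) (Ldu' 1) (Lw s i) (Ldw s i) (wu' 0) (wu' 1) wv' (ww' i) C0 hC n.
apply: (le_trans h); rewrite -[leRHS]mulrA; apply: ler_wpM2l; first by rewrite addr_ge0 ?mulr_ge0.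
have [h1 _] := sqr_le_load s 0; have [h2 _] := sqr_le_load s 1.
have l1 := load_ge1 s.
have a1 : N2 lam2 (du s 0) + N2 lam2 (du s 1) <= 4 * load s.
  have := self_le_sqr h1; have := self_le_sqr h2; lra.
have a2 := N2w_bound s i; have a3 := N2dw_bound s i; have a4 := hu s 0; have a5 := hu s 1.
have z g : 0 <= N2 lam2 (g : PL R -> R) by exact: N2_ge0.
have b1 : (N2 lam2 (du s 0) + N2 lam2 (du s 1)) * (2 * N2 lam2 (w s i)) <= 4 * load s * (2 * (2 * M)).
  by apply: ler_pM; rewrite ?addr_ge0 ?mulr_ge0//; apply: ler_wpM2l.
have b2 : 2 * N2 lam2 (u s 0) * N2 lam2 (dw s i) <= 2 * M * (2 * load s).
  by apply: ler_pM; rewrite ?mulr_ge0//; apply: ler_wpM2l.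
have b3 : (N2 lam2 (u s 0) + N2 lam2 (u s 1)) * N2 lam2 (w s i) <= 2 * M * (2 * M).
  by apply: ler_pM; rewrite ?addr_ge0//; lra.
have M2 : 0 <= M ^+ 2 by exact: sqr_ge0.
have b4 : 4 * M ^+ 2 <= 4 * M ^+ 2 * load s by rewrite ler_peMr// mulr_ge0.
apply: (le_trans (lerD (lerD b1 b2) b3)).
have -> : (8 * M * 2 + 2 * M * 2 + 4 * M ^+ 2) * load s =
  4 * load s * (2 * (2 * M)) + 2 * M * (2 * load s) + 4 * M ^+ 2 * load s by ring.
rewrite lerD2l; apply: le_trans b4; rewrite le_eqVlt; apply/orP; left; apply/eqP; ring.
Qed.

Lemma commutator_cvg i s :
  (fun n => Int lam2 (fun x => `|transport_commutator (u s) (U s) n i x|)) @ \oo --> (0 : R).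
Proof.
have [Lu' Ldu' wu' wv'] := su s.
have [_ _ ww' _] := slice_sub (su s) (sU s).
exact: (comm_cvg (Lu' 0) (Lu' 1) (Ldu' 0) (Ldu' 1) (Lw s i) (Ldw s i) (wu' 0) (wu' 1) wv' (ww' i)).
Qed.

Lemma error_bound n i s : N2 lam2 (fun x => cv (mm n) (dw s i) x - dw s i x) ^+ 2 <= 40 * load s.
Proof.
have [L h] := N2_cv_mm n (Ldw s i).
have k := N2B L (Ldw s i).
have k2 := le_sqr_sum2 (N2_ge0 _ _) k; apply: (le_trans k2).
have h2 : N2 lam2 (cv (mm n) (dw s i)) ^+ 2 <= 4 * N2 lam2 (dw s i) ^+ 2.
  have -> : 4 * N2 lam2 (dw s i) ^+ 2 = (2 * N2 lam2 (dw s i)) ^+ 2 by ring.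
  by rewrite lerXn2r ?nnegrE ?mulr_ge0 ?N2_ge0.
have := N2dw_sqr s i; lra.
Qed.

Lemma dissipation_bound n i s : `|N2 lam2 (dw s i) ^+ 2 - N2 lam2 (cv (mm n) (dw s i)) ^+ 2| <= 20 * load s.
Proof.
have [L h] := N2_cv_mm n (Ldw s i).
have h2 : N2 lam2 (cv (mm n) (dw s i)) ^+ 2 <= 4 * N2 lam2 (dw s i) ^+ 2.
  have -> : 4 * N2 lam2 (dw s i) ^+ 2 = (2 * N2 lam2 (dw s i)) ^+ 2 by ring.
  by rewrite lerXn2r ?nnegrE ?mulr_ge0 ?N2_ge0.
have a := sqr_ge0 (N2 lam2 (dw s i)); have b := sqr_ge0 (N2 lam2 (cv (mm n) (dw s i))).
have c := N2dw_sqr s i; have l0 := load_ge0 s.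
move: a b c h2 l0; move: (_ ^+ 2) (_ ^+ 2) (load s) => x y z a b c d l.
by rewrite ler_norml; apply/andP; split; lra.
Qed.

Lemma dissipation_cvg i s :
  (fun n => N2 lam2 (dw s i) ^+ 2 - N2 lam2 (cv (mm n) (dw s i)) ^+ 2) @ \oo --> (0 : R).
Proof.
have c : (fun n => N2 lam2 (cv (mm n) (dw s i))) @ \oo --> N2 lam2 (dw s i).
  apply: (@cvg_dist0 _ _ (fun n => N2 lam2 (fun x => cv (mm n) (dw s i) x - dw s i x))); last exact: mm_cvg.
  by move=> n; have [L _] := N2_cv_mm n (Ldw s i); have h := N2_tri L (Ldw s i); exact: h.
rewrite -[X in _ --> X](subrr (N2 lam2 (dw s i) ^+ 2)).
by apply: cvgB; [exact: cvg_cst|rewrite expr2; under eq_fun do rewrite expr2; exact: cvgM].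
Qed.

Lemma error_cvg i s :
  (fun n => N2 lam2 (fun x => cv (mm n) (dw s i) x - dw s i x) ^+ 2) @ \oo --> (0 : R).
Proof.
have c := mm_cvg (Ldw s i); rewrite -[X in _ --> X](mulr0 (0 : R)).
under eq_fun do rewrite expr2; exact: cvgM.
Qed.

(** The terms of the estimate that vanish as n tends to infinity while [e] and [mu'] are kept
    fixed. *)
Definition remainder (e mu' : R) (n : nat) (s : RM) : R :=
  (1 + e^-1) * Q n s + P n s + (1 + mu'^-1) * (8 * E n s).

Lemma remainder_meas e mu' n : measurable_fun setT (remainder e mu' n).
Proof.
have m1 i := meas_commutator n i.
have m2 i := jmeas_N2sq (mdw i).
have m3 i := jmeas_N2sq (jmeas_cv (ker_mm (R := R) n).1 (mdw i)).
have m4 i := jmeas_N2sq (jmeasB (jmeas_cv (ker_mm (R := R) n).1 (mdw i)) (mdw i)).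
apply: measurable_funD; [apply: measurable_funD|].
- by apply: measurable_funM => //; apply: measurable_funD.
- by apply: measurable_funD; apply: measurable_funB.
- by apply: measurable_funM => //; apply: measurable_funM => //; apply: measurable_funD.
Qed.

Lemma remainder_arith (k j a b c d f g C l : R) : 0 <= k -> 0 <= j -> 0 <= a -> 0 <= b -> 0 <= f -> 0 <= g ->
  a <= C * l -> b <= C * l -> `|c| <= 20 * l -> `|d| <= 20 * l -> f <= 40 * l -> g <= 40 * l ->
  `|k * (a + b) + (c + d) + j * (8 * (f + g))| <= (k * (C + C) + 40 + j * 640) * l.
Proof.
move=> k0 j0 a0 b0 f0 g0 a1 b1 c1 d1 f1 g1.
have h1 : `|k * (a + b)| <= k * (C * l + C * l).
  by rewrite normrM (ger0_norm k0) (ger0_norm (addr_ge0 a0 b0)); apply: ler_wpM2l => //; exact: lerD.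
have h2 : `|c + d| <= 40 * l by apply: (le_trans (ler_normD _ _)); lra.
have h3 : `|j * (8 * (f + g))| <= j * (640 * l).
  have fg : 0 <= 8 * (f + g) by lra.
  by rewrite normrM (ger0_norm j0) (ger0_norm fg); apply: ler_wpM2l => //; lra.
have -> : (k * (C + C) + 40 + j * 640) * l = k * (C * l + C * l) + 40 * l + j * (640 * l) by ring.
apply: (le_trans (ler_normD _ _)); apply: lerD => //.
by apply: (le_trans (ler_normD _ _)); apply: lerD.
Qed.

Lemma remainder_bound e mu' : 0 < e -> 0 < mu' ->
  exists2 C : R, 0 <= C & forall n s, `|remainder e mu' n s| <= C * load s.
Proof.
move=> e0 mu0; have [C C0 hC] := commutator_bound.
have e1 : 0 <= 1 + e^-1 by rewrite addr_ge0// invr_ge0 ltW.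
have mu1 : 0 <= 1 + mu'^-1 by rewrite addr_ge0// invr_ge0 ltW.
exists ((1 + e^-1) * (C + C) + 40 + (1 + mu'^-1) * 640).
  exact: (addr_ge0 (addr_ge0 (mulr_ge0 e1 (addr_ge0 C0 C0)) (ler0n _ 40)) (mulr_ge0 mu1 (ler0n _ 640))).
move=> n s; rewrite /remainder.
have q0 := hC n 0 s; have q1 := hC n 1 s.
have p0 := dissipation_bound n 0 s; have p1 := dissipation_bound n 1 s.
have r0 := error_bound n 0 s; have r1 := error_bound n 1 s.
have z0 i : 0 <= Int lam2 (fun x => `|transport_commutator (u s) (U s) n i x|) by exact: Int_ge0.
have y0 i : 0 <= N2 lam2 (fun x => cv (mm n) (dw s i) x - dw s i x) ^+ 2 by exact: sqr_ge0.
exact: (remainder_arith e1 mu1 (z0 0) (z0 1) (y0 0) (y0 1) q0 q1 p0 p1 r0 r1).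
Qed.

Lemma remainder_cvg e mu' s : (fun n => remainder e mu' n s) @ \oo --> (0 : R).
Proof.
have q i := commutator_cvg i s; have p i := dissipation_cvg i s; have r i := error_cvg i s.
have -> : (0 : R) = (1 + e^-1) * (0 + 0) + (0 + 0) + (1 + mu'^-1) * (8 * (0 + 0)) by ring.
apply: cvgD; [apply: cvgD|].
- by apply: cvgMr; apply: cvgD; [exact: (q 0)|exact: (q 1)].
- by apply: cvgD; [exact: (p 0)|exact: (p 1)].
- by apply: cvgMr; apply: cvgMr; apply: cvgD; [exact: (r 0)|exact: (r 1)].
Qed.

Definition growth (s : RM) : R := (64 * 65 * ((1 + M) * (N2 lam2 (D2 s) + N2 lam2 (dU s 0)))) ^+ 2.
Definition gap (s : RM) : R := N2 lam2 (w s 0) ^+ 2 + N2 lam2 (w s 1) ^+ 2.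
Definition tails (m : R) (s : RM) : R := tail m (dw s 0) + tail m (dw s 1).

Lemma gap_bound s : 0 <= gap s <= 8 * M ^+ 2.
Proof.
rewrite addr_ge0 ?sqr_ge0//=.
have h i : N2 lam2 (w s i) ^+ 2 <= 4 * M ^+ 2.
  have -> : 4 * M ^+ 2 = (2 * M) ^+ 2 by ring.
  by rewrite lerXn2r ?nnegrE ?mulr_ge0 ?N2_ge0// N2w_bound.
by have := h 0; have := h 1; rewrite /gap; lra.
Qed.

Lemma meas_gap : measurable_fun setT gap.
Proof. by apply: measurable_funD; apply: jmeas_N2sq; exact: mw. Qed.

Lemma dominated_growth : dominated growth.
Proof.
split.
  apply: measurable_funX; apply: measurable_funM => //; apply: measurable_funM => //.
  by apply: measurable_funD; apply: jmeas_N2.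
exists ((64 * 65 * (1 + M)) ^+ 2 * 4); first by rewrite mulr_ge0 ?sqr_ge0.
move=> s; rewrite ger0_norm ?sqr_ge0// /growth.
have -> : (64 * 65 * ((1 + M) * (N2 lam2 (D2 s) + N2 lam2 (dU s 0)))) ^+ 2 =
  (64 * 65 * (1 + M)) ^+ 2 * (N2 lam2 (D2 s) + N2 lam2 (dU s 0)) ^+ 2 by ring.
rewrite -[leRHS]mulrA; apply: ler_wpM2l; first exact: sqr_ge0.
have h := @le_sqr_sum2 (N2 lam2 (D2 s) + N2 lam2 (dU s 0)) _ _ (addr_ge0 (N2_ge0 _ _) (N2_ge0 _ _)) (lexx _).
apply: (le_trans h); have [_ [h1 h2]] := sqr_le_load s 0; lra.
Qed.

Lemma dominated_gapM b : dominated b -> dominated (fun s => b s * gap s).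
Proof.
move=> [mb [C C0 hC]]; split; first by apply: measurable_funM => //; exact: meas_gap.
exists (C * (8 * M ^+ 2)); first by rewrite !mulr_ge0 ?sqr_ge0.
move=> s; have /andP[g0 g1] := gap_bound s; rewrite normrM (ger0_norm g0) mulrAC.
by apply: ler_pM.
Qed.

Lemma tail_le m (g : PL R -> R) : L2 lam2 g -> 0 <= tail m g <= N2 lam2 g ^+ 2.
Proof.
move=> Lg; rewrite Int_ge0 => [|x]; last by case: ifP => // _; exact: sqr_ge0.
rewrite N2sq; apply: le_Int0; [|exact: Lg.2|].
  apply: measurable_fun_ifT => //; last exact: measurable_funX Lg.1.
  by apply: measurable_fun_ltr => //; exact: measurable_funX Lg.1.
by move=> x; case: ifP => _; rewrite ?sqr_ge0 ?lexx.
Qed.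

Lemma tail_cvg (g : PL R -> R) : L2 lam2 g -> (fun k : nat => tail k%:R g) @ \oo --> (0 : R).
Proof.
move=> Lg.
have [_ c] : L1 lam2 (fun=> 0 : R) /\ (fun k : nat => tail k%:R g) @ \oo --> Int lam2 (fun _ : PL R => (0 : R)).
  apply: (Int_dct (f_ := fun k x => if k%:R < g x ^+ 2 then g x ^+ 2 else 0) (g := fun x => g x ^+ 2)) => //.
  - move=> k; apply: measurable_fun_ifT => //; last exact: measurable_funX Lg.1.
    by apply: measurable_fun_ltr => //; exact: measurable_funX Lg.1.
  - move=> x; apply: cvg_near_cst; near=> k; case: ifPn => //; rewrite ltNge => /negP[].
    by near: k; exact: nbhs_infty_ger.
  - exact: Lg.2.
  - by move=> k x; case: ifP => _; rewrite ?normr0 ?sqr_ge0// ger0_norm ?sqr_ge0.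
by rewrite Int0 in c.
Unshelve. all: end_near. Qed.

Lemma tails_bound m s : `|tails m s| <= 8 * load s.
Proof.
have /andP[a0 a1] := tail_le m (Ldw s 0); have /andP[b0 b1] := tail_le m (Ldw s 1).
rewrite ger0_norm ?addr_ge0//; have := N2dw_sqr s 0; have := N2dw_sqr s 1; rewrite /tails; lra.
Qed.

Lemma meas_tails m : measurable_fun setT (tails m).
Proof.
have h i : measurable_fun setT (fun s => tail m (dw s i)).
  have m2 := jmeas_sqr (mdw i).
  apply: jmeas_Int; apply: measurable_fun_ifT => //.
  by apply: measurable_fun_ltr.
by apply: measurable_funD.
Qed.

Lemma dominated_tails m : dominated (tails m).
Proof. by split; [exact: meas_tails|exists 8 => // s; exact: tails_bound]. Qed.

Lemma pressure_load n s : N2 lam2 (pressure (u s) (U s) n) ^+ 2 <= (400 * 400) * M ^+ 2 * load s.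
Proof.
have [_ h] := pressure_bound (su s) (sU s) (hu s) (hU s) n.
set S := N2 lam2 (du s 0) + _ + _ in h.
have S0 : 0 <= S by rewrite !addr_ge0 ?N2_ge0.
have hS : S ^+ 2 <= 100 * load s.
  have [h1 [h2 _]] := sqr_le_load s 0; have [h3 [h4 _]] := sqr_le_load s 1.
  have z g : 0 <= N2 lam2 (g : PL R -> R) by exact: N2_ge0.
  have l0 := load_ge0 s.
  have k1 := @le_sqr_sum2 (N2 lam2 (du s 0) + N2 lam2 (du s 1)) _ _ (addr_ge0 (z _) (z _)) (lexx _).
  have k2 := @le_sqr_sum2 (N2 lam2 (dU s 0) + N2 lam2 (dU s 1)) _ _ (addr_ge0 (z _) (z _)) (lexx _).
  have k3 := @le_sqr_sum2 S _ _ S0 (lexx _).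
  apply: (le_trans k3); lra.
apply: (@le_trans _ _ ((40 * (M * S)) ^+ 2)).
  exact: (lerXn2r 2 (N2_ge0 _ _) (mulr_ge0 (ler0n _ 40) (mulr_ge0 M0 S0)) h).
have -> : (40 * (M * S)) ^+ 2 = 1600 * M ^+ 2 * S ^+ 2 by ring.
have -> : 400 * 400 * M ^+ 2 * load s = 1600 * M ^+ 2 * (100 * load s) by ring.
exact: (ler_wpM2l (mulr_ge0 (ler0n _ _) (sqr_ge0 M)) hS).
Qed.

Lemma power_arith (X k1 b c d f g k l a A em mi mu' : R) : 0 <= mu' -> a <= A * l ->
  X <= k1 * b + c + f * d + 2 * mu' * a + (1 + mi) * (8 * g + 8 * k + em * d) ->
  X <= k1 * b + c + (1 + mi) * (8 * g) + f * d + 2 * mu' * A * l + (1 + mi) * (8 * k + em * d).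
Proof.
move=> mu0 hA hX.
have p : 2 * mu' * a <= 2 * mu' * (A * l) by apply: ler_wpM2l => //; rewrite mulr_ge0.
apply: (le_trans hX); rewrite -subr_ge0.
have -> : k1 * b + c + (1 + mi) * (8 * g) + f * d + 2 * mu' * A * l + (1 + mi) * (8 * k + em * d) -
  (k1 * b + c + f * d + 2 * mu' * a + (1 + mi) * (8 * g + 8 * k + em * d)) = 2 * mu' * (A * l) - 2 * mu' * a by ring.
by rewrite subr_ge0.
Qed.

Lemma power_estimate n e m mu' s : 0 < e -> 0 <= m -> 0 < mu' ->
  Int lam2 (fun x => beta1 e (V n 0 s x) * B n 0 s x) + Int lam2 (fun x => beta1 e (V n 1 s x) * B n 1 s x) <=
  remainder e mu' n s + growth s * gap s + 2 * mu' * ((400 * 400) * M ^+ 2) * load s +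
  (1 + mu'^-1) * (8 * tails m s + 48 * e * m * gap s).
Proof.
move=> e0 m0 mu0.
have h := static_estimate (su s) (sU s) (LD2 s) (wD2 s) (hu s) (hU s) n e0 m0 mu0.
exact: (power_arith (ltW mu0) (pressure_load n s) h).
Qed.

Lemma beta_sub (e a b : R) : 0 <= e -> `|beta e a - beta e b| <= `|a - b| * (`|a| + `|b|).
Proof.
Transparent beta.
move=> e0; have a0 := beta_den a e0; have b0 := beta_den b e0.
have -> : beta e a - beta e b = (a - b) * (a + b) * (2 * ((1 + e * a ^+ 2) * (1 + e * b ^+ 2)))^-1.
  by rewrite /beta; field; rewrite !beta_den0.
have d1 : 1 <= 2 * ((1 + e * a ^+ 2) * (1 + e * b ^+ 2)).
  have : 1 <= (1 + e * a ^+ 2) * (1 + e * b ^+ 2) by apply: mulr_ege1.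
  by lra.
rewrite !normrM -mulrA; apply: ler_wpM2l => //.
rewrite -[leRHS]mulr1; apply: ler_pM => //; first exact: ler_normD.
by rewrite normfV ger0_norm ?(le_trans ler01 d1)// invf_le1 ?(lt_le_trans ltr01 d1).
Opaque beta.
Qed.

Lemma energy_cvg (e : R) (g : PL R -> R) : 0 < e -> L2 lam2 g ->
  (fun n => Int lam2 (fun x => beta e (cv (mm n) g x))) @ \oo --> Int lam2 (fun x => beta e (g x)).
Proof.
move=> e0 Lg; have mb : measurable_fun setT (beta e : RM -> R).
  by apply: continuous_measurable_fun; exact: beta_continuous (ltW e0).
have Lb h : L2 lam2 h -> L1 lam2 (fun x => beta e (h x)).
  move=> Lh; apply: (L1_le (mcomp mb Lh.1) Lh.2) => x.
  by rewrite ger0_norm ?beta_le ?beta_ge0// ltW.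
pose d n := N2 lam2 (fun x => cv (mm n) g x - g x).
apply: (@cvg_dist0 _ _ (fun n => d n * (3 * N2 lam2 g))); last first.
  by rewrite -[X in _ --> X](mul0r (3 * N2 lam2 g)); apply: cvgM; [exact: mm_cvg|exact: cvg_cst].
move=> n; have [Lv hv] := N2_cv_mm n Lg.
have Ld := L2B Lv Lg; have Ls := L2D (L2_abs Lv) (L2_abs Lg).
rewrite -(IntB (Lb _ Lv) (Lb _ Lg)).
apply: (@le_trans _ _ (Int lam2 (fun x => `|(cv (mm n) g x - g x) * (`|cv (mm n) g x| + `|g x|)|))).
  apply: abs_Int_le; [apply: L1B; exact: Lb|by apply: L1_abs; exact: L2M|move=> x].
  have h := beta_sub (cv (mm n) g x) (g x) (ltW e0); apply: (le_trans h).
  by rewrite normrM [X in _ <= _ * X]ger0_norm// addr_ge0.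
have h := CS Ld Ls; apply: (le_trans h); apply: ler_wpM2l; first exact: N2_ge0.
have h2 := N2D (L2_abs Lv) (L2_abs Lg); apply: (le_trans h2); rewrite !N2_absE; lra.
Qed.

Lemma energy_cvg2 (g : PL R -> R) : L2 lam2 g ->
  (fun k : nat => Int lam2 (fun x => beta (k.+1%:R^-1 ^+ 2) (g x))) @ \oo --> N2 lam2 g ^+ 2 / 2.
Proof.
Transparent beta.
move=> Lg; pose e (k : nat) : R := k.+1%:R^-1 ^+ 2.
have e0 k : 0 <= e k by exact: sqr_ge0.
have ce : e @ \oo --> (0 : R).
  rewrite -[X in _ --> X](mulr0 (0 : R)) /e; under eq_fun do rewrite expr2.
  by apply: cvgM; exact: cvg_harmonic.
have [_ c] : L1 lam2 (fun x => g x ^+ 2 / 2) /\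
    (fun k : nat => Int lam2 (fun x => beta (e k) (g x))) @ \oo --> Int lam2 (fun x => g x ^+ 2 / 2).
  apply: (Int_dct (f_ := fun k x => beta (e k) (g x)) (g := fun x => g x ^+ 2)).
  - move=> k; have mb : measurable_fun setT (beta (e k) : RM -> R).
      by apply: continuous_measurable_fun; exact: beta_continuous.
    exact: (mcomp mb Lg.1).
  - move=> x; apply: (@cvg_dist0 _ _ (fun k => e k * g x ^+ 4)); last first.
      by rewrite -[X in _ --> X](mul0r (g x ^+ 4)); apply: cvgM => //; exact: cvg_cst.
    move=> k; have d := beta_den (g x) (e0 k).
    have -> : beta (e k) (g x) - g x ^+ 2 / 2 = - (e k * g x ^+ 4 * (2 * (1 + e k * g x ^+ 2))^-1).
      by rewrite /beta; field; rewrite beta_den0.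
    have h4 : 0 <= e k * g x ^+ 4 by rewrite mulr_ge0// (_ : 4%N = (2 * 2)%N)// exprM sqr_ge0.
    have d2 : 1 <= 2 * (1 + e k * g x ^+ 2) by lra.
    rewrite normrN normrM (ger0_norm h4) -[leRHS]mulr1; apply: ler_wpM2l => //.
    by rewrite normfV ger0_norm ?(le_trans ler01 d2)// invf_le1 ?(lt_le_trans ltr01 d2).
  - exact: Lg.2.
  - by move=> k x; rewrite ger0_norm ?beta_le ?beta_ge0.
by rewrite N2sq -(IntZr _ Lg.2).
Opaque beta.
Qed.

Hypothesis identity : {ae lam, forall t : RM, 0 < t < T -> forall n i x,
  cv (mm n) (w t i) x = prim (fun s => B n i s x) t}.

Let identity_i n i : {ae lam, forall s : RM, 0 < s < T -> forall x, V n i s x = prim (fun r => B n i r x) s}.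
Proof. by apply: filterS identity => s hs sT x; exact: hs. Qed.

Section good_time.
Variable t : R.
Hypotheses (t0 : 0 < t) (tT : t < T).
Hypothesis ht : forall n i x, V n i t x = prim (fun r => B n i r x) t.

Lemma power_dominated e n : 0 < e -> dominated (fun s =>
  Int lam2 (fun x => beta1 e (V n 0 s x) * B n 0 s x) + Int lam2 (fun x => beta1 e (V n 1 s x) * B n 1 s x)).
Proof.
move=> e0; have H i : dominated (fun s => Int lam2 (fun x => beta1 e (V n i s x) * B n i s x)).
  have [mB _] := controlled_force n i; have [C C0 hC] := power_bound n i e0.
  split.
    apply: jmeas_Int; apply: (jmeasM _ mB).
    by apply: (jmeas_comp (beta1_continuous (ltW e0))); apply: jmeas_cv; [exact: (ker_mm n).1|exact: mw].
  exists C => // s; have [h1 h2] := hC s; exact: le_trans (abs_Int h1) h2.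
by apply: dominatedD.
Qed.

Lemma integrated_estimate n e m mu' : 0 < e -> 0 <= m -> 0 < mu' ->
  Int lam2 (fun x => beta e (V n 0 t x)) + Int lam2 (fun x => beta e (V n 1 t x)) <=
  prim (remainder e mu' n) t + (prim (fun s => growth s * gap s) t + 2 * mu' * (400 * 400 * M ^+ 2) * prim load t +
  (1 + mu'^-1) * (8 * prim (tails m) t + 48 * e * m * prim gap t)).
Proof.
move=> e0 m0 mu0.
have hp i := (power_bound n i e0).
have E i := energy_identity e0 t0 (ltW tT) (identity_i n i) (ht n i).
have Li i : L1 lam (fun s => seg t s * Int lam2 (fun x => beta1 e (V n i s x) * B n i s x)).
  apply: (dominated_L1 (ltW tT)).
  have [mB _] := controlled_force n i; have [C C0 hC] := power_bound n i e0.
  split.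
    apply: jmeas_Int; apply: (jmeasM _ mB).
    by apply: (jmeas_comp (beta1_continuous (ltW e0))); apply: jmeas_cv; [exact: (ker_mm n).1|exact: mw].
  exists C => // s; have [h1 h2] := hC s; exact: le_trans (abs_Int h1) h2.
rewrite !E /prim -(IntD (Li 0) (Li 1)).
have -> : Int lam (fun s => seg t s * Int lam2 (fun x => beta1 e (V n 0 s x) * B n 0 s x) +
    seg t s * Int lam2 (fun x => beta1 e (V n 1 s x) * B n 1 s x)) =
  prim (fun s => Int lam2 (fun x => beta1 e (V n 0 s x) * B n 0 s x) + Int lam2 (fun x => beta1 e (V n 1 s x) * B n 1 s x)) t.
  by apply: eq_Int => s; rewrite mulrDr.
have dr : dominated (remainder e mu' n).
  by split; [exact: remainder_meas|have [C C0 hC] := remainder_bound e0 mu0; exists C].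
have dg := dominated_gapM dominated_growth.
have dgap : dominated gap.
  split; first exact: meas_gap.
  exists (8 * M ^+ 2); first by rewrite mulr_ge0 ?sqr_ge0.
  move=> s; have /andP[h0 h1] := gap_bound s; rewrite ger0_norm//; apply: (le_trans h1).
  by rewrite ler_peMr ?load_ge1// mulr_ge0 ?sqr_ge0.
have dl := dominatedZ (2 * mu' * (400 * 400 * M ^+ 2)) dominated_load.
have d1 := dominatedZ 8 (dominated_tails m); have d2 := dominatedZ (48 * e * m) dgap.
have d3 := dominatedZ (1 + mu'^-1) (dominatedD d1 d2).
have d4 := dominatedD (dominatedD dg dl) d3.
have tT' := ltW tT.
have p1 := primD tT' dr d4; have p2 := primD tT' (dominatedD dg dl) d3; have p3 := primD tT' dg dl.
have p4 := primZ (2 * mu' * (400 * 400 * M ^+ 2)) tT' dominated_load.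
have p5 := primZ (1 + mu'^-1) tT' (dominatedD d1 d2); have p6 := primD tT' d1 d2.
have p7 := primZ 8 tT' (dominated_tails m); have p8 := primZ (48 * e * m) tT' dgap.
have := prim_le tT' (power_dominated n e0) (dominatedD dr d4).
rewrite p1 p2 p3 p4 p5 p6 p7 p8 => h; apply: h => s.
have h := power_estimate n s e0 m0 mu0; apply: (le_trans h).
by rewrite !addrA.
Qed.

(** The mollification is removed while [e] is fixed, so that the factor 1 + 1/e inside [remainder]
    is a mere constant. *)
Lemma truncated_estimate e m mu' : 0 < e -> 0 <= m -> 0 < mu' ->
  Int lam2 (fun x => beta e (w t 0 x)) + Int lam2 (fun x => beta e (w t 1 x)) <=
  prim (fun s => growth s * gap s) t + 2 * mu' * (400 * 400 * M ^+ 2) * prim load t +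
  (1 + mu'^-1) * (8 * prim (tails m) t + 48 * e * m * prim gap t).
Proof.
move=> e0 m0 mu0; set X := (X in _ <= X).
have c1 : (fun n => Int lam2 (fun x => beta e (V n 0 t x)) + Int lam2 (fun x => beta e (V n 1 t x))) @ \oo -->
    Int lam2 (fun x => beta e (w t 0 x)) + Int lam2 (fun x => beta e (w t 1 x)).
  by apply: cvgD; apply: energy_cvg.
have c2 : (fun n => prim (remainder e mu' n) t + X) @ \oo --> 0 + X.
  apply: cvgD; last exact: cvg_cst.
  have [C C0 hC] := remainder_bound e0 mu0.
  apply: (prim_cvg0 (C := C) (ltW tT)) => //; first by move=> n; exact: remainder_meas.
  by move=> s; exact: remainder_cvg.
rewrite -[leRHS]add0r; apply: (ler_cvg_to c1 c2); apply: nearW => n.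
exact: integrated_estimate.
Qed.

Lemma limit_estimate mu' : 0 < mu' ->
  gap t / 2 <= prim (fun s => growth s * gap s) t + 2 * mu' * (400 * 400 * M ^+ 2) * prim load t.
Proof.
move=> mu0; set X := (X in _ <= X).
(* The cutting level is m = k and e = (k + 1)^-2: the tails vanish, and e m is at most 1 / (k +
   1). *)
pose e (k : nat) : R := k.+1%:R^-1 ^+ 2.
have e0 k : 0 < e k by rewrite exprn_gt0// invr_gt0.
have c1 : (fun k => Int lam2 (fun x => beta (e k) (w t 0 x)) + Int lam2 (fun x => beta (e k) (w t 1 x))) @ \oo -->
    gap t / 2.
  by rewrite /gap mulrDl; apply: cvgD; exact: energy_cvg2.
have ct : (fun k : nat => prim (tails k%:R) t) @ \oo --> (0 : R).
  apply: (prim_cvg0 (C := 8) (ltW tT)).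
  - by move=> k; exact: meas_tails.
  - by move=> k s; exact: tails_bound.
  - move=> s; rewrite -[X in _ --> X](addr0 0); apply: cvgD; exact: tail_cvg.
have ce : (fun k : nat => 48 * e k * k%:R * prim gap t) @ \oo --> (0 : R).
  have P0 : 0 <= prim gap t by apply: prim_ge0 => s; have /andP[] := gap_bound s.
  apply: (@cvg0_le _ _ (fun k => 48 * prim gap t * k.+1%:R^-1)); last first.
    by rewrite -[X in _ --> X](mulr0 (48 * prim gap t)); apply: cvgMr; exact: cvg_harmonic.
  move=> k; rewrite !mulr_ge0 ?(ltW (e0 k))//=.
  have -> : 48 * e k * k%:R * prim gap t = 48 * prim gap t * (e k * k%:R) by ring.
  apply: ler_wpM2l; first by rewrite mulr_ge0.
  rewrite /e expr2 -mulrA -[leRHS]mulr1; apply: ler_wpM2l; first by rewrite invr_ge0.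
  by rewrite mulrC ler_pdivrMr ?ltr0n// mul1r ler_nat.
have c2 : (fun k : nat => X + (1 + mu'^-1) * (8 * prim (tails k%:R) t + 48 * e k * k%:R * prim gap t)) @ \oo -->
    X + (1 + mu'^-1) * (8 * 0 + 0).
  apply: cvgD; first exact: cvg_cst.
  by apply: cvgMr; apply: cvgD => //; apply: cvgMr.
have h := ler_cvg_to c1 c2; rewrite mulr0 addr0 mulr0 addr0 in h; apply: h.
apply: nearW => k; exact: truncated_estimate.
Qed.

(** The last parameter [mu'] tends to zero; what remains is the integral inequality to which
    Gronwall's lemma applies. *)
Lemma gap_estimate : gap t <= prim (fun s => 2 * growth s * gap s) t.
Proof.
have dg := dominated_gapM dominated_growth.
have -> : prim (fun s => 2 * growth s * gap s) t = 2 * prim (fun s => growth s * gap s) t.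
  by rewrite -(primZ 2 (ltW tT) dg); apply: eq_Int => s; rewrite !mulrA.
suff h : gap t / 2 <= prim (fun s => growth s * gap s) t by lra.
apply/ler_addgt0Pr => e e0.
pose c := 2 * (400 * 400 * M ^+ 2) * prim load t.
have c0 : 0 <= c.
  have P0 : 0 <= prim load t by apply: prim_ge0; exact: load_ge0.
  exact: (mulr_ge0 (mulr_ge0 (ler0n _ 2) (mulr_ge0 (mulr_ge0 (ler0n _ _) (ler0n _ _)) (sqr_ge0 M))) P0).
have c1 : 0 < c + 1 by rewrite ltr_wpDl.
have h := limit_estimate (divr_gt0 e0 c1); apply: (le_trans h); rewrite lerD2l.
have -> : 2 * (e / (c + 1)) * (400 * 400 * M ^+ 2) * prim load t = c * (e / (c + 1)).
  by rewrite /c; move: (400 * 400 * M ^+ 2) (prim load t) (e / _) => a b d; ring.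
by rewrite mulrA ler_pdivrMr// mulrC ler_wpM2l ?(ltW e0)// lerDl.
Qed.

End good_time.

Theorem evolution_uniqueness : {ae lam, forall t : RM, 0 < t < T -> forall i, N2 lam2 (w t i) = 0}.
Proof.
pose b (s : RM) := seg T s * (2 * growth s).
(* [gronwall] concerns all positive times, the estimates only those before [T]; hence [b] and [y]
   are set to zero beyond [T]. *)
pose y (s : RM) := if s < T then gap s else 0.
have y0 s : 0 <= y s <= 8 * M ^+ 2.
  rewrite /y; case: ifP => _; first exact: gap_bound.
  by rewrite lexx mulr_ge0 ?sqr_ge0.
have b0 s : 0 <= b s by exact: (mulr_ge0 (seg_ge0 T s) (mulr_ge0 (ler0n _ 2) (sqr_ge0 _))).
have Lb : L1 lam b by apply: (dominated_L1 (lexx T)); apply: dominatedZ; exact: dominated_growth.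
have my : measurable_fun setT y.
  by apply: measurable_fun_ifT => //; [exact: measurable_fun_ltr|exact: meas_gap].
have Py (t : R) : t < T -> prim (fun s => 2 * growth s * gap s) t = prim (fun s => b s * y s) t.
  move=> tT; apply: eq_Int => s; rewrite /b /y /seg; case: ifP; rewrite ?mul0r// => /andP[s0 st].
  by rewrite s0 (le_trans st (ltW tT)) (le_lt_trans st tT) !mul1r.
have H : {ae lam, forall t : RM, 0 < t -> y t <= prim (fun s => b s * y s) t}.
  apply: filterS identity => t h t0; rewrite /y; have [tT|tT] := ltP t T.
    by rewrite -/y -Py//; apply: gap_estimate => //; apply: h; rewrite t0.
  by rewrite -/y; apply: prim_ge0 => s; rewrite mulr_ge0//; have /andP[] := y0 s.
have G := gronwall Lb b0 my y0 H.
apply: filterS H => t h /andP[t0 tT] i.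
have := h t0; rewrite G /y tT => h1.
have I2 := ordinal2.
have q0 := sqr_ge0 (N2 lam2 (w t 0)); have q1 := sqr_ge0 (N2 lam2 (w t 1)).
apply/eqP; rewrite -sqrf_eq0 eq_le sqr_ge0 andbT.
move: h1; rewrite /gap; by have [->|->] := I2 i; lra.
Qed.

End evolution.

(** * Weak solutions at almost every time *)

Lemma ae_countable d (S : measurableType d) (R : realType) (mu : {measure set S -> \bar R})
    (I : countType) (P : I -> S -> Prop) :
  (forall i, {ae mu, forall x, P i x}) -> {ae mu, forall x, forall i, P i x}.
Proof.
move=> h.
have h' : {ae mu, forall x, forall n : nat, forall i, unpickle n = Some i -> P i x}.
  apply: ae_foralln => n; case E : (unpickle n) => [i|]; last by apply: aeW => x i.
  by apply: filterS (h i) => x hx j [<-].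
by apply: filterS h' => x hx i; apply: (hx (pickle i)); exact: pickleK.
Qed.

Section time_representatives.
Context {R : realType}.
Notation RM := (measurableTypeR R).
Local Opaque N2.
Variable T : R.
Implicit Types f g : RM -> PL R -> R.

Lemma ae_null (P : RM -> Prop) : {ae lam, forall t, P t} ->
  exists N : set RM, [/\ measurable N, lam N = 0%E & forall t, ~ N t -> P t].
Proof.
move=> [N [mN N0 h]]; exists N; split=> // t Nt; apply: contrapT => Pt; apply: Nt; exact: h.
Qed.

Lemma slab_ext f : slab_measurable T f -> jmeas (fun t x => if 0 < t < T then f t x else 0).
Proof.
move=> mf; pose A : set (RM * PL R) := (`]0, T[%classic : set RM) `*` setT.
have mA : measurable A by apply: measurableX => //; exact: measurable_itv.
have mf' : measurable_fun A (fun z : RM * PL R => f z.1 z.2) by exact: mf.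
have := (measurable_restrictT _ mA).1 mf'.
rewrite (_ : (fun z => _) \_ A = (fun z : RM * PL R => if 0 < z.1 < T then f z.1 z.2 else 0))//.
apply/funext => -[t x]; rewrite patchE /=.
have -> : ((t, x) \in A) = (0 < t < T) => //.
by apply/idP/idP; rewrite inE /A /= in_itv/= => // -[].
Qed.

(** Replaces a function by zero on a set of times, to be taken null. The zero function has all
    properties of a slice, so that what holds at almost every time may be assumed at every time. *)
Definition tmask (N : set RM) f : RM -> PL R -> R := fun t x => (1 - \1_N t) * f t x.

Lemma mask_in N f t : N t -> tmask N f t = fun=> 0.
Proof. by move=> Nt; apply/funext => x; rewrite /tmask indicE mem_set// subrr mul0r. Qed.

Lemma mask_out N f t : ~ N t -> tmask N f t = f t.
Proof. by move=> Nt; apply/funext => x; rewrite /tmask indicE memNset// subr0 mul1r. Qed.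

Lemma jmeas_mask N f : measurable N -> jmeas f -> jmeas (tmask N f).
Proof.
move=> mN mf; apply: jmeasM mf; apply: (jmeas_time (k := fun t => 1 - \1_N t)).
by apply: measurable_funB => //; exact: measurable_indic.
Qed.

(* Jointly measurable versions that are square integrable in space at every time. *)
Definition rep f f' : Prop := [/\ jmeas f', forall t, L2 lam2 (f' t),
  L1 lam (fun t => N2 lam2 (f' t) ^+ 2), {ae lam, forall t : RM, 0 < t < T -> f' t = f t}
  & forall t : RM, ~~ (0 < t < T) -> f' t = fun=> 0].

Lemma ae_out (N : set RM) : measurable N -> lam N = 0%E -> {ae lam, forall t, ~ N t}.
Proof. by move=> mN N0; exists N; split=> // t /= h; apply: contrapT. Qed.

Lemma rep_mask N f f' : measurable N -> lam N = 0%E -> rep f f' -> rep f (tmask N f').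
Proof.
move=> mN N0 [m1 m2 m3 m4 m5]; split.
- exact: jmeas_mask.
- move=> t; have [Nt|Nt] := pselect (N t); first by rewrite mask_in//; exact: L2_0.
  by rewrite mask_out.
- apply: ae_eq_L1 m3; first by apply: jmeas_N2sq; exact: jmeas_mask.
  by apply: filterS (ae_out mN N0) => t Nt _; rewrite mask_out.
- by apply: filterS2 m4 (ae_out mN N0) => t h Nt tT; rewrite mask_out// h.
- move=> t tT; have [Nt|Nt] := pselect (N t); first by rewrite mask_in.
  by rewrite mask_out// m5.
Qed.

Lemma Lnorm_sqr (g : PL R -> R) : measurable_fun setT g ->
  ('N[leb2]_2%:E[EFin \o g] ^+ 2 = \int[lam2]_x (g x ^+ 2)%:E)%E.
Proof.
move=> mg.
have h : ('N[leb2]_2%:E[EFin \o g] `^ 2 = \int[leb2]_x (`| (EFin \o g) x | `^ 2))%E.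
  by apply: poweR_Lnorm; rewrite pnatr_eq0.
have -> : ('N[leb2]_2%:E[EFin \o g] ^+ 2 = 'N[leb2]_2%:E[EFin \o g] `^ 2)%E.
  have := @Lnorm_ge0 _ _ _ (@leb2 R) 2%:E (EFin \o g).
  case: ('N[leb2]_2%:E[EFin \o g])%E => [r| |] //; last by rewrite expe2 /= mulyy pnatr_eq0.
  by rewrite lee_fin => r0; rewrite poweR_EFin powR_mulrn// EFin_expe.
rewrite h; apply: eq_integral => x _ /=; rewrite powR_mulrn//.
by rewrite real_normK ?num_real.
Qed.

Lemma rep_of_integrable f : slab_measurable T f ->
  (\int[lebesgue_measure]_(t in `]0%R, T[) 'N[leb2]_2%:E[EFin \o f t] ^+ 2 < +oo)%E ->
  exists f', rep f f'.
Proof.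
move=> mf hf; pose f0 (t : RM) (x : PL R) := if 0 < t < T then f t x else 0.
have m0 : jmeas f0 by exact: slab_ext.
pose g (t : RM) := (\int[lam2]_x (f0 t x ^+ 2)%:E)%E.
have mg : measurable_fun setT g by exact: (meas_int lam2 (F := fun t x => f0 t x ^+ 2) (jmeas_sqr m0)).
have g0 t : (0 <= g t)%E by apply: integral_ge0 => x _; rewrite lee_fin sqr_ge0.
have ms t : measurable_fun setT (f0 t) by exact: (mslice (f := f0) t m0).
have ig : lam.-integrable setT g.
  apply/integrableP; split => //.
  have e1 : (\int[lam]_t `|g t| = \int[lebesgue_measure]_(t in `]0%R, T[) 'N[leb2]_2%:E[EFin \o f t] ^+ 2)%E.
    rewrite [RHS]integral_mkcond; apply: eq_integral => t _; rewrite patchE gee0_abs//.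
    have -> : (t \in (`]0, T[%classic : set RM)) = (0 < t < T).
      by apply/idP/idP; rewrite inE/= in_itv/=.
    rewrite /g /f0; case: ifPn => tT.
      have mt : measurable_fun setT (f t : PL R -> R).
        by have := ms t; rewrite (_ : f0 t = f t)//; apply/funext => x; rewrite /f0 tT.
      by rewrite Lnorm_sqr.
    by rewrite integral0_eq// => x _; rewrite expr0n.
  by rewrite e1.
have [Lg _] := L1_fine ig.
have fin := integrable_ae measurableT ig.
have sq t : g t \is a fin_num -> L2 lam2 (f0 t).
  move=> ft; split => //; apply: L1_0le; [exact: measurable_funX|by move=> x; exact: sqr_ge0|].
  by rewrite -/(g t) ltey_eq ft.
have [N [mN N0 hN]] := ae_null fin.
have E t : fine (g t) = N2 lam2 (f0 t) ^+ 2 by rewrite N2sq IntDef.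
exists (tmask N f0); split.
- exact: jmeas_mask.
- move=> t; have [Nt|Nt] := pselect (N t); first by rewrite mask_in//; exact: L2_0.
  by rewrite mask_out//; apply: sq; exact: hN.
- apply: ae_eq_L1 Lg; first by apply: jmeas_N2sq; exact: jmeas_mask.
  by apply: filterS (ae_out mN N0) => t Nt _; rewrite mask_out// E.
- apply: filterS (ae_out mN N0) => t Nt tT; rewrite mask_out//.
  by apply/funext => x; rewrite /f0 tT.
- move=> t tT; have [Nt|Nt] := pselect (N t); first by rewrite mask_in.
  by rewrite mask_out//; apply/funext => x; rewrite /f0 (negbTE tT).
Qed.

Lemma rep_L2 f : L2_L2 T f -> exists f', rep f f'.
Proof. by move=> [mf hf]; exact: rep_of_integrable. Qed.

Lemma rep_Linfty f : 0 < T -> Linfty_L2 T f -> exists f' M, rep f f' /\ forall t, N2 lam2 (f' t) <= M.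
Proof.
move=> T0 [mf hf].
have [M M0 hM] : exists2 M : R, 0 <= M & {ae lam, forall t : RM, 0 < t < T ->
    ('N[leb2]_2%:E[EFin \o f t] <= M%:E)%E}.
  set h := (X in ess_sup _ X) in hf.
  have h1 := @ess_sup_ge _ _ _ (@lebesgue_measure R) h.
  move: hf h1; case: (ess_sup _ _) => [m|//|] _ h1.
    exists (Num.max 0 m); first by rewrite le_max lexx.
    apply: filterS h1 => t + tT; rewrite /h patchE mem_set/=; last by rewrite in_itv.
    by move=> h2; apply: (le_trans h2); rewrite lee_fin le_max lexx orbT.
  exists 0 => //; apply: filterS h1 => t + tT; rewrite /h patchE mem_set/=; last by rewrite in_itv.
  by move=> h2; apply: (le_trans h2); exact: leNye.
have fin : (\int[lebesgue_measure]_(t in `]0%R, T[) 'N[leb2]_2%:E[EFin \o f t] ^+ 2 < +oo)%E.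
  pose f0 (t : RM) (x : PL R) := if 0 < t < T then f t x else 0.
  have m0 : jmeas f0 by exact: slab_ext.
  pose g (t : RM) := (\int[lam2]_x (f0 t x ^+ 2)%:E)%E.
  have mg : measurable_fun setT g by exact: (meas_int lam2 (F := fun t x => f0 t x ^+ 2) (jmeas_sqr m0)).
  have ms t : measurable_fun setT (f0 t) by exact: (mslice (f := f0) t m0).
  have gE t : 0 < t < T -> ('N[leb2]_2%:E[EFin \o f t] ^+ 2 = g t)%E.
    move=> tT; have e : f0 t = f t by apply/funext => x; rewrite /f0 tT.
    by rewrite -e Lnorm_sqr.
  have e1 : (\int[lebesgue_measure]_(t in `]0%R, T[) 'N[leb2]_2%:E[EFin \o f t] ^+ 2 = \int[lebesgue_measure]_(t in `]0%R, T[) g t)%E.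
    by apply: eq_integral => t; rewrite inE/= in_itv/= => tT; exact: gE.
  rewrite e1.
  apply: (@le_lt_trans _ _ (\int[lebesgue_measure]_(t in `]0%R, T[) (M ^+ 2)%:E)%E).
    apply: ae_ge0_le_integral => //.
    - by move=> t _; apply: integral_ge0 => x _; rewrite lee_fin sqr_ge0.
    - exact: measurable_funTS.
    - by move=> t _; rewrite lee_fin sqr_ge0.
    apply: filterS hM => t ht; rewrite /= in_itv/= => tT; rewrite -gE//.
    by rewrite EFin_expe lee_sqr ?Lnorm_ge0 ?lee_fin//; exact: ht.
  rewrite integral_cst//.
  have hE := @lebesgue_measure_itv R `]0, T[%R.
  apply: lte_mul_pinfty => //; first by rewrite lee_fin sqr_ge0.
  apply: (@eq_ind_r _ _ (fun y => y < +oo)%E _ _ hE).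
  by rewrite /=; case: ifPn => // _; rewrite -EFinB ltry.
have [f' rf] := rep_of_integrable mf fin.
have [m1 m2 m3 m4 m5] := rf.
have bM : {ae lam, forall t : RM, N2 lam2 (f' t) <= M}.
  apply: filterS2 m4 hM => t e h; have [tT|tT] := boolP (0 < t < T); last by rewrite m5// N2_0.
  have := h tT; rewrite -e//.
  move=> h2; rewrite -[leRHS](ger0_norm M0) -(ger0_norm (N2_ge0 lam2 (f' t))) -ler_sqr ?nnegrE//.
  rewrite !real_normK ?num_real// N2sq -lee_fin (IntE (m2 t).2) -Lnorm_sqr; last exact: (m2 t).1.
  by rewrite EFin_expe lee_sqr ?Lnorm_ge0 ?lee_fin.
have [N [mN N0 hN]] := ae_null bM.
exists (tmask N f'), M; split; first exact: rep_mask.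
move=> t; have [Nt|Nt] := pselect (N t); first by rewrite mask_in// N2_0.
by rewrite mask_out//; exact: hN.
Qed.

Lemma slab_integral f f' : slab_measurable T f -> jmeas f' -> (forall t, L1 lam2 (f' t)) ->
  L1 lam (fun t => Int lam2 (f' t)) -> {ae lam, forall t : RM, 0 < t < T -> f' t = f t} ->
  (forall t : RM, ~~ (0 < t < T) -> f' t = fun=> 0) ->
  (\int[lebesgue_measure]_(t in `]0%R, T[) \int[leb2]_x (f t x)%:E = (Int lam (fun t => Int lam2 (f' t)))%:E)%E.
Proof.
move=> mf m' L' LI h h0.
pose f0 (t : RM) (x : PL R) := if 0 < t < T then f t x else 0.
have m0 : jmeas f0 by exact: slab_ext.
rewrite (IntE LI).
have -> : (\int[lebesgue_measure]_(t in `]0%R, T[) \int[leb2]_x (f t x)%:E = \int[lam]_t \int[lam2]_x (f0 t x)%:E)%E.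
  rewrite [LHS]integral_mkcond; apply: eq_integral => t _; rewrite patchE.
  have -> : (t \in (`]0, T[%classic : set RM)) = (0 < t < T).
    by apply/idP/idP; rewrite inE/= in_itv/=.
  by rewrite /f0; case: ifPn => tT //; rewrite integral0_eq.
apply: ae_eq_integral => //.
- exact: (meas_int lam2 (F := f0) m0).
- by apply/measurable_EFinP; exact: L1_meas LI.
apply: filterS h => t ht _; rewrite (IntE (L' t)); apply: eq_integral => x _.
rewrite /f0; case: ifPn => tT; first by rewrite ht.
by rewrite h0.
Qed.

End time_representatives.

(** * Test functions of product form *)

Section tensor_test_functions.
Context {R : realType}.
Notation RM := (measurableTypeR R).
Notation e_ i := (basis_vector i : R * R).
Local Opaque N2.
Implicit Types (h : R -> R) (K : R * R -> R) (x : R * R).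

(** A time cut-off times a translated kernel. Testing with these in space and time, and with
    translated kernels in space alone, is all that is drawn from the definition of weak
    solutions. *)
Definition tensor h K x : R * (R * R) -> R := fun z => h z.1 * K (z.2 - x).

Lemma Sm_shift K x : Sm K -> Sm (fun y => K (y - x)).
Proof.
move=> sK; apply: (Sm_pull (A := fun y => y - x)) sK => l l1 l2 l3.
have -> : (fun y => l (y - x)) = (fun y => l y + l (- x)) by apply/funext => y; exact: l1.
by apply: Sm_add; [exact: Sm_lin|exact: Sm_cst].
Qed.

Lemma Sm_tensor h K x : smooth1 h -> Sm K -> Sm (tensor h K x).
Proof.
move=> sh sK; apply: Sm_mul.
  apply: (Sm_comp sh); apply: Sm_lin => //= z; exact: cvg_fst.
apply: (Sm_pull (A := fun z : R * (R * R) => z.2)) (Sm_shift x sK) => l l1 l2 l3.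
apply: Sm_lin => [y z|a z|z] /=; [exact: l1|exact: l2|].
by apply: (cvg_comp (fun z : R * (R * R) => z.2) l); [exact: cvg_snd|exact: l3].
Qed.

Lemma support_compact (V : normedModType R) (f : V -> R) (A Omega : set V) : compact A -> A `<=` Omega ->
  (forall v, f v != 0 -> A v) ->
  compact (closure [set v | f v != 0]) /\ closure [set v | f v != 0] `<=` Omega.
Proof.
move=> cA AO h; have clA : closed A by apply: compact_closed => //; exact: norm_hausdorff.
have sub : closure [set v | f v != 0] `<=` A.
  by rewrite [X in _ `<=` X](closure_id A).1//; apply: closure_subset => v; exact: h.
by split; [apply: (subclosed_compact _ cA sub); exact: closed_closure|exact: subset_trans AO].
Qed.

Lemma box_compact (A : R) x : compact ((`[x.1 - A, x.1 + A] `*` `[x.2 - A, x.2 + A]) : set (R * R)).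
Proof. by apply: compact_setX; exact: segment_compact. Qed.

Lemma sker_box K x : sker K -> exists A : R, forall y, K (y - x) != 0 ->
  (`[x.1 - A, x.1 + A] `*` `[x.2 - A, x.2 + A]) y.
Proof.
move=> [_ [A hA]]; exists A => y /hA[/=]; rewrite !ler_distl => h1 h2; split => /=; by rewrite in_itv.
Qed.

Lemma test_shift K x : sker K -> test_function setT (fun y => K (y - x)).
Proof.
move=> sK; have [A hA] := sker_box x sK.
have [c1 c2] := support_compact (@box_compact A x) (@subsetT _ _) hA.
by split => //; apply: Sm_smooth; apply: Sm_shift; exact: sK.1.
Qed.

Lemma test_tensor h K x a b T : smooth1 h -> sker K -> (forall s, h s != 0 -> a <= s <= b) ->
  0 < a -> b < T -> test_function (slab T) (tensor h K x).
Proof.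
move=> sh sK hs a0 bT; have [A hA] := sker_box x sK.
have cc : compact (`[a, b] `*` (`[x.1 - A, x.1 + A] `*` `[x.2 - A, x.2 + A]) : set (R * (R * R))).
  by apply: compact_setX; [exact: segment_compact|exact: box_compact].
have [|z|c1 c2] := @support_compact _ (tensor h K x) _ (slab T) cc.
- move=> z [/= z1 _]; split => //=; move: z1; rewrite !in_itv/= => /andP[h1 h2].
  by rewrite (lt_le_trans a0 h1) (le_lt_trans h2 bT).
- rewrite /tensor mulf_eq0 negb_or => /andP[h1 h2]; split; last exact: hA.
  by rewrite /= in_itv/=; exact: hs.
by split => //; apply: Sm_smooth; apply: Sm_tensor => //; exact: sK.1.
Qed.

Lemma derive_translate i K x y : sker K -> 'D_(e_ i) (fun y => K (y - x)) y = pd i K (y - x).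
Proof.
move=> sK; have [d _] := sker_C1 i sK (y - x).
have d0 := d 0; rewrite scale0r addr0 in d0.
have [//] : is_derive y (e_ i) (fun y => K (y - x)) (pd i K (y - x)).
apply: line_is_derive; move: d0; congr is_derive; apply/funext => s.
by rewrite addrAC.
Qed.

Lemma dx_tensor i h K x t y : sker K -> dx i (tensor h K x) t y = h t * pd i K (y - x).
Proof.
move=> sK; have [d _] := sker_C1 i sK (y - x).
have d0 := d 0; rewrite scale0r addr0 in d0.
have [//] : is_derive (t, y) (space_direction i) (tensor h K x) (h t * pd i K (y - x)).
apply: line_is_derive; have := is_deriveZ (h t) d0; congr is_derive; apply/funext => s.
rewrite /tensor /space_direction /=; congr (h _ * K _); first by rewrite /GRing.scale/= mulr0 addr0.
by rewrite addrAC.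
Qed.

Lemma dt_tensor h h' K x t y : (forall s : R, is_derive s 1 h (h' s)) ->
  dt (tensor h K x) t y = h' t * K (y - x).
Proof.
move=> dh; have [//] : is_derive (t, y) time_direction (tensor h K x) (h' t * K (y - x)).
apply: line_is_derive.
have d : is_derive (0 : R) 1 (fun s : R => h (t + s)) (h' t).
  have d1 : is_derive (0 : R) 1 (fun s : R => t + s) 1.
    have d2 := is_deriveD (is_derive_cst t (0 : R) (1 : R)) (is_derive_id (0 : R) (1 : R)).
    by rewrite add0r in d2.
  have d3 : is_derive (t + 0) 1 h (h' (t + 0)) := dh (t + 0).
  have d4 := is_derive1_comp d3 d1; rewrite addr0 mulr1 in d4; exact: d4.
have := is_deriveZ (K (y - x)) d; rewrite /GRing.scale/= mulrC; congr is_derive; apply/funext => s.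
rewrite /tensor /time_direction /= [LHS]mulrC; congr (h (_ + _) * K _).
  by rewrite /GRing.scale/= mulr1.
by rewrite scaler0 addr0.
Qed.

End tensor_test_functions.

(** * Weak derivatives at almost every time *)

Section weak_identities.
Context {R : realType}.
Notation RM := (measurableTypeR R).
Notation e_ i := (basis_vector i : R * R).
Local Opaque N2 rh.
Variable T : R.

Lemma rep_N2_L1 f f' : rep T f f' -> L1 lam (fun t => N2 lam2 (f' t)).
Proof.
move=> [m1 m2 m3 m4 m5].
apply: (L1_le (jmeas_N2 m1) (L1D (L1_seg T) m3)) => t; rewrite ger0_norm ?N2_ge0//.
have [tT|tT] := boolP (0 < t < T); last by rewrite m5// N2_0 expr0n addr0 seg_ge0.
have /andP[t0 t1] := tT; rewrite /seg (ltW t0) (ltW t1)/=; exact: self_le_sqr.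
Qed.

Lemma rep_cv_L1 f f' K x : rep T f f' -> ker K -> L1 lam (fun t => cv K (f' t) x).
Proof.
move=> rf kK; have [m1 m2 m3 m4 m5] := rf.
apply: (L1_le _ (L1Z (N2 lam2 K) (rep_N2_L1 rf))).
  have mc := jmeas_cv kK.1 m1; apply: (mcomp2 mc); [exact: measurable_id|exact: measurable_cst].
by move=> t; exact: cv_bd.
Qed.

Lemma jmeas_ker K x : measurable_fun setT (K : PL R -> R) -> jmeas (fun (t : RM) (y : PL R) => K (y - x)).
Proof. by move=> mK; exact: (mcomp (meas_ker_sub x mK) measurable_snd). Qed.

Lemma step_support d a b (s : R) : 0 < d -> a < b -> ramp d a s - ramp d b s != 0 -> a <= s <= b + d.
Proof.
move=> d0 ab h; apply/andP; split; rewrite leNgt; apply/negP => h1; move/eqP : h; apply.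
  by rewrite !ramp_small ?subrr// ltW// (lt_trans h1 ab).
rewrite !ramp_large ?subrr ?ltW//; apply: lt_trans h1; by rewrite ltrD2r.
Qed.

Lemma smooth1_step d a b : smooth1 (fun s : R => ramp d a s - ramp d b s).
Proof. by apply: Sm_smooth1; apply: Sm_sub; apply: smooth1_Sm; exact: smooth1_ramp. Qed.

Lemma step_derive d a b (s : R) : is_derive s 1 (fun s => ramp d a s - ramp d b s) (ramp' d a s - ramp' d b s).
Proof. exact: (is_deriveB (ramp_derive d a s) (ramp_derive d b s)). Qed.

Lemma step_bound d a b (s : R) : `|ramp d a s - ramp d b s| <= theta 1 + theta 1.
Proof. by apply: (le_trans (ler_normB _ _)); apply: lerD; exact: ramp_bound. Qed.

Lemma meas_step d a b : measurable_fun setT (fun s : RM => ramp d a s - ramp d b s).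
Proof. by apply: measurable_funB; exact: meas_ramp. Qed.

Lemma weak_dx_integral f f' K x (h : RM -> R) c : rep T f f' -> slab_measurable T f -> sker K ->
  measurable_fun setT h -> (forall s, `|h s| <= c) ->
  (\int[lebesgue_measure]_(t in `]0%R, T[) \int[leb2]_y (f t y * (h t * K (y - x)))%:E =
   (Int lam (fun t => h t * cv K (f' t) x))%:E)%E.
Proof.
move=> rf mf sK mh hc; have kK := sker_ker sK; have [m1 m2 m3 m4 m5] := rf.
have mK : jmeas (fun t y => h t * K (y - x)).
  by apply: jmeasM; [exact: jmeas_time|apply: jmeas_ker; exact: kK.1].
have LK t := cv_L1 x kK (L2_Lloc (m2 t)).
have E t : Int lam2 (fun y => f' t y * (h t * K (y - x))) = h t * cv K (f' t) x.
  rewrite cvE -(IntZ (h t) (LK t)); apply: eq_Int => y; ring.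
rewrite (slab_integral (f' := fun t y => f' t y * (h t * K (y - x)))).
- by congr (_%:E); apply: eq_Int.
- apply: measurable_funM; first exact: mf.
  exact: measurable_funTS.
- exact: jmeasM.
- move=> t; have := L1Z (h t) (LK t).
  rewrite (_ : (fun y => _) = (fun y => f' t y * (h t * K (y - x))))//; apply/funext => y; ring.
- have := L1_bd mh hc (rep_cv_L1 x rf kK); by rewrite (_ : (fun t => _) = (fun t => Int lam2 (fun y => f' t y * (h t * K (y - x)))))//; apply/funext => t; rewrite E.
- by apply: filterS m4 => t ht tT; apply/funext => y; rewrite ht.
- by move=> t tT; apply/funext => y; rewrite m5// mul0r.
Qed.

(** Testing with products and applying [time_fundamental] yields the identity at almost every time.
    The null set depends on the kernel and on the point; this is repaired in [ae_all_points]. *)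
Lemma weak_dx_slices i f g f' g' K x : weak_dx T i f g -> slab_measurable T f -> slab_measurable T g ->
  rep T f f' -> rep T g g' -> sker K ->
  {ae lam, forall t : RM, cv (pd i K) (f' t) x = - cv K (g' t) x}.
Proof.
move=> wfg mf mg rf rg sK; have sp := sker_pd i sK; have kK := sker_ker sK; have kp := sker_ker sp.
have [m1 m2 m3 m4 m5] := rf; have [n1 n2 n3 n4 n5] := rg.
have Lf := rep_cv_L1 x rf kp; have Lg := rep_cv_L1 x rg kK.
have h : {ae lam, forall t : RM, 0 < t < T -> cv (pd i K) (f' t) x + cv K (g' t) x = 0}.
  apply: time_fundamental; first exact: L1D.
  move=> d a b d0 a0 ab bT.
  have tst := @test_tensor _ _ K x _ _ _ (smooth1_step d a b) sK (fun s => step_support d0 ab) a0 bT.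
  have := wfg _ tst.
  have -> : (\int[lebesgue_measure]_(t in `]0%R, T[) \int[leb2]_y (f t y * dx i (tensor (fun s => ramp d a s - ramp d b s) K x) t y)%:E =
    \int[lebesgue_measure]_(t in `]0%R, T[) \int[leb2]_y (f t y * ((ramp d a t - ramp d b t) * pd i K (y - x)))%:E)%E.
    by apply: eq_integral => t _; apply: eq_integral => y _; rewrite dx_tensor.
  have A1 := weak_dx_integral x rf mf sp (meas_step d a b) (step_bound d a b).
  have A2 := weak_dx_integral x rg mg sK (meas_step d a b) (step_bound d a b).
  rewrite A1 A2 => -[A3].
  have B1 := L1_bd (meas_step d a b) (step_bound d a b) Lf.
  have B2 := L1_bd (meas_step d a b) (step_bound d a b) Lg.
  have -> : Int lam (fun s : RM => (ramp d a s - ramp d b s) * (cv (pd i K) (f' s) x + cv K (g' s) x)) =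
    Int lam (fun s : RM => (ramp d a s - ramp d b s) * cv (pd i K) (f' s) x + (ramp d a s - ramp d b s) * cv K (g' s) x).
    by apply: eq_Int => s; rewrite mulrDr.
  by rewrite (IntD B1 B2) A3 addNr.
apply: filterS h => t ht; have [tT|tT] := boolP (0 < t < T); first by apply/eqP; rewrite -addr_eq0; apply/eqP; exact: ht.
have z L : cv L (fun=> 0 : R) x = 0.
  by rewrite cvE (_ : (fun y => _) = fun=> 0) ?Int0//; apply/funext => y; rewrite mulr0.
by rewrite m5// n5// !z oppr0.
Qed.

Lemma rational_zero (g : R -> R) : continuous g -> (forall q : rat, g (ratr q) = 0) -> forall s, g s = 0.
Proof.
move=> cg h s; apply: contrapT => /eqP gs.
have op : open [set r : R | g r != 0].
  have -> : [set r : R | g r != 0] = g @^-1` [set r | r != 0] by [].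
  by apply: open_comp; [move=> r _; exact: cg|exact: open_neq].
have [r [gr [q _ qr]]] := @dense_rat R _ (ex_intro _ s gs) op.
by move: gr; rewrite /= -qr h eqxx.
Qed.

(** Continuity is given along the axes only: the function vanishes on the vertical lines through
    rational abscissae, and each horizontal line meets these in a dense set. *)
Lemma plane_rational_zero (h : PL R -> R) : (forall i x, continuous (fun s : R => h (x + s *: e_ i))) ->
  (forall p : rat * rat, h (ratr p.1, ratr p.2) = 0) -> forall x, h x = 0.
Proof.
move=> ch hp x.
have E0 (a b s : R) : ((a, b) + s *: e_ 0 : PL R) = (a + s, b).
  by rewrite paddE /= /GRing.scale /= mulr1 mulr0 addr0.
have E1 (a b s : R) : ((a, b) + s *: e_ 1 : PL R) = (a, b + s).
  by rewrite paddE /= /GRing.scale /= mulr1 mulr0 addr0.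
have step1 (q : rat) (b : R) : h (ratr q, b) = 0.
  have c := ch 1 (ratr q, 0).
  have := rational_zero c _ b; rewrite E1 add0r; apply => r.
  by rewrite E1 add0r; exact: (hp (q, r)).
have c := ch 0 (0, x.2).
have := rational_zero c _ x.1; rewrite E0 add0r -surjective_pairing; apply => r.
by rewrite E0 add0r.
Qed.

Lemma cv_line_continuous i K f x : sker K -> Lloc f -> continuous (fun s : R => cv K f (x + s *: e_ i)).
Proof.
move=> sK Lf; have [d _] := C1_cv (sker_ker sK) (sker_ker (sker_pd i sK)) (sker_C1 i sK) Lf x.
exact: is_derive_cont d.
Qed.

(** Testing with the sequence of mollifiers pays off here: the countably many pairs of a mollifier
    and a rational point leave one null set, and continuity of correlations gives all points. *)
Lemma ae_all_points (f g : RM -> PL R -> R) i :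
  (forall t, L2 lam2 (f t)) -> (forall t, L2 lam2 (g t)) ->
  (forall K x, sker K -> {ae lam, forall t : RM, cv (pd i K) (f t) x = - cv K (g t) x}) ->
  {ae lam, forall t : RM, wd i (f t) (g t)}.
Proof.
move=> Lf Lg H.
have sr n : sker (rh n : R * R -> R) by exact: sker_rh.
have h : {ae lam, forall t : RM, forall p : nat * (rat * rat),
    cv (pd i (rh p.1)) (f t) (ratr p.2.1, ratr p.2.2) = - cv (rh p.1) (g t) (ratr p.2.1, ratr p.2.2)}.
  by apply: ae_countable => p; apply: H.
apply: filterS h => t ht n x.
have := @plane_rational_zero (fun x => cv (pd i (rh n)) (f t) x + cv (rh n) (g t) x) _ _ x.
move=> h0; apply/eqP; rewrite -addr_eq0; apply/eqP; apply: h0.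
  move=> j y s; apply: cvgD; apply: cv_line_continuous; by [exact: sker_pd|exact: sr|exact: L2_Lloc].
by move=> p; have := ht (n, p) => /= ->; rewrite addNr.
Qed.

End weak_identities.

(** * The projected momentum equation *)

Section projected_kernels.
Context {R : realType}.
Notation RM := (measurableTypeR R).
Notation KK := (@KK R).
Local Opaque N2 rh sg mm.

(* The entries of the mollified Leray projection. *)
Definition lproj n (i k : 'I_2) (y : R * R) : R := (k == i)%:R * mm n y - pd i (KK n k) y.

Lemma sker_proj n i k : sker (lproj n i k).
Proof. by apply: skerB; [apply: skerZ; exact: sker_mm|exact: sker_pdKK]. Qed.

Lemma pd_proj n i j k : pd j (lproj n i k) = fun y => (k == i)%:R * pd j (mm n) y - pd j (pd i (KK n k)) y.
Proof.
have sm := (sker_mm (R := R) n).1; have sp := (sker_pdKK (R := R) n k i).1.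
rewrite !(pdE j) /lproj DvB//; last by apply: Sm_mul => //; exact: Sm_cst.
by apply/funext => y; rewrite DvZ.
Qed.

(** Derivatives commute and the divergence of [KK n] is [mm n], so the two contributions cancel. *)
Lemma div_proj n i y : \sum_(k < 2) pd k (lproj n i k) y = 0.
Proof.
have s0 := (sker_pdKK (R := R) n 0 0).1; have s1 := (sker_pdKK (R := R) n 1 1).1.
have E : pd i (mm n) = fun y => pd i (pd 0 (KK n 0)) y + pd i (pd 1 (KK n 1)) y.
  by rewrite mmE !(pdE i) DvD.
have I2 := ordinal2 i.
rewrite big_ord_recl big_ord1 !pd_proj.
have -> : (lift ord0 ord0 : 'I_2) = 1 by exact/val_inj.
have -> : (ord0 : 'I_2) = 0 by exact/val_inj.
have C0 := congr1 (fun F => F y) (pdC 0 i (sker_KK (R := R) n 0)).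
have C1' := congr1 (fun F => F y) (pdC 1 i (sker_KK (R := R) n 1)).
move: (congr1 (fun F => F y) E) C0 C1'; rewrite /=.
by have [->|->] := I2; rewrite ?eqxx /= ?mul1r ?mul0r => h1 h2 h3; lra.
Qed.

Variables (u du : 'I_2 -> PL R -> R).
Hypothesis su : slice u du.

Let Lu i : L2 lam2 (u i). Proof. by case: su. Qed.
Let Ldu i : L2 lam2 (du i). Proof. by case: su. Qed.
Let wu i : wd 0 (u i) (du i). Proof. by case: su. Qed.
Let wv : wd 1 (u 1) (fun x => - du 0 x). Proof. by case: su. Qed.

Lemma slice_div (K : R * R -> R) x : sker K -> cv (pd 0 K) (u 0) x + cv (pd 1 K) (u 1) x = 0.
Proof.
move=> sK; have h0 := wd_ker x sK (Lu 0) (Ldu 0) (wu 0).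
have h1 := wd_ker x sK (Lu 1) (L2N (Ldu 0)) wv.
have h2 := cvN (sker_ker sK) (L2_Lloc (Ldu 0)).
by rewrite h0 h1 h2 opprK addNr.
Qed.

Lemma slice_div_d (K : R * R -> R) x : sker K -> cv (pd 0 K) (du 0) x + cv (pd 1 K) (du 1) x = 0.
Proof.
move=> sK; have s0 := sker_pd 0 sK.
have h0 := wd_ker x (sker_pd 0 sK) (Lu 0) (Ldu 0) (wu 0).
have h1 := wd_ker x (sker_pd 1 sK) (Lu 1) (Ldu 1) (wu 1).
have := slice_div x s0; rewrite (pdC 1 0 sK) h0 h1 -opprD => /eqP; rewrite oppr_eq0 => /eqP.
by [].
Qed.

Lemma cv_proj n i k (f : PL R -> R) x : Lloc f ->
  cv (lproj n i k) f x = (k == i)%:R * cv (mm n) f x - cv (pd i (KK n k)) f x.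
Proof.
move=> Lf; have kmn := ker_mm (R := R) n; have kp : ker (fun y => -1 * pd i (KK n k) y) by apply: kerZ; exact: ker_pdKK.
have -> : lproj n i k = fun y => (k == i)%:R * mm n y + -1 * pd i (KK n k) y.
  by apply/funext => y; rewrite mulN1r.
have h := cvDl (kerZ (k == i)%:R kmn) kp Lf; rewrite h.
have h1 := cvZl (k == i)%:R kmn Lf; have h2 := cvZl (-1) (ker_pdKK n k i) Lf.
by rewrite h1 h2 mulN1r.
Qed.

Lemma cv_pd_proj n i j k (f : PL R -> R) x : Lloc f ->
  cv (pd j (lproj n i k)) f x = (k == i)%:R * cv (pd j (mm n)) f x - cv (pd j (pd i (KK n k))) f x.
Proof.
move=> Lf; have kmn := ker_pd j (sker_mm (R := R) n).
have kq := ker_pd j (sker_pdKK (R := R) n k i).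
rewrite pd_proj.
have -> : (fun y => (k == i)%:R * pd j (mm n) y - pd j (pd i (KK n k)) y) =
    fun y => (k == i)%:R * pd j (mm n) y + -1 * pd j (pd i (KK n k)) y.
  by apply/funext => y; rewrite mulN1r.
have h := cvDl (kerZ (k == i)%:R kmn) (kerZ (-1) kq) Lf; rewrite h.
have h1 := cvZl (k == i)%:R kmn Lf; have h2 := cvZl (-1) kq Lf.
by rewrite h1 h2 mulN1r.
Qed.

(** The projection acts trivially on divergence free fields: by symmetry of the Jacobian of [KK n],
    its second part is a correlation with a divergence. *)
Lemma proj_moment n i x : \sum_(k < 2) cv (lproj n i k) (u k) x = cv (mm n) (u i) x.
Proof.
have I2 := ordinal2 i.
rewrite big_ord_recl big_ord1.
have -> : (lift ord0 ord0 : 'I_2) = 1 by exact/val_inj.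
have -> : (ord0 : 'I_2) = 0 by exact/val_inj.
have h := slice_div x (sker_KK (R := R) n i).
have c0 := cv_proj n i 0 x (L2_Lloc (Lu 0)); have c1 := cv_proj n i 1 x (L2_Lloc (Lu 1)).
rewrite c0 c1 (KK_sym n 0 i) (KK_sym n 1 i).
by move: h; have [->|->] := I2; rewrite ?eqxx /= ?mul1r ?mul0r => h; lra.
Qed.

(** The pressure arises from the quadratic terms alone: the horizontal derivative of [u] is
    divergence free as well, so the diffusion term passes unchanged through the projection. *)
Lemma proj_flux n i x : \sum_(k < 2) (\sum_(j < 2) cv (pd j (lproj n i k)) (fun y => u k y * u j y) x -
    cv (pd 0 (lproj n i k)) (du k) x) =
  cv (pd 0 (mm n)) (fun y => u i y * u 0 y) x + cv (pd 1 (mm n)) (fun y => u i y * u 1 y) x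
  - (cv (pd i (pd 0 (KK n 0))) (fun y => u 0 y * u 0 y) x + cv (pd i (pd 1 (KK n 0))) (fun y => u 0 y * u 1 y) x
  + (cv (pd i (pd 0 (KK n 1))) (fun y => u 1 y * u 0 y) x + cv (pd i (pd 1 (KK n 1))) (fun y => u 1 y * u 1 y) x))
  - cv (pd 0 (mm n)) (du i) x.
Proof.
have I2 := ordinal2 i.
have Luu k j := L1_Lloc (L2M (Lu k) (Lu j)).
have c k j := cv_pd_proj n i j k x (Luu k j).
have d k := cv_pd_proj n i 0 k x (L2_Lloc (Ldu k)).
rewrite !big_ord_recl !big_ord0 /= !addr0.
have -> : (lift ord0 ord0 : 'I_2) = 1 by exact/val_inj.
have -> : (ord0 : 'I_2) = 0 by exact/val_inj.
rewrite !c !d.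
have z : cv (pd 0 (pd i (KK n 0))) (du 0) x + cv (pd 0 (pd i (KK n 1))) (du 1) x = 0.
  rewrite (KK_sym n 0 i) (KK_sym n 1 i) (pdC 0 1 (sker_KK (R := R) n i)).
  exact: (slice_div_d x (sker_pdKK n i 0)).
have C k j : pd j (pd i (KK n k)) = pd i (pd j (KK n k)) by exact: pdC (sker_KK n k).
have C0 := C 0 0; have C1' := C 1 0.
move: z; rewrite !(C _ 1) !(C _ 0).
move: (cv (pd i (pd 0 (KK n 0))) (fun y => u 0 y * u 0 y) x) (cv (pd i (pd 1 (KK n 0))) (fun y => u 0 y * u 1 y) x)
  (cv (pd i (pd 0 (KK n 1))) (fun y => u 1 y * u 0 y) x) (cv (pd i (pd 1 (KK n 1))) (fun y => u 1 y * u 1 y) x)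
  (cv (pd i (pd 0 (KK n 0))) (du 0) x) (cv (pd i (pd 0 (KK n 1))) (du 1) x) => a1 a2 a3 a4 b1 b2 z.
have -> : b2 = - b1 by lra.
by have [->|->] := I2; rewrite ?eqxx /=; ring.
Qed.

End projected_kernels.

Section force.
Context {R : realType}.
Notation KK := (@KK R).
Local Opaque N2 rh sg mm.
Variables (u du U dU : 'I_2 -> PL R -> R).
Hypotheses (su : slice u du) (sU : slice U dU).

Definition flux (v dv Psi : 'I_2 -> PL R -> R) (x : PL R) : R :=
  \sum_(k < 2) (\sum_(j < 2) cv (pd j (Psi k)) (fun y => v k y * v j y) x - cv (pd 0 (Psi k)) (dv k) x).

Lemma flux_force n i x : flux u du (lproj n i) x - flux U dU (lproj n i) x = mollified_force u du U dU n i x.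
Proof.
rewrite /flux (proj_flux su) (proj_flux sU) /mollified_force /dpressure.
have [Lu Ldu _ _] := su; have [LU LdU _ _] := sU.
have B (K : PL R -> R) k j : ker K -> cv K (fun y => u k y * u j y - U k y * U j y) x =
    cv K (fun y => u k y * u j y) x - cv K (fun y => U k y * U j y) x.
  move=> kK; have h := cvB kK (L1_Lloc (L2M (Lu k) (Lu j))) (L1_Lloc (L2M (LU k) (LU j))).
  by rewrite h.
have kp j := ker_pd j (sker_mm (R := R) n).
have kq j k := ker_pd i (sker_pdKK (R := R) n j k).
have Bd : cv (pd 0 (mm n)) (fun y => du i y - dU i y) x = cv (pd 0 (mm n)) (du i) x - cv (pd 0 (mm n)) (dU i) x.
  by have h := cvB (kp 0) (L2_Lloc (Ldu i)) (L2_Lloc (LdU i)); rewrite h.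
rewrite Bd !(B _ _ _ (kp _)) !(B _ _ _ (kq _ _)).
move: (cv _ _ x) (cv _ _ x) (cv _ _ x) (cv _ _ x) (cv _ _ x) (cv _ _ x) (cv _ _ x) (cv _ _ x)
  (cv _ _ x) (cv _ _ x) (cv _ _ x) (cv _ _ x) (cv _ _ x) (cv _ _ x) => a1 a2 a3 a4 a5 a6 a7 b1 b2 b3 b4 b5 b6 b7.
ring.
Qed.

End force.

(** * Representatives continuous in time *)

Section continuous_representatives.
Context {R : realType}.
Notation RM := (measurableTypeR R).
Local Opaque N2.
Variable T : R.
Implicit Types (f : R -> R * R -> R).

Lemma Lnorm_N2 (g : PL R -> R) : L2 lam2 g -> ('N[leb2]_2%:E[EFin \o g] = (N2 lam2 g)%:E)%E.
Proof.
move=> Lg; apply/eqP; rewrite eq_le; apply/andP; split.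
  by rewrite -lee_sqr ?Lnorm_ge0 ?lee_fin ?N2_ge0// (Lnorm_sqr Lg.1) -EFin_expe N2sq (IntE Lg.2).
by rewrite -lee_sqr ?Lnorm_ge0 ?lee_fin ?N2_ge0// (Lnorm_sqr Lg.1) -EFin_expe N2sq (IntE Lg.2).
Qed.

Lemma Lfun_L2 (g : PL R -> R) : g \in Lfun leb2 2%:E -> L2 lam2 g.
Proof.
move=> Lg; have mg : measurable_fun setT g.
  by have := sub_Lfun_mfun Lg; rewrite inE.
have fg : ('N[leb2]_2%:E[EFin \o g] < +oo)%E.
  by have := sub_Lfun_finLfun Lg; rewrite inE.
split=> //; apply: L1_0le; [exact: measurable_funX|by move=> x; exact: sqr_ge0|].
rewrite -(Lnorm_sqr mg); move: fg; have := @Lnorm_ge0 _ _ _ (@leb2 R) 2%:E (EFin \o g).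
by case: ('N[leb2]_2%:E[EFin \o g])%E => [r| |] // _ _; rewrite -EFin_expe ltry.
Qed.

Lemma C_L2_L2 f t : C_L2 T f -> 0 <= t <= T -> L2 lam2 (f t).
Proof. by move=> [h _] tT; apply: Lfun_L2; apply: h; rewrite in_itv. Qed.

Lemma C_L2_continuous f t : C_L2 T f -> 0 <= t <= T -> forall e : R, 0 < e -> exists2 h : R, 0 < h &
  forall s, 0 <= s <= T -> `|s - t| < h -> N2 lam2 (fun x => f s x - f t x) <= e.
Proof.
move=> cf tT e e0; have [_ /(_ t)] := cf; rewrite in_itv/= => /(_ tT) c.
have Lt := C_L2_L2 cf tT.
have ev : \forall s \near within `[0, T] (nbhs t), (fine ('N[leb2]_2%:E[EFin \o (f s \- f t)%R]) <= e)%R.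
  have /fine_cvgP[_ /cvgrPdist_le /(_ e e0)] := c.
  apply: filterS => s; rewrite sub0r normrN => h; exact: le_trans (ler_norm _) h.
move: ev; rewrite near_withinE => /nbhs_ballP[h /= h0 H]; exists h => // s sT st.
have := H s; rewrite /ball /= distrC => /(_ st); rewrite in_itv/= => /(_ sT).
by rewrite Lnorm_N2//; exact: (L2B (C_L2_L2 cf sT) Lt).
Qed.

Lemma cv_ae K (f g : PL R -> R) x : measurable_fun setT K -> measurable_fun setT f -> measurable_fun setT g ->
  f = g %[ae lam2] -> cv K f x = cv K g x.
Proof.
move=> mK mf mg h; rewrite !cvE; apply: ae_eq_Int.
- by apply: measurable_funM => //; exact: meas_ker_sub.
- by apply: measurable_funM => //; exact: meas_ker_sub.
- by apply: filterS h => y hy _; rewrite hy.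
Qed.

End continuous_representatives.

Lemma jmeas_sum (R : realType) (I : Type) (s : seq I) (F : I -> measurableTypeR R -> PL R -> R) :
  (forall i, jmeas (F i)) -> jmeas (fun t x => \sum_(i <- s) F i t x).
Proof. by move=> h; apply: measurable_sum => i; exact: h. Qed.

(** * The tested equation as an identity in time *)

Section weak_solutions_in_time.
Context {R : realType}.
Notation RM := (measurableTypeR R).
Local Opaque N2 rh sg mm.
Variables (T : R) (u ubar d1u : vector_field R) (v dv : RM -> 'I_2 -> PL R -> R) (M : R).
Hypotheses (mu : forall i, slab_measurable T (u i)) (md : forall i, slab_measurable T (d1u i)).
Hypotheses (rv : forall i, rep T (u i) (fun t => v t i)) (rd : forall i, rep T (d1u i) (fun t => dv t i)).
Hypothesis vM : forall t i, N2 lam2 (v t i) <= M.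
Hypothesis hrep : continuous_representative T u ubar.
Hypothesis momentum : forall phi : 'I_2 -> R * (R * R) -> R,
  (forall i, test_function (slab T) (phi i)) ->
  (forall t x, \sum_(i < 2) dx i (phi i) t x = 0) ->
  (\int[lebesgue_measure]_(t in `]0%R, T[) \int[leb2]_x
     (\sum_(i < 2) dt (phi i) t x * u i t x
      + \sum_(i < 2) \sum_(j < 2) dx j (phi i) t x * (u i t x * u j t x)
      - \sum_(i < 2) dx 0 (phi i) t x * d1u i t x)%:E = 0)%E.
Variables (Psi : 'I_2 -> R * R -> R) (x : PL R).
Hypotheses (sP : forall i, sker (Psi i)) (dP : forall y, \sum_(i < 2) pd i (Psi i) y = 0).

Let Lv t i : L2 lam2 (v t i). Proof. by have [_ h _ _ _] := rv i. Qed.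
Let Ldv t i : L2 lam2 (dv t i). Proof. by have [_ h _ _ _] := rd i. Qed.
Let mv i : jmeas (fun t => v t i). Proof. by have [h _ _ _ _] := rv i. Qed.
Let mdv i : jmeas (fun t => dv t i). Proof. by have [h _ _ _ _] := rd i. Qed.
Let v0 t i : ~~ (0 < t < T) -> v t i = fun=> 0. Proof. by have [_ _ _ _ h] := rv i; exact: h. Qed.
Let dv0 t i : ~~ (0 < t < T) -> dv t i = fun=> 0. Proof. by have [_ _ _ _ h] := rd i; exact: h. Qed.
Let M0 : 0 <= M. Proof. exact: le_trans (N2_ge0 _ _) (vM 0 0). Qed.
Let kP i : ker (Psi i : PL R -> R). Proof. exact: sker_ker. Qed.
Let kpP i j : ker (pd j (Psi i) : PL R -> R). Proof. exact: ker_pd. Qed.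

Definition moment (z : 'I_2 -> PL R -> R) : R := \sum_(k < 2) cv (Psi k) (z k) x.

Lemma meas_moment : measurable_fun setT (fun t => moment (v t)).
Proof.
apply: measurable_sum => k; have mc := jmeas_cv (kP k).1 (mv k).
by apply: (mcomp2 mc); [exact: measurable_id|exact: measurable_cst].
Qed.

Lemma moment_bound : exists2 C : R, 0 <= C & forall t, `|moment (v t)| <= C.
Proof.
exists (\sum_(k < 2) N2 lam2 (Psi k) * M); first by apply: sumr_ge0 => k _; rewrite mulr_ge0 ?N2_ge0.
move=> t; apply: (le_trans (ler_norm_sum _ _ _)); apply: ler_sum => k _.
apply: (le_trans (cv_bd x (kP k) (Lv t k))); apply: ler_wpM2l; [exact: N2_ge0|exact: vM].
Qed.

Lemma zero_cv K : cv K (fun=> 0 : R) x = 0.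
Proof.
by rewrite cvE (_ : (fun y => _) = fun=> 0) ?Int0//; apply/funext => y; rewrite mulr0.
Qed.

Lemma L1_flux : L1 lam (fun t => flux (v t) (dv t) Psi x).
Proof.
apply: L1_sum => k; apply: L1B; last exact: (rep_cv_L1 x (rd k)).
apply: L1_sum => j; have [_ [C [_ C0 hC _ _]]] := ker_bd (kpP k j).
apply: (L1_le _ (L1Z (C * M ^+ 2) (L1_seg T))).
  have mc := jmeas_cv (kpP k j).1 (jmeasM (mv k) (mv j)).
  by apply: (mcomp2 mc); [exact: measurable_id|exact: measurable_cst].
move=> t; have [tT|tT] := boolP (0 < t < T); last first.
  rewrite (v0 k tT) (_ : (fun y => _) = fun=> 0); last by apply/funext => y; rewrite mul0r.
  by rewrite zero_cv normr0 !mulr_ge0 ?sqr_ge0 ?seg_ge0.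
have /andP[t0 t1] := tT; rewrite /seg (ltW t0) (ltW t1)/= mulr1.
apply: (le_trans (cv_bd1 x (kpP k j) hC (L2M (Lv t k) (Lv t j)))); apply: ler_wpM2l => //.
apply: (le_trans (CS (Lv t k) (Lv t j))); rewrite expr2; apply: ler_pM; rewrite ?N2_ge0//; exact: vM.
Qed.

(** The test field is the difference of two ramps times the translate of [Psi], divergence free
    because [Psi] is. This is the form that [time_primitive] asks for. *)
Lemma momentum_cutoff d a b : 0 < d -> 0 < a -> a < b -> b + d < T ->
  Int lam (fun s => (ramp' d a s - ramp' d b s) * moment (v s)) =
  - Int lam (fun s => (ramp d a s - ramp d b s) * flux (v s) (dv s) Psi x).
Proof.
move=> d0 a0 ab bT.
pose h (s : R) := ramp d a s - ramp d b s; pose h' (s : R) := ramp' d a s - ramp' d b s.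
pose phi i := tensor h (Psi i) x.
have tst i : test_function (slab T) (phi i).
  exact: (test_tensor x (smooth1_step d a b) (sP i) (fun s => step_support d0 ab) a0 bT).
have dphi t y : \sum_(i < 2) dx i (phi i) t y = 0.
  under eq_bigr do rewrite (dx_tensor _ _ _ _ _ (sP _)).
  by rewrite -mulr_sumr dP mulr0.
have := momentum tst dphi.
pose w t (y : PL R) := h' t * (\sum_(i < 2) Psi i (y - x) * u i t y) +
  h t * (\sum_(i < 2) (\sum_(j < 2) pd j (Psi i) (y - x) * (u i t y * u j t y) - pd 0 (Psi i) (y - x) * d1u i t y)).
pose W t (y : PL R) := h' t * (\sum_(i < 2) Psi i (y - x) * v t i y) +
  h t * (\sum_(i < 2) (\sum_(j < 2) pd j (Psi i) (y - x) * (v t i y * v t j y) - pd 0 (Psi i) (y - x) * dv t i y)).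
have -> : (\int[lebesgue_measure]_(t in `]0%R, T[) \int[leb2]_y
     (\sum_(i < 2) dt (phi i) t y * u i t y
      + \sum_(i < 2) \sum_(j < 2) dx j (phi i) t y * (u i t y * u j t y)
      - \sum_(i < 2) dx 0 (phi i) t y * d1u i t y)%:E =
   \int[lebesgue_measure]_(t in `]0%R, T[) \int[leb2]_y (w t y)%:E)%E.
  apply: eq_integral => t _; apply: eq_integral => y _; congr (_%:E).
  rewrite /w sumrB mulrBr !mulr_sumr addrA; congr (_ + _ - _).
  - by apply: eq_bigr => i _; rewrite (dt_tensor _ _ _ _ (step_derive d a b)) mulrA.
  - by apply: eq_bigr => i _; rewrite mulr_sumr; apply: eq_bigr => j _; rewrite (dx_tensor _ _ _ _ _ (sP _)) -mulrA.
  - by apply: eq_bigr => i _; rewrite (dx_tensor _ _ _ _ _ (sP _)) mulrA.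
have mh : measurable_fun setT (h : RM -> R) by exact: meas_step.
have mh' : measurable_fun setT (h' : RM -> R) by apply: measurable_funB; exact: meas_ramp'.
have L1a t i : L1 lam2 (fun y => Psi i (y - x) * v t i y) by apply: cv_L1 => //; exact: L2_Lloc.
have L1b t i j : L1 lam2 (fun y => pd j (Psi i) (y - x) * (v t i y * v t j y)).
  by apply: cv_L1 => //; apply: L1_Lloc; exact: L2M.
have L1c t i : L1 lam2 (fun y => pd 0 (Psi i) (y - x) * dv t i y) by apply: cv_L1 => //; exact: L2_Lloc.
have LA t : L1 lam2 (fun y => \sum_(i < 2) Psi i (y - x) * v t i y) by exact: L1_sum.
have LB' t i : L1 lam2 (fun y => \sum_(j < 2) pd j (Psi i) (y - x) * (v t i y * v t j y)).
  by apply: L1_sum => j; exact: L1b.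
have LB t : L1 lam2 (fun y => \sum_(i < 2) (\sum_(j < 2) pd j (Psi i) (y - x) * (v t i y * v t j y) - pd 0 (Psi i) (y - x) * dv t i y)).
  by apply: L1_sum => i; exact: L1B.
have EW t : Int lam2 (W t) = h' t * moment (v t) + h t * flux (v t) (dv t) Psi x.
  rewrite (IntD (L1Z (h' t) (LA t)) (L1Z (h t) (LB t))) (IntZ (h' t) (LA t)) (IntZ (h t) (LB t)).
  congr (_ * _ + _ * _).
    by rewrite (Int_sum _ (L1a t)); apply: eq_bigr => i _; rewrite cvE.
  rewrite (Int_sum _ (fun i => L1B (LB' t i) (L1c t i))); apply: eq_bigr => i _.
  rewrite (IntB (LB' t i) (L1c t i)) cvE; congr (_ - _).
  by rewrite (Int_sum _ (L1b t i)); apply: eq_bigr => j _; rewrite cvE.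
have [C C0 hC] := moment_bound.
have b0 : 0 < b := lt_trans a0 ab.
have L1r : L1 lam (h' : RM -> R) by apply: L1B; apply: L1_ramp' => //; exact: ltW.
have L1' : L1 lam (fun t => h' t * moment (v t)).
  have := L1_bd meas_moment hC L1r; rewrite (_ : (fun t => _ * h' t) = (fun t => h' t * moment (v t)))//.
  by apply/funext => t; exact: mulrC.
have L2' : L1 lam (fun t => h t * flux (v t) (dv t) Psi x).
  exact: (L1_bd mh (step_bound d a b) L1_flux).
have jP (K : R * R -> R) : ker (K : PL R -> R) -> jmeas (fun (t : RM) (y : PL R) => K (y - x)).
  by move=> kK; apply: jmeas_ker; exact: kK.1.
rewrite (slab_integral (f' := W)).
- move=> [E]; apply/eqP; rewrite -addr_eq0 -(IntD L1' L2') -E; apply/eqP.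
  by apply: eq_Int => t; rewrite EW.
- apply: measurable_funD.
    apply: measurable_funM.
      by apply: measurable_funTS; exact: (mcomp mh' measurable_fst).
    apply: measurable_sum => i; apply: measurable_funM; last exact: mu.
    by apply: measurable_funTS; exact: (jP _ (kP i)).
  apply: measurable_funM.
    by apply: measurable_funTS; exact: (mcomp mh measurable_fst).
  apply: measurable_sum => i; apply: measurable_funB.
    apply: measurable_sum => j; apply: measurable_funM.
      by apply: measurable_funTS; exact: (jP _ (kpP i j)).
    by apply: measurable_funM; exact: mu.
  apply: measurable_funM; last exact: md.
  by apply: measurable_funTS; exact: (jP _ (kpP i 0)).
- apply: jmeasD.
    apply: jmeasM; first exact: jmeas_time.
    by apply: jmeas_sum => i; apply: jmeasM; [exact: (jP _ (kP i))|exact: mv].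
  apply: jmeasM; first exact: jmeas_time.
  apply: jmeas_sum => i; apply: jmeasB.
    by apply: jmeas_sum => j; apply: jmeasM; [exact: (jP _ (kpP i j))|exact: jmeasM].
  by apply: jmeasM; [exact: (jP _ (kpP i 0))|exact: mdv].
- by move=> t; apply: L1D; apply: L1Z.
- by under eq_fun do rewrite EW; exact: L1D.
- have H i : {ae lam, forall t : RM, 0 < t < T -> v t i = u i t /\ dv t i = d1u i t}.
    have [_ _ _ h1 _] := rv i; have [_ _ _ h2 _] := rd i.
    by apply: filterS2 h1 h2 => t g1 g2 tT; rewrite g1// g2.
  have I2 := ordinal2.
  apply: filterS2 (H 0) (H 1) => t g0 g1 tT.
  have gv i : v t i = u i t by have [->|->] := I2 i; [have [] := g0 tT|have [] := g1 tT].
  have gd i : dv t i = d1u i t by have [->|->] := I2 i; [have [] := g0 tT|have [] := g1 tT].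
  apply/funext => y; rewrite /W /w; congr (_ * _ + _ * _); apply: eq_bigr => i _; first by rewrite gv.
  by rewrite gd; congr (_ - _); apply: eq_bigr => j _; rewrite !gv.
- move=> t tT; apply/funext => y; rewrite /W !big1 ?mulr0 ?addr0// => i _; last by rewrite v0// mulr0.
  by rewrite big1 ?dv0// ?mulr0 ?subr0// => j _; rewrite !v0// !mulr0.
Qed.

Lemma moment_sub (z z' : 'I_2 -> PL R -> R) : (forall i, L2 lam2 (z i)) -> (forall i, L2 lam2 (z' i)) ->
  `|moment z - moment z'| <= \sum_(k < 2) N2 lam2 (Psi k) * N2 lam2 (fun y => z k y - z' k y).
Proof.
move=> Lz Lz'; rewrite /moment -sumrB; apply: (le_trans (ler_norm_sum _ _ _)); apply: ler_sum => k _.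
have h := cvB (kP k) (L2_Lloc (Lz k)) (L2_Lloc (Lz' k)).
rewrite -(congr1 (fun F => F x) h); apply: cv_bd => //; exact: L2B.
Qed.

Lemma ubar_L2 t i : 0 <= t <= T -> L2 lam2 (ubar i t).
Proof. by move=> tT; apply: (C_L2_L2 _ tT); have [h _] := hrep; exact: h. Qed.

Lemma v_ubar : {ae lam, forall t : RM, 0 < t < T -> forall i, v t i = ubar i t %[ae lam2]}.
Proof.
have [_ h'] := hrep.
have h : {ae lam, forall t : RM, t \in `]0%R, T[ -> L2_eq u ubar t} by exact: h'.
have H i : {ae lam, forall t : RM, 0 < t < T -> v t i = u i t} by have [_ _ _ h1 _] := rv i.
have H2 : {ae lam, forall t : RM, forall i, 0 < t < T -> v t i = u i t}.
  have I2 := ordinal2.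
  by apply: filterS2 (H 0) (H 1) => t h0 h1 i; have [->|->] := I2 i.
apply: filterS2 h H2 => t g1 g2 tT i; rewrite g2//.
by apply: g1; rewrite in_itv.
Qed.

Lemma moment_ae (z z' : 'I_2 -> PL R -> R) : (forall i, L2 lam2 (z i)) -> (forall i, L2 lam2 (z' i)) ->
  (forall i, z i = z' i %[ae lam2]) -> moment z = moment z'.
Proof.
move=> Lz Lz' h; apply: eq_bigr => k _; apply: cv_ae; [exact: (kP k).1|exact: (Lz k).1|exact: (Lz' k).1|exact: h].
Qed.

(** [v] agrees with the continuous representative at almost every time only, which is what the
    notion [right_limit] allows for. *)
Lemma moment_right_limit a : 0 <= a < T ->
  right_limit (fun s => moment (v s)) a (moment (fun i => ubar i a)).
Proof.
move=> /andP[a0 aT] e e0.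
pose S := \sum_(k < 2) N2 lam2 (Psi k).
have S0 : 0 <= S by apply: sumr_ge0 => k _; exact: N2_ge0.
have S1 : 0 < S + 1 by rewrite ltr_wpDl.
have aT' : 0 <= a <= T by rewrite a0 ltW.
have [hc _] := hrep.
have H i := C_L2_continuous (hc i) aT' (divr_gt0 e0 S1).
have [h0 h00 H0] := H 0; have [h1 h10 H1] := H 1.
exists (Num.min (Num.min h0 h1) (T - a)); first by rewrite !lt_min h00 h10 subr_gt0.
apply: filterS v_ubar => s hs /andP[as1].
rewrite -ltrBlDl !lt_min => /andP[/andP[s1 s2] s3].
have s0 : 0 < s := le_lt_trans a0 as1.
have sT : s < T by rewrite -(ltrD2r (- a)).
have sT' : 0 <= s <= T by rewrite !ltW.
have sa : 0 <= s - a by rewrite subr_ge0 ltW.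
have E : moment (v s) = moment (fun i => ubar i s).
  apply: moment_ae => [i|i|i]; [exact: Lv|exact: ubar_L2|apply: hs; by rewrite s0].
rewrite E; apply: (le_trans (moment_sub (fun i => ubar_L2 i sT') (fun i => ubar_L2 i aT'))).
apply: (@le_trans _ _ (S * (e / (S + 1)))); last first.
  by rewrite mulrA ler_pdivrMr// mulrC ler_wpM2l ?(ltW e0)// lerDl.
rewrite /S mulr_suml; apply: ler_sum => k _; apply: ler_wpM2l; first exact: N2_ge0.
have I2 := ordinal2.
by have [->|->] := I2 k; [apply: H0|apply: H1] => //; rewrite ger0_norm.
Qed.

(** The value at time 0 enters here as a right limit, the weak formulation itself seeing interior
    times only. *)
Lemma moment_evolution t : 0 < t < T ->
  moment (fun i => ubar i t) - moment (fun i => ubar i 0) = prim (fun s => flux (v s) (dv s) Psi x) t.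
Proof.
move=> tT; have [C C0 hC] := moment_bound; have /andP[t0 t1] := tT.
apply: (time_primitive meas_moment hC L1_flux tT momentum_cutoff); apply: moment_right_limit.
  by rewrite lexx (lt_trans t0 t1).
by rewrite (ltW t0).
Qed.

End weak_solutions_in_time.

(** * Uniqueness *)

Section uniqueness.
Context {R : realType}.
Notation RM := (measurableTypeR R).
Local Opaque N2 rh sg mm.
Variable T : R.

(** Turns incompressibility into a formula for the vertical derivative of the second component, the
    form required by [slice]. *)
Lemma divergence_slices (u : vector_field R) (v dv : RM -> 'I_2 -> PL R -> R) K x :
  weakly_divergence_free T u -> (forall i, rep T (u i) (fun t => v t i)) ->
  (forall t, L2 lam2 (dv t 0)) -> (forall t : RM, ~~ (0 < t < T) -> dv t 0 = fun=> 0) -> sker K ->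
  {ae lam, forall t : RM, cv (pd 0 K) (v t 0) x = - cv K (dv t 0) x} ->
  {ae lam, forall t : RM, cv (pd 1 K) (v t 1) x = - cv K (fun y => - dv t 0 y) x}.
Proof.
move=> hdiv rv Ldv dv0 sK h0.
have hd' := hdiv _ (test_shift x sK).
have hd : {ae lam, forall t : RM, t \in `]0%R, T[ ->
    (\int[leb2]_y (\sum_(i < 2) u i t y * 'D_(basis_vector i) (fun y => K (y - x)) y)%:E = 0)%E} by exact: hd'.
have Lv i t : L2 lam2 (v t i) by have [_ h _ _ _] := rv i.
have kp i := sker_ker (sker_pd i sK); have kK := sker_ker sK.
have m4 i : {ae lam, forall t : RM, 0 < t < T -> v t i = u i t} by have [_ _ _ h _] := rv i.
have H : {ae lam, forall t : RM, 0 < t < T -> cv (pd 0 K) (v t 0) x + cv (pd 1 K) (v t 1) x = 0}.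
  apply: (filterS3 _ _ hd (m4 0) (m4 1)) => t ht g0 g1 tT.
  have := ht _; rewrite in_itv/= => /(_ tT).
  have E y : \sum_(i < 2) u i t y * 'D_(basis_vector i) (fun y => K (y - x)) y =
      pd 0 K (y - x) * v t 0 y + pd 1 K (y - x) * v t 1 y.
    rewrite big_ord_recl big_ord1 !derive_translate//.
    have -> : (lift ord0 ord0 : 'I_2) = 1 by exact/val_inj.
    have -> : (ord0 : 'I_2) = 0 by exact/val_inj.
    by rewrite (g0 tT) (g1 tT) mulrC [X in _ + X]mulrC.
  under eq_integral do rewrite E.
  have La := cv_L1 x (kp 0) (L2_Lloc (Lv 0 t)); have Lb := cv_L1 x (kp 1) (L2_Lloc (Lv 1 t)).
  have -> : (\int[leb2]_y (pd 0 K (y - x) * v t 0 y + pd 1 K (y - x) * v t 1 y)%:E =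
    (Int lam2 (fun y => pd 0 K (y - x) * v t 0 y + pd 1 K (y - x) * v t 1 y))%:E)%E.
    by rewrite (IntE (L1D La Lb)).
  by move=> [E2]; rewrite !cvE -(IntD La Lb).
apply: filterS2 H h0 => t h1 h2.
have h3 := cvN kK (L2_Lloc (Ldv t)); rewrite (congr1 (fun F => F x) h3) opprK.
have [tT|tT] := boolP (0 < t < T).
  by have := h1 tT; rewrite h2 => /eqP; rewrite addrC subr_eq0 => /eqP.
have z L : cv L (fun=> 0 : R) x = 0 by exact: zero_cv.
have [_ _ _ _ z1] := rv 1; have := z1 t tT => /= ->.
by rewrite dv0// !z.
Qed.

Lemma slice0 : slice (fun _ (_ : PL R) => 0 : R) (fun _ _ => 0).
Proof.
have w0 i : wd i (fun _ : PL R => 0 : R) (fun=> 0) by move=> n x; rewrite !zero_cv oppr0.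
split=> // [i|i|]; [exact: L2_0|exact: L2_0|].
by rewrite (_ : (fun _ => - 0) = fun=> 0)//; apply/funext => x; rewrite oppr0.
Qed.

(** All null sets of times are discarded at once, by masking with zero. In the evolution of the
    moments the left-hand side refers to the continuous representative and the integrand to the
    measurable one, for which the slice properties hold at every time. *)
Lemma solution_rep (u ubar : vector_field R) : 0 < T -> weak_solution T u -> continuous_representative T u ubar ->
  exists (v dv : RM -> 'I_2 -> PL R -> R) (d1u : vector_field R) (M : R),
  [/\ forall i, rep T (u i) (fun t => v t i), forall i, rep T (d1u i) (fun t => dv t i),
    forall t, slice (v t) (dv t), forall t i, N2 lam2 (v t i) <= M
  & forall Psi x t, (forall i, sker (Psi i)) -> (forall y, \sum_(i < 2) pd i (Psi i) y = 0) -> 0 < t < T ->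
    moment Psi x (fun i => ubar i t) - moment Psi x (fun i => ubar i 0) = prim (fun s => flux (v s) (dv s) Psi x) t].
Proof.
move=> T0 [hinf [d1u [hd hdiv hmom]]] hrep.
have [v1M hv1] : {vM : 'I_2 -> (RM -> PL R -> R) * R &
    forall i, rep T (u i) (vM i).1 /\ forall t, N2 lam2 ((vM i).1 t) <= (vM i).2}.
  apply: (@choice _ _ (fun i (vM : (RM -> PL R -> R) * R) => rep T (u i) vM.1 /\ forall t, N2 lam2 (vM.1 t) <= vM.2)) => i.
  by have [f' [M h]] := rep_Linfty T0 (hinf i); exists (f', M).
have [dv1 hdv1] : {dv1 : 'I_2 -> RM -> PL R -> R & forall i, rep T (d1u i) (dv1 i)}.
  by apply: (@choice _ _ (fun i f' => rep T (d1u i) f')) => i; have [h _] := hd i; exact: rep_L2.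
pose v2 (t : RM) i := (v1M i).1 t; pose dv2 (t : RM) i := dv1 i t.
have rv2 i : rep T (u i) (fun t => v2 t i) by have [] := hv1 i.
have rd2 i : rep T (d1u i) (fun t => dv2 t i) by exact: hdv1.
have Lv i t : L2 lam2 (v2 t i) by have [_ h _ _ _] := rv2 i.
have Ld i t : L2 lam2 (dv2 t i) by have [_ h _ _ _] := rd2 i.
have mu i : slab_measurable T (u i) by have [] := hinf i.
have md i : slab_measurable T (d1u i) by have [[]] := hd i.
have W K x i : sker K -> {ae lam, forall t : RM, cv (pd 0 K) (v2 t i) x = - cv K (dv2 t i) x}.
  by have [_ h] := hd i; exact: (weak_dx_slices x h (mu i) (md i) (rv2 i) (rd2 i)).
have ae0 i : {ae lam, forall t : RM, wd 0 (v2 t i) (dv2 t i)}.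
  by apply: ae_all_points => // K x sK; exact: W.
have ae1 : {ae lam, forall t : RM, wd 1 (v2 t 1) (fun y => - dv2 t 0 y)}.
  apply: ae_all_points => // [t|K x sK]; first exact: L2N.
  apply: (divergence_slices hdiv rv2 _ _ sK (W K x 0 sK)) => // t tT.
  by have [_ _ _ _ z] := rd2 0; have := z t tT.
have [N [mN N0 hN]] : exists N : set RM, [/\ measurable N, lam N = 0%E & forall t, ~ N t -> slice (v2 t) (dv2 t)].
  apply: ae_null; apply: (filterS3 _ _ (ae0 0) (ae0 1) ae1) => t h0 h1 h2; split=> // i.
  by have [->|->] := ordinal2 i.
pose v t i := tmask N (fun t => v2 t i) t; pose dv t i := tmask N (fun t => dv2 t i) t.
pose M := Num.max (v1M 0).2 (v1M 1).2.
have vM t i : N2 lam2 (v t i) <= M.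
  have h : N2 lam2 (v2 t i) <= M.
    have [_ h] := hv1 i; apply: (le_trans (h t)); rewrite /M le_max.
    by have [->|->] := ordinal2 i; rewrite lexx ?orbT.
  have [Nt|Nt] := pselect (N t); last by rewrite /v mask_out.
  by rewrite /v mask_in// N2_0; exact: le_trans (N2_ge0 _ _) h.
have rv i : rep T (u i) (fun t => v t i) by exact: rep_mask.
have rd i : rep T (d1u i) (fun t => dv t i) by exact: rep_mask.
exists v, dv, d1u, M; split=> //.
- move=> t; have [Nt|Nt] := pselect (N t).
    have -> : v t = fun _ _ => 0 by apply/funext => i; rewrite /v mask_in.
    have -> : dv t = fun _ _ => 0 by apply/funext => i; rewrite /dv mask_in.
    exact: slice0.
  have -> : v t = v2 t by apply/funext => i; rewrite /v mask_out.
  have -> : dv t = dv2 t by apply/funext => i; rewrite /dv mask_out.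
  exact: hN.
- by move=> Psi x t sP dP tT; exact: (moment_evolution mu md rv rd vM hrep hmom x sP dP tT).
Qed.

Lemma ae_exists (P : RM -> Prop) a b : {ae lam, forall t, P t} -> a < b -> exists2 t : R, a < t < b & P t.
Proof.
move=> hP ab; have [N [mN N0 hN]] := ae_null hP.
apply: contrapT => h.
have sub : (`]a, b[%classic : set RM) `<=` N.
  move=> t; rewrite /= in_itv/= => tab; apply: contrapT => Nt; apply: h; exists t => //; exact: hN.
have := @subset_measure0 _ _ _ (@lam R) _ _ (measurable_itv `]a, b[) mN sub N0.
rewrite /lam /= lebesgue_measure_itv /= lte_fin ab -EFinB => -[] /eqP.
by rewrite subr_eq0 gt_eqF.
Qed.

End uniqueness.

Local Opaque N2 rh sg mm.

Local Opaque N2 rh sg mm.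

Theorem theorem1p3 (R : realType) (T : R) (hT : 0 < T)
    (u U ubar Ubar : vector_field R)
    (hu : weak_solution T u) (hU : weak_solution T U)
    (hubar : continuous_representative T u ubar)
    (hUbar : continuous_representative T U Ubar)
    (hd2U1 : exists d2U1 : R -> R * R -> R,
        L2_L2 T d2U1 /\ weak_dx T 1 (U 0) d2U1)
    (h0 : L2_eq ubar Ubar 0) :
  forall t : R, 0 < t <= T -> L2_eq ubar Ubar t.
Proof.
have [d2U1 [hD wD]] := hd2U1.
have [v [dv [d1u [M [rv rd sv vM mv]]]]] := solution_rep hT hu hubar.
have [V1 [dV1 [d1U [M' [rV1 rD1 sV1 VM1 mV1]]]]] := solution_rep hT hU hUbar.
have [E1 rE1] := rep_L2 hD.
(* The vertical derivative of [U 0] costs a further null set of times, on which [U] and its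
   derivatives are replaced by zero. *)
have [N [mN N0 hN]] : exists N : set (measurableTypeR R), [/\ measurable N, lam N = 0%E & forall t, ~ N t -> wd 1 (V1 t 0) (E1 t)].
  apply: ae_null; apply: ae_all_points.
  - by move=> t; have [_ h _ _ _] := rV1 0.
  - by move=> t; have [_ h _ _ _] := rE1.
  move=> K x sK; have [hinf _] := hU; have [mU _] := hinf 0; have [mD _] := hD.
  exact: (weak_dx_slices x wD mU mD (rV1 0) rE1 sK).
pose V t i := tmask N (fun t => V1 t i) t; pose dV t i := tmask N (fun t => dV1 t i) t; pose E2 := tmask N E1.
have rV i : rep T (U i) (fun t => V t i) by exact: rep_mask.
have rD i : rep T (d1U i) (fun t => dV t i) by exact: rep_mask.
have rE : rep T d2U1 E2 by exact: rep_mask.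
have Vin t : N t -> V t = (fun _ _ => 0) /\ dV t = (fun _ _ => 0).
  by move=> Nt; split; apply/funext => i; rewrite /V /dV mask_in.
have Vout t : ~ N t -> V t = V1 t /\ dV t = dV1 t.
  by move=> Nt; split; apply/funext => i; rewrite /V /dV mask_out.
have sV t : slice (V t) (dV t).
  have [Nt|Nt] := pselect (N t); first by have [-> ->] := Vin t Nt; exact: slice0.
  by have [-> ->] := Vout t Nt.
have LE t : L2 lam2 (E2 t) by have [_ h _ _ _] := rE.
have wE t : wd 1 (V t 0) (E2 t).
  have [Nt|Nt] := pselect (N t).
    have [-> _] := Vin t Nt; rewrite /E2 mask_in//.
    by move=> n x; rewrite !zero_cv oppr0.
  by have [-> _] := Vout t Nt; rewrite /E2 mask_out//; exact: hN.
pose MM := Num.max M M'.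
have bv t i : N2 lam2 (v t i) <= MM by rewrite /MM le_max vM.
have bV t i : N2 lam2 (V t i) <= MM.
  have [Nt|Nt] := pselect (N t).
    have [-> _] := Vin t Nt; rewrite N2_0; exact: le_trans (N2_ge0 _ _) (bv 0 0).
  by have [-> _] := Vout t Nt; rewrite /MM le_max VM1 orbT.
have Lv t i : L2 lam2 (v t i) by have [_ h _ _ _] := rv i.
have LV t i : L2 lam2 (V t i) by have [_ h _ _ _] := rV i.
have Ldv t i : L2 lam2 (dv t i) by have [_ h _ _ _] := rd i.
have LdV t i : L2 lam2 (dV t i) by have [_ h _ _ _] := rD i.
have vu := v_ubar rv hubar; have Vu := v_ubar rV hUbar.
have Lub := ubar_L2 hubar; have LUb := ubar_L2 hUbar.
(* The two moment identities are subtracted: the initial moments agree by [h0], and by [proj_moment]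
   the moments against the projection are the mollified components. *)
have id : {ae lam, forall t : (measurableTypeR R), 0 < t < T -> forall n i x,
    cv (mm n) (fun y => v t i y - V t i y) x = prim (fun s => mollified_force (v s) (dv s) (V s) (dV s) n i x) t}.
  apply: filterS2 vu Vu => t e1 e2 tT n i x.
  have /andP[t0 t1] := tT.
  have tT' : 0 <= t <= T by rewrite !ltW.
  have T00 : 0 <= (0 : R) <= T by rewrite lexx ltW.
  have sP := sker_proj (R := R) n i; have dP := div_proj (R := R) n i.
  have a1 := mv _ x t sP dP tT; have a2 := mV1 _ x t sP dP tT.
  have b1 := moment_ae x sP (Lv t) (fun i => Lub t i tT') (e1 tT).
  have b2 := moment_ae x sP (LV t) (fun i => LUb t i tT') (e2 tT).
  have b3 := moment_ae x sP (fun i => Lub 0 i T00) (fun i => LUb 0 i T00) h0.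
  have c1 := proj_moment (sv t) n i x; have c2 := proj_moment (sV t) n i x.
  have h := cvB (ker_mm (R := R) n) (L2_Lloc (Lv t i)) (L2_Lloc (LV t i)).
  rewrite (congr1 (fun F => F x) h) -c1 -c2 -/(moment (lproj n i) x (v t)) -/(moment (lproj n i) x (V t)).
  have Lf := L1_flux rv rd bv x sP; have LF := L1_flux rV rD bV x sP.
  have LF1 := L1_flux rV1 rD1 VM1 x sP.
  (* Masking on a null set of times does not change the integral in time. *)
  have pe : prim (fun s => flux (V1 s) (dV1 s) (lproj n i) x) t = prim (fun s => flux (V s) (dV s) (lproj n i) x) t.
    apply: ae_eq_Int; [exact: L1_meas (L1_segM t LF1)|exact: L1_meas (L1_segM t LF)|].
    apply: filterS (ae_out mN N0) => s Ns _; by have [-> ->] := Vout s Ns.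
  have pd' : prim (fun s => mollified_force (v s) (dv s) (V s) (dV s) n i x) t =
      prim (fun s => flux (v s) (dv s) (lproj n i) x) t - prim (fun s => flux (V s) (dV s) (lproj n i) x) t.
    rewrite /prim -(IntB (L1_segM t Lf) (L1_segM t LF)); apply: eq_Int => s.
    by rewrite -(flux_force (sv s) (sV s)) mulrBr.
  rewrite pd' -pe -a1 -a2 b1 b2 b3.
  move: (moment _ _ _) (moment _ _ _) (moment _ _ _) => p q r; ring.
have jm f f' : rep T f f' -> jmeas f' by case.
have i2 f f' : rep T f f' -> L1 lam (fun s => seg T s * N2 lam2 (f' s) ^+ 2).
  by move=> [_ _ h _ _]; exact: L1_segM.
have key := evolution_uniqueness (fun i => jm _ _ (rv i)) (fun i => jm _ _ (rd i)) (fun i => jm _ _ (rV i))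
  (fun i => jm _ _ (rD i)) (jm _ _ rE) sv sV LE wE bv bV (fun i => i2 _ _ (rd i)) (fun i => i2 _ _ (rD i))
  (i2 _ _ rE) id.
have ae_zero : {ae lam, forall t : (measurableTypeR R), 0 < t < T -> forall i, N2 lam2 (fun y => ubar i t y - Ubar i t y) = 0}.
  apply: (filterS3 _ _ key vu Vu) => t k e1 e2 tT i.
  have /andP[t0 t1] := tT; have tT' : 0 <= t <= T by rewrite !ltW.
  rewrite -(k tT i); apply: ae_eq_N2.
  - exact: (L2B (Lub t i tT') (LUb t i tT')).1.
  - exact: (L2B (Lv t i) (LV t i)).1.
  by apply: filterS2 (e1 tT i) (e2 tT i) => y g1 g2 yT; rewrite g1// g2.
move=> t /andP[t0 tT] i.
have tT' : 0 <= t <= T by rewrite ltW.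
have LD := L2B (Lub t i tT') (LUb t i tT').
have z : N2 lam2 (fun y => ubar i t y - Ubar i t y) = 0.
  apply/eqP; rewrite eq_le N2_ge0 andbT; apply/ler_addgt0Pr => e e0; rewrite add0r.
  have e20 : 0 < e / 2 by rewrite divr_gt0.
  have [c1 _] := hubar; have [c2 _] := hUbar.
  have [h1 h10 H1] := C_L2_continuous (c1 i) tT' e20.
  have [h2 h20 H2] := C_L2_continuous (c2 i) tT' e20.
  (* Times of agreement are sought to the left of [t], so that the final time [T] is covered;
     continuity in L2 carries the agreement to [t]. *)
  pose a := Num.max 0 (t - Num.min h1 h2).
  have at' : a < t by rewrite /a gt_max t0 ltrBlDr ltrDl lt_min h10.
  have [s /andP[as' st] hs] := ae_exists ae_zero at'.
  move: as'; rewrite /a gt_max => /andP[s0 sh].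
  have sT : 0 < s < T by rewrite s0 (lt_le_trans st tT).
  have sT' : 0 <= s <= T by have /andP[? ?] := sT; rewrite !ltW.
  have d : `|s - t| < Num.min h1 h2 by rewrite distrC ger0_norm ?subr_ge0 ?ltW// ltrBlDr -ltrBlDl.
  move: d; rewrite lt_min => /andP[d1 d2].
  have L1' := L2B (Lub s i sT') (Lub t i tT'); have L2' := L2B (LUb s i sT') (LUb t i tT').
  have L3 := L2B (Lub s i sT') (LUb s i sT').
  have E : (fun y => ubar i t y - Ubar i t y) = (fun y => (ubar i s y - Ubar i s y) -
      ((ubar i s y - ubar i t y) - (Ubar i s y - Ubar i t y))).
    by apply/funext => y; ring.
  have g1 := N2B L3 (L2B L1' L2'); have g2 := N2B L1' L2'.
  rewrite E; apply: (le_trans g1); rewrite (hs sT i) add0r; apply: (le_trans g2).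
  have := H1 s sT' d1; have := H2 s sT' d2; lra.
have h := N2_eq0_ae LD z.
by apply: filterS h => y hy yT; apply/eqP; rewrite -subr_eq0; apply/eqP; exact: hy.
Qed.
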